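(* Let $\Omega\subset\mathbb{C}$ be a bounded finitely connected domain whose boundary components are smooth analytic curves, with Green's function $G$, Bergman kernel $K$ and Schiffer kernel $L$. The limit set of the set of critical points of $G(\cdot,\zeta)$ as $\zeta\to\partial\Omega$ is exactly the set of zeros of $K(\cdot,\zeta)$ for $\zeta\in\partial\Omega$. More precisely, for $z\in\Omega$ and $\zeta\in\partial\Omega$ the following statements are equivalent: (i) $K(z,\zeta)=0$. (ii) $L(z,\zeta)=0$. (iii) There exist $(z_n,\zeta_n)\in\Omega\times\Omega$ ($n=1,2,\dots$) with $\partial_zG(z_n,\zeta_n)=0$ such that $(z_n,\zeta_n)\to(z,\zeta)$ as $n\to\infty$. (iv) For each sequence $\{\zeta_n\}_{n\ge1}\subset\Omega$ with $\zeta_n\to\zeta$ there exist $z_n\in\Omega$ with $z_n\to z$ such that $\partial_zG(z_n,\zeta_n)=0$.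
   Context: The Green's function is $G(z,\zeta)=-\log|z-\zeta|+$ harmonic in $z\in\Omega$, with $G(z,\zeta)=0$ for $z\in\partial\Omega$. A critical point of $G(\cdot,\zeta)$ is a point $z$ with $\partial_zG(z,\zeta)=0$, where $\partial_z$ is the Wirtinger derivative in the first variable. The Bergman kernel is $K(z,\zeta)=-\frac{2}{\pi}\frac{\partial^2G}{\partial z\partial\bar\zeta}(z,\zeta)$ and the Schiffer kernel is $L(z,\zeta)=-\frac{2}{\pi}\frac{\partial^2G}{\partial z\partial\zeta}(z,\zeta)$. Since $\partial\Omega$ is analytic, for fixed $z\in\Omega$ both kernels extend continuously (even real-analytically) in $\zeta$ across $\partial\Omega$, and $K(z,\zeta)$, $L(z,\zeta)$ for $\zeta\in\partial\Omega$ denote these extended values. *)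

(* Defs.v *)
From HB Require Import structures.
From mathcomp Require Export all_boot all_order all_algebra.
From mathcomp Require Export all_classical all_reals all_analysis.
From mathcomp Require Export complex.
Export Order.TTheory GRing.Theory Num.Theory numFieldNormedType.Exports.

Set Implicit Arguments.
Unset Strict Implicit.
Unset Printing Implicit Defensive.

Local Open Scope classical_set_scope.
Local Open Scope ring_scope.
Local Open Scope complex_scope.

(* The topology of the complex plane is the one of the modulus. *)
HB.instance Definition _ (R : realType) := NormedModule.copy R[i] R[i]^o.

Definition frontier (T : topologicalType) (A : set T) : set T :=
  closure A `\` interior A.

Section PlaneDomains.
Context {R : realType}.

Definition domain (U : set R[i]) : Prop := [/\ open U, connected U & U !=set0].

Definition boundary_component (U : set R[i]) (p : R[i]) : set R[i] :=
  connected_component (frontier U) p.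

(* A bounded domain has as many boundary components as its complement in the
   Riemann sphere has components. *)
Definition finitely_connected (U : set R[i]) : Prop :=
  finite_set [set boundary_component U p | p in frontier U].

Definition real_analytic (g : R -> R[i]) : Prop :=
  forall t0 : R, exists (a : nat -> R[i]) (r : R), 0 < r /\
    forall t : R, `|t - t0| < r ->
      series (fun k => a k * (t - t0)%:C ^+ k) @ \oo --> g t.

Definition velocity (g : R -> R[i]) (t : R) : R[i] :=
  derive1 (fun s => complex.Re (g s)) t +i* derive1 (fun s => complex.Im (g s)) t.

Definition smooth_analytic_curve (C : set R[i]) : Prop :=
  exists g : R -> R[i],
    [/\ real_analytic g, forall t, velocity g t != 0,
        forall t, g (t + 1) = g t, {in `[0, 1[ &, injective g} &
        C = g @` [set` `[0, 1[]].

Definition analytic_boundary (U : set R[i]) : Prop :=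
  forall p, frontier U p -> smooth_analytic_curve (boundary_component U p).

(* Real directional derivative of a real function on the plane: e = 1 gives
   d/dx and e = 'i%C gives d/dy. Beware that in ring_scope 'i is
   Num.imaginary, not Complex 0 1. *)
Definition ddir (e : R[i]) (u : R[i] -> R) (z : R[i]) : R :=
  derive1 (fun t : R => u (z + t%:C * e)) 0.

Definition C1_on (U : set R[i]) (u : R[i] -> R) : Prop :=
  forall z e, U z -> e = 1 \/ e = 'i%C ->
    derivable (fun t : R => u (z + t%:C * e)) 0 1 /\
    {for z, continuous (ddir e u)}.

Definition harmonic_on (U : set R[i]) (u : R[i] -> R) : Prop :=
  [/\ C1_on U u, C1_on U (ddir 1 u), C1_on U (ddir 'i%C u) &
      forall z, U z -> ddir 1 (ddir 1 u) z + ddir 'i%C (ddir 'i%C u) z = 0].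

Definition cddir (e : R[i]) (f : R[i] -> R[i]) (z : R[i]) : R[i] :=
  ddir e (fun w => complex.Re (f w)) z +i* ddir e (fun w => complex.Im (f w)) z.

Definition wirtinger (f : R[i] -> R[i]) (z : R[i]) : R[i] :=
  (cddir 1 f z - 'i%C * cddir 'i%C f z) / 2.

Definition wirtinger_bar (f : R[i] -> R[i]) (z : R[i]) : R[i] :=
  (cddir 1 f z + 'i%C * cddir 'i%C f z) / 2.

(* Only the values of G z zeta for zeta in U and z in the closure of U, z
   distinct from zeta, are specified; these are then unique. The boundary
   condition is meaningful because h is continuous up to the boundary. *)
Definition green_function (U : set R[i]) (G : R[i] -> R[i] -> R) : Prop :=
  forall zeta, U zeta ->
    (exists h : R[i] -> R,
       [/\ harmonic_on U h, {within closure U, continuous h} &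
           forall z, closure U z -> z != zeta ->
             G z zeta = - ln (complex.Re `|z - zeta|) + h z]) /\
    (forall z, frontier U z -> G z zeta = 0).

Definition dzG (G : R[i] -> R[i] -> R) (z zeta : R[i]) : R[i] :=
  wirtinger (fun w => (G w zeta)%:C) z.

(* The pole zeta is excluded: derivatives are total functions, whose value
   there would be meaningless. *)
Definition green_critical (U : set R[i]) (G : R[i] -> R[i] -> R)
    (zeta : R[i]) : set R[i] :=
  [set z | [/\ U z, z != zeta & dzG G z zeta = 0]].

Definition bergman (G : R[i] -> R[i] -> R) (z zeta : R[i]) : R[i] :=
  - (2 / pi)%:C *
  wirtinger (fun w => wirtinger_bar (fun v => (G w v)%:C) zeta) z.

Definition schiffer (G : R[i] -> R[i] -> R) (z zeta : R[i]) : R[i] :=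
  - (2 / pi)%:C *
  wirtinger (fun w => wirtinger (fun v => (G w v)%:C) zeta) z.

(* Value at zeta in the frontier of U of the continuous extension of F z. *)
Definition boundary_value (U : set R[i]) (F : R[i] -> R[i] -> R[i])
    (z zeta : R[i]) : R[i] :=
  lim (F z v @[v --> within U (nbhs zeta)]).

(* Limits of critical points along poles zeta_ n tending to the frontier of U,
   i.e. eventually in each of its neighborhoods. *)
Definition critical_limit_set (U : set R[i]) (G : R[i] -> R[i] -> R) :
    set R[i] :=
  [set z | exists z_ zeta_ : nat -> R[i],
    [/\ forall n, U (zeta_ n) /\ green_critical U G (zeta_ n) (z_ n),
        zeta_ @ \oo `=>` set_nbhs (frontier U) & z_ @ \oo --> z]].

End PlaneDomains.

(* Main.v *)
Require Import Defs.
From mathcomp Require Import ring lra.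

Set Implicit Arguments.
Unset Strict Implicit.
Unset Printing Implicit Defensive.

Local Open Scope classical_set_scope.
Local Open Scope ring_scope.
Local Open Scope complex_scope.

(* In a holomorphic chart Phi that straightens the boundary at p = Phi 0, the
   Green function E(z, s) = G(z, Phi s) vanishes for real s, so it extends by
   odd reflection to a harmonic function of s near 0, uniformly in z. Its
   normal derivative a(z) at s = 0 is positive and harmonic in z, and
   E(z, s) / Im s tends to a(z) together with its gradient in z. The boundary
   values of both kernels at p are nonzero multiples of the gradient of a,
   hence (i) and (ii) say that this gradient vanishes at z, and a limit of
   critical points is a zero of it. Conversely a is not constant, since it
   tends to 0 at the other boundary points, so by Hurwitz's theorem a zero of
   its gradient attracts critical points for every pole near p. Poles far from
   p have critical points too, because the set of the poles that have one is
   open by Hurwitz's theorem and closed, provided that no critical points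
   accumulate at the boundary: away from the pole this is Hopf's lemma, and
   when both points tend to p the Green function differs from that of a half
   plane by an odd harmonic function of size O(Im s).

   Integrals are avoided: Poisson integrals are replaced by finite sums of
   Poisson kernels with poles outside the closed disc, which approximate
   harmonic functions uniformly and have explicit Taylor estimates. *)

(** * Calculus in the plane *)

(** That a boundary component is an analytic curve does not say that the domain lies on one side of
    it, as a chart requires. This is deduced from connectedness by following a square root around
    the curve, in place of Jordan's theorem; finite connectivity keeps the other components away
    from p. The definition of the Green function says nothing about its dependence on the pole, and
    its symmetry is not proved: harmonicity in the pole comes from the boundary values log |w -
    zeta| of the regular part, which are harmonic in zeta, through approximation and the maximum
    principle. Statement (iv) asks for a critical point for every index, also while zeta_n is still
    far from zeta; hence the discussion of distant poles. Derivatives are never exchanged with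
    limits directly: the sums satisfy Taylor inequalities with uniform constants, and inequalities
    pass to limits along an ultrafilter. Hurwitz's theorem and the open mapping property come from
    Harnack's inequality for log (M / |f|). *)

Section Modulus.
Context {R : realType}.
Implicit Types (z w : R[i]) (x y : R).

(** The norm of [R[i]] is itself a complex number; a real-valued modulus allows [lra] and [nra] in
    estimates. *)
Definition cabs z : R := Normc.normc z.

Lemma normC_cabs z : `|z| = (cabs z)%:C.
Proof. by rewrite normc_def; case: z. Qed.

Lemma cabsE z : cabs z = Num.sqrt (complex.Re z ^+ 2 + complex.Im z ^+ 2).
Proof. by case: z. Qed.

Lemma sqr_cabs z : cabs z ^+ 2 = complex.Re z ^+ 2 + complex.Im z ^+ 2.
Proof. by rewrite cabsE sqr_sqrtr // addr_ge0 ?sqr_ge0. Qed.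

Lemma cabs_ge0 z : 0 <= cabs z.
Proof. by rewrite cabsE sqrtr_ge0. Qed.

Lemma cabs0 : cabs 0 = 0. Proof. exact: Normc.normc0. Qed.
Lemma cabs1 : cabs 1 = 1. Proof. exact: Normc.normc1. Qed.

Lemma cabs_eq0 z : (cabs z == 0) = (z == 0).
Proof.
by apply/eqP/eqP => [/Normc.eq0_normc //|->]; exact: cabs0.
Qed.

Lemma cabs_gt0 z : (0 < cabs z) = (z != 0).
Proof. by rewrite lt_neqAle cabs_ge0 andbT eq_sym cabs_eq0. Qed.

Lemma cabsM z w : cabs (z * w) = cabs z * cabs w.
Proof. exact: Normc.normcM. Qed.

Lemma cabsV z : cabs z^-1 = (cabs z)^-1.
Proof. exact: Normc.normcV. Qed.

Lemma cabsX z n : cabs (z ^+ n) = cabs z ^+ n.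
Proof. by elim: n => [|n IH]; rewrite ?expr0 ?cabs1 // !exprS cabsM IH. Qed.

Lemma cabsN z : cabs (- z) = cabs z.
Proof. by rewrite !cabsE; case: z => a b /=; rewrite !sqrrN. Qed.

Lemma cabsB z w : cabs (z - w) = cabs (w - z).
Proof. by rewrite -cabsN opprB. Qed.

Lemma cabsD z w : cabs (z + w) <= cabs z + cabs w.
Proof.
have := ler_normD z w; rewrite !normC_cabs -rmorphD /=.
by rewrite lecR.
Qed.

Lemma cabs_tri z w v : cabs (z - v) <= cabs (z - w) + cabs (w - v).
Proof. by apply: le_trans (cabsD _ _); rewrite addrA subrK. Qed.

Lemma cabs_subr z w : cabs z - cabs w <= cabs (z - w).
Proof. by rewrite lerBlDr -{1}(subrK w z) cabsD. Qed.

Lemma cabs_Re z : `|complex.Re z| <= cabs z.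
Proof.
rewrite -sqrtr_sqr cabsE ler_sqrt ?lerDl ?sqr_ge0 //.
by rewrite addr_ge0 ?sqr_ge0.
Qed.

Lemma cabs_Im z : `|complex.Im z| <= cabs z.
Proof.
rewrite -sqrtr_sqr cabsE ler_sqrt ?lerDr ?sqr_ge0 //.
by rewrite addr_ge0 ?sqr_ge0.
Qed.

Lemma cabsR x : cabs x%:C = `|x|.
Proof. by rewrite cabsE /= expr0n /= addr0 sqrtr_sqr. Qed.

Lemma cabsi : cabs 'i%C = 1 :> R.
Proof. by rewrite cabsE /= expr0n add0r expr1n sqrtr1. Qed.

Lemma cabs_ReIm z : cabs z <= `|complex.Re z| + `|complex.Im z|.
Proof.
rewrite -[leLHS]ger0_norm ?cabs_ge0 // -ler_sqr ?nnegrE ?addr_ge0 //.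
rewrite real_normK ?num_real // sqr_cabs sqrrD !real_normK ?num_real //.
by rewrite -addrA lerD2l lerDr mulrn_wge0 // mulr_ge0.
Qed.

Lemma cabs_conj z : cabs z^* = cabs z.
Proof. by rewrite !cabsE; case: z => a b /=; rewrite sqrrN. Qed.

Lemma ReD z w : complex.Re (z + w) = complex.Re z + complex.Re w.
Proof. by case: z; case: w. Qed.
Lemma ImD z w : complex.Im (z + w) = complex.Im z + complex.Im w.
Proof. by case: z; case: w. Qed.
Lemma ReN z : complex.Re (- z) = - complex.Re z.
Proof. by case: z. Qed.
Lemma ImN z : complex.Im (- z) = - complex.Im z.
Proof. by case: z. Qed.
Lemma ReM z w : complex.Re (z * w) =
  complex.Re z * complex.Re w - complex.Im z * complex.Im w.
Proof. by case: z; case: w. Qed.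
Lemma ImM z w : complex.Im (z * w) =
  complex.Re z * complex.Im w + complex.Im z * complex.Re w.
Proof. by case: z => a b; case: w => c d /=. Qed.

Definition ReImE := (ReD, ReN, ImD, ImN, ReM, ImM).

Lemma complex_ext z w : complex.Re z = complex.Re w ->
  complex.Im z = complex.Im w -> z = w.
Proof. by case: z; case: w => a b c d /= -> ->. Qed.

Lemma nbhsC z (A : set R[i]) :
  nbhs z A <-> exists2 e : R, 0 < e & forall w, cabs (w - z) < e -> A w.
Proof.
split=> [/nbhs_ballP[e /= e0 eA]|[e e0 eA]].
  have eR : e = (complex.Re e)%:C.
    by move: e0; rewrite ltcE /= => /andP[/eqP H _]; case: (e) H => a b /= ->.
  have e0' : 0 < complex.Re e by rewrite eR ltcR in e0.
  exists (complex.Re e) => // w we; apply: eA; rewrite -ball_normE /ball_ /=.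
  by rewrite normC_cabs cabsB eR ltcR.
apply/nbhs_ballP; exists e%:C => /=; first by rewrite ltcR.
move=> w; rewrite -ball_normE /ball_ /= normC_cabs ltcR cabsB; exact: eA.
Qed.

Lemma openC (U : set R[i]) : open U <->
  forall z, U z -> exists2 e : R, 0 < e & forall w, cabs (w - z) < e -> U w.
Proof.
split=> [oU z Uz|H]; first by apply/nbhsC; apply: open_nbhs_nbhs.
rewrite openE => z Uz; apply/nbhsC; exact: H.
Qed.

Lemma closureC (A : set R[i]) z :
  closure A z <-> forall e : R, 0 < e -> exists2 w, A w & cabs (w - z) < e.
Proof.
split=> [cA e e0|H B /nbhsC[e e0 eB]].
  have [|w [Aw ew]] := cA [set w | cabs (w - z) < e]; last by exists w.
  by apply/nbhsC; exists e.
by have [w Aw we] := H _ e0; exists w; split=> //; apply: eB.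
Qed.

Lemma not_closureC (A : set R[i]) z : ~ closure A z ->
  exists2 e : R, 0 < e & forall w, cabs (w - z) < e -> ~ A w.
Proof.
move=> /closureC /existsNP[e /not_implyP[e0 H]]; exists e => // w we Aw.
by apply: H; exists w.
Qed.

Lemma cvgC (T : Type) (F : set_system T) {FF : Filter F} (f : T -> R[i]) l :
  f @ F --> l <-> forall e : R, 0 < e -> \forall x \near F, cabs (f x - l) < e.
Proof.
split=> [H e e0|H A /nbhsC[e e0 eA]].
  by apply: (H [set w | cabs (w - l) < e]); apply/nbhsC; exists e.
by apply: filterS (H _ e0) => x; exact: eA.
Qed.

Lemma cvgR (T : Type) (F : set_system T) {FF : Filter F} (f : T -> R) l :
  f @ F --> l <-> forall e : R, 0 < e -> \forall x \near F, `|f x - l| < e.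
Proof.
split=> [/cvgrPdist_lt H e e0|H].
  by apply: filterS (H _ e0) => x; rewrite distrC.
by apply/cvgrPdist_lt => e e0; apply: filterS (H _ e0) => x; rewrite distrC.
Qed.

Lemma compactC (K : set R[i]) (M : R) : closed K ->
  (forall z, K z -> cabs z <= M) -> compact K.
Proof.
move=> cK bK.
pose f (p : R * R) : R[i] := p.1 +i* p.2.
have cf : continuous f.
  move=> [a b]; apply/cvgC => e e0.
  have e2 : 0 < e / 2 by lra.
  exists ([set x | `|x - a| < e / 2], [set y | `|y - b| < e / 2]).
    by split; apply/nbhs_normP; exists (e / 2) => //= x; rewrite /ball_ /= distrC.
  move=> [c d] /= [h1 h2].
  change (cabs ((c +i* d) - (a +i* b)) < e).
  apply: le_lt_trans (cabs_ReIm _) _ => /=; lra.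
apply: (@subclosed_compact _ _ (f @` (`[-M, M] `*` `[-M, M]))) => //.
  apply: continuous_compact; first exact: continuous_subspaceT.
  by apply: compact_setX; apply: segment_compact.
move=> z /bK zM; exists (complex.Re z, complex.Im z); last by case: (z).
split=> /=; rewrite in_itv /= -ler_norml.
  exact: le_trans (cabs_Re z) zM.
exact: le_trans (cabs_Im z) zM.
Qed.

(* The shape in which compactness is used: a property that holds locally up to
   a positive error holds globally up to a positive error. *)
Lemma compact_uniform (K : set R[i]) (P : R -> R[i] -> Prop) : compact K ->
  (forall d d' z, 0 < d' -> d' <= d -> P d z -> P d' z) ->
  (forall z, K z -> exists2 d, 0 < d &
     forall w, K w -> cabs (w - z) < d -> P d w) ->
  exists2 d, 0 < d & forall z, K z -> P d z.
Proof.
move=> /compact_near_coveringP cK mP lP.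
have /(_ R (0^'+) (fun d z => K z -> P d z)) := cK.
case=> [|d d0 H].
  move=> z Kz; have [d d0 H] := lP z Kz.
  exists ([set w | cabs (w - z) < d], [set e | 0 < e < d]).
    split=> /=; first by apply/nbhsC; exists d.
    exists d => //= x /=; rewrite sub0r normrN => xd x0.
    by rewrite x0 /= (le_lt_trans (ler_norm _) xd).
  move=> [w e] /= [wd /andP[e0 ed]] Kw; apply: (mP d) (ltW ed) _ => //.
  exact: H.
exists (d / 2); first by move: d0 => /=; lra.
move=> z Kz; apply: (H (d / 2)) => //=; move: d0 => /= d0; last lra.
by rewrite sub0r normrN gtr0_norm; lra.
Qed.

(** Pointwise continuity relative to K; uniformity is derived in [ucontK_unif]. Only values on K are
    compared, which suits functions that are continuous up to the boundary. *)
Definition ucontK (K : set R[i]) (u : R[i] -> R) := forall z, K z ->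
  forall e : R, 0 < e -> exists2 d, 0 < d &
  forall w, K w -> cabs (w - z) < d -> `|u w - u z| < e.

Lemma compact_bounded (K : set R[i]) u : compact K -> ucontK K u ->
  exists2 M, 0 < M & forall z, K z -> `|u z| <= M.
Proof.
move=> cK uK.
(* The bound is written d^-1 so that it weakens as d decreases, as [compact_uniform] demands. *)
have [d d0 ud] : exists2 d, 0 < d & forall z, K z -> `|u z| <= d^-1.
  apply: compact_uniform => // [d d' z d0 dd /le_trans|z Kz].
    by apply; rewrite lef_pV2 ?posrE //; apply: lt_le_trans dd.
  have [d d0 H] := uK z Kz 1 ltr01.
  have b0 : 0 < `|u z| + 1 by have := normr_ge0 (u z); lra.
  have m0 : 0 < Num.min d (`|u z| + 1)^-1 by rewrite lt_min d0 invr_gt0.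
  exists (Num.min d (`|u z| + 1)^-1) => // w Kw.
  rewrite lt_min => /andP[wd _].
  have {}H := H w Kw wd.
  apply: (@le_trans _ _ (`|u z| + 1)).
    by have := ler_normD (u w - u z) (u z); rewrite subrK; lra.
  by rewrite -[leLHS]invrK lef_pV2 ?posrE ?invr_gt0 // ge_min lexx orbT.
by exists d^-1; rewrite ?invr_gt0.
Qed.

(** If the supremum were not attained, u would stay below it by a positive margin locally, hence
    globally, which contradicts its definition. *)
Lemma compact_max (K : set R[i]) u : compact K -> K !=set0 -> ucontK K u ->
  exists2 z, K z & forall w, K w -> u w <= u z.
Proof.
move=> cK [z0 Kz0] uK.
have [M M0 uM] := compact_bounded cK uK.
pose S := [set u z | z in K].
have hS : has_sup S.
  split; first by exists (u z0), z0.
  by exists M => _ [z Kz <-]; apply: le_trans (ler_norm _) (uM _ Kz).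
have uS z : K z -> u z <= sup S by move=> Kz; apply: ub_le_sup; [exact: hS.2|exists z].
apply: contrapT => /forall2NP H.
have [d d0 ud] : exists2 d, 0 < d & forall z, K z -> u z <= sup S - d.
  apply: compact_uniform => // [d d' z d0 dd|z Kz]; first lra.
  have [//|/existsNP[w /not_implyP[Kw /negP]]] := H z; rewrite -ltNge => uzw.
  have e0 : 0 < (sup S - u z) / 2 by have := uS w Kw; lra.
  have [d d0 {}H] := uK z Kz _ e0.
  have m0 : 0 < Num.min d ((sup S - u z) / 2) by rewrite lt_min d0 e0.
  exists (Num.min d ((sup S - u z) / 2)) => // v Kv.
  rewrite lt_min => /andP[wd _].
  have := H v Kv wd; rewrite ltr_norml => /andP[_ h2].
  have : Num.min d ((sup S - u z) / 2) <= (sup S - u z) / 2.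
    by rewrite ge_min lexx orbT.
  lra.
have : sup S <= sup S - d by apply: ge_sup; [exact: hS.1|move=> _ [z Kz <-]; exact: ud].
lra.
Qed.

End Modulus.

(** * Derivatives along a line *)

Section RealDerivative.
Context {R : realType}.
Implicit Types (f : R -> R) (x l : R).

(** Linear approximation instead of a quotient: h = 0 needs no exception, and the form is the same
    as for [cgrad] and [cder]. *)
Definition rder f x l := forall e : R, 0 < e -> exists2 d : R, 0 < d &
  forall h, `|h| < d -> `|f (x + h) - f x - l * h| <= e * `|h|.

Lemma rderP f x l : rder f x l <-> is_derive x 1 f l.
Proof.
split=> [H|H].
  have cv : (fun h => h^-1 *: ((f \o shift x) (h *: 1) - f x)) @ 0^' --> l.
    apply/cvgrPdist_lt => e e0.
    have e2 : 0 < e / 2 by lra.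
    have [d d0 {}H] := H _ e2.
    exists d => //= h /=; rewrite sub0r normrN => hd h0.
    have := H h hd; rewrite [h *: 1]mulr1 /shift /= (addrC h x) => {}H.
    have n0 : 0 < `|h| by rewrite normr_gt0.
    rewrite distrC; apply: (@le_lt_trans _ _ (e / 2)); last lra.
    rewrite -(ler_pM2r n0); apply: le_trans H; rewrite -normrM.
    rewrite (_ : forall q, (h^-1 *: q - l) * h = q - l * h) // => q.
    by change (h^-1 *: q) with (h^-1 * q); field.
  split; first by apply/cvg_ex; exists l.
  by apply: cvg_lim.
have cv : (fun h => h^-1 *: ((f \o shift x) (h *: 1) - f x)) @ 0^' --> l.
  by case: H => dv <-; exact: dv.
move=> e e0; have /cvgrPdist_lt/(_ e e0)[d /= d0 {}H] := cv.
exists d => // h hd.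
have [->|h0] := eqVneq h 0; first by rewrite addr0 subrr mulr0 subr0 normr0 mulr0.
have := H h; rewrite /= sub0r normrN => /(_ hd h0).
rewrite [h *: 1]mulr1 /shift /= (addrC h x) => /ltW {}H.
have n0 : 0 < `|h| by rewrite normr_gt0.
rewrite -(ler_pM2r n0) in H; apply: le_trans H; rewrite -normrM.
rewrite le_eqVlt; apply/orP; left; apply/eqP; rewrite -[RHS]normrN; congr `|_|.
by change (h^-1 *: (f (x + h) - f x)) with (h^-1 * (f (x + h) - f x)); field.
Qed.

Lemma rder_shift f x l : rder (fun t => f (x + t)) 0 l -> rder f x l.
Proof.
by move=> H e e0; have [d d0 {}H] := H e e0; exists d => // h /H; rewrite add0r addr0.
Qed.

Lemma rderD f g x l m : rder f x l -> rder g x m ->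
  rder (fun t => f t + g t) x (l + m).
Proof. by move=> /rderP Hf /rderP Hg; apply/rderP; apply: is_deriveD. Qed.

Lemma rderN f x l : rder f x l -> rder (fun t => - f t) x (- l).
Proof. by move=> /rderP Hf; apply/rderP; apply: is_deriveN. Qed.

Lemma rder_ext f g x l : f =1 g -> rder f x l -> rder g x l.
Proof. by move=> /funext ->. Qed.

Lemma rder_quad (a b c x : R) :
  rder (fun t => a + b * t + c * t ^+ 2) x (b + 2 * c * x).
Proof.
move=> e e0.
have c0 : 0 < `|c| + 1 by have := normr_ge0 c; lra.
exists (e / (`|c| + 1)); first by rewrite divr_gt0.
move=> h hd.
rewrite (_ : _ - _ - _ = c * h * h); last by ring.
rewrite normrM ler_wpM2r // normrM.
rewrite ltr_pdivlMr // mulrDr mulr1 in hd.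
by have := normr_ge0 h; rewrite mulrC; lra.
Qed.

Lemma rder_ext_near f g x l (d : R) : 0 < d ->
  (forall h, `|h| < d -> f (x + h) = g (x + h)) -> rder f x l -> rder g x l.
Proof.
move=> d0 fg H e e0; have [d' d'0 {}H] := H e e0.
exists (Num.min d d'); first by rewrite lt_min d0.
move=> h; rewrite lt_min => /andP[h1 h2].
rewrite -fg // -[X in g X]addr0 -fg ?normr0 // addr0; exact: H.
Qed.

Lemma rder_mvt f f' (a b : R) : a < b ->
  (forall t, a <= t <= b -> rder f t (f' t)) ->
  exists2 c, a < c < b & f b - f a = f' c * (b - a).
Proof.
move=> ab H.
have [c|c' |c cab ->] := @MVT R f f' a b ab.
- by rewrite in_itv /= => /andP[h1 h2]; apply/rderP/H; rewrite !ltW.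
- apply: derivable_within_continuous => t; rewrite in_itv /= => tab.
  by have /rderP[] := H t tab.
- by exists c => //; move: cab; rewrite in_itv.
Qed.

(** A case split on the sign of f' 0 replaces the fact that it vanishes at a maximum: as f' grows at
    0, either f' > 0 just to the right of 0 or f' < 0 just to the left. *)
Lemma second_derivative_test f f' L (d : R) : 0 < d ->
  (forall t, `|t| < d -> rder f t (f' t)) -> rder f' 0 L -> 0 < L ->
  exists2 t, `|t| < d & f 0 < f t.
Proof.
move=> d0 Hf Hf' L0.
have L2 : 0 < L / 2 by lra.
have [d' d'0 {}Hf'] := Hf' _ L2.
pose s := Num.min d d' / 2.
have [s0 sd sd'] : [/\ 0 < s, s < d & s < d'].
  have m0 : 0 < Num.min d d' by rewrite lt_min d0.
  have : Num.min d d' <= d by rewrite ge_min lexx.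
  have : Num.min d d' <= d' by rewrite ge_min lexx orbT.
  by rewrite /s; split; lra.
have [f0|f0] := leP 0 (f' 0).
  exists s; first by rewrite gtr0_norm.
  have [|c /andP[c0 cs] E] := @rder_mvt f f' 0 s s0.
    by move=> t /andP[t0 ts]; apply: Hf; rewrite ger0_norm //; lra.
  have := Hf' c; rewrite add0r gtr0_norm //.
  move=> /(_ (lt_trans cs sd')); rewrite ler_norml => /andP[h1 _].
  have fc : 0 < f' c by nra.
  by rewrite -subr_gt0 E subr0 mulr_gt0.
exists (- s); first by rewrite normrN gtr0_norm.
have [||c /andP[c0 cs] E] := @rder_mvt f f' (- s) 0.
- lra.
- by move=> t /andP[t0 ts]; apply: Hf; rewrite ler0_norm //; lra.
have := Hf' c; rewrite add0r ltr0_norm // => /(_ ltac:(lra)).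
rewrite ler_norml => /andP[_ h1].
have fc : f' c < 0 by nra.
move: E; rewrite sub0r opprK; nra.
Qed.

End RealDerivative.

(** * Gradients, complex derivatives and harmonic functions *)

Section ComplexDerivative.
Context {R : realType}.
Implicit Types (z w h : R[i]) (u v : R[i] -> R) (f g : R[i] -> R[i]).

(* The real differential of u at z is h |-> Re (p h), that is, p is twice the
   Wirtinger derivative of u. *)
Definition cgrad u z (p : R[i]) := forall e : R, 0 < e ->
  exists2 d : R, 0 < d & forall h, cabs h < d ->
    `|u (z + h) - u z - complex.Re (p * h)| <= e * cabs h.

Definition cder f z (l : R[i]) := forall e : R, 0 < e ->
  exists2 d : R, 0 < d & forall h, cabs h < d ->
    cabs (f (z + h) - f z - l * h) <= e * cabs h.

Lemma Im_mulNi z : complex.Im z = complex.Re (- 'i%C * z).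
Proof. by case: z => a b; rewrite ReM /=; ring. Qed.

(** The Cauchy-Riemann equations: the differentials h |-> Re (l h) and h |-> Im (l h) = Re (- i l h)
    come from a single number l. *)
Lemma cderP f z l : cder f z l <->
  cgrad (fun w => complex.Re (f w)) z l /\
  cgrad (fun w => complex.Im (f w)) z (- 'i%C * l).
Proof.
split=> [H|[H1 H2]].
  split=> e /H[d d0 {}H]; exists d => // h /H; apply: le_trans.
    by have := cabs_Re (f (z + h) - f z - l * h); rewrite !ReD !ReN.
  have := cabs_Im (f (z + h) - f z - l * h).
  by rewrite -mulrA -Im_mulNi !ImD !ImN.
move=> e e0; have e2 : 0 < e / 2 by lra.
have [d d0 {}H1] := H1 _ e2; have [d' d'0 {}H2] := H2 _ e2.
exists (Num.min d d'); first by rewrite lt_min d0.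
move=> h; rewrite lt_min => /andP[/H1 {}H1 /H2 {}H2].
apply: le_trans (cabs_ReIm _) _; move: H1 H2.
rewrite -[- 'i%C * l * h]mulrA -Im_mulNi !ReD !ReN !ImD !ImN; lra.
Qed.

Lemma cgrad_ext_near u v z p (d : R) : 0 < d ->
  (forall w, cabs (w - z) < d -> u w = v w) -> cgrad u z p -> cgrad v z p.
Proof.
move=> d0 uv H e e0; have [d' d'0 {}H] := H e e0.
exists (Num.min d d'); first by rewrite lt_min d0.
move=> h; rewrite lt_min => /andP[h1 h2].
rewrite -!uv ?H ?subrr ?cabs0 //.
by rewrite addrAC subrr add0r.
Qed.

Lemma cder_ext_near f g z l (d : R) : 0 < d ->
  (forall w, cabs (w - z) < d -> f w = g w) -> cder f z l -> cder g z l.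
Proof.
move=> d0 fg /cderP[H1 H2]; apply/cderP; split.
  by apply: (cgrad_ext_near d0 _ H1) => w /fg ->.
by apply: (cgrad_ext_near d0 _ H2) => w /fg ->.
Qed.

Lemma cgradD u v z p q : cgrad u z p -> cgrad v z q ->
  cgrad (fun w => u w + v w) z (p + q).
Proof.
move=> H1 H2 e e0; have e2 : 0 < e / 2 by lra.
have [d d0 {}H1] := H1 _ e2; have [d' d'0 {}H2] := H2 _ e2.
exists (Num.min d d'); first by rewrite lt_min d0.
move=> h; rewrite lt_min => /andP[/H1 {}H1 /H2 {}H2].
rewrite mulrDl ReD (_ : _ - _ = (u (z + h) - u z - complex.Re (p * h)) +
  (v (z + h) - v z - complex.Re (q * h))); last by ring.
by apply: le_trans (ler_normD _ _) _; lra.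
Qed.

Lemma cgradZ u z p (c : R) : cgrad u z p -> cgrad (fun w => c * u w) z (c%:C * p).
Proof.
move=> H e e0; have c0 : 0 < `|c| + 1 by have := normr_ge0 c; lra.
have [d d0 {}H] := H (e / (`|c| + 1)) (divr_gt0 e0 c0).
exists d => // h /H {}H.
rewrite -mulrA ReM /= mul0r subr0 -!mulrBr normrM.
apply: le_trans (ler_wpM2l (normr_ge0 _) H) _.
rewrite mulrA ler_wpM2r ?cabs_ge0 // mulrA ler_pdivrMr // mulrC ler_wpM2l //; lra.
Qed.

Lemma cgrad_cst (c : R) z : cgrad (fun=> c) z 0.
Proof.
move=> e e0; exists 1 => // h _; rewrite mul0r !subrr normr0.
by rewrite mulr_ge0 ?cabs_ge0 // ltW.
Qed.

Lemma cgrad_cont u z p : cgrad u z p -> forall e : R, 0 < e ->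
  exists2 d, 0 < d & forall w, cabs (w - z) < d -> `|u w - u z| < e.
Proof.
move=> H e e0; have [d d0 {}H] := H 1 ltr01.
have c0 : 0 < cabs p + 1 by have := cabs_ge0 p; lra.
exists (Num.min d (e / (cabs p + 1))); first by rewrite lt_min d0 divr_gt0.
move=> w; rewrite lt_min => /andP[/H]; rewrite ltr_pdivlMr // => H1 H2.
rewrite (addrC z) subrK in H1.
have := cabs_Re (p * (w - z)); rewrite cabsM => H3.
have := ler_normD (u w - u z - complex.Re (p * (w - z))) (complex.Re (p * (w - z))).
by rewrite subrK; lra.
Qed.

Lemma cder_cont f z l : cder f z l -> forall e : R, 0 < e ->
  exists2 d, 0 < d & forall w, cabs (w - z) < d -> cabs (f w - f z) < e.
Proof.
move=> /cderP[H1 H2] e e0; have e2 : 0 < e / 2 by lra.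
have [d d0 {}H1] := cgrad_cont H1 e2; have [d' d'0 {}H2] := cgrad_cont H2 e2.
exists (Num.min d d'); first by rewrite lt_min d0.
move=> w; rewrite lt_min => /andP[/H1 {}H1 /H2 {}H2].
by apply: le_lt_trans (cabs_ReIm _) _; rewrite !ReImE; lra.
Qed.

Lemma cgrad_comp u f z p l : cgrad u (f z) p -> cder f z l ->
  cgrad (fun w => u (f w)) z (p * l).
Proof.
move=> H1 H2 e e0.
have p0 : 0 < 2 * (cabs p + 1) by have := cabs_ge0 p; lra.
have l0 : 0 < 2 * (cabs l + 1) by have := cabs_ge0 l; lra.
have [d1 d10 {}H1] := H1 _ (divr_gt0 e0 l0).
have [d2 d20 Hc] := cder_cont H2 d10.
have [d3 d30 H3] := H2 1 ltr01.
have [d4 d40 H4] := H2 _ (divr_gt0 e0 p0).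
exists (Num.min (Num.min d2 d3) d4); first by rewrite !lt_min d20 d30.
move=> h; rewrite !lt_min => /andP[/andP[h2 h3] h4].
have {}Hc := Hc (z + h); rewrite addrAC subrr add0r in Hc.
have := H1 _ (Hc h2); rewrite [f z + _]addrC subrK.
set k := f (z + h) - f z => E1.
have := H3 h h3; have := H4 h h4; rewrite mul1r -/k => E4 E3.
have k0 : cabs k <= (cabs l + 1) * cabs h.
  by have := cabsD (k - l * h) (l * h); rewrite subrK cabsM; lra.
have E5 : `|complex.Re (p * (k - l * h))| <= cabs p * (e / (2 * (cabs p + 1)) * cabs h).
  apply: le_trans (cabs_Re _) _; rewrite cabsM.
  by apply: ler_wpM2l => //; apply: cabs_ge0.
have -> : u (f (z + h)) - u (f z) - complex.Re (p * l * h) =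
  (u (f (z + h)) - u (f z) - complex.Re (p * k)) + complex.Re (p * (k - l * h)).
  by rewrite [p * (k - _)]mulrBr ReD ReN -[p * l * h]mulrA; ring.
apply: le_trans (ler_normD _ _) _.
have E6 : e / (2 * (cabs l + 1)) * cabs k <= e / 2 * cabs h.
  rewrite (_ : e / 2 * _ = e / (2 * (cabs l + 1)) * ((cabs l + 1) * cabs h)); last first.
    by field; have := cabs_ge0 l; lra.
  by apply: ler_wpM2l => //; rewrite divr_ge0 // ltW.
have E7 : cabs p * (e / (2 * (cabs p + 1)) * cabs h) <= e / 2 * cabs h.
  rewrite mulrA ler_wpM2r ?cabs_ge0 // mulrA ler_pdivrMr //.
  by have := cabs_ge0 p; nra.
lra.
Qed.

Lemma cder_comp f g z l m : cder g (f z) m -> cder f z l ->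
  cder (fun w => g (f w)) z (m * l).
Proof.
move=> /cderP[H1 H2] H; apply/cderP; rewrite mulrA.
by split; [exact: cgrad_comp H1 H|exact: cgrad_comp H2 H].
Qed.

Lemma cderD f g z l m : cder f z l -> cder g z m ->
  cder (fun w => f w + g w) z (l + m).
Proof.
move=> /cderP[H1 H2] /cderP[H3 H4]; apply/cderP; rewrite mulrDr; split.
  by apply: cgrad_ext_near ltr01 _ (cgradD H1 H3) => w _; rewrite ReD.
by apply: cgrad_ext_near ltr01 _ (cgradD H2 H4) => w _; rewrite ImD.
Qed.

Lemma cder_cst (c : R[i]) z : cder (fun=> c) z 0.
Proof. by apply/cderP; rewrite mulr0; split; exact: cgrad_cst. Qed.

Lemma cderZ (c : R[i]) f z l : cder f z l -> cder (fun w => c * f w) z (c * l).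
Proof.
apply: (cder_comp (g := fun w => c * w)) => e e0; exists 1 => // h _.
rewrite (_ : _ - _ = 0) ?cabs0; last by ring.
by rewrite mulr_ge0 ?cabs_ge0 // ltW.
Qed.

Lemma cder_id z : cder id z 1.
Proof.
move=> e e0; exists 1 => // h _; rewrite /= (_ : _ - _ = 0) ?cabs0; last by ring.
by rewrite mulr_ge0 ?cabs_ge0 // ltW.
Qed.

Lemma cder_sqr z : cder (fun w => w ^+ 2) z (2 * z).
Proof.
move=> e e0; exists e => // h he; rewrite (_ : _ - _ = h * h); last by ring.
by rewrite cabsM ler_wpM2r ?cabs_ge0 // ltW.
Qed.

(** By polarisation, f g = ((f + g)^2 - (f - g)^2) / 4, so the chain rule and the derivative of the
    square suffice. *)
Lemma cderM f g z l m : cder f z l -> cder g z m ->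
  cder (fun w => f w * g w) z (l * g z + f z * m).
Proof.
move=> Hf Hg.
have H1 := cder_comp (cder_sqr _) (cderD Hf Hg).
have H2 := cder_comp (cder_sqr _) (cderD Hf (cderZ (-1) Hg)).
have := cderD (cderZ (1 / 4) H1) (cderZ (- (1 / 4)) H2).
rewrite (_ : _ + _ = l * g z + f z * m); last by field.
by apply: cder_ext_near ltr01 _ => w _; field.
Qed.

Lemma cderV z : z != 0 -> cder (fun w => w^-1) z (- z ^- 2).
Proof.
move=> z0 e e0; have c0 : 0 < cabs z by rewrite cabs_gt0.
exists (Num.min (cabs z / 2) (e * cabs z ^+ 3 / 2)).
  by rewrite lt_min !divr_gt0 ?mulr_gt0 ?exprn_gt0.
move=> h; rewrite lt_min => /andP[h1 h2].
have h3 : cabs z / 2 <= cabs (z + h).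
  by have := cabsB z (- h); have := cabs_subr z (- h); rewrite opprK cabsN; lra.
have zh : z + h != 0 by rewrite -cabs_gt0; lra.
rewrite (_ : _ - _ = h / (z ^+ 2 * (z + h)) * h); last by field; apply/andP.
rewrite cabsM ler_wpM2r ?cabs_ge0 // !cabsM cabsV cabsM cabsX.
rewrite ler_pdivrMr ?mulr_gt0 ?exprn_gt0 //; last lra.
apply: (le_trans (ltW h2)).
rewrite (_ : e * cabs z ^+ 3 / 2 = e * cabs z ^+ 2 * (cabs z / 2)); last by ring.
by rewrite [leRHS]mulrA ler_wpM2l // mulr_ge0 ?sqr_ge0 // ltW.
Qed.

(** Division by z reduces to the point 1, where ln |1 + h| = ln (1 + y) / 2 with y = 2 Re h + |h|^2,
    and y - 2 y^2 <= ln (1 + y) <= y. *)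
Lemma cgrad_ln z : z != 0 -> cgrad (fun w => ln (cabs w)) z z^-1.
Proof.
suff H : cgrad (fun w => ln (cabs (1 + w))) 0 1.
  move=> z0; have H1 : cder (fun w => z^-1 * w + -1) z z^-1.
    by have := cderD (cderZ z^-1 (cder_id z)) (cder_cst (-1) z); rewrite mulr1 addr0.
  have := @cgrad_comp _ _ z 1 _ _ H1; rewrite mulVf // subrr mul1r => /(_ _ H) H2.
  have c0 : 0 < cabs z by rewrite cabs_gt0.
  have := cgradD H2 (cgrad_cst (ln (cabs z)) z); rewrite addr0.
  apply: (cgrad_ext_near c0) => w wz.
  have w0 : 0 < cabs w.
    by have := cabs_subr z w; rewrite cabsB; lra.
  rewrite addrCA subrr addr0 cabsM cabsV -lnM ?posrE ?mulr_gt0 ?invr_gt0 //.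
by congr ln; field; apply: lt0r_neq0.
move=> e e0; exists (Num.min (1/4) (e / 10)); first by rewrite lt_min; apply/andP; split; lra.
move=> h; rewrite lt_min add0r mul1r addr0 cabs1 ln1 subr0 => /andP[h1 h2].
have c0 := cabs_ge0 h.
have hR : `|complex.Re h| <= cabs h := cabs_Re h.
pose y : R := 2 * complex.Re h + cabs h ^+ 2.
have yE : cabs (1 + h) ^+ 2 = 1 + y.
  by rewrite /y !sqr_cabs ReD ImD /=; ring.
have y0 : 1 + y >= 1/2.
  rewrite -yE; have := cabs_subr 1 (- h); rewrite opprK cabsN cabs1; nra.
have p0 : 0 < cabs (1 + h).
  by rewrite cabs_gt0; apply/eqP => E; move: yE; rewrite E cabs0 expr0n /=; lra.
have L2 : ln (1 + y) = 2 * ln (cabs (1 + h)) by rewrite -yE lnXn // mulr_natl.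
have p1 : 0 < 1 + y by lra.
have U : ln (1 + y) <= y by rewrite -ler_expR lnK ?posrE // expR_ge1Dx.
have L : y - 2 * y ^+ 2 <= ln (1 + y).
  have := @expR_ge1Dx R (- ln (1 + y)); rewrite expRN lnK ?posrE //.
  move=> E; have E2 : 1 - (1 + y)^-1 <= ln (1 + y) by lra.
  apply: le_trans E2.
  rewrite -subr_ge0 (_ : _ - _ = y ^+ 2 * (2 * (1 + y) - 1) / (1 + y)); last by field; lra.
  apply: divr_ge0; last lra.
  by apply: mulr_ge0; [exact: sqr_ge0|lra].
have y3 : y ^+ 2 <= 9 * cabs h ^+ 2.
  have : `|y| <= 3 * cabs h.
    rewrite /y; apply: le_trans (ler_normD _ _) _.
    rewrite normrM [`|2|]gtr0_norm // [`|_ ^+ 2|]ger0_norm ?sqr_ge0 //.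
    have : cabs h ^+ 2 <= cabs h by rewrite expr2 ler_piMr //; lra.
    lra.
  move=> H; have := ler_pM (normr_ge0 y) (normr_ge0 y) H H.
  by rewrite -expr2 real_normK ?num_real //; lra.
have : cabs h ^+ 2 * 10 <= e * cabs h by nra.
have yd : y = 2 * complex.Re h + cabs h ^+ 2 by [].
have := sqr_ge0 (cabs h); clearbody y; move=> s0 q; rewrite mul1r ler_norml; apply/andP; split; lra.
Qed.

(** Harmonicity as complex differentiability of the gradient p: stable under composition with
    holomorphic maps, with no second partial derivatives to handle. *)
Definition harm (V : set R[i]) u := exists p p1 : R[i] -> R[i],
  forall z, V z -> cgrad u z (p z) /\ cder p z (p1 z).

(** The second derivative is part of the notion because [harm_Re] and [harm_comp] need the
    derivative to be differentiable, and Cauchy's theorem is not at hand to provide it. *)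
Definition hol2 (V : set R[i]) f := exists f1 f2 : R[i] -> R[i],
  forall z, V z -> cder f z (f1 z) /\ cder f1 z (f2 z).

Lemma harm_sub (V W : set R[i]) u : W `<=` V -> harm V u -> harm W u.
Proof. by move=> WV [p [p1 H]]; exists p, p1 => z /WV; exact: H. Qed.

Lemma hol2_sub (V W : set R[i]) f : W `<=` V -> hol2 V f -> hol2 W f.
Proof. by move=> WV [p [p1 H]]; exists p, p1 => z /WV; exact: H. Qed.

Lemma harmD (V : set R[i]) u v : harm V u -> harm V v -> harm V (fun z => u z + v z).
Proof.
move=> [p [p1 H1]] [q [q1 H2]]; exists (fun z => p z + q z), (fun z => p1 z + q1 z).
by move=> z Vz; have [? ?] := H1 z Vz; have [? ?] := H2 z Vz; split;
  [exact: cgradD|exact: cderD].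
Qed.

Lemma harmZ (V : set R[i]) u (c : R) : harm V u -> harm V (fun z => c * u z).
Proof.
move=> [p [p1 H1]]; exists (fun z => c%:C * p z), (fun z => c%:C * p1 z).
by move=> z Vz; have [? ?] := H1 z Vz; split; [exact: cgradZ|exact: cderZ].
Qed.

Lemma harm_cst (V : set R[i]) (c : R) : harm V (fun=> c).
Proof. by exists (fun=> 0), (fun=> 0) => z _; split; [exact: cgrad_cst|exact: cder_cst]. Qed.

Lemma harmB (V : set R[i]) u v : harm V u -> harm V v -> harm V (fun z => u z - v z).
Proof.
move=> hu /(harmZ (-1)) /(harmD hu); congr harm.
by apply/funext => z; rewrite mulN1r.
Qed.

Lemma harm_sum (V : set R[i]) (I : Type) (s : seq I) (F : I -> R[i] -> R) :
  (forall i, harm V (F i)) -> harm V (fun z => \sum_(i <- s) F i z).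
Proof.
move=> H; elim: s => [|i s IH].
  by under eq_fun do rewrite big_nil; exact: harm_cst.
by under eq_fun do rewrite big_cons; exact: harmD.
Qed.

Lemma harm_comp (V W : set R[i]) u f : harm V u -> hol2 W f ->
  (forall z, W z -> V (f z)) -> harm W (fun z => u (f z)).
Proof.
move=> [p [p1 H1]] [f1 [f2 H2]] WV.
exists (fun z => p (f z) * f1 z).
exists (fun z => p1 (f z) * f1 z * f1 z + p (f z) * f2 z) => z Wz.
have [h1 h2] := H2 z Wz; have [h3 h4] := H1 _ (WV z Wz); split.
  exact: cgrad_comp.
by apply: cderM => //; exact: cder_comp.
Qed.

Lemma hol2_comp (V W : set R[i]) g f : hol2 V g -> hol2 W f ->
  (forall z, W z -> V (f z)) -> hol2 W (fun z => g (f z)).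
Proof.
move=> [p [p1 H1]] [f1 [f2 H2]] WV.
exists (fun z => p (f z) * f1 z).
exists (fun z => p1 (f z) * f1 z * f1 z + p (f z) * f2 z) => z Wz.
have [h1 h2] := H2 z Wz; have [h3 h4] := H1 _ (WV z Wz); split.
  exact: cder_comp.
by apply: cderM => //; exact: cder_comp.
Qed.

Lemma harm_Re (V : set R[i]) f : hol2 V f -> harm V (fun z => complex.Re (f z)).
Proof.
move=> [f1 [f2 H]]; exists f1, f2 => z /H[h1 h2]; split => //.
by have /cderP[] := h1.
Qed.

Lemma hol2_cst (V : set R[i]) (c : R[i]) : hol2 V (fun=> c).
Proof. by exists (fun=> 0), (fun=> 0) => z _; split; exact: cder_cst. Qed.

Lemma hol2_id (V : set R[i]) : hol2 V id.
Proof.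
by exists (fun=> 1), (fun=> 0) => z _; split; [exact: cder_id|exact: cder_cst].
Qed.

Lemma hol2D (V : set R[i]) f g : hol2 V f -> hol2 V g -> hol2 V (fun z => f z + g z).
Proof.
move=> [p [p1 H1]] [q [q1 H2]]; exists (fun z => p z + q z), (fun z => p1 z + q1 z).
by move=> z Vz; have [? ?] := H1 z Vz; have [? ?] := H2 z Vz; split; exact: cderD.
Qed.

Lemma hol2M (V : set R[i]) f g : hol2 V f -> hol2 V g -> hol2 V (fun z => f z * g z).
Proof.
move=> [p [p1 H1]] [q [q1 H2]]; exists (fun z => p z * g z + f z * q z).
exists (fun z => (p1 z * g z + p z * q z) + (p z * q z + f z * q1 z)).
move=> z Vz; have [? ?] := H1 z Vz; have [? ?] := H2 z Vz; split; first exact: cderM.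
by apply: cderD; exact: cderM.
Qed.

Lemma hol2Z (V : set R[i]) (c : R[i]) f : hol2 V f -> hol2 V (fun z => c * f z).
Proof. by move=> H; apply: hol2M => //; exact: hol2_cst. Qed.

Lemma hol2B (V : set R[i]) f g : hol2 V f -> hol2 V g -> hol2 V (fun z => f z - g z).
Proof.
move=> hu /(hol2Z (-1)) /(hol2D hu); congr hol2.
by apply/funext => z; rewrite mulN1r.
Qed.

Lemma hol2V (V : set R[i]) f : hol2 V f -> (forall z, V z -> f z != 0) ->
  hol2 V (fun z => (f z)^-1).
Proof.
apply: (hol2_comp (V := [set z | z != 0]) (g := fun z => z^-1)).
exists (fun z => - z ^- 2), (fun z => 2 * z ^- 3) => z /= z0; split; first exact: cderV.
have z2 : z ^+ 2 != 0 by rewrite expf_eq0.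
have := cderZ (-1) (@cder_comp (fun w => w ^+ 2) (fun w => w^-1) z _ _
  (cderV z2) (cder_sqr z)).
rewrite (_ : -1 * _ = 2 * z ^- 3); last by field.
by apply: cder_ext_near ltr01 _ => w _; rewrite mulN1r.
Qed.

Lemma harm_ln (V : set R[i]) f : hol2 V f -> (forall z, V z -> f z != 0) ->
  harm V (fun z => ln (cabs (f z))).
Proof.
apply: (harm_comp (V := [set z | z != 0]) (u := fun z => ln (cabs z))).
exists (fun z => z^-1), (fun z => - z ^- 2) => z /= z0.
by split; [exact: cgrad_ln|exact: cderV].
Qed.

End ComplexDerivative.

(** * The maximum principle, with one exceptional point *)

Section MaximumPrinciple.
Context {R : realType}.
Implicit Types (z w h : R[i]) (u v : R[i] -> R) (f g : R[i] -> R[i]).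

Definition dirder (e : R[i]) u z (l : R) := rder (fun t : R => u (z + t%:C * e)) 0 l.

(* The weakest notion of harmonicity for which the maximum principle holds *)
Definition lapl (V : set R[i]) u := exists p1 q1 p2 q2 : R[i] -> R,
  forall z, V z -> [/\ dirder 1 u z (p1 z), dirder 1 p1 z (q1 z),
    dirder 'i%C u z (p2 z), dirder 'i%C p2 z (q2 z) & q1 z + q2 z = 0].

Lemma cgrad_dirder u z p e : cgrad u z p -> dirder e u z (complex.Re (p * e)).
Proof.
move=> H r r0; have e0 : 0 < cabs e + 1 by have := cabs_ge0 e; lra.
have [d d0 {}H] := H _ (divr_gt0 r0 e0).
exists (d / (cabs e + 1)); first exact: divr_gt0.
move=> h; rewrite ltr_pdivlMr // => hd; rewrite add0r rmorph0 mul0r addr0.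
have hE : cabs (h%:C * e) = `|h| * cabs e by rewrite cabsM cabsR.
have n0 := normr_ge0 h.
have {}H := H (h%:C * e) ltac:(rewrite hE; nra).
have -> : complex.Re (p * e) * h = complex.Re (p * (h%:C * e)).
  by rewrite [p * (_ * e)]mulrCA [RHS]ReM /= mul0r subr0 mulrC.
apply: le_trans H _; rewrite hE mulrAC ler_pdivrMr // mulrA.
have : 0 <= r * `|h| by rewrite mulr_ge0 // ltW.
lra.
Qed.

Lemma harm_lapl (V : set R[i]) u : harm V u -> lapl V u.
Proof.
move=> [p [p1 H]].
exists (fun z => complex.Re (p z)), (fun z => complex.Re (p1 z)).
exists (fun z => - complex.Im (p z)), (fun z => - complex.Re (p1 z)) => z Vz.
have [h1 /cderP[h2 h3]] := H z Vz; split.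
- by have := cgrad_dirder 1 h1; rewrite mulr1.
- by have := cgrad_dirder 1 h2; rewrite mulr1.
- by have := cgrad_dirder 'i%C h1; rewrite ReM /= mulr0 mulr1 sub0r.
- have := cgrad_dirder 'i%C h3.
  rewrite (_ : - 'i%C * p1 z * 'i%C = p1 z); last first.
    by case: (p1 z) => a b; apply: complex_ext; rewrite !ReImE /=; ring.
  exact: rderN.
- by rewrite subrr.
Qed.

Lemma lapl_sub (V W : set R[i]) u : W `<=` V -> lapl V u -> lapl W u.
Proof.
by move=> WV [p1 [q1 [p2 [q2 H]]]]; exists p1, q1, p2, q2 => z /WV; exact: H.
Qed.

Lemma laplD (V : set R[i]) u v : lapl V u -> lapl V v -> lapl V (fun z => u z + v z).
Proof.
move=> [p1 [q1 [p2 [q2 H]]]] [p1' [q1' [p2' [q2' H']]]].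
exists (fun z => p1 z + p1' z), (fun z => q1 z + q1' z).
exists (fun z => p2 z + p2' z), (fun z => q2 z + q2' z) => z Vz.
have [h1 h2 h3 h4 h5] := H z Vz; have [k1 k2 k3 k4 k5] := H' z Vz.
by split; try exact: rderD; lra.
Qed.

Lemma laplN (V : set R[i]) u : lapl V u -> lapl V (fun z => - u z).
Proof.
move=> [p1 [q1 [p2 [q2 H]]]].
exists (fun z => - p1 z), (fun z => - q1 z).
exists (fun z => - p2 z), (fun z => - q2 z) => z Vz.
have [h1 h2 h3 h4 h5] := H z Vz.
by split; try exact: rderN; lra.
Qed.

Lemma laplB (V : set R[i]) u v : lapl V u -> lapl V v -> lapl V (fun z => u z - v z).
Proof. by move=> hu /laplN; exact: laplD. Qed.

Definition compact_cabs (K : set R[i]) (cK : compact K) :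
  exists2 M : R, 0 < M & forall z, K z -> cabs z <= M.
Proof.
have [|M M0 H] := @compact_bounded R K cabs cK.
  move=> z _ e e0; exists e => // w _ we; apply: le_lt_trans we.
  rewrite ler_norml; have := cabs_subr w z; have := cabs_subr z w.
  by rewrite (cabsB z w) => ? ?; apply/andP; split; lra.
by exists M => // z /H; apply: le_trans; exact: ler_norm.
Qed.

Lemma sqr_cabs_line z (t : R) e : cabs e = 1 ->
  cabs (z + t%:C * e) ^+ 2 = cabs z ^+ 2 + (2 * complex.Re (z * e^*)) * t + 1 * t ^+ 2.
Proof.
move=> e1; have : cabs e ^+ 2 = 1 by rewrite e1 expr1n.
rewrite !sqr_cabs; case: z => a b; case: e {e1} => c d /= e1.
by rewrite -[X in X * t ^+ 2]e1; ring.
Qed.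

(** Along the line through z in direction e, the function u + ep |w|^2 has second derivative q + 2
    ep > 0 at z, so z is no local maximum. *)
Lemma dirder_max K u p q r z e (d ep : R) : 0 < ep -> 0 < d -> cabs e = 1 ->
  (forall w, cabs (w - z) < d -> K w /\ dirder e u w (p w)) ->
  dirder e p z q -> 0 < q + 2 * ep -> r = (fun w => u w + ep * cabs w ^+ 2) ->
  exists2 w, K w & r z < r w.
Proof.
move=> ep0 d0 e1 H Hq q0 ->.
pose A := 2 * complex.Re (z * e^*).
have cz t : cabs (z + t%:C * e - z) = `|t| by rewrite addrAC subrr add0r cabsM cabsR e1 mulr1.
have [||||t td] := @second_derivative_test R
  (fun t => u (z + t%:C * e) + ep * cabs (z + t%:C * e) ^+ 2)
  (fun t => p (z + t%:C * e) + ep * (A + 2 * t)) (q + 2 * ep) d => //.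
- move=> t td; have [|Kw dw] := H (z + t%:C * e); first by rewrite cz.
  apply: rderD.
    apply: rder_shift; apply: rder_ext dw => s.
    by rewrite rmorphD /= mulrDl addrA.
  have := rder_quad (ep * cabs z ^+ 2) (ep * A) ep t.
  rewrite (_ : ep * A + 2 * ep * t = ep * (A + 2 * t)); last by ring.
  by apply: rder_ext => s; rewrite sqr_cabs_line // -/A; ring.
- apply: rderD => //.
  have := rder_quad (ep * A) (2 * ep) 0 0; rewrite (_ : 2 * ep + 2 * 0 * 0 = 2 * ep); last by ring.
  by apply: rder_ext => s; ring.
rewrite rmorph0 mul0r addr0 => lt; exists (z + t%:C * e) => //.
by have [] := H (z + t%:C * e); first by rewrite cz.
Qed.

Lemma ucontKD K u v : ucontK K u -> ucontK K v -> ucontK K (fun z => u z + v z).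
Proof.
move=> H1 H2 z Kz e e0; have e2 : 0 < e / 2 by lra.
have [d d0 {}H1] := H1 z Kz _ e2; have [d' d'0 {}H2] := H2 z Kz _ e2.
exists (Num.min d d'); first by rewrite lt_min d0.
move=> w Kw; rewrite lt_min => /andP[/(H1 w Kw) {}H1 /(H2 w Kw) {}H2].
rewrite (_ : _ - _ = (u w - u z) + (v w - v z)); last by ring.
by apply: le_lt_trans (ler_normD _ _) _; lra.
Qed.

Lemma ucontKN K u : ucontK K u -> ucontK K (fun z => - u z).
Proof.
move=> H1 z Kz e e0; have [d d0 {}H1] := H1 z Kz _ e0.
by exists d => // w Kw /(H1 w Kw); rewrite -opprD normrN.
Qed.

Lemma ucontKB K u v : ucontK K u -> ucontK K v -> ucontK K (fun z => u z - v z).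
Proof. by move=> hu /ucontKN; exact: ucontKD. Qed.

Lemma ucontK_sub (K L : set R[i]) u : L `<=` K -> ucontK K u -> ucontK L u.
Proof.
move=> LK H z Lz e e0; have [d d0 {}H] := H z (LK _ Lz) e e0.
by exists d => // w /LK; exact: H.
Qed.

Lemma harm_ucontK (V K : set R[i]) u : harm V u -> K `<=` V -> ucontK K u.
Proof.
move=> [p [p1 H]] KV z /KV /H[Hz _] e e0.
by have [d d0 {}H] := cgrad_cont Hz e0; exists d => // w _; exact: H.
Qed.

Lemma ucontK_sqr_cabs K (c : R) : ucontK K (fun z => c * cabs z ^+ 2).
Proof.
have H z : cgrad (fun w => c * cabs w ^+ 2) z (c%:C * (2 * z^*)).
  apply: cgradZ => e e0; exists e => // h he.
  have -> : cabs (z + h) ^+ 2 - cabs z ^+ 2 - complex.Re (2 * z^* * h) = cabs h ^+ 2.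
    rewrite !sqr_cabs -mulrA; case: z => a b; case: h {he} => x y.
    by rewrite mulr_natl mulr2n !ReImE /=; ring.
  by rewrite ger0_norm ?sqr_ge0 // expr2 ler_wpM2r ?cabs_ge0 // ltW.
move=> z _ e e0; have [d d0 {}H] := cgrad_cont (H z) e0.
by exists d => // w _; exact: H.
Qed.

Lemma maximum_principle0 (K V : set R[i]) u (m : R) : compact K -> open V -> V `<=` K ->
  ucontK K u -> lapl V u -> (forall z, K z -> ~ V z -> u z <= m) ->
  forall z, K z -> u z <= m.
Proof.
move=> cK oV VK cu [p1 [q1 [p2 [q2 H]]]] hm z0 Kz0; apply: contrapT => /negP.
rewrite -ltNge => lt.
have [M M0 KM] := compact_cabs cK.
(* The term ep |z|^2 makes the Laplacian positive, yet on K it stays below half of the excess u z0 -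
   m. *)
pose ep := (u z0 - m) / (2 * M ^+ 2).
have M2 : 0 < 2 * M ^+ 2 by rewrite mulr_gt0 ?exprn_gt0.
have ep0 : 0 < ep by rewrite divr_gt0 // subr_gt0.
pose r w := u w + ep * cabs w ^+ 2.
have KM2 z : K z -> ep * cabs z ^+ 2 <= (u z0 - m) / 2.
  move=> /KM zM; rewrite (_ : (u z0 - m) / 2 = ep * M ^+ 2).
    by rewrite ler_pM2l // lerXn2r // ?nnegrE ?cabs_ge0 // ltW.
  by rewrite /ep; field; apply: lt0r_neq0.
have [z1 Kz1 z1max] : exists2 z, K z & forall w, K w -> r w <= r z.
  apply: compact_max => //; first by exists z0.
  by apply: ucontKD => //; exact: ucontK_sqr_cabs.
have [Vz1|nV] := pselect (V z1); last first.
  have := z1max _ Kz0; have := hm z1 Kz1 nV; have := KM2 _ Kz1.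
  have : 0 <= ep * cabs z0 ^+ 2 by rewrite mulr_ge0 ?sqr_ge0 // ltW.
  rewrite /r; lra.
have [d d0 dV] := (openC V).1 oV z1 Vz1.
have [h1 h2 h3 h4 h5] := H z1 Vz1.
have [w Kw] : exists2 w, K w & r z1 < r w.
  (* As q1 + q2 = 0, one of the two second derivatives is nonnegative, and 2 ep is added to it. *)
  have [q1p|q1n] := leP 0 (q1 z1).
    apply: (@dirder_max K u p1 (q1 z1) r z1 1 d ep) => //.
    - exact: cabs1.
    - by move=> w /dV Vw; have [? _ _ _ _] := H w Vw; split => //; exact: VK.
    - lra.
  apply: (@dirder_max K u p2 (q2 z1) r z1 'i%C d ep) => //.
  - exact: cabsi.
  - by move=> w /dV Vw; have [_ _ ? _ _] := H w Vw; split => //; exact: VK.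
  - lra.
by have := z1max _ Kw; lra.
Qed.

Lemma compact_diff_ball (K : set R[i]) c (r : R) : compact K ->
  compact [set z | K z /\ r <= cabs (z - c)].
Proof.
move=> cK; apply: (subclosed_compact _ cK) => [|z []//].
apply: closedI; first by apply: compact_closed => //; exact: norm_hausdorff.
move=> z /closureC H /=; rewrite leNgt; apply/negP => lt.
have [w /= rw wz] := H (r - cabs (z - c)) ltac:(lra).
by have := cabs_tri w z c; lra.
Qed.

Lemma open_diff_ball (V : set R[i]) c (r : R) : open V ->
  open [set z | V z /\ r < cabs (z - c)].
Proof.
move=> /openC oV; apply/openC => z [Vz rz].
have [e e0 He] := oV z Vz.
exists (Num.min e (cabs (z - c) - r)); first by rewrite lt_min e0 subr_gt0.
move=> w; rewrite lt_min => /andP[/He Vw h2]; split => //.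
by have := cabs_tri z w c; rewrite (cabsB z w); lra.
Qed.

(* At the exceptional point s continuity suffices: subtract a small multiple of
   log (1 / |z - s|). *)
Lemma maximum_principle (K V : set R[i]) u (m : R) s : compact K -> open V ->
  V `<=` K -> ucontK K u -> lapl [set z | V z /\ z != s] u ->
  (forall z, K z -> ~ V z -> u z <= m) -> forall z, K z -> u z <= m.
Proof.
move=> cK oV VK cu lu hm.
suff H z0 : K z0 -> z0 != s -> u z0 <= m.
  move=> z0 Kz0; have [z0s|] := eqVneq z0 s; last exact: H.
  have [Vz0|] := pselect (V z0); last exact: hm.
  rewrite leNgt; apply/negP => lt.
  have [d d0 Hd] := cu _ Kz0 (u z0 - m) ltac:(lra).
  have [e e0 He] := (openC V).1 oV z0 Vz0.
  pose t := Num.min d e / 2.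
  have m0 : 0 < Num.min d e by rewrite lt_min d0.
  have t0 : 0 < t by rewrite divr_gt0.
  have tz : cabs (z0 + t%:C - z0) = t by rewrite addrAC subrr add0r cabsR gtr0_norm.
  have [td te] : t < d /\ t < e.
    have : Num.min d e <= d by rewrite ge_min lexx.
    have : Num.min d e <= e by rewrite ge_min lexx orbT.
    by rewrite /t; split; lra.
  have Kt : K (z0 + t%:C) by apply/VK/He; rewrite tz.
  have := Hd _ Kt; rewrite tz => /(_ td); rewrite ltr_norml => /andP[h1 _].
  have := H _ Kt; rewrite -z0s -subr_eq0 -cabs_eq0 tz => /(_ (lt0r_neq0 t0)).
  lra.
move=> Kz0 z0s; apply: contrapT => /negP; rewrite -ltNge => lt.
have [M M0 KM] := compact_cabs cK; have [M' M'0 uM] := compact_bounded cK cu.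
pose D := M + cabs s + 1.
have D0 : 0 < D by rewrite /D; have := cabs_ge0 s; lra.
have KD z : K z -> cabs (z - s) <= D.
  by move=> /KM; have := cabsD z (- s); rewrite cabsN /D; lra.
pose l w := ln (cabs (w - s)) - ln D.
have l0 w : K w -> l w <= 0.
  move=> /KD wD; rewrite /l subr_le0.
  have [->|ws] := eqVneq w s; last by rewrite ler_ln ?posrE // cabs_gt0 subr_eq0.
  rewrite subrr cabs0 ln0 // ln_ge0 // /D.
  by have := cabs_ge0 s; lra.
have lz0 : l z0 <= 0 := l0 _ Kz0.
(* Since l <= 0, this makes the loss dl * |l z0| smaller than the excess u z0 - m. *)
pose dl := (u z0 - m) / (2 * (1 - l z0)).
have dl0 : 0 < dl by rewrite divr_gt0 ?mulr_gt0; lra.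
have rs0 : 0 < cabs (z0 - s) by rewrite cabs_gt0 subr_eq0.
(* On the circle of radius eta where it bounds the region, dl * l is at most m - M', which offsets
   the bound M' of u. *)
pose eta := Num.min (cabs (z0 - s)) (D * expR ((m - M') / dl)).
have eta0 : 0 < eta by rewrite lt_min rs0 mulr_gt0 ?expR_gt0.
have hl : harm [set z | z != s] l.
  apply: harmB; last exact: harm_cst.
  apply: harm_ln; first by apply: hol2B; [exact: hol2_id|exact: hol2_cst].
  by move=> z /= zs; rewrite subr_eq0.
have nes w : eta <= cabs (w - s) -> w != s.
  by move=> h; rewrite -subr_eq0 -cabs_gt0; lra.
have : u z0 + dl * l z0 <= m.
  apply: (@maximum_principle0 [set z | K z /\ eta <= cabs (z - s)]
    [set z | V z /\ eta < cabs (z - s)]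
    (fun z => u z + dl * l z)).
  - exact: compact_diff_ball.
  - exact: open_diff_ball.
  - by move=> z [/VK Kz /ltW].
  - apply: ucontKD; first by apply: ucontK_sub cu => z [].
    apply: (@harm_ucontK [set z | z != s]); first exact: harmZ.
    by move=> z [_ /nes].
  - apply: laplD.
      by apply: lapl_sub lu => z [Vz /ltW /nes].
    apply: harm_lapl; apply: harmZ; apply: harm_sub hl.
    by move=> z [_ /ltW/nes].
  - move=> z [Kz ez] nV.
    have [Vz|nVz] := pselect (V z); last first.
      have := hm _ Kz nVz; have := l0 _ Kz.
      move=> h1 h2; have : dl * l z <= 0 by rewrite pmulr_rle0.
      lra.
    have ze : cabs (z - s) = eta.
      by apply/eqP; rewrite eq_le ez andbT leNgt; apply/negP => ?; apply: nV.
    have : l z <= (m - M') / dl.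
      rewrite /l ze lerBlDr.
      have -> : (m - M') / dl + ln D = ln (D * expR ((m - M') / dl)).
        by rewrite lnM ?posrE ?expR_gt0 // expRK addrC.
      by rewrite ler_ln ?posrE ?mulr_gt0 ?expR_gt0 // ge_min lexx orbT.
    rewrite ler_pdivlMr // mulrC => h1.
    have := uM _ Kz; have := ler_norm (u z); lra.
  - by split => //; rewrite ge_min lexx.
have : dl * (2 * (1 - l z0)) = u z0 - m by rewrite /dl; field; lra.
nra.
Qed.

Lemma maximum_principle_abs (K V : set R[i]) u (m : R) s : compact K -> open V ->
  V `<=` K -> ucontK K u -> lapl [set z | V z /\ z != s] u ->
  (forall z, K z -> ~ V z -> `|u z| <= m) -> forall z, K z -> `|u z| <= m.
Proof.
move=> cK oV VK cu lu hm z Kz; rewrite ler_norml lerNl; apply/andP; split.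
  apply: (maximum_principle (u := fun z => - u z) (s := s) cK oV VK) => //.
  - exact: ucontKN.
  - exact: laplN.
  - by move=> w Kw nV; apply: le_trans (hm w Kw nV); rewrite -normrN ler_norm.
apply: (maximum_principle (s := s) cK oV VK) => // w Kw nV.
by apply: le_trans (hm w Kw nV); rewrite ler_norm.
Qed.

End MaximumPrinciple.

(** * Poisson sums and interior estimates *)

Section PoissonSums.
Context {R : realType}.
Implicit Types (z w h s : R[i]) (u v : R[i] -> R) (f g : R[i] -> R[i]).

(** The kernel of the disc of radius |w|, equal to 1 at s = 0; written as a real part, it is visibly
    harmonic in s. *)
Definition poisson w s : R := complex.Re ((w + s) / (w - s)).

Lemma poissonE w s : w != s ->
  poisson w s = (cabs w ^+ 2 - cabs s ^+ 2) / cabs (w - s) ^+ 2.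
Proof.
rewrite -subr_eq0 -cabs_gt0 => ws; rewrite /poisson.
have : cabs (w - s) ^+ 2 != 0 by apply: lt0r_neq0; rewrite exprn_gt0.
rewrite !sqr_cabs ReM; case: w ws => a b ws; case: s ws => c d ws /= n0.
by field.
Qed.

Lemma poisson_conj w s : poisson w s^* = poisson w^* s.
Proof.
rewrite /poisson.
have -> : (w + s^*) / (w - s^*) = ((w^* + s) / (w^* - s))^*.
  by rewrite rmorphM /= rmorphD /= fmorphV rmorphB /= !conjcK.
by case: (_ / (w^* - s)).
Qed.

(** Equally spaced sample points on a circle, as the roots of w^(2^m) = A: powers of two need only
    complex square roots, no exponential or trigonometric function. *)
Fixpoint dyadic_roots m (A : R[i]) : seq R[i] :=
  if m is m'.+1 then
    flatten [seq [:: sqrtc a; - sqrtc a] | a <- dyadic_roots m' A]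
  else [:: A].

Lemma dyadic_rootsP m A w : w \in dyadic_roots m A -> w ^+ (2 ^ m) = A.
Proof.
elim: m w => [|m IH] w /=; first by rewrite inE expn0 expr1 => /eqP.
move=> /flatten_mapP[a /IH aA].
rewrite !inE expnS exprM => /orP[]/eqP ->; by rewrite ?sqrrN sqr_sqrtc.
Qed.

Lemma size_dyadic_roots m A : size (dyadic_roots m A) = (2 ^ m)%N.
Proof.
elim: m => //= m IH; rewrite expnS -IH; elim: (dyadic_roots m A) => //= a s ->.
by rewrite mulnS.
Qed.

(** Two opposite roots b and -b contribute 2 (b^2 + s^2) / (b^2 - s^2), the same expression for the
    squares; hence the induction on m. *)
Lemma sum_dyadic_roots m A s : s ^+ (2 ^ m) != A ->
  \sum_(w <- dyadic_roots m A) (w + s) / (w - s) =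
  (2 ^ m)%:R * ((A + s ^+ (2 ^ m)) / (A - s ^+ (2 ^ m))).
Proof.
elim: m s => [|m IH] s sA; first by rewrite big_seq1 expn0 expr1 mul1r.
rewrite /= big_flatten big_map /= expnS exprM natrM -mulrA -IH; last by rewrite -exprM -expnS.
rewrite big_distrr; apply: eq_big_seq => a aA.
have a2 := dyadic_rootsP aA.
have as2 : a - s ^+ 2 != 0.
  by rewrite subr_eq0; apply: contra sA => /eqP E; rewrite -a2 E -exprM -expnS.
rewrite big_cons big_seq1; have := sqr_sqrtc a; set b := sqrtc a => bE.
rewrite -bE in as2 *; move: as2; rewrite subr_sqr mulf_eq0 negb_or => /andP[n1 n2].
change (GRing.GRing_mul__canonical__Monoid_MulLaw (complex_complex__canonical__GRing_PzSemiRing R) 2 ((b ^+ 2 + s ^+ 2) / ((b - s) * (b + s)))) with (2 * ((b ^+ 2 + s ^+ 2) / ((b - s) * (b + s)))).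
have n3 : - b - s != 0 by rewrite -opprD oppr_eq0.
by field; rewrite ?n1 ?n2 ?n3.
Qed.

Lemma expr_ge_Bernoulli (x : R) n : 0 <= x -> 1 + n%:R * x <= (1 + x) ^+ n.
Proof.
move=> x0; elim: n => [|n IH]; first by rewrite mul0r addr0.
have : (0 : R) <= n%:R by [].
by rewrite exprS -natr1; nra.
Qed.

Definition psum (l : seq (R * R[i])) s := \sum_(p <- l) p.1 * poisson p.2 s.

(** The bound M on the total weight makes the derivative estimates uniform over the whole class. *)
Definition PC (M : R) v := exists l : seq (R * R[i]),
  [/\ forall p, p \in l -> 1 < cabs p.2 <= 2, \sum_(p <- l) `|p.1| <= M & v = psum l].

Lemma harm_poisson (V : set R[i]) w : (forall s, V s -> w != s) -> harm V (poisson w).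
Proof.
move=> H; apply: harm_Re; apply: hol2M.
  by apply: hol2D; [exact: hol2_cst|exact: hol2_id].
apply: hol2V; first by apply: hol2B; [exact: hol2_cst|exact: hol2_id].
by move=> s /H; rewrite subr_eq0.
Qed.

Lemma harm_PC M v (V : set R[i]) : PC M v -> (forall s, V s -> cabs s <= 1) -> harm V v.
Proof.
move=> [l [H _ ->]] V1.
have -> : psum l = (fun s => \sum_(p <- l) if p \in l then p.1 * poisson p.2 s else 0).
  by apply/funext => s; rewrite /psum; apply: eq_big_seq => p ->.
apply: harm_sum => p; have [pl|_] := boolP (p \in l); last exact: harm_cst.
apply: harmZ; apply: harm_poisson => s /V1 s1.
by have /andP[h _] := H p pl; apply: contraTneq h => ->; rewrite -leNgt.
Qed.

(** The mean is Re ((A + s^N) / (A - s^N)) with A = r^N, close to 1 because r^N >= 1 + N (r - 1). *)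
Lemma psum_circle (r : R) m s : 1 < r -> cabs s = 1 ->
  `|(\sum_(w <- dyadic_roots m (r ^+ (2 ^ m))%:C) poisson w s) / (2 ^ m)%:R - 1| <=
  2 / ((2 ^ m)%:R * (r - 1)).
Proof.
move=> r1 s1; set N := (2 ^ m)%N; set A := (r ^+ N)%:C.
have N0 : (0 : R) < N%:R by rewrite ltr0n expn_gt0.
have sN : cabs (s ^+ N) = 1 by rewrite cabsX s1 expr1n.
have rN : 1 + N%:R * (r - 1) <= r ^+ N.
  by have := @expr_ge_Bernoulli (r - 1) N ltac:(lra); rewrite addrCA subrr addr0.
have r0 : 0 < N%:R * (r - 1) by rewrite mulr_gt0 // subr_gt0.
have AN : cabs A = r ^+ N by rewrite cabsR ger0_norm // exprn_ge0 //; lra.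
have As : N%:R * (r - 1) <= cabs (A - s ^+ N) by have := cabs_subr A (s ^+ N); lra.
have nA : A - s ^+ N != 0 by rewrite -cabs_gt0; lra.
have -> : \sum_(w <- dyadic_roots m A) poisson w s =
  complex.Re (\sum_(w <- dyadic_roots m A) (w + s) / (w - s)).
  elim: (dyadic_roots m A) => [|a l IH]; first by rewrite !big_nil.
  by rewrite !big_cons ReD IH.
rewrite sum_dyadic_roots; last by rewrite eq_sym -subr_eq0.
have -> : (A + s ^+ N) / (A - s ^+ N) = 1 + 2 * s ^+ N / (A - s ^+ N) by field.
rewrite -/N (_ : N%:R = (N%:R : R)%:C); last by rewrite rmorph_nat.
rewrite ReM /= mul0r subr0 ReD /= mulrAC divff ?lt0r_neq0 // mul1r addrAC subrr add0r.
apply: le_trans (cabs_Re _) _; rewrite !cabsM sN mulr1 cabsV.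
have -> : cabs (2 : R[i]) = 2 by rewrite (_ : 2 = (2 : R)%:C) ?cabsR ?gtr0_norm // rmorph_nat.
by rewrite ler_pM2l // lef_pV2 ?posrE //; lra.
Qed.

Lemma exists_dyadic (x : R) : exists m, x <= (2 ^ m)%:R.
Proof.
exists (Num.bound x); apply/ltW; apply: lt_trans (unstable.ltr_bound x) _.
by rewrite ltr_nat ltn_expl.
Qed.

(* On the circle of radius r the Poisson kernel of the unit disc is an
   approximate identity as r tends to 1; N = 2 ^ m sample points make its mean
   value close to 1. *)
Lemma poisson_approx (ep de M : R) : 0 < ep -> 0 < de -> 0 < M ->
  exists2 wl : seq R[i] * R,
   [/\ 1 < wl.2 <= 2, wl.1 != [::] & forall w, w \in wl.1 -> cabs w = wl.2] &
   forall u, (forall s, cabs s = 1 -> `|u s| <= M) ->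
     (forall x y, cabs x = 1 -> cabs y = 1 -> cabs (x - y) < de -> `|u x - u y| <= ep) ->
     forall s, cabs s = 1 ->
     `|psum [seq (u (w / (wl.2)%:C) / (size wl.1)%:R, w) | w <- wl.1] s - u s| <= 4 * ep.
Proof.
move=> ep0 de0 M0.
(* For r so close to 1, the points w and w / r differ by at most de / 2, and the kernel is at most
   ep / (2 M) at distance de / 2 or more. *)
pose r : R := 1 + Num.min (Num.min 1 (de / 2)) (ep * de ^+ 2 / (24 * M)).
have d2 : 0 < de ^+ 2 by rewrite exprn_gt0.
have K0 : 0 < ep * de ^+ 2 / (24 * M) by rewrite divr_gt0 ?mulr_gt0.
have [r1 r2 rd rM] : [/\ 1 < r, r <= 2, r - 1 <= de / 2 &
    (r ^+ 2 - 1) / (de / 2) ^+ 2 * (2 * M) <= ep].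
  set t := Num.min _ _ in r *; have t0 : 0 < t by rewrite !lt_min ltr01 divr_gt0.
  have t1 : t <= 1 by rewrite !ge_min lexx.
  have t2 : t <= de / 2 by rewrite !ge_min lexx orbT.
  have t3 : t <= ep * de ^+ 2 / (24 * M) by rewrite !ge_min lexx !orbT.
  rewrite /r; split; try lra.
  rewrite ler_pdivlMr ?mulr_gt0 // in t3.
  rewrite mulrAC ler_pdivrMr ?exprn_gt0 ?divr_gt0 //.
  have : t * t * M <= t * M by rewrite ler_wpM2r ?ler_piMr // ltW.
  rewrite expr_div_n; nra.
pose eta := Num.min 1 (ep / M).
have eta0 : 0 < eta by rewrite lt_min ltr01 divr_gt0.
have [m mP] := exists_dyadic (2 / (eta * (r - 1))).
pose ws := dyadic_roots m (r ^+ (2 ^ m))%:C.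
have r0 : 0 < r - 1 by lra.
have N0 : (0 : R) < (2 ^ m)%:R by rewrite ltr0n expn_gt0.
have wr w : w \in ws -> cabs w = r.
  move=> /dyadic_rootsP /(congr1 cabs); rewrite cabsX cabsR ger0_norm.
    move=> /eqP; rewrite eqrXn2 ?cabs_ge0 ?expn_gt0 //; first by move=> /eqP.
    by lra.
  by rewrite exprn_ge0 //; lra.
exists (ws, r) => /=.
  split=> //; first by rewrite r1 r2.
  by rewrite -size_eq0 size_dyadic_roots -lt0n expn_gt0.
move=> u uM ue s s1.
have us := uM s s1.
have avg := psum_circle m r1 s1; rewrite -/ws in avg.
have {}avg : `|(\sum_(w <- ws) poisson w s) / (2 ^ m)%:R - 1| <= eta.
  apply: le_trans avg _; rewrite ler_pdivrMr ?mulr_gt0 //.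
  by rewrite ler_pdivrMr ?mulr_gt0 // in mP; lra.
set a := _ / _ in avg.
rewrite size_dyadic_roots /psum big_map /=.
(* The error splits into the weighted oscillation of u around s and u s times the defect of the
   mean. *)
have -> : \sum_(w <- ws) u (w / r%:C) / (2 ^ m)%:R * poisson w s - u s =
  (\sum_(w <- ws) (u (w / r%:C) - u s) * poisson w s) / (2 ^ m)%:R + u s * (a - 1).
  rewrite /a mulr_suml (_ : u s * _ = \sum_(w <- ws) (u s * poisson w s) / (2 ^ m)%:R - u s).
    rewrite addrA -big_split /=; congr (_ - _); apply: eq_bigr => w _.
    by field; rewrite lt0r_neq0.
  by rewrite mulrBr mulr1 mulrA mulr_sumr mulr_suml.
have wp w : w \in ws -> 0 <= poisson w s /\
    `|u (w / r%:C) - u s| * poisson w s <= ep * poisson w s + ep.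
  move=> /wr wr'.
  have rC : r%:C != 0 :> R[i] by rewrite -cabs_gt0 cabsR gtr0_norm; lra.
  have wrs : cabs (w / r%:C) = 1.
    by rewrite cabsM cabsV cabsR wr' gtr0_norm ?divff ?lt0r_neq0 //; lra.
  have nws : w != s by apply/eqP => E; move: wr'; rewrite E s1; lra.
  have pE := poissonE nws; rewrite wr' s1 expr1n in pE.
  have p0 : 0 <= poisson w s by rewrite pE divr_ge0 ?sqr_ge0 //; nra.
  (* Near s the oscillation of u is at most ep; away from s the kernel itself is small. *)
  split=> //; have [lt|ge] := ltP (cabs (w / r%:C - s)) de.
    by have := ler_wpM2r p0 (ue _ _ wrs s1 lt); lra.
  have : `|u (w / r%:C) - u s| * poisson w s <= ep.
    have wsd : de / 2 <= cabs (w - s).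
      have : cabs (w / r%:C - w) = r - 1.
        rewrite (_ : _ - w = w / r%:C * (1 - r)%:C); last by rewrite rmorphB /=; field.
        by rewrite cabsM wrs mul1r cabsR ler0_norm; lra.
      by have := cabs_tri (w / r%:C) w s; lra.
    apply: le_trans rM; rewrite mulrC.
    apply: ler_pM => //; first last.
      by have := ler_normB (u (w / r%:C)) (u s); have := uM _ wrs; lra.
    have dh : 0 < de / 2 by lra.
    have wp : 0 < cabs (w - s) by lra.
    rewrite pE; apply: ler_wpM2l; first by nra.
    by rewrite lef_pV2 ?posrE ?exprn_gt0 // lerXn2r ?nnegrE // ltW.
  by have := mulr_ge0 (ltW ep0) p0; lra.
have S1 : `|\sum_(w <- ws) (u (w / r%:C) - u s) * poisson w s| / (2 ^ m)%:R <= ep * a + ep.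
  rewrite ler_pdivrMr // mulrDl.
  have -> : ep * a * (2 ^ m)%:R = \sum_(w <- ws) ep * poisson w s.
    by rewrite -mulr_sumr /a; field; rewrite lt0r_neq0.
  have -> : ep * (2 ^ m)%:R = \sum_(w <- ws) ep.
    by rewrite big_const_seq count_predT size_dyadic_roots iter_addr_0 mulr_natr.
  rewrite -big_split /=; apply: le_trans (ler_norm_sum _ _ _) _.
  rewrite big_seq [leRHS]big_seq; apply: ler_sum => w /wp[p0 pw].
  by rewrite normrM (ger0_norm p0).
have E1 : eta <= 1 by rewrite ge_min lexx.
have E2 : `|u s * (a - 1)| <= ep.
  have : eta <= ep / M by rewrite ge_min lexx orbT.
  rewrite ler_pdivlMr // => E2; rewrite normrM.
  by have := ler_pM (normr_ge0 _) (normr_ge0 _) us avg; lra.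
have a2 : a <= 2 by move: avg; rewrite ler_norml => /andP[_]; lra.
apply: le_trans (ler_normD _ _) _; rewrite normrM normfV (@ger0_norm _ (2 ^ m)%:R) //.
have : ep * a <= ep * 2 by rewrite ler_pM2l.
lra.
Qed.

End PoissonSums.

(** * Taylor estimates that pass to uniform limits *)

Section TaylorEstimates.
Context {R : realType}.
Implicit Types (z w h s : R[i]) (u v : R[i] -> R) (f g p : R[i] -> R[i]).

Lemma cabsM_le x X y Y : cabs x <= X -> cabs y <= Y -> cabs (x * y : R[i]) <= X * Y.
Proof. by move=> xX yY; rewrite cabsM; apply: ler_pM => //; exact: cabs_ge0. Qed.

Lemma cabsX_le x X n : cabs (x : R[i]) <= X -> cabs (x ^+ n) <= X ^+ n.
Proof.
move=> xX; rewrite cabsX lerXn2r // nnegrE ?cabs_ge0 //.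
exact: le_trans (cabs_ge0 _) xX.
Qed.

Lemma cabs_nat n : cabs (n%:R : R[i]) = n%:R.
Proof. by rewrite (_ : n%:R = (n%:R : R)%:C) ?cabsR ?ger0_norm // rmorph_nat. Qed.

(* A generous bound for the derivatives up to order three, on the disc of
   radius 1/2, of the Poisson kernels with poles w such that 1 < |w| <= 2 *)
Definition CT : R := 2 ^+ 17.

Lemma CT_gt0 : 0 < CT. Proof. by rewrite exprn_gt0. Qed.

(** Inequalities between values with constants depending on M only: unlike differentiability, they
    survive pointwise limits, and they imply it ([tay_cgrad]). *)
Definition tay (M : R) u p0 p1 p2 := forall s, cabs s < 1/2 ->
  [/\ cabs (p0 s) <= CT * M, cabs (p1 s) <= CT * M, cabs (p2 s) <= CT * M &
  forall h, cabs (s + h) < 1/2 ->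
  [/\ `|u (s + h) - u s - complex.Re (p0 s * h)| <= CT * M * cabs h ^+ 2,
      cabs (p0 (s + h) - p0 s - p1 s * h) <= CT * M * cabs h ^+ 2 &
      cabs (p1 (s + h) - p1 s - p2 s * h) <= CT * M * cabs h ^+ 2]].

(** Since poisson w t = Re (2 w / (w - t)) - 1, the derivatives are those of 2 w / (w - t), and |w -
    t| >= 1/2 on the disc of radius 1/2. *)
Lemma tay_poisson w : 1 < cabs w <= 2 ->
  tay 1 (poisson w) (fun s => 2 * w * (w - s)^-1 ^+ 2)
    (fun s => 4 * w * (w - s)^-1 ^+ 3) (fun s => 12 * w * (w - s)^-1 ^+ 4).
Proof.
move=> /andP[w1 w2] s s2; rewrite mulr1.
have inv2 t : cabs t < 1/2 -> w - t != 0 /\ cabs (w - t)^-1 <= 2.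
  move=> t2; have t0 : 1/2 <= cabs (w - t) by have := cabs_subr w t; lra.
  have t0' : 0 < cabs (w - t) by lra.
  by rewrite -cabs_gt0 cabsV; split => //; rewrite -[leRHS]invrK lef_pV2 ?posrE; lra.
have [a0 aV] := inv2 s s2.
have E2 : cabs (2 : R[i]) = 2 by exact: cabs_nat.
have E4 : cabs (4 : R[i]) = 4 by exact: cabs_nat.
have E12 : cabs (12 : R[i]) = 12 by exact: cabs_nat.
have le2 : cabs (2 : R[i]) <= 2 by rewrite E2.
have le3 : cabs (3 : R[i]) <= 3 by rewrite cabs_nat.
have le4 : cabs (4 : R[i]) <= 4 by rewrite E4.
have le6 : cabs (6 : R[i]) <= 6 by rewrite cabs_nat.
have le8 : cabs (8 : R[i]) <= 8 by rewrite cabs_nat.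
have le12 : cabs (12 : R[i]) <= 12 by rewrite E12.
split.
- apply: le_trans (cabsM_le (cabsM_le le2 w2) (cabsX_le 2 aV)) _; rewrite /CT; lra.
- apply: le_trans (cabsM_le (cabsM_le le4 w2) (cabsX_le 3 aV)) _; rewrite /CT; lra.
- apply: le_trans (cabsM_le (cabsM_le le12 w2) (cabsX_le 4 aV)) _; rewrite /CT; lra.
move=> h h2; have [b0 bV] := inv2 _ h2.
have hh : cabs h <= 1.
  by have := cabs_subr (s + h) s; have := cabsD (s + h) (- s); rewrite cabsN addrAC subrr add0r; lra.
have ha : cabs (w - s) <= 5/2 by have := cabsD w (- s); rewrite cabsN; lra.
have b0' : w - s - h != 0 by rewrite -addrA -opprD.
have bV' : cabs (w - s - h)^-1 <= 2 by rewrite -addrA -opprD.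
rewrite (_ : w - (s + h) = w - s - h); last by ring.
have lh := lexx (cabs h ^+ 2); rewrite -{1}cabsX in lh.
set a := w - s in a0 aV ha b0' bV' *.
have pE t : w - t != 0 -> poisson w t = complex.Re (2 * w * (w - t)^-1) - 1.
  move=> t0; rewrite /poisson (_ : (w + t) / (w - t) = 2 * w * (w - t)^-1 - 1).
    by rewrite ReD ReN.
  by field.
have fin (C : R) : C <= CT -> C * cabs h ^+ 2 <= CT * cabs h ^+ 2.
  by move=> CC; rewrite ler_wpM2r ?sqr_ge0.
split.
- rewrite !pE // (_ : w - (s + h) = a - h); last by rewrite /a; ring.
  rewrite -/a.
  have -> : complex.Re (2 * w * (a - h)^-1) - 1 - (complex.Re (2 * w * a^-1) - 1) -
     complex.Re (2 * w * a^-1 ^+ 2 * h) =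
     complex.Re (2 * w * (a - h)^-1 - 2 * w * a^-1 - 2 * w * a^-1 ^+ 2 * h).
    by rewrite !ReD !ReN; ring.
  apply: le_trans (cabs_Re _) _.
  rewrite (_ : _ - _ = 2 * w * a^-1 ^+ 2 * (a - h)^-1 * h ^+ 2); last by field; apply/andP.
  apply: le_trans (cabsM_le (cabsM_le (cabsM_le (cabsM_le le2 w2) (cabsX_le 2 aV)) bV') lh) _.
  by apply: fin; rewrite /CT; lra.
- have q : cabs (3 * a - 2 * h) <= 19/2.
    have := cabsD (3 * a) (- (2 * h)); rewrite cabsN.
    by have := cabsM_le le3 ha; have := cabsM_le le2 hh; lra.
  rewrite (_ : _ - _ = 2 * w * (3 * a - 2 * h) * a^-1 ^+ 3 * (a - h)^-1 ^+ 2 * h ^+ 2);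
    last by field; apply/andP.
  apply: le_trans (cabsM_le (cabsM_le (cabsM_le (cabsM_le (cabsM_le le2 w2) q)
    (cabsX_le 3 aV)) (cabsX_le 2 bV')) lh) _.
  by apply: fin; rewrite /CT; lra.
- have q : cabs (6 * a ^+ 2 - 8 * (a * h) + 3 * h ^+ 2) <= 61.
    have := cabsD (6 * a ^+ 2 - 8 * (a * h)) (3 * h ^+ 2).
    have := cabsD (6 * a ^+ 2) (- (8 * (a * h))); rewrite cabsN.
    have := cabsM_le le6 (cabsX_le 2 ha); have := cabsM_le le8 (cabsM_le ha hh).
    have := cabsM_le le3 (cabsX_le 2 hh); lra.
  rewrite (_ : _ - _ = 4 * w * (6 * a ^+ 2 - 8 * (a * h) + 3 * h ^+ 2) *
     a^-1 ^+ 4 * (a - h)^-1 ^+ 3 * h ^+ 2); last by field; apply/andP.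
  apply: le_trans (cabsM_le (cabsM_le (cabsM_le (cabsM_le (cabsM_le le4 w2) q)
    (cabsX_le 4 aV)) (cabsX_le 3 bV')) lh) _.
  by apply: fin; rewrite /CT; lra.
Qed.

Lemma tay_PC M v : PC M v -> exists p0 p1 p2, tay M v p0 p1 p2.
Proof.
move=> [l [H lM ->]].
suff : exists p0 p1 p2, tay (\sum_(p <- l) `|p.1|) (psum l) p0 p1 p2.
  move=> [p0 [p1 [p2 T]]]; exists p0, p1, p2 => s /T[h1 h2 h3 h4].
  have C0 := CT_gt0; have D : CT * \sum_(p <- l) `|p.1| <= CT * M by rewrite ler_pM2l.
  split; try exact: le_trans D.
  move=> h /h4[k1 k2 k3].
  have D' : CT * (\sum_(p <- l) `|p.1|) * cabs h ^+ 2 <= CT * M * cabs h ^+ 2.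
    by rewrite ler_wpM2r ?sqr_ge0.
  by split; exact: le_trans D'.
elim: l H {lM} => [|[c w] l IH] H.
  exists (fun=> 0), (fun=> 0), (fun=> 0) => s _.
  rewrite big_nil mulr0 /psum !big_nil cabs0; split=> // h _.
  rewrite !big_nil !mul0r (_ : complex.Re 0 = 0) // !subr0 normr0 cabs0.
  by [].
have [p0 [p1 [p2 T]]] := IH (fun q ql => H q (mem_behead (s := (c, w) :: l) ql)).
have Tw := tay_poisson (H (c, w) (mem_head _ _)).
exists (fun s => c%:C * (2 * w * (w - s)^-1 ^+ 2) + p0 s).
exists (fun s => c%:C * (4 * w * (w - s)^-1 ^+ 3) + p1 s).
exists (fun s => c%:C * (12 * w * (w - s)^-1 ^+ 4) + p2 s) => s s2.
have [h1 h2 h3 h4] := T s s2; have [k1 k2 k3 k4] := Tw s s2.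
have add (x y : R[i]) (X Y q : R) : cabs x <= CT * 1 * q -> cabs y <= CT * Y * q ->
    cabs (c%:C * x + y) <= CT * (`|c| + Y) * q.
  move=> Hx Hy; apply: le_trans (cabsD _ _) _; rewrite cabsM cabsR.
  by have := ler_wpM2l (normr_ge0 c) Hx; lra.
have add1 (x y : R[i]) (Y : R) : cabs x <= CT * 1 -> cabs y <= CT * Y ->
    cabs (c%:C * x + y) <= CT * (`|c| + Y).
  by have := @add x y 0 Y 1; rewrite !mulr1.
rewrite big_cons; split; try exact: add1.
move=> h hs; have [m1 m2 m3] := h4 h hs; have [n1 n2 n3] := k4 h hs; split.
- have pc t : psum ((c, w) :: l) t = c * poisson w t + psum l t.
    by rewrite /psum big_cons.
  rewrite !pc.
  have -> : c * poisson w (s + h) + psum l (s + h) - (c * poisson w s + psum l s) -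
    complex.Re ((c%:C * (2 * w * (w - s)^-1 ^+ 2) + p0 s) * h) =
    c * (poisson w (s + h) - poisson w s - complex.Re (2 * w * (w - s)^-1 ^+ 2 * h)) +
    (psum l (s + h) - psum l s - complex.Re (p0 s * h)).
    rewrite mulrDl ReD -[c%:C * _ * h]mulrA (ReM c%:C) [complex.Im c%:C]/= [complex.Re c%:C]/= mul0r subr0; ring.
  apply: le_trans (ler_normD _ _) _; rewrite normrM.
  by have := ler_wpM2l (normr_ge0 c) n1; lra.
- rewrite (_ : _ - _ = c%:C * (2 * w * (w - (s + h))^-1 ^+ 2 - 2 * w * (w - s)^-1 ^+ 2 -
     4 * w * (w - s)^-1 ^+ 3 * h) + (p0 (s + h) - p0 s - p1 s * h)); last by ring.
  exact: add.
- rewrite (_ : _ - _ = c%:C * (4 * w * (w - (s + h))^-1 ^+ 3 - 4 * w * (w - s)^-1 ^+ 3 -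
     12 * w * (w - s)^-1 ^+ 4 * h) + (p1 (s + h) - p1 s - p2 s * h)); last by ring.
  exact: add.
Qed.

(** An ultrafilter gives limits to all bounded sequences at once, hence to the derivatives at every
    point, in place of extracting diagonal subsequences. *)
Lemma bounded_ultra_lim (F : set_system nat) (x : nat -> R[i]) (B : R) :
  UltraFilter F -> (forall n, cabs (x n) <= B) ->
  exists2 l, x @ F --> l & cabs l <= B.
Proof.
move=> FU xB.
have cB : compact [set z : R[i] | cabs z <= B].
  apply: (@compactC _ _ B) => // z /closureC H /=.
  rewrite leNgt; apply/negP => lt.
  have [w /= wB wz] := H (cabs z - B) ltac:(lra).
  by have := cabs_subr z w; rewrite (cabsB z); lra.
have UF : UltraFilter (x @ F).
  split=> [|G GP xG]; first exact: fmap_proper_filter.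
  apply/seteqP; split=> // A GA.
  have [//|FA] := in_ultra_setVsetC (x @^-1` A) FU.
  have GF : Filter G by case: GP.
  have := @filterI _ G GF _ _ GA (xG (~` A) FA).
  by move=> /(@filter_ex _ G GP)[z []].
have := cB; rewrite compact_ultra => /(_ _ UF).
case=> [|l [/= lB xl]]; last by exists l.
by have := @filterE _ F _ (x @^-1` [set z | cabs z <= B]); apply.
Qed.

Lemma taylor_closed (F : set_system nat) (f g g1 : nat -> R[i]) (a b c h : R[i]) (B : R) :
  ProperFilter F -> f @ F --> a -> g @ F --> b -> g1 @ F --> c ->
  (forall n, cabs (f n - g n - g1 n * h) <= B) -> cabs (a - b - c * h) <= B.
Proof.
move=> FP fa gb gc le; have FF : Filter F by case: FP.
apply/ler_addgt0Pr => e e0.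
have e3 : 0 < e / (2 + cabs h + 1) by rewrite divr_gt0 //; have := cabs_ge0 h; lra.
have k1 := (@cvgC R nat F FF f a).1 fa _ e3.
have k2 := (@cvgC R nat F FF g b).1 gb _ e3.
have k3 := (@cvgC R nat F FF g1 c).1 gc _ e3.
have [n [[n1 n2] n3]] := @filter_ex _ F FP _ (@filterI _ F FF _ _ (@filterI _ F FF _ _ k1 k2) k3).
rewrite /= in n1 n2 n3; have := le n.
have E : a - b - c * h = (f n - g n - g1 n * h) - ((f n - a) - (g n - b) - (g1 n - c) * h).
  by ring.
have := cabsD (f n - g n - g1 n * h) (- ((f n - a) - (g n - b) - (g1 n - c) * h)).
rewrite -E cabsN => h1 h2.
have := cabsD (f n - a - (g n - b)) (- ((g1 n - c) * h)).
have := cabsD (f n - a) (- (g n - b)); rewrite !cabsN cabsM.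
have : e / (2 + cabs h + 1) * (2 + cabs h + 1) = e.
  by field; apply: lt0r_neq0; have := cabs_ge0 h; lra.
have := ler_wpM2r (cabs_ge0 h) (ltW n3); lra.
Qed.

Definition uniform_limit (u : R[i] -> R) (Q : (R[i] -> R) -> Prop) :=
  forall e : R, 0 < e -> exists2 v, Q v & forall s, cabs s < 1 -> `|u s - v s| <= e.

(** The derivatives of u are defined as limits, along an ultrafilter, of those of approximating
    sums; the Taylor inequalities identify them. *)
Lemma tay_limit M u : uniform_limit u (PC M) -> exists p0 p1 p2, tay M u p0 p1 p2.
Proof.
move=> H.
have /choice[v vP] : forall n : nat, exists v, PC M v /\
    forall s, cabs s < 1 -> `|u s - v s| <= n.+1%:R^-1.
  by move=> n; have [|v Pv uv] := H n.+1%:R^-1; [rewrite invr_gt0|exists v].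
have /choice[p pP] : forall n, exists p : (R[i] -> R[i]) * (R[i] -> R[i]) * (R[i] -> R[i]),
    tay M (v n) p.1.1 p.1.2 p.2.
  by move=> n; have [p0 [p1 [p2 T]]] := tay_PC (vP n).1; exists (p0, p1, p2).
have [F [FU Foo]] := @ultraFilterLemma nat \oo _.
have FP : ProperFilter F := @ultra_proper _ F FU.
have FF : Filter F by case: FP.
have lim (q : nat -> R[i] -> R[i]) :
    (forall n s, cabs s < 1/2 -> cabs (q n s) <= CT * M) ->
    exists q' : R[i] -> R[i], forall s, cabs s < 1/2 ->
      (fun n => q n s) @ F --> q' s /\ cabs (q' s) <= CT * M.
  move=> qM.
  have /choice[q' q'P] : forall s, exists l, cabs s < 1/2 ->
      (fun n => q n s) @ F --> l /\ cabs l <= CT * M.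
    move=> s; have [lt|ge] := ltP (cabs s) (1/2); last by exists 0.
    by have [l] := bounded_ultra_lim FU (fun n => qM n s lt); exists l.
  by exists q'.
have [|p0 p0P] := lim (fun n => (p n).1.1); first by move=> n s /(pP n)[].
have [|p1 p1P] := lim (fun n => (p n).1.2); first by move=> n s /(pP n)[].
have [|p2 p2P] := lim (fun n => (p n).2); first by move=> n s /(pP n)[].
exists p0, p1, p2 => s s2; have [l0 b0] := p0P s s2.
have [l1 b1] := p1P s s2; have [l2 b2] := p2P s s2; split => // h hs.
have [m0 _] := p0P _ hs; have [m1 _] := p1P _ hs; split.
- apply/ler_addgt0Pr => e e0.
  have e3 : 0 < e / (2 + cabs h) by rewrite divr_gt0 //; have := cabs_ge0 h; lra.
  have N1 : F [set n | n.+1%:R^-1 < e / (2 + cabs h)].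
    apply: Foo; have := near_infty_natSinv_lt (PosNum e3).
    by [].
  have N2 := (@cvgC R nat F FF (fun n => (p n).1.1 s) (p0 s)).1 l0 _ e3.
  have [n [n1 n2]] := @filter_ex _ F FP _ (@filterI _ F FF _ _ N1 N2).
  rewrite /= in n1 n2.
  have [_ _ _ /(_ h hs)[T _ _]] := pP n s s2.
  have s1 : cabs s < 1 by lra.
  have sh1 : cabs (s + h) < 1 by lra.
  have U1 := (vP n).2 _ s1; have U2 := (vP n).2 _ sh1.
  have n2' : `|complex.Re (((p n).1.1 s - p0 s) * h)| <= e / (2 + cabs h) * cabs h.
    apply: le_trans (cabs_Re _) _; rewrite cabsM.
    by apply: ler_wpM2r; [exact: cabs_ge0|exact: ltW].
  have : e / (2 + cabs h) * (2 + cabs h) = e.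
    by field; apply: lt0r_neq0; have := cabs_ge0 h; lra.
  rewrite mulrBl ReD ReN in n2'.
  move: n1 n2' U1 U2; set q := _^-1; set q' := e / _ => n1 n2' U1 U2.
  clearbody q q'.
  move: T U1 U2 n2'; rewrite !ler_norml => /andP[? ?] /andP[? ?] /andP[? ?] /andP[? ?] ?.
  by apply/andP; split; lra.
- by apply: (taylor_closed FP m0 l0 l1) => n; have [_ _ _ /(_ h hs)[]] := pP n s s2.
- by apply: (taylor_closed FP m1 l1 l2) => n; have [_ _ _ /(_ h hs)[]] := pP n s s2.
Qed.

Lemma tay_cgrad M u p0 p1 p2 s : tay M u p0 p1 p2 -> cabs s < 1/2 ->
  [/\ cgrad u s (p0 s), cder p0 s (p1 s) & cder p1 s (p2 s)].
Proof.
move=> T s2; have [c0 _ _ H] := T s s2.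
have C0 : 0 <= CT * M by apply: le_trans c0; exact: cabs_ge0.
have small e : 0 < e -> exists2 d : R, 0 < d & forall h, cabs h < d ->
    cabs (s + h) < 1/2 /\ CT * M * cabs h ^+ 2 <= e * cabs h.
  move=> e0; exists (Num.min (1/2 - cabs s) (e / (CT * M + 1))).
    by rewrite lt_min; apply/andP; split; [lra|rewrite divr_gt0 //; lra].
  move=> h; rewrite lt_min ltr_pdivlMr; last lra.
  move=> /andP[h1 h2]; split; first by have := cabsD s h; lra.
  rewrite expr2 mulrA ler_wpM2r ?cabs_ge0 //; have := cabs_ge0 h; lra.
by split=> e /small[d d0 {}small]; exists d => // h /small[/H[? ? ?]]; exact: le_trans.
Qed.

End TaylorEstimates.

(** * Interior estimates and regularity of harmonic functions *)

Section InteriorEstimates.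
Context {R : realType}.
Implicit Types (z w h s c : R[i]) (u v : R[i] -> R) (f g : R[i] -> R[i]) (r M : R).

(** This is u_x - i u_y, the number p of [cgrad] wherever that exists; as a total function it avoids
    carrying witnesses along. *)
Definition gr u z : R[i] := ddir 1 u z +i* (- ddir 'i%C u z).

(** By the Cauchy-Riemann equations the real part of f determines its complex derivative. *)
Definition dc f z : R[i] := gr (fun w => complex.Re (f w)) z.

Lemma grE u z : gr u z = ddir 1 u z +i* (- ddir 'i%C u z).
Proof. by []. Qed.

Lemma dirder_ddir e u z l : dirder e u z l -> ddir e u z = l.
Proof. by move=> /rderP H; rewrite /ddir derive1E; case: H. Qed.

Lemma cgrad_gr u z p : cgrad u z p -> gr u z = p.
Proof.
move=> H; rewrite /gr (dirder_ddir (cgrad_dirder 1 H)) (dirder_ddir (cgrad_dirder 'i%C H)).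
by rewrite mulr1 ReM /= mulr0 mulr1 sub0r opprK; case: p {H}.
Qed.

Lemma cder_dc f z l : cder f z l -> dc f z = l.
Proof. by move=> /cderP[/cgrad_gr]. Qed.

Definition cdisc c r : set R[i] := [set z | cabs (z - c) <= r].
Definition odisc c r : set R[i] := [set z | cabs (z - c) < r].

Lemma compact_cdisc c r : compact (cdisc c r).
Proof.
apply: (@compactC _ _ (r + cabs c)) => [z /closureC H|z zr].
  rewrite /cdisc /= leNgt; apply/negP => lt.
  have [w /= wB wz] := H (cabs (z - c) - r) ltac:(lra).
  by move: wB; rewrite /cdisc /=; have := cabs_tri z w c; rewrite (cabsB z w); lra.
by move: zr; rewrite /cdisc /=; have := cabs_subr z c; lra.
Qed.

Arguments compact_cdisc : clear implicits.

Lemma open_odisc c r : open (odisc c r).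
Proof.
apply/openC => z zr; exists (r - cabs (z - c)); first by rewrite subr_gt0.
by move=> w wz; rewrite /odisc /=; have := cabs_tri w z c; lra.
Qed.

Lemma cabs_real_pos r : 0 < r -> cabs (r%:C : R[i]) = r.
Proof. by move=> r0; rewrite cabsR gtr0_norm. Qed.

Lemma lapl_affine (V : set R[i]) u c r :
  lapl V u -> lapl [set s | V (c + r%:C * s)] (fun s => u (c + r%:C * s)).
Proof.
move=> [p1 [q1 [p2 [q2 H]]]].
have sc e (F : R[i] -> R) s l :
    dirder e F (c + r%:C * s) l -> dirder e (fun s => F (c + r%:C * s)) s (r * l).
  move=> D ep ep0; have r0 : 0 < `|r| + 1 by have := normr_ge0 r; lra.
  have [d d0 {}D] := D _ (divr_gt0 ep0 r0).
  exists (d / (`|r| + 1)); first exact: divr_gt0.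
  move=> h; rewrite ltr_pdivlMr // => hd.
  have := D (r * h) ltac:(rewrite normrM; have := normr_ge0 h; nra).
  rewrite !add0r !rmorph0 !mul0r !addr0 rmorphM /= => {}D.
  rewrite (_ : c + r%:C * (s + h%:C * e) = c + r%:C * s + r%:C * h%:C * e); last by ring.
  rewrite (_ : r * l * h = l * (r * h)); last by ring.
  apply: le_trans D _; rewrite normrM mulrA ler_wpM2r // mulrAC ler_pdivrMr //.
  by have := normr_ge0 r; nra.
have sc2 (F : R[i] -> R) e s l :
    dirder e F (c + r%:C * s) l -> dirder e (fun s => r * F (c + r%:C * s)) s (r * (r * l)).
  by move=> /sc /rderP D; apply/rderP; apply: is_deriveZ.
exists (fun s => r * p1 (c + r%:C * s)), (fun s => r * (r * q1 (c + r%:C * s))).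
exists (fun s => r * p2 (c + r%:C * s)), (fun s => r * (r * q2 (c + r%:C * s))).
move=> s /= Vs; have [h1 h2 h3 h4 h5] := H _ Vs.
split; [exact: sc|exact: sc2|exact: sc|exact: sc2|].
by rewrite -!mulrDr h5 !mulr0.
Qed.

Lemma ucontK_affine (K : set R[i]) u c r : 0 < r ->
  ucontK K u -> ucontK [set s | K (c + r%:C * s)] (fun s => u (c + r%:C * s)).
Proof.
move=> r0 H s Ks e e0; have [d d0 {}H] := H _ Ks e e0.
exists (d / r); first exact: divr_gt0.
move=> w Kw ws; apply: H => //.
rewrite (_ : _ - _ = r%:C * (w - s)); last by ring.
by rewrite cabsM cabs_real_pos // mulrC -ltr_pdivlMr.
Qed.

Lemma ucontK_unif (K : set R[i]) u e : compact K -> ucontK K u -> 0 < e ->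
  exists2 d, 0 < d & forall x y, K x -> K y -> cabs (x - y) < d -> `|u x - u y| <= e.
Proof.
move=> cK uK e0; have e2 : 0 < e / 2 by lra.
have [d d0 H] : exists2 d, 0 < d &
    forall x, K x -> forall y, K y -> cabs (y - x) < d -> `|u y - u x| <= e.
  apply: compact_uniform => // [d d' z d'0 dd H y Ky yz|z Kz].
    by apply: H => //; apply: lt_le_trans dd.
  have [d d0 H] := uK z Kz _ e2.
  exists (d / 2) => [|w Kw wz y Ky yw]; first lra.
  have := H w Kw ltac:(lra).
  have := H y Ky; have := cabs_tri y w z => t /(_ ltac:(lra)).
  rewrite ler_norml !ltr_norml => /andP[? ?] /andP[? ?]; apply/andP; split; lra.
by exists d => // x y Kx Ky; exact: H.
Qed.

(* The signs of the coefficients are recorded for the sake of Hopf's lemma. *)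
Definition sampled u (l : seq (R * R[i])) := forall p, p \in l ->
  1 < cabs p.2 <= 2 /\
  exists x k, [/\ p.2 = (cabs p.2)%:C * x, cabs x = 1, 0 <= k & p.1 = k * u x].

Lemma circle_approx M u e : 0 < M -> ucontK (cdisc 0 1) u ->
  (forall s, cabs s = 1 -> `|u s| <= M) -> 0 < e ->
  exists l, [/\ sampled u l, \sum_(p <- l) `|p.1| <= M &
    forall s, cabs s = 1 -> `|u s - psum l s| <= e].
Proof.
move=> M0 cu uM e0; have e4 : 0 < e / 4 by lra.
have [d d0 ud] := ucontK_unif (compact_cdisc 0 1) cu e4.
have [[ws r] /= [/andP[r1 r2] ws0 wsr] H] := poisson_approx e4 d0 M0.
pose l := [seq (u (w / r%:C) / (size ws)%:R, w) | w <- ws].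
have N0 : (0 : R) < (size ws)%:R by rewrite ltr0n lt0n size_eq0.
have r0 : 0 < r by lra.
have rC : r%:C != 0 :> R[i] by rewrite -cabs_gt0 cabs_real_pos.
have unit w : w \in ws -> cabs (w / r%:C) = 1.
  by move=> /wsr wr; rewrite cabsM cabsV cabs_real_pos // wr divff // lt0r_neq0.
exists l; split.
- move=> _ /mapP[w wws ->] /=; rewrite (wsr _ wws) r1 r2; split => //.
  exists (w / r%:C), (size ws)%:R^-1.
  split; [by field|exact: unit|by rewrite invr_ge0 ltW|by rewrite mulrC].
- rewrite big_map /=; apply: (@le_trans _ _ (\sum_(w <- ws) M / (size ws)%:R)).
    rewrite big_seq [leRHS]big_seq; apply: ler_sum => w /unit wr.
    rewrite normrM normfV (ger0_norm (ltW N0)) ler_wpM2r ?invr_ge0 ?(ltW N0) //.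
    exact: uM.
  by rewrite big_const_seq count_predT iter_addr_0 -[leLHS]mulr_natr divfK ?lt0r_neq0.
- move=> s s1; rewrite distrC (_ : e = 4 * (e / 4)); last by field.
  apply: H => // x y x1 y1 xy; apply: ud => //; rewrite /cdisc /= subr0 ?x1 ?y1 //.
Qed.

Lemma sampled_PC M u l : sampled u l -> \sum_(p <- l) `|p.1| <= M -> PC M (psum l).
Proof. by move=> sl lM; exists l; split => // p /sl[]. Qed.

(** The sum approximates u on the circle; as both are harmonic inside, the maximum principle extends
    this to the disc. It stands in for the Poisson integral. *)
Lemma disc_approx M u s0 : 0 < M -> ucontK (cdisc 0 1) u ->
  lapl [set s | odisc 0 1 s /\ s != s0] u -> (forall s, cabs s = 1 -> `|u s| <= M) ->
  forall e, 0 < e -> exists l, [/\ sampled u l, PC M (psum l) &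
    forall s, cabs s <= 1 -> `|u s - psum l s| <= e].
Proof.
move=> M0 cu lu uM e e0; have [l [sl lM le]] := circle_approx M0 cu uM e0.
have Pv := sampled_PC sl lM; exists l; split => // s s1.
have hv : harm (cdisc 0 1) (psum l).
  by apply: harm_PC Pv _ => t; rewrite /cdisc /= subr0.
apply: (@maximum_principle_abs R (cdisc 0 1) (odisc 0 1) (fun s => u s - psum l s) e s0).
- exact: compact_cdisc.
- exact: open_odisc.
- by move=> t /ltW.
- by apply: ucontKB => //; apply: harm_ucontK hv _.
- apply: laplB => //; apply: harm_lapl; apply: harm_sub hv => t [/ltW] //.
- move=> t t1 nt; apply: le.
  move: t1 nt; rewrite /cdisc /odisc /= subr0 => t1 nt.
  by apply/eqP; rewrite eq_le t1 leNgt; apply/negP.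
- by rewrite /cdisc /= subr0.
Qed.

Lemma uniform_limit_trans (Q : (R[i] -> R) -> Prop) u :
  (forall e, 0 < e -> exists2 v, uniform_limit v Q &
    forall s, cabs s < 1 -> `|u s - v s| <= e) -> uniform_limit u Q.
Proof.
move=> H e e0; have e2 : 0 < e / 2 by lra.
have [v /(_ _ e2)[w Qw vw] uv] := H _ e2; exists w => // s s1.
have := ler_normD (u s - v s) (v s - w s); have := uv s s1; have := vw s s1.
by rewrite addrA subrK; lra.
Qed.

(* Interior estimates on the disc of half radius for a harmonic function bounded
   by M on the disc of centre c and radius r *)
Definition est c r M u := forall z, cabs (z - c) < r / 2 ->
  [/\ [/\ cgrad u z (gr u z), cder (gr u) z (dc (gr u) z) &
       cder (dc (gr u)) z (dc (dc (gr u)) z)],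
      cabs (gr u z) <= CT * M / r, cabs (dc (gr u) z) <= CT * M / r ^+ 2 &
   forall h, cabs (z + h - c) < r / 2 ->
     `|u (z + h) - u z - complex.Re (gr u z * h)| <= CT * M / r ^+ 2 * cabs h ^+ 2 /\
     cabs (gr u (z + h) - gr u z - dc (gr u) z * h) <= CT * M / r ^+ 3 * cabs h ^+ 2].

Lemma est_limit c r M u : 0 < r ->
  uniform_limit (fun s => u (c + r%:C * s)) (PC M) -> est c r M u.
Proof.
move=> r0 /tay_limit[p0 [p1 [p2 T]]].
have rC : r%:C != 0 :> R[i] by rewrite -cabs_gt0 cabs_real_pos.
pose b z := r%:C^-1 * (z - c).
have cb z : cabs (b z) = cabs (z - c) / r.
  by rewrite cabsM cabsV cabs_real_pos // mulrC.
have db z : cder b z r%:C^-1.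
  have := cderZ r%:C^-1 (cderD (cder_id z) (cder_cst (- c) z)).
  by rewrite addr0 mulr1.
have b2 z : cabs (z - c) < r / 2 -> cabs (b z) < 1 / 2.
  by rewrite cb ltr_pdivrMr // mulrC mul1r.
have bK z : c + r%:C * b z = z by rewrite /b; field.
have near z : cabs (z - c) < r / 2 -> exists2 d, 0 < d &
    forall w, cabs (w - z) < d -> cabs (w - c) < r / 2.
  move=> zc; exists (r / 2 - cabs (z - c)); first by rewrite subr_gt0.
  by move=> w wz; have := cabs_tri w z c; lra.
have D0 z : cabs (z - c) < r / 2 -> cgrad u z (r%:C^-1 * p0 (b z)).
  move=> zc; have [H _ _] := tay_cgrad T (b2 z zc).
  have := cgrad_comp H (db z); rewrite mulrC.
  by apply: (cgrad_ext_near r0) => w _; rewrite bK.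
have E0 z : cabs (z - c) < r / 2 -> gr u z = r%:C^-1 * p0 (b z).
  by move=> /D0 /cgrad_gr.
have D1 z : cabs (z - c) < r / 2 -> cder (gr u) z (r%:C^-1 ^+ 2 * p1 (b z)).
  move=> zc; have [_ H _] := tay_cgrad T (b2 z zc); have [d d0 dz] := near z zc.
  have := cderZ r%:C^-1 (cder_comp H (db z)).
  rewrite (_ : r%:C^-1 * _ = r%:C^-1 ^+ 2 * p1 (b z)); last by ring.
  by apply: (cder_ext_near d0) => w /dz /E0 ->.
have E1 z : cabs (z - c) < r / 2 -> dc (gr u) z = r%:C^-1 ^+ 2 * p1 (b z).
  by move=> /D1 /cder_dc.
have D2 z : cabs (z - c) < r / 2 -> cder (dc (gr u)) z (r%:C^-1 ^+ 3 * p2 (b z)).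
  move=> zc; have [_ _ H] := tay_cgrad T (b2 z zc); have [d d0 dz] := near z zc.
  have := cderZ (r%:C^-1 ^+ 2) (cder_comp H (db z)).
  rewrite (_ : r%:C^-1 ^+ 2 * _ = r%:C^-1 ^+ 3 * p2 (b z)); last by ring.
  by apply: (cder_ext_near d0) => w /dz /E1 ->.
have cr n : cabs (r%:C^-1 ^+ n : R[i]) = r^-1 ^+ n by rewrite cabsX cabsV cabs_real_pos.
have rV : 0 <= r^-1 by rewrite invr_ge0 ltW.
move=> z zc; have [h0 h1 h2 h3] := T _ (b2 z zc); split.
- split; first by rewrite E0 //; exact: D0.
    by rewrite E1 //; exact: D1.
  by have H := D2 z zc; rewrite (cder_dc H).
- by rewrite E0 // cabsM cabsV cabs_real_pos // mulrC ler_wpM2r.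
- by rewrite E1 // cabsM cr exprVn mulrC ler_wpM2r // -exprVn exprn_ge0.
move=> h hc.
have bh : b (z + h) = b z + r%:C^-1 * h by rewrite /b; ring.
have [|k1 k2 _] := h3 (r%:C^-1 * h); first by rewrite -bh; exact: b2.
rewrite -bh !bK in k1; rewrite -bh in k2.
have ch : cabs (r%:C^-1 * h) = cabs h / r by rewrite cabsM cabsV cabs_real_pos // mulrC.
rewrite ch expr_div_n in k1 k2; split.
  rewrite E0 // (_ : r%:C^-1 * _ * h = p0 (b z) * (r%:C^-1 * h)); last by ring.
  by apply: le_trans k1 _; rewrite mulrA mulrAC.
rewrite !E0 // E1 //.
rewrite (_ : _ - _ = r%:C^-1 * (p0 (b (z + h)) - p0 (b z) - p1 (b z) * (r%:C^-1 * h)));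
  last by ring.
rewrite cabsM cabsV cabs_real_pos //.
apply: le_trans (ler_wpM2l rV k2) _.
rewrite le_eqVlt; apply/orP; left; apply/eqP; field; exact: lt0r_neq0.
Qed.

Lemma uniform_limit_lapl c r M u s0 : 0 < r -> 0 < M -> ucontK (cdisc c r) u ->
  lapl [set z | odisc c r z /\ z != s0] u ->
  (forall z, cabs (z - c) = r -> `|u z| <= M) ->
  uniform_limit (fun s => u (c + r%:C * s)) (PC M).
Proof.
move=> r0 M0 cu lu uM e e0.
have cE s : cabs (c + r%:C * s - c) = r * cabs s.
  by rewrite addrAC subrr add0r cabsM cabs_real_pos.
have rC : r%:C != 0 :> R[i] by rewrite -cabs_gt0 cabs_real_pos.
have [|||l [_ Pv uv]] := @disc_approx M (fun s => u (c + r%:C * s)) (r%:C^-1 * (s0 - c)) M0 _ _ _ _ e0.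
- apply: ucontK_sub (ucontK_affine (c := c) r0 cu) => s.
  by rewrite /cdisc /= cE subr0 => s1; rewrite -[leRHS]mulr1 ler_pM2l.
- apply: lapl_sub (lapl_affine c r lu) => s [].
  rewrite /odisc /= cE subr0 => s1 ss; split; first by rewrite -[ltRHS]mulr1 ltr_pM2l.
  by apply: contraNneq ss => <-; apply/eqP; field.
- by move=> s s1; apply: uM; rewrite cE s1 mulr1.
by exists (psum l) => // s /ltW; exact: uv.
Qed.

(** The estimates hold at s0 too: an isolated point where u is merely continuous is a removable
    singularity. *)
Lemma est_lapl c r M u s0 : 0 < r -> 0 < M -> ucontK (cdisc c r) u ->
  lapl [set z | odisc c r z /\ z != s0] u ->
  (forall z, cabs (z - c) = r -> `|u z| <= M) -> est c r M u.
Proof.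
by move=> r0 M0 cu lu uM; apply: est_limit => //; exact: (uniform_limit_lapl (s0 := s0)).
Qed.

Definition smooth (V : set R[i]) u := forall z, V z ->
  [/\ cgrad u z (gr u z), cder (gr u) z (dc (gr u) z) &
       cder (dc (gr u)) z (dc (dc (gr u)) z)].

(** Near each point u is a uniform limit of Poisson sums with bounded weights, so the second order
    equation alone yields regularity. *)
Lemma smooth_lapl (V : set R[i]) u : open V -> ucontK V u -> lapl V u -> smooth V u.
Proof.
move=> /openC oV cu lu z Vz; have [d d0 dV] := oV z Vz.
have dV' : cdisc z (d / 2) `<=` V by move=> w zw; apply: dV; move: zw; rewrite /cdisc /=; lra.
have [M M0 HM] := compact_bounded (compact_cdisc z (d / 2)) (ucontK_sub dV' cu).
have d2 : 0 < d / 2 by lra.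
have [] := @est_lapl z (d / 2) M u 0 d2 M0 (ucontK_sub dV' cu) _ _ z; last by [].
- by apply: lapl_sub lu => w [/ltW /dV'].
- by move=> w wz; apply: HM; rewrite /cdisc /= wz.
- by rewrite subrr cabs0; lra.
Qed.

Lemma harm_smooth (V : set R[i]) u : open V -> harm V u -> smooth V u.
Proof.
move=> oV hu; apply: smooth_lapl => //; first exact: harm_ucontK hu _.
exact: harm_lapl.
Qed.

Lemma smooth_harm (V : set R[i]) u : smooth V u -> harm V u.
Proof. by move=> H; exists (gr u), (dc (gr u)) => z /H[]. Qed.

Lemma smooth_hol2 (V : set R[i]) u : smooth V u -> hol2 V (gr u).
Proof. by move=> H; exists (dc (gr u)), (dc (dc (gr u))) => z /H[]. Qed.

Lemma est_harm c r M u : 0 < r -> 0 < M -> harm (cdisc c r) u ->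
  (forall z, cabs (z - c) <= r -> `|u z| <= M) -> est c r M u.
Proof.
move=> r0 M0 hu uM; apply: (est_lapl (s0 := 0)) => //.
- exact: harm_ucontK hu _.
- by apply: harm_lapl; apply: harm_sub hu => z [/ltW].
- by move=> z zc; apply: uM; rewrite zc.
Qed.

Lemma uniform_limit_harm c r M u : 0 < r -> 0 < M -> harm (cdisc c r) u ->
  (forall z, cabs (z - c) <= r -> `|u z| <= M) ->
  uniform_limit (fun s => u (c + r%:C * s)) (PC M).
Proof.
move=> r0 M0 hu uM; apply: (uniform_limit_lapl (s0 := 0)) => //.
- exact: harm_ucontK hu _.
- by apply: harm_lapl; apply: harm_sub hu => z [/ltW].
- by move=> z zc; apply: uM; rewrite zc.
Qed.

End InteriorEstimates.

Arguments compact_cdisc {R} c r.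

(** * Harnack's inequality and the identity theorem *)

Section Positivity.
Context {R : realType}.
Implicit Types (z w h s c : R[i]) (u : R[i] -> R) (f g : R[i] -> R[i]) (r M : R).

Lemma odisc_sub_cdisc c r : odisc c r `<=` cdisc c r.
Proof. by move=> z /ltW. Qed.

Lemma cdisc_center c r : 0 <= r -> cdisc c r c.
Proof. by rewrite /cdisc /= subrr cabs0. Qed.

(** All weights are nonnegative by [sampled], so a single kernel is enough: poisson w 0 = 1, and
    poisson w s >= (|w| - |s|) / (|w| + |s|) >= 1/3. *)
Lemma harnack_unit u s : ucontK (cdisc 0 1) u -> lapl (odisc 0 1) u ->
  (forall t, cabs t = 1 -> 0 <= u t) -> cabs s <= 1/2 -> u 0 <= 3 * u s.
Proof.
move=> cu lu u0 s2; have [M M0 uM] := compact_bounded (compact_cdisc 0 1) cu.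
apply/ler_addgt0Pr => e e0; have e4 : 0 < e / 4 by lra.
have [||l [sl _ ul]] := @disc_approx R M u 0 M0 cu _ _ _ e4.
- by apply: lapl_sub lu => t [].
- by move=> t t1; apply: uM; rewrite /cdisc /= subr0 t1.
have : psum l 0 <= 3 * psum l s.
  rewrite /psum mulr_sumr big_seq [leRHS]big_seq; apply: ler_sum => p /sl.
  move=> [/andP[w1 w2] [x [k [wE x1 k0 ->]]]].
  rewrite mulrCA ler_wpM2l //; first by rewrite mulr_ge0 // u0.
  have n0 : p.2 != s by apply/eqP => E; move: w1; rewrite E; lra.
  have n1 : p.2 != 0 by rewrite -cabs_gt0; lra.
  have d0 : 0 < cabs (p.2 - s) by rewrite cabs_gt0 subr_eq0.
  rewrite !poissonE // subr0 cabs0 expr0n /= subr0 divff; last first.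
    by rewrite lt0r_neq0 // exprn_gt0; lra.
  rewrite mulrA ler_pdivlMr ?exprn_gt0 // mul1r.
  have := cabsD p.2 (- s); rewrite cabsN; have := cabs_ge0 s.
  set a := cabs s in s2 *; set b := cabs p.2 in w1 w2 *.
  set q := cabs (p.2 - s) in d0 * => a0 qab.
  apply: (@le_trans _ _ ((b + a) ^+ 2)); first by rewrite lerXn2r ?nnegrE; lra.
  nra.
have := ul 0; have := ul s; rewrite cabs0 => /(_ ltac:(lra)) + /(_ ler01).
by rewrite !ler_norml => /andP[? ?] /andP[? ?] ?; lra.
Qed.

Lemma affine_cdisc c r s : 0 < r -> cdisc 0 1 s -> cdisc c r (c + r%:C * s).
Proof.
move=> r0; rewrite /cdisc /= subr0 addrAC subrr add0r cabsM cabs_real_pos // => s1.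
by rewrite -[leRHS]mulr1 ler_pM2l.
Qed.

Lemma harnack c r u z : 0 < r -> harm (cdisc c r) u ->
  (forall w, cdisc c r w -> 0 <= u w) -> cabs (z - c) <= r / 2 -> u c <= 3 * u z.
Proof.
move=> r0 hu u0 zc; have rC : r%:C != 0 :> R[i] by rewrite -cabs_gt0 cabs_real_pos.
have := @harnack_unit (fun s => u (c + r%:C * s)) (r%:C^-1 * (z - c)).
rewrite (_ : c + r%:C * (r%:C^-1 * (z - c)) = z); last by field.
rewrite mulr0 addr0; apply.
- have cu : ucontK (cdisc c r) u by exact: harm_ucontK hu _.
  apply: ucontK_sub (ucontK_affine (c := c) r0 cu).
  by move=> s s1; exact: (affine_cdisc c r0 s1).
- apply: lapl_sub (lapl_affine c r (harm_lapl hu)) => s /odisc_sub_cdisc s1.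
  exact: (affine_cdisc c r0 s1).
- by move=> t t1; apply/u0/affine_cdisc => //; rewrite /cdisc /= subr0 t1.
- by rewrite cabsM cabsV cabs_real_pos // mulrC ler_pdivrMr //; lra.
Qed.

Lemma ucontK_cabs (K : set R[i]) f : (forall z, K z -> exists l, cder f z l) ->
  ucontK K (fun z => cabs (f z)).
Proof.
move=> H z /H[l dl] e e0; have [d d0 {}H] := cder_cont dl e0.
exists d => // w _ /H; apply: le_lt_trans; rewrite ler_norml.
have := cabs_subr (f w) (f z); have := cabs_subr (f z) (f w).
by rewrite (cabsB (f z) (f w)) => ? ?; apply/andP; split; lra.
Qed.

(* Harnack's inequality for log (M / |f|): a zero free bounded holomorphic
   function that is small at the centre is small on the disc of half radius. *)
Lemma zero_free_small c r M f z : 0 < r -> hol2 (cdisc c r) f ->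
  (forall w, cdisc c r w -> f w != 0) -> (forall w, cdisc c r w -> cabs (f w) <= M) ->
  cabs (z - c) <= r / 2 -> cabs (f z) ^+ 3 <= M ^+ 2 * cabs (f c).
Proof.
move=> r0 hf f0 fM zc.
have zr : cdisc c r z by rewrite /cdisc /=; lra.
have cr : cdisc c r c by apply: cdisc_center; exact: ltW.
have M0 : 0 < M by apply: lt_le_trans (fM c cr); rewrite cabs_gt0 f0.
have H : ln M - ln (cabs (f c)) <= 3 * (ln M - ln (cabs (f z))).
  apply: (@harnack c r (fun w => ln M - ln (cabs (f w)))) => //.
    by apply: harmB; [exact: harm_cst|exact: harm_ln].
  by move=> w wc; rewrite subr_ge0 ler_ln ?posrE ?cabs_gt0 ?f0 // fM.
have pz : 0 < cabs (f z) by rewrite cabs_gt0 f0.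
have pc : 0 < cabs (f c) by rewrite cabs_gt0 f0.
rewrite -ler_ln ?posrE ?exprn_gt0 ?mulr_gt0 ?exprn_gt0 //.
rewrite lnM ?posrE ?exprn_gt0 // !lnXn //.
by rewrite -[ln (cabs (f z)) *+ 3]mulr_natl -[ln M *+ 2]mulr_natl; lra.
Qed.

(** In place of a power series, the maximum principle for f (w - a)^(-n) on an annulus, whose inner
    circle lies where f vanishes: |f z| <= 2 M (|z - a| / r)^n for every n. *)
Lemma identity_disc a r d f : 0 < d -> d < r -> hol2 (cdisc a r) f ->
  (forall z, cdisc a d z -> f z = 0) -> forall z, odisc a r z -> f z = 0.
Proof.
move=> d0 dr hf fd z zr.
have [|M M0 fM] := @compact_bounded R (cdisc a r) (fun z => cabs (f z)) (compact_cdisc a r).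
  by case: hf => f1 [f2 H]; apply: ucontK_cabs => w /H[? _]; exists (f1 w).
have r0 : 0 < r by lra.
have [zd|zd] := leP (cabs (z - a)) d; first exact: fd.
pose K := [set w | cdisc a r w /\ d / 2 <= cabs (w - a)].
have Ka w : K w -> w - a != 0 by move=> [_ h]; rewrite -cabs_gt0; lra.
have hg n : hol2 K (fun w => f w * (w - a)^-1 ^+ n).
  have hi : hol2 K (fun w => (w - a)^-1).
    by apply: hol2V => //; apply: hol2B; [exact: hol2_id|exact: hol2_cst].
  apply: hol2M; first by apply: hol2_sub hf => w [].
  elim: n => [|n IH].
    by under eq_fun do rewrite expr0; exact: hol2_cst.
  by under eq_fun do rewrite exprS; exact: hol2M.
have key n (b : R[i]) : cabs b = 1 ->
    `|complex.Re (b * (f z * (z - a)^-1 ^+ n))| <= M / r ^+ n.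
  move=> b1.
  have hR : harm K (fun w => complex.Re (b * (f w * (w - a)^-1 ^+ n))).
    by apply: harm_Re; exact: hol2Z.
  apply: (@maximum_principle_abs R K [set w | odisc a r w /\ d / 2 < cabs (w - a)]
    (fun w => complex.Re (b * (f w * (w - a)^-1 ^+ n))) (M / r ^+ n) a).
  - by apply: compact_diff_ball; exact: compact_cdisc.
  - by apply: open_diff_ball; exact: open_odisc.
  - by move=> w [/ltW wr /ltW wd].
  - exact: harm_ucontK hR _.
  - by apply/harm_lapl/(harm_sub _ hR) => w [[/ltW wr /ltW wd] _].
  - move=> w [wr wd] nw; have [wd'|wd'] := leP (cabs (w - a)) d.
      by rewrite fd // mul0r mulr0 /= normr0 divr_ge0 ?exprn_ge0 ?ltW.
    have wE : cabs (w - a) = r.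
      by apply/eqP; rewrite eq_le wr leNgt; apply/negP => h; apply: nw; split => //=; lra.
    apply: le_trans (cabs_Re _) _; rewrite !cabsM b1 mul1r cabsX cabsV wE exprVn.
    apply: ler_wpM2r; first by rewrite invr_ge0 exprn_ge0 // ltW.
    exact: le_trans (ler_norm _) (fM w wr).
  - by split; [exact: ltW|lra].
have key2 n : cabs (f z) <= 2 * M * (cabs (z - a) / r) ^+ n.
  have k1 := key n 1 cabs1; have k2 := key n (- 'i%C) ltac:(by rewrite cabsN cabsi).
  rewrite mul1r in k1; rewrite -Im_mulNi in k2.
  have := cabs_ReIm (f z * (z - a)^-1 ^+ n); rewrite cabsM cabsX cabsV.
  have p0 : 0 < cabs (z - a) ^+ n by rewrite exprn_gt0 //; lra.
  rewrite [(cabs _)^-1 ^+ n]exprVn ler_pdivrMr // expr_div_n => k3; apply: le_trans k3 _.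
  rewrite (_ : 2 * M * _ = (M / r ^+ n + M / r ^+ n) * cabs (z - a) ^+ n); last by ring.
  by rewrite ler_pM2r //; lra.
have q1 : `|cabs (z - a) / r| < 1.
  by rewrite ger0_norm ?divr_ge0 ?cabs_ge0 ?ltW // ltr_pdivrMr // mul1r.
apply/eqP; rewrite -cabs_eq0 eq_le cabs_ge0 andbT.
have cv : (fun n => 2 * M * (cabs (z - a) / r) ^+ n) @ \oo --> 2 * M * 0.
  by apply: cvgMr; exact: cvg_expr.
rewrite mulr0 in cv; rewrite -(cvg_lim _ cv) //.
apply: limr_ge; first by apply/cvg_ex; exists 0.
by apply: nearW => n; exact: key2.
Qed.

Lemma connected_clopen (U A : set R[i]) : connected U -> A `<=` U -> A !=set0 ->
  open A -> (forall z, U z -> (forall e : R, 0 < e -> exists2 w, A w & cabs (w - z) < e) -> A z) ->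
  forall z, U z -> A z.
Proof.
move=> cU AU A0 oA clA z Uz; rewrite (cU A) //; first by exists A => //; rewrite setIidr.
exists (closure A); first exact: closed_closure.
apply/seteqP; split=> [w Aw|w [Uw /closureC cw]]; last exact: clA.
by split; [exact: AU|exact: subset_closure].
Qed.

Lemma identity_theorem (U : set R[i]) f z0 d : open U -> connected U -> hol2 U f ->
  U z0 -> 0 < d -> (forall z, cabs (z - z0) < d -> f z = 0) -> forall z, U z -> f z = 0.
Proof.
move=> /openC oU cU hf Uz0 d0 fd.
pose A := [set z | U z /\ exists2 e : R, 0 < e & forall w, cabs (w - z) < e -> f w = 0].
suff H : forall z, U z -> A z.
  by move=> z /H[_ [e e0]]; apply; rewrite subrr cabs0.
apply: (connected_clopen cU) => [z []//| | |z Uz H].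
- by exists z0; split => //; exists d.
- apply/openC => z [Uz [e e0 fe]]; have [e' e'0 Ue] := oU z Uz.
  exists (Num.min e' (e / 2)); first by rewrite lt_min e'0; lra.
  move=> w; rewrite lt_min => /andP[w1 w2]; split; first exact: Ue.
  exists (e / 2); first lra.
  by move=> v vw; apply: fe; have := cabs_tri v w z; lra.
- have [e e0 Ue] := oU z Uz; have [|w [Uw [e' e'0 fe]] wz] := H (e / 4); first lra.
  pose m := Num.min (e' / 2) (e / 4).
  have m0 : 0 < m by rewrite lt_min; apply/andP; split; lra.
  have me : m <= e' / 2 by rewrite ge_min lexx.
  have me2 : m <= e / 4 by rewrite ge_min lexx orbT.
  have fw : forall v, odisc w (e / 2) v -> f v = 0.
    apply: (@identity_disc w (e / 2) m) => //; first lra.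
      apply: hol2_sub hf => v; rewrite /cdisc /= => vw; apply: Ue.
      by have := cabs_tri v w z; lra.
    by move=> v; rewrite /cdisc /= => vm; apply: fe; lra.
  split=> //; exists (e / 4); first lra.
  by move=> v vz; apply: fw; rewrite /odisc /=; have := cabs_tri v z w; rewrite (cabsB z w); lra.
Qed.

End Positivity.

(** * Schwarz reflection *)

Section Reflection.
Context {R : realType}.
Implicit Types (z w h s c : R[i]) (u v : R[i] -> R) (f g : R[i] -> R[i]) (r M : R).

(** The odd part under conjugation, again a Poisson sum by [poisson_conj]. *)
Definition osum (l : seq (R * R[i])) s := (psum l s - psum l s^*) / 2.

Lemma osumE l s :
  osum l s = \sum_(p <- l) p.1 / 2 * (poisson p.2 s - poisson p.2^* s).
Proof.
rewrite /osum /psum -sumrB mulr_suml; apply: eq_bigr => p _.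
by rewrite poisson_conj; ring.
Qed.

Lemma PC_osum M u l : sampled u l -> \sum_(p <- l) `|p.1| <= M -> PC M (osum l).
Proof.
move=> sl lM.
exists ([seq (p.1 / 2, p.2) | p <- l] ++ [seq (- p.1 / 2, p.2^*) | p <- l]); split.
- move=> p; rewrite mem_cat => /orP[]/mapP[q /sl[q12 _] ->] //=.
  by rewrite cabs_conj.
- rewrite big_cat /= !big_map /= -big_split /=; apply: le_trans lM.
  apply: ler_sum => p _; rewrite !normrM normrN normfV (@ger0_norm _ 2) //; lra.
- apply/funext => s; rewrite osumE /psum big_cat /= !big_map /= -big_split /=.
  by apply: eq_bigr => p _; ring.
Qed.

Definition half_disc : set R[i] := [set s | cabs s < 1 /\ 0 < complex.Im s].

Definition odd_conj u := forall s, u s^* = - u s.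

Lemma odd_conj_real u s : odd_conj u -> complex.Im s = 0 -> u s = 0.
Proof.
move=> ou s0; have E : s^* = s by case: s s0 => a b /= ->; rewrite oppr0.
by have := ou s; rewrite E; lra.
Qed.

(** Harmonicity is known on the half disc only, and the error is estimated on its boundary: on the
    diameter both odd functions vanish, and on the arc the error of the odd part averages those of
    [psum l] at s and at its conjugate. Oddness covers the lower half. *)
Lemma reflection M u s0 e : 0 < M -> ucontK (cdisc 0 1) u -> odd_conj u ->
  lapl [set s | half_disc s /\ s != s0] u ->
  (forall s, cabs s = 1 -> `|u s| <= M) -> 0 < e ->
  exists l, [/\ sampled u l, \sum_(p <- l) `|p.1| <= M &
    forall s, cabs s <= 1 -> `|u s - osum l s| <= e].
Proof.
move=> M0 cu ou lu uM e0; have [l [sl lM le]] := circle_approx M0 cu uM e0.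
exists l; split => //.
have Po := PC_osum sl lM.
have hv : harm (cdisc 0 1) (osum l).
  by apply: harm_PC Po _ => t; rewrite /cdisc /= subr0.
have oo s : osum l s^* = - osum l s by rewrite /osum conjcK; ring.
have H s : cabs s <= 1 -> 0 <= complex.Im s -> `|u s - osum l s| <= e.
  move=> s1 sI.
  apply: (@maximum_principle_abs R [set s | cabs s <= 1 /\ 0 <= complex.Im s]
    half_disc (fun s => u s - osum l s) e s0) => //.
  - apply: (subclosed_compact _ (compact_cdisc 0 1)) => [t /closureC ct|t [t1 _]].
      split; rewrite leNgt; apply/negP => lt.
        have [w [w1 _] wt] := ct (cabs t - 1) ltac:(lra).
        by have := cabs_subr t w; rewrite (cabsB t w); lra.
      have [w [_ w1] wt] := ct (- complex.Im t) ltac:(lra).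
      have := cabs_Im (w - t); rewrite ImD ImN ler_norml => /andP[_]; lra.
    by rewrite /cdisc /= subr0.
  - apply/openC => t [t1 tI]; exists (Num.min (1 - cabs t) (complex.Im t)).
      by rewrite lt_min subr_gt0 t1.
    move=> w; rewrite lt_min => /andP[w1 w2]; split; first by have := cabs_subr w t; lra.
    by have := cabs_Im (w - t); rewrite ImD ImN ler_norml => /andP[]; lra.
  - by move=> t [/ltW ? /ltW].
  - apply: (@ucontK_sub _ (cdisc 0 1)); first by move=> t [t1 _]; rewrite /cdisc /= subr0.
    by apply: ucontKB => //; apply: harm_ucontK hv _.
  - apply: laplB => //; apply: harm_lapl; apply: harm_sub hv => t [[/ltW t1 _] _].
    by rewrite /cdisc /= subr0.
  - move=> t [t1 tI] nt; have [tI0|tI0] := leP (complex.Im t) 0.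
      have tE : complex.Im t = 0 by lra.
      by rewrite (odd_conj_real ou tE) (odd_conj_real oo tE) subrr normr0 ltW.
    have tE : cabs t = 1.
      by apply/eqP; rewrite eq_le t1 leNgt; apply/negP => h; apply: nt.
    rewrite (_ : _ - _ = ((u t - psum l t) - (u t^* - psum l t^*)) / 2); last first.
      by rewrite ou /osum; field.
    have := le t tE; have := le t^*; rewrite cabs_conj => /(_ tE) h1 h2.
    have := ler_normB (u t - psum l t) (u t^* - psum l t^*).
    by rewrite normrM normfV (@ger0_norm _ 2) //; lra.
move=> s s1; have [sI|sI] := leP 0 (complex.Im s); first exact: H.
have := H s^*; rewrite cabs_conj ou oo -opprD normrN; apply => //.
by case: (s) sI => a b /=; lra.
Qed.

Lemma reflection_limit M u s0 : 0 < M -> ucontK (cdisc 0 1) u -> odd_conj u ->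
  lapl [set s | half_disc s /\ s != s0] u ->
  (forall s, cabs s = 1 -> `|u s| <= M) -> uniform_limit u (PC M).
Proof.
move=> M0 cu ou lu uM e e0; have [l [sl lM le]] := reflection M0 cu ou lu uM e0.
by exists (osum l); [exact: (PC_osum sl lM)|move=> s /ltW; exact: le].
Qed.

Lemma reflection_est M u s0 : 0 < M -> ucontK (cdisc 0 1) u -> odd_conj u ->
  lapl [set s | half_disc s /\ s != s0] u ->
  (forall s, cabs s = 1 -> `|u s| <= M) -> est 0 1 M u.
Proof.
move=> M0 cu ou lu uM; apply: est_limit => //.
have := reflection_limit M0 cu ou lu uM; congr (uniform_limit _ _).
by apply/funext => s; rewrite add0r mul1r.
Qed.

Lemma poisson_diff w s : w != s -> w != s^* ->
  poisson w s - poisson w^* s = 4 * complex.Im w * complex.Im s *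
   (cabs w ^+ 2 - cabs s ^+ 2) / (cabs (w - s) ^+ 2 * cabs (w - s^*) ^+ 2).
Proof.
move=> n1 n2; rewrite -poisson_conj !poissonE // cabs_conj.
have p1 : cabs (w - s) != 0 by rewrite cabs_eq0 subr_eq0.
have p2 : cabs (w - s^*) != 0 by rewrite cabs_eq0 subr_eq0.
have E : cabs (w - s^*) ^+ 2 - cabs (w - s) ^+ 2 = 4 * complex.Im w * complex.Im s.
  by rewrite !sqr_cabs; case: (w) => a b; case: (s) => x y /=; ring.
by rewrite -E; field; rewrite ?p2 ?p1.
Qed.

(* On the imaginary derivative of an odd pair of Poisson kernels: twice the
   difference of w / (w - s)^2 and its reflection is
   -4 i (Im w) (|w|^2 - s^2) / ((w - s) (w^* - s))^2. *)
Lemma poisson_diff_grad w s : 1 < cabs w <= 2 -> cabs s <= 1/20 ->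
  exists2 q : R, 1/8 <= q & complex.Re ('i%C * (2 * w * (w - s)^-1 ^+ 2 -
      2 * w^* * (w^* - s)^-1 ^+ 2)) = 4 * complex.Im w * q.
Proof.
move=> /andP[w1 w2] s1.
have n1 : w - s != 0 by rewrite -cabs_gt0; have := cabs_subr w s; lra.
have n2 : w^* - s != 0.
  by rewrite -cabs_gt0; have := cabs_subr w^* s; rewrite cabs_conj; lra.
have ww : w * w^* = (cabs w ^+ 2)%:C.
  by rewrite sqr_cabs; case: (w) => a b; apply: complex_ext => /=; ring.
set X : R[i] := ((cabs w ^+ 2)%:C - s ^+ 2) / ((w - s) * (w^* - s)) ^+ 2.
have wI : w - w^* = 'i%C * (2 * complex.Im w)%:C.
  by case: (w) => a b; apply: complex_ext => /=; ring.
have i2 : 'i%C * 'i%C = -1 :> R[i] by rewrite -expr2 sqr_i.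
exists (complex.Re X); last first.
  have -> : 'i%C * (2 * w * (w - s)^-1 ^+ 2 - 2 * w^* * (w^* - s)^-1 ^+ 2) =
      (4 * complex.Im w)%:C * X.
    have -> : 'i%C * (2 * w * (w - s)^-1 ^+ 2 - 2 * w^* * (w^* - s)^-1 ^+ 2) =
      - 2 * 'i%C * (w - w^*) * X.
      by rewrite /X -ww; field; rewrite n1 n2.
    rewrite wI (_ : - 2 * 'i%C * ('i%C * _) = - ('i%C * 'i%C) * (2 * (2 * complex.Im w)%:C)); last by ring.
    rewrite i2 opprK mul1r !rmorphM /= !rmorph_nat; congr (_ * _).
    by rewrite mulrA; congr (_ * _); rewrite -natrM.
  by rewrite ReM /= mul0r subr0.
have [r2 r2E] : exists x : R[i], x = (cabs w ^+ 2)%:C by exists (cabs w ^+ 2)%:C.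
have cr2 : cabs r2 = cabs w ^+ 2 by rewrite r2E cabsR ger0_norm ?sqr_ge0.
have r21 : 1 < cabs w ^+ 2 by rewrite expr2; nra.
have r24 : cabs w ^+ 2 <= 4 by rewrite expr2; nra.
have r20 : r2 != 0 by rewrite -cabs_gt0; lra.
pose a := s ^+ 2 / r2; pose eta := (s ^+ 2 - s * (w + w^*)) / r2.
have s2 : cabs (s ^+ 2) <= 1/400.
  by have := cabsX_le 2 s1; lra.
have ca : cabs a <= 1/400.
  rewrite /a cabsM cabsV cr2 ler_pdivrMr; last lra.
  by apply: le_trans s2 _; rewrite -[leLHS]mulr1; rewrite ler_pM2l; lra.
have ce : cabs eta <= 41/400.
  rewrite /eta cabsM cabsV cr2 ler_pdivrMr; last lra.
  have q1 : cabs (s * (w + w^*)) <= 1/10 * cabs w.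
    rewrite cabsM; have := cabsD w w^*; rewrite cabs_conj => q.
    have := ler_pM (cabs_ge0 _) (cabs_ge0 _) s1 q; lra.
  have := cabsD (s ^+ 2) (- (s * (w + w^*))); rewrite cabsN.
  have : cabs w <= cabs w ^+ 2 by rewrite expr2; nra.
  lra.
have e1 : 1 + eta != 0.
  by rewrite -cabs_gt0; have := cabs_subr 1 (- eta); rewrite opprK cabsN cabs1; lra.
have wse : (w - s) * (w^* - s) = r2 * (1 + eta).
  rewrite /eta (_ : r2 * _ = r2 + (s ^+ 2 - s * (w + w^*))); last by field.
  by rewrite r2E -ww; ring.
have XE : X = r2^-1 * (1 - (2 * eta + eta ^+ 2 + a) / (1 + eta) ^+ 2).
  by rewrite /X wse -r2E /a; field; rewrite e1 r20.
have cq : cabs ((2 * eta + eta ^+ 2 + a) / (1 + eta) ^+ 2) <= 1/2.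
  have e9 : 7/8 <= cabs (1 + eta).
    by have := cabs_subr 1 (- eta); rewrite opprK cabsN cabs1; lra.
  have e92 : 3/4 <= cabs (1 + eta) ^+ 2 by rewrite expr2; nra.
  rewrite cabsM cabsV cabsX ler_pdivrMr; last lra.
  have := cabsD (2 * eta + eta ^+ 2) a; have := cabsD (2 * eta) (eta ^+ 2).
  rewrite cabsM cabsX cabs_nat.
  have : cabs eta ^+ 2 <= 41/400 * (41/400).
    by rewrite expr2; apply: ler_pM => //; exact: cabs_ge0.
  lra.
rewrite XE r2E -fmorphV ReM /= mul0r subr0 ReD ReN.
have := cabs_Re ((2 * eta + eta ^+ 2 + a) / (1 + eta) ^+ 2).
rewrite ler_norml => /andP[_ q2].
rewrite [leRHS]mulrC ler_pdivlMr; last lra.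
have : complex.Re (1 : R[i]) = 1 by [].
lra.
Qed.

(** The inequality holds for each odd pair of kernels. By oddness the weight has the sign of Im w;
    up to that sign, the derivative of the pair is at least |Im w| / 2 by [poisson_diff_grad] and
    its value at i/2 is at most 128 |Im w|, whence 256. *)
Lemma hopf M u s0 : 0 < M -> ucontK (cdisc 0 1) u -> odd_conj u ->
  lapl [set s | half_disc s /\ s != s0] u ->
  (forall s, cabs s = 1 -> `|u s| <= M) ->
  (forall s, cabs s = 1 -> 0 <= complex.Im s -> 0 <= u s) ->
  forall s, cabs s <= 1/20 ->
    u (0 +i* (1/2)) / 256 <= complex.Re ('i%C * gr u s).
Proof.
move=> M0 cu ou lu uM u0 s s1.
set i2 := 0 +i* (1/2).
have ci2 : cabs i2 = 1/2.
  by rewrite cabsE /= expr0n add0r sqrtr_sqr ger0_norm.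
have CT0 := @CT_gt0 R.
(* Uniform approximation controls differences and not derivatives, so the bound is first proved for
   increments, with a quadratic error; then h tends to 0. *)
have step (h : R) : 0 < h -> h < 1/4 ->
    h * (u i2 / 256) - CT * M * h ^+ 2 <= u (s + (0 +i* h)) - u s.
  move=> h0 h4; set ih := 0 +i* h.
  have cih : cabs ih = h by rewrite cabsE /= expr0n add0r sqrtr_sqr ger0_norm // ltW.
  have cs1 : cabs s < 1/2 by lra.
  have cs2 : cabs (s + ih) < 1/2 by have := cabsD s ih; lra.
  apply/ler_addgt0Pr => e e0; have e4 : 0 < e / 4 by lra.
  have [l [sl lM le]] := reflection M0 cu ou lu uM e4.
  have H : h * (osum l i2 / 256) - CT * M * h ^+ 2 <= osum l (s + ih) - osum l s.
    apply: (@le_trans _ _ (\sum_(p <- l) (h * (p.1 / 2 * (poisson p.2 i2 - poisson p.2^* i2) / 256)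
       - CT * `|p.1| * h ^+ 2))).
      rewrite sumrB -mulr_sumr -mulr_suml osumE -mulr_suml -mulr_sumr lerD2l lerN2.
      by rewrite ler_wpM2r ?sqr_ge0 // ler_pM2l.
    rewrite !osumE -sumrB big_seq [leRHS]big_seq; apply: ler_sum => p /sl.
    move=> [w12 [x [k [wE x1 k0 ->]]]].
    have /andP[w1 w2] := w12.
    have w12' : 1 < cabs p.2^* <= 2 by rewrite cabs_conj.
    have [q q8 qE] := poisson_diff_grad w12 s1.
    have [_ _ _ /(_ ih cs2)[T1 _ _]] := tay_poisson w12 cs1.
    have [_ _ _ /(_ ih cs2)[T2 _ _]] := tay_poisson w12' cs1.
    rewrite cih mulr1 in T1 T2.
    have Di : poisson p.2 i2 - poisson p.2^* i2 = complex.Im p.2 *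
       (2 * (cabs p.2 ^+ 2 - 1/4) / (cabs (p.2 - i2) ^+ 2 * cabs (p.2 - i2^*) ^+ 2)).
      have m1 : p.2 != i2 by apply/eqP => E; move: w1; rewrite E ci2; lra.
      have m2 : p.2 != i2^* by apply/eqP => E; move: w1; rewrite E cabs_conj ci2; lra.
      by rewrite poisson_diff // ci2 /= expr_div_n; field; rewrite !cabs_eq0 !subr_eq0 m1 m2.
    set D := 2 * _ / _ in Di.
    (* Both distances are at least 1/2, so D <= 2 * 4 / (1/16). *)
    have D128 : 0 <= D <= 128.
      have b1 : 1/2 <= cabs (p.2 - i2) by have := cabs_subr p.2 i2; lra.
      have b2 : 1/2 <= cabs (p.2 - i2^*) by have := cabs_subr p.2 i2^*; rewrite cabs_conj; lra.
      have b3 : 1/4 <= cabs (p.2 - i2) ^+ 2 by rewrite expr2; nra.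
      have b4 : 1/4 <= cabs (p.2 - i2^*) ^+ 2 by rewrite expr2; nra.
      have b5 : 1/16 <= cabs (p.2 - i2) ^+ 2 * cabs (p.2 - i2^*) ^+ 2 by nra.
      have b6 : 0 <= cabs p.2 ^+ 2 - 1/4 <= 4 by rewrite expr2; apply/andP; split; nra.
      move/andP: b6 => [b6 b7]; rewrite /D; apply/andP; split.
        by rewrite divr_ge0 //; lra.
      by rewrite ler_pdivrMr; lra.
    have sgn : 0 <= u x * complex.Im p.2.
      rewrite wE ImM /= mul0r addr0.
      have w0 : 0 <= cabs p.2 by lra.
      have [xI|xI] := leP 0 (complex.Im x).
        by rewrite mulr_ge0 ?u0 // mulr_ge0.
      have := u0 x^*; rewrite cabs_conj ou => /(_ x1) ux.
      have {}ux : u x <= 0.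
        by rewrite -oppr_ge0; apply: ux; case: (x) xI => a b /=; lra.
      by rewrite -mulrNN mulr_ge0 ?oppr_ge0 // mulr_ge0_le0 // ltW.
    have key : complex.Re ((2 * p.2 * (p.2 - s)^-1 ^+ 2) * ih) -
        complex.Re ((2 * p.2^* * (p.2^* - s)^-1 ^+ 2) * ih) = h * (4 * complex.Im p.2 * q).
      rewrite -qE -ReN -ReD -mulNr -mulrDl.
      have -> : ih = 'i%C * h%:C by apply: complex_ext; rewrite /= ?ImM ?ReM /=; ring.
      by rewrite mulrA [RHS]mulrC ['i%C * _]mulrC ReM /= mulr0 subr0.
    rewrite Di; set I := complex.Im p.2 in sgn key *.
    set b := u x in sgn *.
    have kI : 0 <= k * b * I by rewrite -mulrA mulr_ge0.
    move: T1 T2; set P1 := poisson _ _; set P2 := poisson _ _; set P3 := poisson _ _;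
      set P4 := poisson _ _ => T1 T2.
    have E1 : `|P1 - P2 - (P3 - P4) - h * (4 * I * q)| <= 2 * (CT * h ^+ 2).
      rewrite -key; move: T1 T2; rewrite !ler_norml => /andP[? ?] /andP[? ?].
      by apply/andP; split; lra.
    have E2 : k * b / 2 * (P1 - P2 - (P3 - P4) - h * (4 * I * q)) >=
        - (`|k * b| * (CT * h ^+ 2)).
      have := ler_wpM2l (normr_ge0 (k * b)) E1; rewrite -normrM ler_norml => /andP[? ?].
      lra.
    have E3 : h * (k * b * I) * D <= h * (k * b * I) * 128.
      by apply: ler_wpM2l; [rewrite mulr_ge0 // ltW|case/andP: D128].
    have E4 : h * (k * b * I) / 8 <= h * (k * b * I) * q.
      by apply: ler_wpM2l; [rewrite mulr_ge0 // ltW|lra].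
    lra.
  have N1 := le s ltac:(lra); have N2 := le (s + ih) ltac:(lra).
  have N3 := le i2 ltac:(lra).
  move: N1 N2 N3; rewrite !ler_norml => /andP[? ?] /andP[? ?] /andP[? ?].
  have : h * (u i2 / 256 - osum l i2 / 256) <= e / 4 by nra.
  lra.
have [[Hg _ _] _ _ _] := reflection_est M0 cu ou lu uM (z := s) ltac:(rewrite subr0; lra).
apply/ler_addgt0Pr => e e0; have e2 : 0 < e / 2 by lra.
have [d d0 {}Hg] := Hg _ e2.
pose K := CT * M.
have K0 : 0 < K by rewrite mulr_gt0.
pose h := Num.min (Num.min (1/8) (d / 2)) (e / (2 * K)).
have h0 : 0 < h by rewrite !lt_min !divr_gt0 ?mulr_gt0.
have h8 : h <= 1/8 by rewrite !ge_min lexx.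
have hd : h <= d / 2 by rewrite !ge_min lexx orbT.
have hK : h <= e / (2 * K) by rewrite ge_min lexx orbT.
rewrite ler_pdivlMr ?mulr_gt0 // in hK.
have cih : cabs (0 +i* h) = h by rewrite cabsE /= expr0n add0r sqrtr_sqr ger0_norm // ltW.
have := Hg (0 +i* h); rewrite cih => /(_ ltac:(lra)).
have := step h h0 ltac:(lra); rewrite -/K.
have -> : complex.Re (gr u s * (0 +i* h)) = h * complex.Re ('i%C * gr u s).
  by rewrite !ReM /=; ring.
rewrite ler_norml => q1 /andP[q2 q3].
have q4 : h * (h * (2 * K)) <= h * e by rewrite ler_pM2l.
rewrite -(ler_pM2l h0); clearbody h K; lra.
Qed.

End Reflection.

(** * Charts at the boundary *)

Section PowerSeries.
Context {R : realType}.
Implicit Types (z w h s c : R[i]) (f g : R[i] -> R[i]) (r M : R).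

(** The factor 2 adds up the remainders of the real and the imaginary part; [dc f] is already
    controlled through the real part. *)
Definition hest c r M f := forall z, cabs (z - c) < r / 2 ->
  [/\ cder f z (dc f z), cder (dc f) z (dc (dc f) z), cabs (dc f z) <= CT * M / r,
    cabs (dc (dc f) z) <= CT * M / r ^+ 2 &
    forall h, cabs (z + h - c) < r / 2 ->
     cabs (f (z + h) - f z - dc f z * h) <= 2 * (CT * M / r ^+ 2) * cabs h ^+ 2 /\
     cabs (dc f (z + h) - dc f z - dc (dc f) z * h) <= CT * M / r ^+ 3 * cabs h ^+ 2].

Lemma hol_est c r M f : 0 < r -> 0 < M -> hol2 (cdisc c r) f ->
  (forall z, cdisc c r z -> cabs (f z) <= M) -> hest c r M f.
Proof.
move=> r0 M0 hf fM z zc.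
have zr : cdisc c r z by rewrite /cdisc /=; lra.
have hR := harm_Re hf; have hI := harm_Re (hol2Z (- 'i%C) hf).
have ER : est c r M (fun w => complex.Re (f w)).
  by apply: est_harm => // w /fM; apply: le_trans; exact: cabs_Re.
have EI : est c r M (fun w => complex.Re (- 'i%C * f w)).
  apply: est_harm => // w /fM; apply: le_trans.
  by apply: le_trans (cabs_Re _) _; rewrite cabsM cabsN cabsi mul1r.
have [[h1 h2 h3] h4 h5 h6] := ER z zc.
have [[k1 k2 k3] k4 k5 k6] := EI z zc.
have [l Hl] : exists l, cder f z l by case: hf => f1 [f2 /(_ z zr)[? _]]; exists (f1 z).
have lE := cder_dc Hl; rewrite -lE in Hl.
have gI : gr (fun w => complex.Re (- 'i%C * f w)) z = - 'i%C * dc f z.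
  by have := cderZ (- 'i%C) Hl => /cderP[/cgrad_gr].
split; [exact: Hl|exact: h2|exact: h4|exact: h5|move=> h hc].
have [q1 q2] := h6 h hc; have [p1 _] := k6 h hc; split; last exact: q2.
apply: le_trans (cabs_ReIm _) _; rewrite Im_mulNi !mulrBr !ReD !ReN.
move: q1 p1; rewrite gI -/(dc f z) -[- 'i%C * dc f z * h]mulrA; clear; lra.
Qed.

#[local] Opaque gr dc.

(** No convergence is assumed: values and derivatives are bounded, hence have limits along F, and
    the Taylor inequalities pass to them. This is Montel's theorem in ultrafilter form. *)
Lemma weierstrass c r M (f : nat -> R[i] -> R[i]) (F : set_system nat) :
  UltraFilter F -> 0 < r -> 0 < M -> (forall n, hol2 (cdisc c r) (f n)) ->
  (forall n z, cdisc c r z -> cabs (f n z) <= M) ->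
  exists2 g, hol2 (odisc c (r / 2)) g &
    forall z, odisc c (r / 2) z -> (fun n => f n z) @ F --> g z.
Proof.
move=> FU r0 M0 hf fM; have FP : ProperFilter F := @ultra_proper _ F FU.
have He n := hol_est r0 M0 (hf n) (fM n).
have lim (q : nat -> R[i] -> R[i]) (B : R) :
    (forall n s, cabs (s - c) < r / 2 -> cabs (q n s) <= B) ->
    exists q' : R[i] -> R[i], forall s, cabs (s - c) < r / 2 ->
      (fun n => q n s) @ F --> q' s.
  move=> qM.
  have /choice[q' q'P] : forall s, exists l : R[i], cabs (s - c) < r / 2 ->
      (fun n => q n s) @ F --> l.
    move=> s; have [lt|ge] := ltP (cabs (s - c)) (r / 2); last by exists 0.
    by have [l lP _] := bounded_ultra_lim FU (fun n => qM n s lt); exists l.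
  by exists q'.
have [|g gP] := lim f M; first by move=> n s sc; apply: fM; rewrite /cdisc /=; lra.
have [|g1 g1P] := lim (fun n => dc (f n)) (CT * M / r) ; first by move=> n s /(He n)[].
have [|g2 g2P] := lim (fun n => dc (dc (f n))) (CT * M / r ^+ 2); first by move=> n s /(He n)[].
have small (K : R) (q q1 : R[i] -> R[i]) : 0 <= K ->
    (forall z h, cabs (z - c) < r / 2 -> cabs (z + h - c) < r / 2 ->
      cabs (q (z + h) - q z - q1 z * h) <= K * cabs h ^+ 2) ->
    forall z, cabs (z - c) < r / 2 -> cder q z (q1 z).
  move=> K0 H z zc e e0; exists (Num.min (r / 2 - cabs (z - c)) (e / (K + 1))).
    by rewrite lt_min; apply/andP; split; [lra|rewrite divr_gt0 //; lra].
  move=> h; rewrite lt_min ltr_pdivlMr; last lra.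
  move=> /andP[h1 h2]; apply: le_trans (H z h zc _) _.
    by have := cabsD (z - c) h; rewrite addrAC; lra.
  rewrite expr2 mulrA ler_wpM2r ?cabs_ge0 //; have := cabs_ge0 h; lra.
have K0 n : 0 <= CT * M / r ^+ n.
  by rewrite divr_ge0 ?exprn_ge0 ?mulr_ge0 ?ltW ?CT_gt0.
exists g; last exact: gP.
exists g1, g2 => z zc; split.
  apply: (small (2 * (CT * M / r ^+ 2))) => //; first by rewrite mulr_ge0.
  move=> w h wc whc; apply: (taylor_closed FP (gP _ whc) (gP _ wc) (g1P _ wc)) => n.
  by have [_ _ _ _ /(_ h whc)[]] := He n w wc.
apply: (small (CT * M / r ^+ 3)) => //.
move=> w h wc whc; apply: (taylor_closed FP (g1P _ whc) (g1P _ wc) (g2P _ wc)) => n.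
by have [_ _ _ _ /(_ h whc)[]] := He n w wc.
Qed.

Lemma hol2_poly (V : set R[i]) (a : nat -> R[i]) n :
  hol2 V (fun s => series (fun k => a k * s ^+ k) n).
Proof.
have hX k : hol2 V (fun s => s ^+ k).
  elim: k => [|k IH]; first by under eq_fun do rewrite expr0; exact: hol2_cst.
  by under eq_fun do rewrite exprS; apply: hol2M => //; exact: hol2_id.
elim: n => [|n IH].
  by under eq_fun do rewrite /series /= big_geq //; exact: hol2_cst.
under eq_fun do rewrite /series /= big_nat_recr //=.
by apply: hol2D => //; exact: hol2Z.
Qed.

(** The partial sums are bounded on the disc of radius r1 / 2 by a geometric series; the ultrafilter
    limit is holomorphic on half of it and agrees with the sum wherever the series converges. *)
Lemma power_series_hol (a : nat -> R[i]) (B r1 : R) : 0 < r1 -> 0 < B ->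
  (forall k, cabs (a k) * r1 ^+ k <= B) ->
  exists2 f, hol2 (odisc 0 (r1 / 4)) f & forall s l, cabs s < r1 / 4 ->
    series (fun k => a k * s ^+ k) @ \oo --> l -> f s = l.
Proof.
move=> r0 B0 aB; have [F [FU Foo]] := @ultraFilterLemma nat \oo _.
have FP : ProperFilter F := @ultra_proper _ F FU.
have b0 : 0 < 2 * B by lra.
have r2 : 0 < r1 / 2 by lra.
have pb n s : cdisc 0 (r1 / 2) s ->
    cabs (series (fun k => a k * s ^+ k) n) <= 2 * B - 2 * B * 2^-1 ^+ n.
  rewrite /cdisc /= subr0 => s1; rewrite /series /=; elim: n => [|n IH].
    by rewrite big_geq // cabs0 expr0; lra.
  rewrite big_nat_recr //=; apply: le_trans (cabsD _ _) _.
  have : cabs (a n * s ^+ n) <= B * 2^-1 ^+ n.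
    rewrite cabsM cabsX; apply: (@le_trans _ _ (cabs (a n) * (r1 / 2) ^+ n)).
      apply: ler_wpM2l; first exact: cabs_ge0.
      by rewrite lerXn2r ?nnegrE ?cabs_ge0 // ltW.
    rewrite exprMn mulrA ler_wpM2r //.
  by rewrite exprS; lra.
have [|f hf fP] := @weierstrass 0 (r1 / 2) (2 * B) _ F FU r2 b0 (fun n => hol2_poly _ a n).
- move=> n z /(pb n); have : 0 <= 2 * B * 2^-1 ^+ n :> R.
    by rewrite mulr_ge0 ?exprn_ge0 ?invr_ge0 //; lra.
  lra.
exists f; first by apply: hol2_sub hf => z; rewrite /odisc /=; lra.
move=> s l s1 sl; apply: (cvg_unique (@norm_hausdorff _ _) (fP s _)).
  by rewrite /odisc /= subr0; lra.
by move=> A /sl; exact: Foo.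
Qed.

Lemma analytic_extension (g : R -> R[i]) t0 : real_analytic g ->
  exists f r, [/\ 0 < r, hol2 (odisc 0 r) f &
    forall t, `|t| < r -> f t%:C = g (t0 + t)].
Proof.
move=> /(_ t0)[a [r [r0 H]]].
pose r1 := r / 2; have r10 : 0 < r1 by rewrite divr_gt0.
have cv0 : (fun k => a k * r1%:C ^+ k) @ \oo --> (0 : R[i]).
  apply: cvg_series_cvg_0; apply/cvg_ex; exists (g (t0 + r1)).
  have := H (t0 + r1); rewrite addrAC subrr add0r; apply.
  by rewrite gtr0_norm // /r1; lra.
have [N _ NP] := (@cvgC R nat \oo _ _ 0).1 cv0 1 ltr01.
pose B := 1 + \sum_(k < N) cabs (a k) * r1 ^+ k.
have S0 : 0 <= \sum_(k < N) cabs (a k) * r1 ^+ k.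
  by apply: sumr_ge0 => k _; rewrite mulr_ge0 ?cabs_ge0 // exprn_ge0 // ltW.
have aB k : cabs (a k) * r1 ^+ k <= B.
  have [kN|kN] := ltnP k N.
    rewrite /B (bigD1 (Ordinal kN)) //= addrCA lerDl addr_ge0 //.
    by apply: sumr_ge0 => j _; rewrite mulr_ge0 ?cabs_ge0 // exprn_ge0 // ltW.
  have := NP k kN; rewrite /= subr0 cabsM cabsX cabs_real_pos // /B; lra.
have B0 : 0 < B by rewrite /B; lra.
have [f hf fP] := power_series_hol r10 B0 aB.
exists f, (r1 / 4); split => //; first by rewrite divr_gt0.
move=> t tr; apply: fP; first by rewrite cabsR.
have := H (t0 + t); rewrite addrAC subrr add0r; apply.
by move: tr; rewrite /r1; have := normr_ge0 t; lra.
Qed.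

End PowerSeries.

#[local] Opaque gr dc.

(** * Straightening an analytic curve *)

Section Curves.
Context {R : realType}.
Implicit Types (z w h s c p : R[i]) (f : R[i] -> R[i]) (g : R -> R[i]) (r M t : R).

Lemma odisc_center c r : 0 < r -> odisc c r c.
Proof. by rewrite /odisc /= subrr cabs0. Qed.

Lemma hol2_cder (V : set R[i]) f z : hol2 V f -> V z -> exists l, cder f z l.
Proof. by move=> [f1 [f2 H]] /H[? _]; exists (f1 z). Qed.

Lemma hol2_bounded c r f : hol2 (cdisc c r) f ->
  exists2 M, 0 < M & forall z, cdisc c r z -> cabs (f z) <= M.
Proof.
move=> hf.
have [|M M0 fM] := @compact_bounded R (cdisc c r) (fun z => cabs (f z)) (compact_cdisc c r).
  by apply: ucontK_cabs => z zc; exact: hol2_cder hf zc.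
by exists M => // z /fM; apply: le_trans; exact: ler_norm.
Qed.

(** Where [dc f] varies little, f differs from multiplication by dc f 0 by a map with small
    Lipschitz constant; this leaves the lower bound |dc f 0| / 2. *)
Lemma near_translation f r : 0 < r -> hol2 (odisc 0 r) f -> dc f 0 != 0 ->
  exists rho C c0 : R, [/\ 0 < rho, rho <= r, 0 < C, 0 < c0 &
    [/\ forall s, cabs s < rho -> cabs (f s - f 0 - dc f 0 * s) <= C * cabs s ^+ 2 &
     forall s s', cabs s < rho -> cabs s' < rho -> c0 * cabs (s - s') <= cabs (f s - f s')]].
Proof.
move=> r0 hf a0; have r2 : 0 < r / 2 by lra.
have hf2 : hol2 (cdisc 0 (r / 2)) f.
  by apply: hol2_sub hf => z; rewrite /cdisc /odisc /=; lra.
have [M M0 fM] := hol2_bounded hf2.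
have He := hol_est r2 M0 hf2 fM.
pose C := 2 * (CT * M / (r / 2) ^+ 2); pose K := CT * M / (r / 2) ^+ 3.
have CT0 := @CT_gt0 R.
have C0 : 0 < C by rewrite !mulr_gt0 ?invr_gt0 ?exprn_gt0.
have K0 : 0 < K by rewrite !mulr_gt0 ?invr_gt0 ?exprn_gt0.
have z0 : cabs (0 - 0 : R[i]) < r / 2 / 2 by rewrite subrr cabs0; lra.
have [_ _ _ _ H0] := He 0 z0.
pose L := cabs (dc (dc f) 0) + K * r.
have L0 : 0 < L.
  by have : 0 < K * r := mulr_gt0 K0 r0; have := cabs_ge0 (dc (dc f) 0); rewrite /L; lra.
have ca : 0 < cabs (dc f 0) by rewrite cabs_gt0.
pose rho := Num.min (r / 4) (cabs (dc f 0) / (2 * (2 * C + L))).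
have rho0 : 0 < rho by rewrite lt_min !divr_gt0 ?mulr_gt0 //; lra.
have rho4 : rho <= r / 4 by rewrite ge_min lexx.
have rhoa : rho * (2 * (2 * C + L)) <= cabs (dc f 0).
  by rewrite -ler_pdivlMr ?mulr_gt0 ?ge_min ?lexx ?orbT //; lra.
have q4 s : cabs s < rho -> cabs (s - 0) < r / 2 / 2 by rewrite subr0; lra.
have rr : rho <= r by lra.
have a2 : 0 < cabs (dc f 0) / 2 by lra.
exists rho, C, (cabs (dc f 0) / 2); split => //; split.
  move=> s sr; have := H0 s; rewrite !add0r => /(_ (q4 s sr))[H _].
  exact: H.
move=> s' s sr' sr; set h := s' - s.
have sh : s' = s + h by rewrite /h addrC subrK.
have [_ _ _ _ /(_ h)] := He s (q4 s sr); rewrite -sh => /(_ (q4 _ sr'))[H _].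
have := H0 s; rewrite !add0r => /(_ (q4 s sr))[_ D].
have h2 : cabs h <= 2 * rho by have := cabsD s' (- s); rewrite cabsN /h; lra.
have Ds : cabs (dc f s - dc f 0) <= L * cabs s.
  have := cabsD (dc f s - dc f 0 - dc (dc f) 0 * s) (dc (dc f) 0 * s).
  rewrite subrK cabsM => H1; apply: le_trans H1 _.
  have : K * cabs s ^+ 2 <= K * r * cabs s.
    rewrite expr2 mulrA ler_wpM2r ?cabs_ge0 // ler_pM2l //; lra.
  by move: D; rewrite -/K /L; lra.
have E : dc f 0 * h = (f s' - f s) - (f s' - f s - dc f s * h) - (dc f s - dc f 0) * h.
  by ring.
have := cabsD (f s' - f s - (f s' - f s - dc f s * h)) (- ((dc f s - dc f 0) * h)).
have := cabsD (f s' - f s) (- (f s' - f s - dc f s * h)).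
rewrite -E !cabsN !cabsM => t1 t2.
have t3 : cabs (dc f s - dc f 0) * cabs h <= L * rho * cabs h.
  apply: ler_wpM2r; first exact: cabs_ge0.
  by apply: le_trans Ds _; rewrite ler_pM2l // ltW.
have t4 : C * cabs h ^+ 2 <= C * (2 * rho) * cabs h.
  by rewrite expr2 mulrA ler_wpM2r ?cabs_ge0 // ler_pM2l.
have t5 : rho * (2 * (2 * C + L)) * cabs h <= cabs (dc f 0) * cabs h.
  by rewrite ler_wpM2r ?cabs_ge0.
move: H; rewrite -/C => H; move: t1 t2 t3 t4 t5 H.
clear; lra.
Qed.

(** An omitted value w close to f 0 would make f - w zero free and tiny at 0, hence small at eta / 2
    by [zero_free_small], where injectivity keeps f away from f 0. *)
Lemma open_at_center f (rho c0 : R) : 0 < rho -> 0 < c0 -> hol2 (odisc 0 rho) f ->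
  (forall s s', cabs s < rho -> cabs s' < rho -> c0 * cabs (s - s') <= cabs (f s - f s')) ->
  forall eta, 0 < eta -> exists2 d, 0 < d &
    forall w, cabs (w - f 0) < d -> exists2 s, cabs s < eta & f s = w.
Proof.
move=> r0 c00 hf inj eta0 eta00.
pose eta := Num.min rho eta0 / 2.
have e0 : 0 < eta by rewrite divr_gt0 // lt_min r0.
have [er ee] : eta < rho /\ eta < eta0.
  have m0 : 0 < Num.min rho eta0 by rewrite lt_min r0.
  have : Num.min rho eta0 <= rho by rewrite ge_min lexx.
  have : Num.min rho eta0 <= eta0 by rewrite ge_min lexx orbT.
  by rewrite /eta; split; lra.
have hf2 : hol2 (cdisc 0 eta) f.
  by apply: hol2_sub hf => z; rewrite /cdisc /odisc /=; lra.
have [M M0 fM] := hol2_bounded hf2.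
pose M1 := M + cabs (f 0) + 1.
have M10 : 0 < M1 by have := cabs_ge0 (f 0); rewrite /M1; lra.
(* At eta / 2 the value of f is at least 2 k away from f 0, hence k away from w. *)
pose k := c0 * eta / 4.
have k0 : 0 < k by rewrite divr_gt0 // mulr_gt0.
pose d := Num.min 1 (Num.min k (k ^+ 3 / (2 * M1 ^+ 2))).
have k3 : 0 < k ^+ 3 by rewrite exprn_gt0.
have M12 : 0 < 2 * M1 ^+ 2 by rewrite mulr_gt0 ?exprn_gt0.
have d0 : 0 < d by rewrite !lt_min ltr01 k0 divr_gt0.
have d1 : d <= 1 by rewrite ge_min lexx.
have dk : d <= k by rewrite !ge_min lexx orbT.
have d3 : d * (2 * M1 ^+ 2) <= k ^+ 3.
  by rewrite -ler_pdivlMr // !ge_min lexx !orbT.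
exists d => // w wd; apply: contrapT => /forall2NP H.
have H0 s : cdisc 0 eta s -> f s - w != 0.
  rewrite /cdisc /= subr0 => se; rewrite subr_eq0; apply/eqP => E.
  by case: (H s) => //; move=> /negP; rewrite -leNgt; lra.
have fw : forall s, cdisc 0 eta s -> cabs (f s - w) <= M1.
  move=> s /fM; have := cabsD (f s) (- w); rewrite cabsN.
  have := cabs_subr w (f 0); rewrite /M1; lra.
pose x : R[i] := (eta / 2)%:C.
have xE : cabs x = eta / 2 by rewrite cabs_real_pos //; lra.
have := @zero_free_small R 0 eta M1 (fun s => f s - w) x e0.
rewrite subr0 xE => /(_ _ H0 fw (lexx _)).
move=> /(_ ltac:(by apply: hol2B => //; exact: hol2_cst)).
rewrite (cabsB (f 0)) => K.
have kx : k <= cabs (f x - w).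
  have := inj x 0; rewrite xE cabs0 subr0 xE => /(_ ltac:(lra) r0).
  by have := cabs_tri (f x) w (f 0); rewrite /k in dk *; lra.
have : k ^+ 3 <= cabs (f x - w) ^+ 3 by rewrite lerXn2r ?nnegrE ?cabs_ge0 // ltW.
have : M1 ^+ 2 * cabs (w - f 0) < M1 ^+ 2 * d by rewrite ltr_pM2l ?exprn_gt0.
have : 0 < M1 ^+ 2 * d by rewrite mulr_gt0 ?exprn_gt0.
move: K d3; clear; lra.
Qed.

Lemma curve_straightening g t0 : real_analytic g -> velocity g t0 != 0 ->
  exists f (rho C c0 : R), [/\ [/\ 0 < rho, 0 < C & 0 < c0], hol2 (odisc 0 rho) f /\ dc f 0 != 0,
    forall t, `|t| < rho -> f t%:C = g (t0 + t),
    forall s, cabs s < rho -> cabs (f s - f 0 - dc f 0 * s) <= C * cabs s ^+ 2 &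
    forall s s', cabs s < rho -> cabs s' < rho -> c0 * cabs (s - s') <= cabs (f s - f s')].
Proof.
move=> ag v0; have [f [r [r0 hf fg]]] := analytic_extension t0 ag.
have [l Hl] : exists l, cder f 0 l by apply: hol2_cder hf _; exact: odisc_center.
have lE := cder_dc Hl.
have vE : velocity g t0 = l.
  have cv (F : R[i] -> R) q : cgrad (fun s => F (f s)) 0 q ->
      derive1 (fun t => F (g t)) t0 = complex.Re q.
    move=> /(cgrad_dirder 1); rewrite mulr1 => H.
    suff : rder (fun t => F (g t)) t0 (complex.Re q).
      by move=> /rderP[_]; rewrite derive1E.
    apply: rder_shift; apply: (rder_ext_near r0 _ H) => h hr.
    by rewrite !add0r mulr1 fg.
  have /cderP[H1 H2] := Hl; rewrite /velocity (cv _ _ H1) (cv _ _ H2).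
  by rewrite -Im_mulNi; case: (l).
have a0 : dc f 0 != 0 by rewrite lE -vE.
have [rho [C [c0 [rho0 rr C0 c00 [H1 H2]]]]] := near_translation r0 hf a0.
exists f, rho, C, c0; split => //; last by move=> t tr; apply: fg; exact: lt_le_trans rr.
split => //; apply: hol2_sub hf => z; rewrite /odisc /= => zr; exact: lt_le_trans rr.
Qed.

Definition contR g := forall t (e : R), 0 < e -> exists2 d : R, 0 < d &
  forall t', `|t' - t| < d -> cabs (g t' - g t) < e.

Lemma curve_cont g : real_analytic g -> (forall t, velocity g t != 0) -> contR g.
Proof.
move=> ag v0 t e e0; have [f [r [C [c0 [[r0 _ _] [hf _] fg _ _]]]]] := curve_straightening ag (v0 t).
have [l Hl] : exists l, cder f 0 l by apply: hol2_cder hf _; exact: odisc_center.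
have [d d0 H] := cder_cont Hl e0.
exists (Num.min r d); first by rewrite lt_min r0.
move=> t'; rewrite lt_min => /andP[h1 h2].
have := H (t' - t)%:C; rewrite subr0 cabsR => /(_ h2).
have := fg 0; rewrite normr0 rmorph0 addr0 => /(_ r0) ->.
by rewrite fg // (addrC t) subrK.
Qed.

Lemma contR_continuous (F : R[i] -> R) g : contR g ->
  (forall z w, `|F z - F w| <= cabs (z - w)) -> continuous (fun t => F (g t)).
Proof.
move=> cg FL t; apply/cvgR => e e0; have [d d0 H] := cg t e e0.
exists d => //= t' /=; rewrite distrC => /H.
by apply: le_lt_trans; exact: FL.
Qed.

Lemma lip_Re z w : `|complex.Re z - complex.Re w| <= cabs (z - w).
Proof. by rewrite -ReN -ReD cabs_Re. Qed.

Lemma lip_cabs z w : `|cabs z - cabs w| <= cabs (z - w).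
Proof.
rewrite ler_norml; have := cabs_subr z w; have := cabs_subr w z.
by rewrite (cabsB w z) => ? ?; apply/andP; split; lra.
Qed.

End Curves.

(** * A connected open set does not meet both sides of a boundary curve *)

Section OneSided.
Context {R : realType}.
Implicit Types (z w : R[i]) (g S : R -> R[i]) (t : R).

(** The branch with positive real part, whose continuity on the right half plane is proved by
    hand. *)
Definition csq z := if 0 < complex.Re (sqrtc z) then sqrtc z else - sqrtc z.

Lemma csqP z : 0 < complex.Re z -> csq z ^+ 2 = z /\ 0 < complex.Re (csq z).
Proof.
move=> z0; have := sqr_sqrtc z; rewrite /csq; set b := sqrtc z => bz.
have b0 : complex.Re b != 0.
  by apply/eqP => E; move: z0; rewrite -bz expr2 ReM E; nra.
case: ltP => b1; first by split.
by rewrite sqrrN ReN; split => //; move: b0 b1; rewrite neq_lt => /orP[]; lra.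
Qed.

Lemma csq_lip z w : 0 < complex.Re z -> 0 < complex.Re w ->
  cabs (csq z - csq w) * complex.Re (csq z) <= cabs (z - w).
Proof.
move=> /csqP[z2 zp] /csqP[w2 wp].
rewrite -[in leRHS]z2 -[in leRHS]w2 subr_sqr cabsM ler_wpM2l ?cabs_ge0 //.
apply: le_trans (cabs_Re _); rewrite ReD ger0_norm; lra.
Qed.

Lemma contR_csq g : contR g -> (forall t, 0 < complex.Re (g t)) ->
  contR (fun t => csq (g t)).
Proof.
move=> cg g0 t e e0; have [_ p0] := csqP (g0 t).
have [d d0 H] := cg t _ (mulr_gt0 e0 p0); exists d => // t' /H lt.
rewrite -(ltr_pM2r p0); apply: le_lt_trans lt.
by rewrite cabsB (cabsB (g t')) csq_lip.
Qed.

Lemma contR_comp (f : R[i] -> R[i]) g : contR g ->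
  (forall t, exists l, cder f (g t) l) -> contR (fun t => f (g t)).
Proof.
move=> cg df t e e0; have [l Hl] := df t; have [d d0 H] := cder_cont Hl e0.
by have [d' d'0 H'] := cg t d d0; exists d' => // t' /H' /H.
Qed.

Lemma contR_mul g S : contR g -> contR S -> contR (fun t => g t * S t).
Proof.
move=> cg cS t e e0.
pose K := cabs (g t) + cabs (S t) + 1.
have g0 := cabs_ge0 (g t); have S0 := cabs_ge0 (S t).
have K0 : 0 < K by rewrite /K; lra.
have m0 : 0 < Num.min 1 (e / K) by rewrite lt_min ltr01 divr_gt0.
have [d d0 H] := cg t _ m0; have [d' d'0 H'] := cS t _ m0.
exists (Num.min d d'); first by rewrite lt_min d0.
move=> t'; rewrite lt_min => /andP[/H + /H'].
rewrite !lt_min !ltr_pdivlMr // => /andP[q1 q2] /andP[q3 q4].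
have -> : g t' * S t' - g t * S t = (g t' - g t) * (S t' - S t) +
   (g t' - g t) * S t + g t * (S t' - S t) by ring.
have := cabsD ((g t' - g t) * (S t' - S t) + (g t' - g t) * S t) (g t * (S t' - S t)).
have := cabsD ((g t' - g t) * (S t' - S t)) ((g t' - g t) * S t).
rewrite !cabsM; move: q1 q2 q3 q4.
set A := cabs (g t' - g t); set B := cabs (S t' - S t) => q1 q2 q3 q4.
have A0 : 0 <= A := cabs_ge0 _; have B0 : 0 <= B := cabs_ge0 _.
set X := cabs (g t) in g0 *; set Y := cabs (S t) in S0 *.
have k1 : A * B <= A by rewrite ler_piMr // ltW.
have KE : K = X + Y + 1 by [].
suff : A * 1 + A * Y + X * B < e by lra.
have : X * B * K <= X * e by rewrite -mulrA ler_wpM2l // ltW.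
have : A * (1 + Y) * K <= e * (1 + Y).
  by rewrite mulrAC ler_wpM2r //; lra.
move=> h1 h2; rewrite -(ltr_pM2r K0).
have [X0|X0] := eqVneq X 0.
  by rewrite X0 mul0r addr0 KE X0; move: q2; rewrite KE X0; nra.
have X1 : 0 < X by rewrite lt_neqAle eq_sym X0.
have h3 : X * B * K < X * e by rewrite -mulrA ltr_pM2l.
have -> : e * K = X * e + e * (1 + Y) by rewrite KE; ring.
lra.
Qed.

(* Square roots of t |-> (g t - zp) / (g t - z) that are continuous along a
   closed curve g persist as z moves in a connected set avoiding g. *)
Lemma continuous_root (U : set R[i]) g zp : open U -> connected U -> contR g ->
  (forall t, g (t + 1) = g t) -> (forall t, ~ U (g t)) -> U zp ->
  forall z, U z -> exists S, [/\ contR S, forall t, S (t + 1) = S t &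
    forall t, S t ^+ 2 = (g t - zp) / (g t - z)].
Proof.
move=> oU cU cg pg gU Uzp.
pose lift z := exists S, [/\ contR S, forall t, S (t + 1) = S t &
    forall t, S t ^+ 2 = (g t - zp) / (g t - z)].
have gz z t : U z -> g t - z != 0.
  by move=> Uz; rewrite subr_eq0; apply/eqP => E; apply: (gU t); rewrite E.
have move1 z z' : U z -> U z' -> (forall t, cabs (z - z') < cabs (g t - z')) ->
    lift z -> lift z'.
  move=> Uz Uz' zz [S [cS pS S2]].
  (* On the curve f equals 1 - (z - z') / (g t - z') and lies in the right half plane, so
     multiplying the root for z by [csq] of it gives a root for z'. *)
  pose f w := (w - z) / (w - z').
  have f0 t : 0 < complex.Re (f (g t)).
    have -> : f (g t) = 1 - (z - z') / (g t - z').
      by rewrite /f; field; exact: gz.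
    have lt1 : cabs ((z - z') / (g t - z')) < 1.
      by rewrite cabsM cabsV ltr_pdivrMr ?mul1r ?cabs_gt0 ?gz.
    have := cabs_Re ((z - z') / (g t - z')); rewrite ler_norml => /andP[_ q].
    by rewrite ReD ReN (_ : complex.Re 1 = 1) //; lra.
  exists (fun t => S t * csq (f (g t))); split.
  - apply: contR_mul => //; apply: contR_csq => //; apply: contR_comp => // t.
    apply: (@hol2_cder _ [set w | w - z' != 0]); last exact: gz.
    apply: hol2M; first by apply: hol2B; [exact: hol2_id|exact: hol2_cst].
    by apply: hol2V => //; apply: hol2B; [exact: hol2_id|exact: hol2_cst].
  - by move=> t; rewrite pS pg.
  - move=> t; rewrite exprMn S2 (csqP (f0 t)).1 /f.
    by field; rewrite !gz.
have far z (e : R) : 0 < e -> (forall w, cabs (w - z) < e -> U w) ->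
    forall t, e <= cabs (g t - z).
  by move=> e0 He t; rewrite leNgt; apply/negP => /He; exact: gU.
suff H z : U z -> U z /\ lift z by move=> z /H[].
apply: (connected_clopen (A := [set z | U z /\ lift z]) cU) => [w []//| | |{}z Uz H].
- exists zp; split => //; exists (fun=> 1); split => //.
    by move=> t e e0; exists 1 => // t' _; rewrite subrr cabs0.
  by move=> t; rewrite expr1n divff // gz.
- apply/openC => w [Uw lw]; have [e e0 He] := (openC U).1 oU w Uw.
  exists (e / 2); first lra.
  move=> w' ww; have Uw' : U w' by apply: He; lra.
  split => //; apply: (move1 w) => // t.
  have := far w e e0 He t; have := cabs_tri (g t) w' w; rewrite (cabsB w w'); lra.
- have [e e0 He] := (openC U).1 oU z Uz; have [|w [Uw lw] wz] := H (e / 2); first lra.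
  split => //; apply: (move1 w) => // t.
  have := far z e e0 He t; lra.
Qed.

(** If U contained the points g t0 + i ep a and g t0 - i ep a, then (W - i ep) / (W + i ep), with W
    t = (g t - g t0) / a, would have a continuous periodic square root S along the curve. Re S
    vanishes only where W is on the segment from - i ep to i ep, that is, once in a period; but it
    changes sign there, which a periodic function cannot do once only. *)
Lemma no_crossing (U : set R[i]) g (a : R[i]) (t0 ep eta : R) : open U -> connected U ->
  contR g -> (forall t, g (t + 1) = g t) -> (forall t, ~ U (g t)) ->
  a != 0 -> 0 < ep -> 0 < eta -> eta < 1/2 ->
  U (g t0 + 'i%C * ep%:C * a) -> U (g t0 - 'i%C * ep%:C * a) ->
  (forall t, 0 < t < eta -> 0 < complex.Re ((g (t0 + t) - g t0) / a)) ->
  (forall t, - eta < t < 0 -> complex.Re ((g (t0 + t) - g t0) / a) < 0) ->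
  (forall t, eta <= t <= 1 - eta -> ep < cabs ((g (t0 + t) - g t0) / a)) -> False.
Proof.
move=> oU cU cg pg gU a0 ep0 eta0 eta1 Up Um h1 h2 h3.
have [S [cS pS S2]] := continuous_root oU cU cg pg gU Up Um.
pose W t := (g t - g t0) / a.
have gm t : g t - (g t0 - 'i%C * ep%:C * a) != 0.
  by rewrite subr_eq0; apply/eqP => E; apply: (gU t); rewrite E.
(* Real and imaginary parts of S^2 = (W - i ep) / (W + i ep), cleared of the denominator D = |W + i
   ep|^2. *)
have key t : exists2 D : R, 0 < D &
    (complex.Re (S t) ^+ 2 - complex.Im (S t) ^+ 2) * D = cabs (W t) ^+ 2 - ep ^+ 2 /\
    complex.Re (S t) * complex.Im (S t) * D = - (ep * complex.Re (W t)).
  have E : S t ^+ 2 * (W t + 'i%C * ep%:C) = W t - 'i%C * ep%:C.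
    have gm' := gm t.
    by rewrite S2 /W; field; rewrite a0 gm'.
  have n0 : W t + 'i%C * ep%:C != 0.
    have := gm t; apply: contraNneq => E0.
    have -> : g t - (g t0 - 'i%C * ep%:C * a) = a * (W t + 'i%C * ep%:C).
      by rewrite /W; field.
    by rewrite E0 mulr0.
  exists (cabs (W t + 'i%C * ep%:C) ^+ 2); first by rewrite exprn_gt0 // cabs_gt0.
  rewrite !sqr_cabs; move: E; case: (S t) => x y; case: (W t) => b c.
  rewrite expr2 => /(congr1 (fun z => (complex.Re z, complex.Im z))) /=.
  case=> e1 e2; split.
    have e3 : (x * x - y * y) * (b + (0 * ep - 1 * 0)) - (x * y + y * x) * (c + (0 * 0 + 1 * ep)) = b - (0 * ep - 1 * 0) by [].
    have e4 : (x * x - y * y) * (c + (0 * 0 + 1 * ep)) + (x * y + y * x) * (b + (0 * ep - 1 * 0)) = c - (0 * 0 + 1 * ep) by rewrite -e2; ring.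
    have : ((x * x - y * y) * (b + (0 * ep - 1 * 0)) - (x * y + y * x) * (c + (0 * 0 + 1 * ep))) * b +
      ((x * x - y * y) * (c + (0 * 0 + 1 * ep)) + (x * y + y * x) * (b + (0 * ep - 1 * 0))) * (c + ep) = b * b + (c - ep) * (c + ep).
      by rewrite e3 e4; ring.
    lra.
  have e3 : (x * x - y * y) * (b + (0 * ep - 1 * 0)) - (x * y + y * x) * (c + (0 * 0 + 1 * ep)) = b - (0 * ep - 1 * 0) by [].
  have e4 : (x * x - y * y) * (c + (0 * 0 + 1 * ep)) + (x * y + y * x) * (b + (0 * ep - 1 * 0)) = c - (0 * 0 + 1 * ep) by rewrite -e2; ring.
  have : ((x * x - y * y) * (c + (0 * 0 + 1 * ep)) + (x * y + y * x) * (b + (0 * ep - 1 * 0))) * b -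
    ((x * x - y * y) * (b + (0 * ep - 1 * 0)) - (x * y + y * x) * (c + (0 * 0 + 1 * ep))) * (c + ep) = (c - ep) * b - b * (c + ep).
    by rewrite e3 e4; ring.
  lra.
(* If Re S = 0 then S^2 <= 0, so Re W = 0 and |W| <= ep; near the endpoints the sign of Re W
   excludes this, elsewhere the size of W. *)
have nz t : 0 < t < 1 -> complex.Re (S (t0 + t)) != 0.
  move=> /andP[t00 t1]; apply/eqP => E; have [D D0 [k1 k2]] := key (t0 + t).
  rewrite E mul0r mul0r in k2; rewrite E expr0n /= sub0r in k1.
  have WR : complex.Re (W (t0 + t)) = 0.
    have : ep * complex.Re (W (t0 + t)) = 0 by lra.
    by move=> /eqP; rewrite mulf_eq0 (gt_eqF ep0) => /eqP.
  have [lt|ge] := ltP t eta.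
    by have := h1 t; rewrite t00 lt -/(W _) WR ltxx => /(_ isT).
  have [gt|le] := ltP (1 - eta) t.
    have := h2 (t - 1); have -> : g (t0 + (t - 1)) = g (t0 + t) by rewrite -pg; congr g; ring.
    rewrite -/(W _) WR ltxx; suff -> : (- eta < t - 1 < 0) by move=> /(_ isT).
    by apply/andP; split; lra.
  have := h3 t; rewrite ge le -/(W _) => /(_ isT) lt.
  have : ep ^+ 2 < cabs (W (t0 + t)) ^+ 2 by rewrite ltrXn2r ?nnegrE ?cabs_ge0 // ltW.
  have : 0 <= complex.Im (S (t0 + t)) ^+ 2 * D by rewrite mulr_ge0 ?sqr_ge0 // ltW.
  lra.
(* W t0 = 0 makes S t0 equal to i or -i, so Im S keeps its sign near t0 while Re W, and with it Re
   S, changes sign. *)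
have [b0 a00] : complex.Im (S t0) ^+ 2 = 1 /\ complex.Re (S t0) = 0.
  have sE := S2 t0.
  have E1 : S t0 ^+ 2 = -1.
    have n2 : 'i%C * ep%:C * a != 0.
      by rewrite (_ : _ * a = g t0 - (g t0 - 'i%C * ep%:C * a)) ?gm //; ring.
    rewrite sE (_ : g t0 - (g t0 + 'i%C * ep%:C * a) = - ('i%C * ep%:C * a)); last by ring.
    rewrite (_ : g t0 - (g t0 - 'i%C * ep%:C * a) = 'i%C * ep%:C * a); last by ring.
    by rewrite mulNr divff.
  move: E1; rewrite expr2; case: (S t0) => x y /= [e1 e2].
  have xy : x * y = 0 by lra.
  move/eqP: xy; rewrite mulf_eq0 => /orP[]/eqP E.
    by rewrite E in e1 *; split => //; rewrite expr2; lra.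
  by rewrite E in e1; have := sqr_ge0 x; rewrite expr2; lra.
have [d d0 Hd] := cS t0 (1/2) ltac:(lra).
pose t := Num.min d eta / 2.
have t00 : 0 < t by rewrite divr_gt0 // lt_min d0.
have [td te] : t < d /\ t < eta.
  have : Num.min d eta <= d by rewrite ge_min lexx.
  have : Num.min d eta <= eta by rewrite ge_min lexx orbT.
  by rewrite /t in t00 *; split; lra.
have sgnS (s : R) : `|s| < d -> 0 < complex.Im (S (t0 + s)) * complex.Im (S t0).
  move=> sd; have := Hd (t0 + s); rewrite addrAC subrr add0r => /(_ sd) lt.
  have := cabs_Im (S (t0 + s) - S t0); rewrite ImD ImN ler_norml => /andP[q1 q2].
  move: b0 lt q1 q2; set x := complex.Im _; set y := complex.Im _ => b0 lt q1 q2.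
  clear - b0 lt q1 q2; rewrite expr2 in b0; nra.
have [D1 D10 [_ k1]] := key (t0 + t); have [D2 D20 [_ k2]] := key (t0 - t).
have x1 := h1 t; rewrite t00 te in x1; have {}x1 := x1 isT.
have x2 : complex.Re (W (t0 - t)) < 0 by apply: h2; apply/andP; split; lra.
have s1 := sgnS t; rewrite gtr0_norm // in s1; have {}s1 := s1 td.
have s2 := sgnS (- t); rewrite normrN gtr0_norm // in s2; have {}s2 := s2 td.
have r1 : complex.Re (S (t0 + t)) * complex.Im (S t0) < 0.
  have : complex.Re (S (t0 + t)) * complex.Im (S (t0 + t)) < 0.
    rewrite -(pmulr_llt0 _ D10) k1 oppr_lt0 mulr_gt0 //.
  move: b0 s1; clear; set x := complex.Re _; set y := complex.Im _; set b := complex.Im _.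
  by rewrite expr2; nra.
have r2 : 0 < complex.Re (S (t0 - t)) * complex.Im (S t0).
  have : 0 < complex.Re (S (t0 - t)) * complex.Im (S (t0 - t)).
    by rewrite -(pmulr_lgt0 _ D20) k2 oppr_gt0 pmulr_rlt0.
  move: b0 s2; clear; set x := complex.Re _; set y := complex.Im _; set b := complex.Im _.
  by rewrite expr2; nra.
have pS' : S (t0 + (1 - t)) = S (t0 - t) by rewrite -[RHS]pS; congr S; ring.
have [c] : exists2 c, c \in `[t0 + t, t0 + (1 - t)] & complex.Re (S c) = 0.
  apply: (@IVT R (fun t => complex.Re (S t))).
  - lra.
  - apply: continuous_subspaceT => x.
    exact: (contR_continuous (F := fun z => complex.Re z) cS (@lip_Re R)).
  - rewrite pS' ge_min le_max; move: r1 r2.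
    set x := complex.Re _; set y := complex.Re _; set b := complex.Im _ => r1 r2.
    have [bn|bp|bE] := ltrgtP b 0.
    - rewrite nmulr_llt0 // in r1; rewrite nmulr_lgt0 // in r2.
      by rewrite (ltW r1) (ltW r2) orbT.
    - rewrite pmulr_llt0 // in r1; rewrite pmulr_lgt0 // in r2.
      by rewrite (ltW r1) (ltW r2) orbT.
    - by rewrite bE mulr0 ltxx in r1.
rewrite in_itv /= => /andP[c1 c2]; apply/eqP.
have -> : c = t0 + (c - t0) by ring.
by apply: nz; apply/andP; split; lra.
Qed.

End OneSided.

(** * Charts and the exterior tangent disc *)

Section Charts.
Context {R : realType}.
Implicit Types (z w s p : R[i]) (f Phi : R[i] -> R[i]) (g : R -> R[i]) (t : R).

(** [chart_lip] is injectivity with a constant, and [chart_open] supplies preimages of the points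
    near p; together they replace an inverse map. *)
Record chart (U : set R[i]) p Phi : Prop := Chart {
  chart_hol : hol2 (cdisc 0 1) Phi;
  chart_center : Phi 0 = p;
  chart_der : dc Phi 0 != 0;
  chart_lip : exists2 c0 : R, 0 < c0 & forall s s', cabs s <= 1 -> cabs s' <= 1 ->
    c0 * cabs (s - s') <= cabs (Phi s - Phi s');
  chart_up : forall s, cabs s <= 1 -> 0 < complex.Im s -> U (Phi s);
  chart_real : forall s, cabs s <= 1 -> complex.Im s = 0 -> frontier U (Phi s);
  chart_low : forall s, cabs s <= 1 -> complex.Im s < 0 -> ~ closure U (Phi s);
  chart_open : forall eta : R, 0 < eta -> exists2 d : R, 0 < d &
    forall w, cabs (w - p) < d -> exists2 s, cabs s < eta & Phi s = w }.

Lemma frontierE (U : set R[i]) z : open U -> frontier U z <-> closure U z /\ ~ U z.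
Proof. by move=> oU; rewrite /frontier (interior_id U).1. Qed.

(** The image of the segment is connected, and if it missed the frontier, U would cut out a proper
    part of it that is both open and closed. *)
Lemma crossing_frontier (U : set R[i]) f s s' : open U ->
  (forall t, 0 <= t <= 1 -> exists l, cder f (s + t%:C * (s' - s)) l) ->
  U (f s) -> ~ U (f s') ->
  exists2 t, 0 <= t <= 1 & frontier U (f (s + t%:C * (s' - s))).
Proof.
move=> oU df Us Us'; apply: contrapT => H.
have nf t : 0 <= t <= 1 -> ~ frontier U (f (s + t%:C * (s' - s))).
  by move=> t01 F; apply: H; exists t.
pose c t := f (s + t%:C * (s' - s)).
have cI : connected (c @` `[(0 : R), 1]).
  apply: connected_continuous_connected; first exact: segment_connected.
  apply: continuous_in_subspaceT => t; rewrite inE /= in_itv /= => t01.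
  have [l Hl] := df t t01; apply/cvgC => e e0.
  have [d d0 {}Hl] := cder_cont Hl e0.
  have k0 : 0 < cabs (s' - s) + 1 by have := cabs_ge0 (s' - s); lra.
  exists (d / (cabs (s' - s) + 1)) => /=; first exact: divr_gt0.
  move=> t' /= tt'; apply: Hl.
  rewrite (_ : _ - _ = (t' - t)%:C * (s' - s)); last by rewrite rmorphB /=; ring.
  rewrite cabsM cabsR distrC; rewrite ltr_pdivlMr // in tt'.
  by have := normr_ge0 (t - t'); nra.
have c0 : (c @` `[(0 : R), 1]) (f s).
  exists 0; first by rewrite /= in_itv /= lexx ler01.
  by rewrite /c mul0r addr0.
have c1 : (c @` `[(0 : R), 1]) (f s').
  exists 1; first by rewrite /= in_itv /= lexx ler01.
  by rewrite /c mul1r (addrC s) subrK.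
suff E : (c @` `[(0 : R), 1]) `&` U = c @` `[(0 : R), 1].
  by move: c1; rewrite -E => -[_].
apply: cI; first by exists (f s).
  by exists U.
exists (closure U); first exact: closed_closure.
apply/seteqP; split=> [z [cz Uz]|z [[t t01 <-] cl]]; split => //.
- exact: subset_closure.
- apply: contrapT => nU; apply: (nf t); first by move: t01; rewrite /= in_itv.
  by apply/frontierE.
Qed.

Lemma periodic_int g (n : int) t : (forall t, g (t + 1) = g t) -> g (t + n%:~R) = g t.
Proof.
move=> pg; have pn (m : nat) x : g (x + m%:R) = g x.
  by elim: m => [|m IH]; rewrite ?addr0 // -natr1 addrA pg.
case: n => m; first exact: pn.
by rewrite NegzE mulrNz -[LHS](pn m.+1) subrK.
Qed.

Lemma periodic_image g t : (forall t, g (t + 1) = g t) -> (g @` `[(0 : R), 1[) (g t).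
Proof.
move=> pg; exists (t - (Num.floor t)%:~R); last by rewrite -mulrNz periodic_int.
rewrite /= in_itv /=; have := floor_le t; have := floorD1_gt t.
by rewrite intrD; lra.
Qed.

(** Near p the closure consists of points Phi s with Im s >= 0, which leave p towards the side of i
    (dc Phi 0) up to an error B |s|^2; a small disc on the opposite side, tangent at p, avoids
    them. *)
Lemma ext_disc_chart (U : set R[i]) p Phi : chart U p Phi ->
  exists a (r : R), [/\ 0 < r, cabs (p - a) = r & forall w, closure U w -> r <= cabs (w - a)].
Proof.
case=> hP P0 a0 [c0 c00 lip] _ _ low op.
have [M M0 PM] := hol2_bounded hP.
have [||_ _ _ _ T] := @hol_est R 0 1 M Phi _ M0 hP PM 0 _ => //.
  by rewrite subrr cabs0; lra.
set B := 2 * (CT * M / 1 ^+ 2) in T.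
have B0 : 0 < B by rewrite !mulr_gt0 ?invr_gt0 ?exprn_gt0 ?CT_gt0.
have [d d0 dP] := op (1/2) ltac:(lra).
set a1 := dc Phi 0 in a0 T.
have ca : 0 < cabs a1 by rewrite cabs_gt0.
have [e eE] : exists e, e = a1 / (cabs a1)%:C by exists (a1 / (cabs a1)%:C).
(* The error enters the squared distance to the centre as 2 r B |s|^2, and |w - p|^2 >= c0^2 |s|^2
   absorbs it. *)
pose r := Num.min (d / 2) (c0 ^+ 2 / (2 * B)).
have r0 : 0 < r by rewrite lt_min !divr_gt0 ?exprn_gt0 // mulr_gt0.
have rd : r <= d / 2 by rewrite ge_min lexx.
have rB : r * (2 * B) <= c0 ^+ 2 by rewrite -ler_pdivlMr ?mulr_gt0 // ge_min lexx orbT.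
have ce : cabs e = 1.
  by rewrite eE cabsM cabsV cabs_real_pos // divff // lt0r_neq0.
exists (p - 'i%C * e * r%:C), r; split => //.
  by rewrite opprB addrCA subrr addr0 !cabsM cabsi ce !mul1r cabs_real_pos.
move=> w cw; rewrite leNgt; apply/negP => lt.
have wp : cabs (w - p) < d.
  have := cabs_tri w (p - 'i%C * e * r%:C) p.
  rewrite (_ : p - 'i%C * e * r%:C - p = - ('i%C * e * r%:C)); last by ring.
  by rewrite cabsN !cabsM cabsi ce !mul1r cabs_real_pos //; lra.
have [s s2 sw] := dP w wp.
have s1 : cabs s <= 1 by lra.
have sI : 0 <= complex.Im s.
  by rewrite leNgt; apply/negP => sI; apply: (low s s1 sI); rewrite sw.
have [T1 _] := T s ltac:(rewrite add0r subr0; lra).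
rewrite add0r sw P0 in T1.
have L := lip s 0 s1; rewrite cabs0 subr0 sw P0 in L; have {}L := L ler01.
set q := w - p - a1 * s in T1.
have lt2 : cabs (w - (p - 'i%C * e * r%:C)) ^+ 2 < r ^+ 2.
  by rewrite ltrXn2r ?nnegrE ?cabs_ge0 // ltW.
have E1 : cabs (w - (p - 'i%C * e * r%:C)) ^+ 2 =
    cabs (w - p) ^+ 2 + 2 * r * complex.Re ((w - p) * ('i%C * e)^*) + r ^+ 2.
  rewrite (_ : w - (p - 'i%C * e * r%:C) = (w - p) + r%:C * ('i%C * e)); last by ring.
  rewrite sqr_cabs_line ?cabsM ?cabsi ?ce ?mul1r //; ring.
have E2 : complex.Re ((w - p) * ('i%C * e)^*) = cabs a1 * complex.Im s +
    complex.Re (q * ('i%C * e)^*).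
  have -> : w - p = a1 * s + q by rewrite /q; ring.
  rewrite mulrDl ReD; congr (_ + _).
  have -> : a1 * s * ('i%C * e)^* = (cabs a1)%:C * (- 'i%C * s).
    have aa : a1 * conjc a1 = (cabs a1)%:C ^+ 2.
      by rewrite -rmorphXn /= sqr_cabs; case: (a1) => x y; apply: complex_ext => /=; ring.
    have aC : (cabs a1)%:C != 0 :> R[i] by rewrite -cabs_gt0 cabs_real_pos.
    have iC : conjc ('i%C : R[i]) = - 'i%C by apply: complex_ext; rewrite /= ?oppr0.
    have cM x y : conjc (x * y : R[i]) = conjc x * conjc y by exact: rmorphM.
    have eC : conjc ('i%C * e) = - 'i%C * (conjc a1 / (cabs a1)%:C).
      by rewrite eE !cM iC conjc_inv conjc_real.
    rewrite -[X in _ * _ * X = _]/(conjc ('i%C * e)) eC.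
    rewrite (_ : a1 * s * _ = (a1 * conjc a1) * (- 'i%C * s) / (cabs a1)%:C); last by ring.
    by rewrite aa; field.
  by rewrite (ReM (cabs a1)%:C) /= mul0r subr0 -Im_mulNi.
have E3 : - (B * cabs s ^+ 2) <= complex.Re (q * ('i%C * e)^*).
  have := cabs_Re (q * ('i%C * e)^*); rewrite cabsM cabs_conj cabsM cabsi ce !mulr1.
  by rewrite ler_norml => /andP[h _]; lra.
have E4 : c0 ^+ 2 * cabs s ^+ 2 <= cabs (w - p) ^+ 2.
  by rewrite -exprMn lerXn2r ?nnegrE ?mulr_ge0 ?cabs_ge0 // ltW.
have E5 : r * (2 * B) * cabs s ^+ 2 <= c0 ^+ 2 * cabs s ^+ 2.
  by rewrite ler_wpM2r ?sqr_ge0.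
have E6 : 0 <= r * (cabs a1 * complex.Im s) by rewrite !mulr_ge0 // ltW.
have E7 : r * - (B * cabs s ^+ 2) <= r * complex.Re (q * ('i%C * e)^*) by rewrite ler_pM2l.
move: lt2; rewrite E1 E2; move: E4 E5 E6 E7; clear; lra.
Qed.

Lemma chart_scale (U : set R[i]) p Phi (k : R) : 0 < k -> k <= 1 -> chart U p Phi ->
  chart U p (fun s => Phi (k%:C * s)).
Proof.
move=> k0 k1 [hP P0 a0 [c0 c00 lip] up re low op].
have kC : k%:C != 0 :> R[i] by rewrite -cabs_gt0 cabs_real_pos.
have ks s : cabs (k%:C * s) = k * cabs s by rewrite cabsM cabs_real_pos.
have ks1 s : cabs s <= 1 -> cabs (k%:C * s) <= 1.
  by move=> s1; rewrite ks; have := cabs_ge0 s; nra.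
have Ik s : complex.Im (k%:C * s) = k * complex.Im s by rewrite ImM /= mul0r addr0.
have hk : hol2 (cdisc 0 1) (fun s => Phi (k%:C * s)).
  apply: (hol2_comp hP); first by apply: hol2Z; exact: hol2_id.
  by move=> s; rewrite /cdisc /= !subr0; exact: ks1.
split; first exact: hk.
- by rewrite mulr0.
- have [l Hl] : exists l, cder Phi 0 l by apply: hol2_cder hP _; apply: cdisc_center.
  have := @cder_comp R (fun s => k%:C * s) Phi 0 (k%:C * 1) l.
  rewrite mulr0 => /(_ Hl (cderZ _ (cder_id 0))) /cder_dc ->.
  by rewrite mulr1 mulf_neq0 // -(cder_dc Hl).
- exists (c0 * k) => [|s s' s1 s1']; first by rewrite mulr_gt0.
  have := lip _ _ (ks1 s s1) (ks1 s' s1').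
  by rewrite -mulrBr ks mulrA.
- by move=> s s1 sI; apply: up; [exact: ks1|rewrite Ik mulr_gt0].
- by move=> s s1 sI; apply: re; [exact: ks1|rewrite Ik sI mulr0].
- by move=> s s1 sI; apply: low; [exact: ks1|rewrite Ik pmulr_rlt0].
- move=> eta eta0; have [d d0 H] := op (k * eta) (mulr_gt0 k0 eta0).
  exists d => // w /H[s sk sw]; exists (k%:C^-1 * s).
    by rewrite cabsM cabsV cabs_real_pos // mulrC ltr_pdivrMr // mulrC.
  by rewrite mulrA mulfV // mul1r.
Qed.

(** The other components are finitely many closed sets missing p, hence at positive distance; on the
    component of p, injectivity and compactness separate p from the parameters far from t0. *)
Lemma boundary_curve_local (U : set R[i]) p g (t0 eta : R) : finitely_connected U -> frontier U p ->
  boundary_component U p = g @` [set` `[(0 : R), 1[] -> {in `[(0 : R), 1[ &, injective g} ->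
  (forall t, g (t + 1) = g t) -> contR g -> 0 <= t0 < 1 -> g t0 = p -> 0 < eta < 1/2 ->
  exists2 m : R, 0 < m & (forall t, eta <= t <= 1 - eta -> m <= cabs (g (t0 + t) - p)) /\
    forall w, frontier U w -> cabs (w - p) < m -> exists2 t, `|t| <= eta & w = g (t0 + t).
Proof.
move=> fin Fp Cg inj pg cg /andP[t00 t01] gp /andP[eta0 eta2].
have i2 : t0 \in `[0, 1[ by rewrite in_itv /= t00.
have [m1 m10 Hm1] : exists2 m1 : R, 0 < m1 &
    forall t, eta <= t <= 1 - eta -> m1 <= cabs (g (t0 + t) - p).
  have cg' : contR (fun t => g (t0 + t) - p).
    move=> t e e0; have [d d0 H] := cg (t0 + t) e e0; exists d => // t' tt'.
    rewrite (_ : _ - _ = g (t0 + t') - g (t0 + t)); last by ring.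
    by apply: H; rewrite (_ : _ - _ = t' - t) //; ring.
  have cc := contR_continuous (F := fun z => cabs z) cg' (@lip_cabs R).
  have [|c] := @EVT_min R (fun t => cabs (g (t0 + t) - p)) eta (1 - eta) _ (continuous_subspaceT cc).
    lra.
  rewrite in_itv /= => /andP[c1 c2] H.
  exists (cabs (g (t0 + c) - p)); last by move=> t t12; apply: H; rewrite in_itv.
  rewrite cabs_gt0 subr_eq0 -gp; apply/eqP => E.
  have [lt|ge] := ltP (t0 + c) 1.
    have i1 : t0 + c \in `[0, 1[ by rewrite in_itv /=; apply/andP; split; lra.
    by have := inj _ _ i1 i2 E; lra.
  have E2 : g (t0 + c - 1) = g t0 by rewrite -E -[LHS]pg subrK.
  have i1 : t0 + c - 1 \in `[0, 1[ by rewrite in_itv /=; apply/andP; split; lra.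
  by have := inj _ _ i1 i2 E2; lra.
have cF : closed (frontier U).
  by apply: closedI; [exact: closed_closure|apply: open_closedC; exact: open_interior].
pose D := \bigcup_(K in [set K | [set boundary_component U q | q in frontier U] K /\ ~ K p]) K.
have cD : closed D.
  apply: closed_bigcup.
    by apply: sub_finite_set fin => K [].
  by move=> K [[q Fq <-] _]; apply: component_closed.
have nD : ~ D p by move=> [K [_ nK]].
have [m2 m20 Hm2] : exists2 m2 : R, 0 < m2 & forall w, cabs (w - p) < m2 -> ~ D w.
  by apply: not_closureC; rewrite -(closure_id D).1.
exists (Num.min m1 m2); first by rewrite lt_min m10.
split; first by move=> t /Hm1; apply: le_trans; rewrite ge_min lexx.
move=> w Fw; rewrite lt_min => /andP[w1 w2].
have Cw : boundary_component U p w.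
  apply: contrapT => nC; apply: (Hm2 w w2).
  exists (boundary_component U w); last exact: connected_component_refl.
  split; first by exists w.
  by move=> /connected_component_sym.
move: Cw; rewrite Cg => -[t]; rewrite /= in_itv /= => /andP[t1 t2] wE.
have far x : eta <= x <= 1 - eta -> w <> g (t0 + x).
  by move=> /Hm1 h E; move: w1; rewrite E; lra.
have wE0 : w = g (t0 + (t - t0)) by rewrite addrC subrK.
have wE1 : w = g (t0 + (t - t0 + 1)) by rewrite addrA pg.
have wE2 : w = g (t0 + (t - t0 - 1)) by rewrite -pg wE0; congr g; ring.
(* Here |t - t0| < 1. Differences not close to 0, 1 or -1 modulo eta are excluded by [far]; close to
   1 or -1, a shift by the period brings them within eta of 0. *)
have [le|gt] := leP `|t - t0| eta; first by exists (t - t0).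
have [n0|n0] := leP 0 (t - t0).
  rewrite ger0_norm // in gt; exists (t - t0 - 1) => //.
  have [le|gt'] := leP (t - t0) (1 - eta).
    by exfalso; apply: (far _ _ wE0); apply/andP; split; lra.
  by rewrite ler0_norm; lra.
rewrite ltr0_norm // in gt; exists (t - t0 + 1) => //.
have [le|gt'] := leP eta (t - t0 + 1).
  by exfalso; apply: (far _ _ wE1); apply/andP; split; lra.
by rewrite ger0_norm; lra.
Qed.

End Charts.

(** * Existence of charts *)

Section ChartExists.
Context {R : realType}.
Implicit Types (z w s p : R[i]) (f Phi : R[i] -> R[i]) (g : R -> R[i]) (t : R).

(** For real s, f s leaves p in the direction of a up to a quadratic error, so it cannot reach p + e
    a with e small and imaginary. *)
Lemma imaginary_not_on_curve f (a p s : R[i]) (C c0 ep : R) : a != 0 -> 0 < C -> 0 < c0 -> 0 < ep ->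
  ep * (C * cabs a) < c0 ^+ 2 -> complex.Im s = 0 ->
  cabs (f s - p - a * s) <= C * cabs s ^+ 2 -> c0 * cabs s <= cabs (f s - p) ->
  forall e : R[i], cabs e = ep -> complex.Re e = 0 -> f s = p + e * a -> False.
Proof.
move=> a0 C0 c00 ep0 epC sI T L e eE eR fs.
have ca : 0 < cabs a by rewrite cabs_gt0.
rewrite (_ : f s - p - a * s = a * (e - s)) in T; last by rewrite fs; ring.
rewrite (_ : f s - p = e * a) in L; last by rewrite fs; ring.
rewrite !cabsM eE in T L.
have es : ep <= cabs (e - s).
  have : ep = `|complex.Im (e - s)|.
    rewrite ImD ImN sI subr0 -eE cabsE eR expr0n add0r sqrtr_sqr //.
  by move=> ->; exact: cabs_Im.
have s0 := cabs_ge0 s.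
have q1 : cabs a * ep <= C * cabs s ^+ 2 by apply: le_trans T; rewrite ler_pM2l.
have q2 : c0 ^+ 2 * cabs s ^+ 2 <= ep ^+ 2 * cabs a ^+ 2.
  rewrite -!exprMn lerXn2r ?nnegrE ?mulr_ge0 //; lra.
have q3 : c0 ^+ 2 * (cabs a * ep) <= C * (ep ^+ 2 * cabs a ^+ 2).
  apply: le_trans (ler_wpM2l (ltW (exprn_gt0 2 c00)) q1) _.
  by rewrite mulrCA ler_pM2l.
have q4 : ep * (C * cabs a) * (cabs a * ep) < c0 ^+ 2 * (cabs a * ep).
  by rewrite ltr_pM2r // mulr_gt0.
lra.
Qed.

(** The extension f of the curve sends only real parameters near 0 to the frontier, so each half
    disc goes into U as a whole or misses it. One half goes into U because p is in its closure, and
    [no_crossing] forbids both. *)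
Lemma chart_exists (U : set R[i]) p (e : R) : domain U -> finitely_connected U ->
  analytic_boundary U -> frontier U p -> 0 < e ->
  exists2 Phi, chart U p Phi & forall s, cabs s <= 1 -> cabs (Phi s - p) < e.
Proof.
move=> [oU cU _] fin ab Fp e0; have [g [ag v0 pg inj Cg]] := ab p Fp.
have cg := curve_cont ag v0.
have gF t : frontier U (g t).
  have : boundary_component U p (g t) by rewrite Cg; exact: periodic_image.
  exact: connected_component_sub.
have nUF z : frontier U z -> ~ U z by move=> /(frontierE _ oU)[].
have gU t : ~ U (g t) := nUF _ (gF t).
have : boundary_component U p p := connected_component_refl Fp.
rewrite Cg => -[t0]; rewrite /= in_itv /= => t01 gp.
have [f [rho [C [c0 [[rho0 C0 c00] [hf a0] fg T L]]]]] := curve_straightening ag (v0 t0).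
have f0 : f 0 = p by have := fg 0; rewrite normr0 rmorph0 addr0 gp; apply.
set a := dc f 0 in a0 T; rewrite f0 in T.
have ca : 0 < cabs a by rewrite cabs_gt0.
pose eta := Num.min (Num.min (1/4) (rho / 2)) (cabs a / (2 * C)).
have eta0 : 0 < eta by rewrite !lt_min !divr_gt0 ?mulr_gt0.
have eta1 : eta <= 1/4 by rewrite !ge_min lexx.
have eta2 : eta <= rho / 2 by rewrite !ge_min lexx orbT.
have eta3 : eta * (2 * C) <= cabs a by rewrite -ler_pdivlMr ?mulr_gt0 // ge_min lexx orbT.
have etaI : 0 < eta < 1/2 by apply/andP; split; lra.
have [m m0 [far near]] := boundary_curve_local fin Fp Cg inj pg cg t01 gp etaI.
have [l Hl] : exists l, cder f 0 l by apply: hol2_cder hf _; exact: odisc_center.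
have me0 : 0 < Num.min m e by rewrite lt_min m0.
have [d d0 Hd] := cder_cont Hl me0.
pose r := Num.min rho d / 2.
have r0 : 0 < r by rewrite divr_gt0 // lt_min rho0.
have [rr rd] : r < rho /\ r < d.
  have : Num.min rho d <= rho by rewrite ge_min lexx.
  have : Num.min rho d <= d by rewrite ge_min lexx orbT.
  by rewrite /r in r0 *; split; lra.
have fm s : cabs s <= r -> cabs (f s - p) < m /\ cabs (f s - p) < e.
  move=> sr; have := Hd s; rewrite subr0 => /(_ ltac:(lra)).
  by rewrite f0 lt_min => /andP[].
(* Frontier points near p lie on the curve at a parameter close to t0, and f is injective there. *)
have FI s : cabs s <= r -> frontier U (f s) -> complex.Im s = 0.
  move=> sr Fs; have [t te E] := near _ Fs (fm s sr).1.
  have tr : `|t| < rho by lra.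
  rewrite -fg // in E; have := L s t%:C; rewrite cabsR E subrr cabs0.
  move=> /(_ ltac:(lra) tr); rewrite pmulr_rle0 // => q.
  have /eqP : cabs (s - t%:C) = 0 by apply/eqP; rewrite eq_le q cabs_ge0.
  by rewrite cabs_eq0 subr_eq0 => /eqP ->.
have RF s : cabs s <= r -> complex.Im s = 0 -> frontier U (f s).
  move=> sr sI; have sE : s = (complex.Re s)%:C by case: (s) sI => x y /= ->.
  rewrite sE fg; first exact: gF.
  by have := cabs_Re s; lra.
(* A segment inside one open half disc contains no real point, so its image misses the frontier; the
   sign of k selects the half. *)
have side (k : R) s s' : k != 0 -> cabs s <= r -> cabs s' <= r -> 0 < k * complex.Im s ->
    0 < k * complex.Im s' -> U (f s) -> U (f s').
  move=> k0 sr sr' sI sI' Us; apply: contrapT => nU.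
  have cs t : 0 <= t <= 1 -> cabs (s + t%:C * (s' - s)) <= r.
    move=> /andP[t00 t1]; rewrite (_ : _ + _ = (1 - t)%:C * s + t%:C * s'); last first.
      by rewrite rmorphB /=; ring.
    apply: le_trans (cabsD _ _) _; rewrite !cabsM !cabsR !ger0_norm; try lra.
    have h1 : t * cabs s' <= t * r by rewrite ler_wpM2l.
    have h2 : (1 - t) * cabs s <= (1 - t) * r by rewrite ler_wpM2l //; lra.
    lra.
  have [|t t01' Ft] := crossing_frontier oU _ Us nU.
    move=> t /cs h; apply: hol2_cder hf _; rewrite /odisc /= subr0; lra.
  have := FI _ (cs t t01') Ft; rewrite ImD ImM /= mul0r addr0 ImD ImN => E.
  have E' : (1 - t) * (k * complex.Im s) + t * (k * complex.Im s') = 0.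
    by rewrite -[RHS](mulr0 k) -E; ring.
  move/andP: t01' => [t00 t1].
  have h1 : 0 <= t * (k * complex.Im s') by rewrite mulr_ge0 // ltW.
  have h2 : 0 <= (1 - t) * (k * complex.Im s) by rewrite mulr_ge0 //; lra.
  have [t2|t2] := leP t (1/2); nra.
have op := open_at_center rho0 c00 hf L.
have [d1 d10 Hd1] := op r r0.
have Ls s : cabs s <= r -> c0 * cabs s <= cabs (f s - p).
  by move=> sr; have := L s 0; rewrite cabs0 !subr0 f0; apply; lra.
have Ts s : cabs s <= r -> cabs (f s - p - a * s) <= C * cabs s ^+ 2.
  by move=> sr; apply: T; lra.
have notboth s s' : cabs s <= r -> cabs s' <= r -> 0 < complex.Im s -> complex.Im s' < 0 ->
    U (f s) -> U (f s') -> False.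
  move=> sr sr' sI sI' Us Us'.
  (* The three bounds respectively give p + x a a preimage in the disc of radius r, keep the distant
     parameters of the curve farther from p than ep |a|, and allow [imaginary_not_on_curve]. *)
  pose ep := Num.min (Num.min (d1 / (2 * cabs a)) (m / (2 * cabs a))) (c0 ^+ 2 / (2 * (C * cabs a))).
  have c02 : 0 < c0 ^+ 2 by rewrite exprn_gt0.
  have Ca : 0 < C * cabs a by rewrite mulr_gt0.
  have ep0 : 0 < ep by rewrite !lt_min !divr_gt0 ?mulr_gt0.
  have ep1 : ep * (2 * cabs a) <= d1 by rewrite -ler_pdivlMr ?mulr_gt0 // !ge_min lexx.
  have ep2 : ep * (2 * cabs a) <= m by rewrite -ler_pdivlMr ?mulr_gt0 // !ge_min lexx orbT.
  have ep3 : ep * (2 * (C * cabs a)) <= c0 ^+ 2.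
    by rewrite -ler_pdivlMr ?mulr_gt0 // ge_min lexx orbT.
  have epa : 0 < ep * cabs a by rewrite mulr_gt0.
  have epC : ep * (C * cabs a) < c0 ^+ 2.
    have : 0 < ep * (C * cabs a) by rewrite mulr_gt0.
    lra.
  have Uz (x : R[i]) : cabs x = ep -> complex.Re x = 0 -> U (p + x * a).
    move=> xE xR; have [w wr wE] := Hd1 (p + x * a) ltac:(by rewrite f0 addrAC subrr add0r cabsM xE; lra).
    have wr' := ltW wr.
    rewrite -wE; have [wI|wI|wI] := ltgtP (complex.Im w) 0.
    - apply: (side (-1) s') => //; rewrite ?mulN1r ?oppr_gt0 // oppr_eq0 oner_eq0 //.
    - apply: (side 1 s) => //; rewrite ?mul1r // oner_eq0 //.
    - exfalso; apply: (imaginary_not_on_curve a0 C0 c00 ep0 epC wI (Ts w wr') (Ls w wr') xE xR wE).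
  have i0 : cabs ('i%C * ep%:C : R[i]) = ep by rewrite cabsM cabsi mul1r cabs_real_pos.
  (* To first order the quotient is t, so its real part has the sign of t. *)
  have West t : `|t| <= eta -> t != 0 -> `|complex.Re ((g (t0 + t) - g t0) / a) - t| < `|t|.
    move=> te tn0; have tr : `|t| < rho by lra.
    have := T t%:C; rewrite cabsR => /(_ tr); rewrite fg // gp.
    set q := g _ - p - _ => qE.
    have -> : (g (t0 + t) - p) / a = t%:C + q / a by rewrite /q; field.
    rewrite ReD /= addrAC subrr add0r; apply: le_lt_trans (cabs_Re _) _.
    have t00 : 0 < `|t| by rewrite normr_gt0.
    rewrite cabsM cabsV ltr_pdivrMr //; apply: le_lt_trans qE _.
    have : C * `|t| * `|t| <= C * eta * `|t| by rewrite ler_wpM2r // ler_pM2l.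
    have : 0 < C * eta * `|t| by rewrite !mulr_gt0.
    have : eta * (2 * C) * `|t| <= cabs a * `|t| by rewrite ler_wpM2r.
    by rewrite expr2 (mulrC `|t| (cabs a)) mulrA; lra.
  have eta4 : eta < 1 / 2 by lra.
  apply: (no_crossing oU cU cg pg gU a0 ep0 eta0 eta4 (t0 := t0)).
  - by rewrite gp; apply: Uz => //; rewrite ReM /= mul0r mulr0 subrr.
  - rewrite gp -mulNr; apply: Uz; first by rewrite cabsN.
    by rewrite ReN ReM /= mul0r mulr0 subrr oppr0.
  - move=> t /andP[t1 t2]; have := West t; rewrite gtr0_norm // => /(_ (ltW t2) (lt0r_neq0 t1)).
    by rewrite ltr_norml => /andP[]; lra.
  - move=> t /andP[t1 t2]; have := West t; rewrite ltr0_norm // => /(_ ltac:(lra) ltac:(by rewrite ltr0_neq0)).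
    by rewrite ltr_norml => /andP[]; lra.
  - move=> t /far; rewrite gp cabsM cabsV => mt; rewrite ltr_pdivlMr //; lra.
have clo z : ~ U z -> ~ frontier U z -> ~ closure U z.
  move=> nU nF cz; apply: nF; apply/(frontierE _ oU); split; [exact: cz|exact: nU].
have [s [sr sI Us]] : exists s, [/\ cabs s <= r, complex.Im s != 0 & U (f s)].
  have [cp _] := (frontierE p oU).1 Fp.
  have [w Uw wp] := (closureC U p).1 cp d1 d10.
  have [s sr sw] := Hd1 w ltac:(by rewrite f0).
  exists s; rewrite sw ltW //; split => //; apply/eqP => E.
  by apply: (nUF _ (RF s (ltW sr) E)); rewrite sw.
(* The parameter is reversed when the half disc sent into U is the lower one. *)
pose k : R := if 0 < complex.Im s then 1 else -1.
have kk : k = 1 \/ k = -1 by rewrite /k; case: ifP => _; [left|right].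
have k2 : k * k = 1 by case: kk => ->; ring.
have ks : 0 < k * complex.Im s.
  rewrite /k; case: ifP => h; first by rewrite mul1r.
  by rewrite mulN1r oppr_gt0 lt_neqAle sI leNgt h.
have k0 : k != 0 by apply/eqP => E; move: ks; rewrite E mul0r ltxx.
have sk : `|k| = 1 by case: kk => ->; rewrite ?normrN normr1.
pose c : R := k * r.
have cr : `|c| = r by rewrite /c normrM sk mul1r gtr0_norm.
have c0' : c%:C != 0 :> R[i] by rewrite -cabs_gt0 cabsR cr.
have cc x : cabs (c%:C * x) = r * cabs x by rewrite cabsM cabsR cr.
have c1 x : cabs x <= 1 -> cabs (c%:C * x) <= r.
  by move=> x1; rewrite cc -[leRHS]mulr1 ler_pM2l.
have Ic x : complex.Im (c%:C * x) = k * (r * complex.Im x) by rewrite ImM [complex.Re c%:C]/= [complex.Im c%:C]/= mul0r addr0 [RHS]mulrA.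
have kIc x : k * complex.Im (c%:C * x) = r * complex.Im x.
  by rewrite Ic (mulrA k k) k2 mul1r.
have hF : hol2 (cdisc 0 1) (fun x => f (c%:C * x)).
  apply: (hol2_comp hf); first by apply: hol2Z; exact: hol2_id.
  by move=> x; rewrite /cdisc /odisc /= !subr0 => /c1; lra.
exists (fun x => f (c%:C * x)); last by move=> x /c1 /fm[].
split.
- exact: hF.
- by rewrite mulr0.
- have := @cder_comp R (fun s => c%:C * s) f 0 (c%:C * 1) l.
  rewrite mulr0 => /(_ Hl (cderZ _ (cder_id 0))) /cder_dc ->.
  by rewrite mulr1 mulf_neq0 // -(cder_dc Hl).
- exists (c0 * r) => [|x y /c1 x1 /c1 y1]; first by rewrite mulr_gt0.
  have := L (c%:C * x) (c%:C * y) ltac:(lra) ltac:(lra).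
  by rewrite -mulrBr cc mulrA.
- move=> x /c1 x1 xI; apply: (side k s _ k0 sr x1 ks _ Us).
  by rewrite kIc mulr_gt0.
- by move=> x /c1 x1 xI; apply: RF => //; rewrite Ic xI !mulr0.
- move=> x /c1 x1 xI; have kx : k * complex.Im (c%:C * x) < 0.
    by rewrite kIc pmulr_rlt0.
  apply: clo => [Ux|/(FI _ x1) E]; last by move: kx; rewrite E mulr0 ltxx.
  case: kk => kE; rewrite kE ?mul1r ?mulN1r ?oppr_gt0 ?oppr_lt0 in ks kx.
    exact: (notboth s (c%:C * x)).
  exact: (notboth (c%:C * x) s).
- move=> t t1; have [d2 d20 H] := op (r * t) (mulr_gt0 r0 t1).
  exists d2 => // w; rewrite -f0 => /H[x xr xw]; exists (c%:C^-1 * x).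
    by rewrite cabsM cabsV cabsR cr mulrC ltr_pdivrMr // mulrC.
  by rewrite mulrA mulfV // mul1r.
Qed.

End ChartExists.

(** * The Green function *)

Section GreenRegular.
Context {R : realType}.
Implicit Types (z w s p ze : R[i]) (U : set R[i]) (u : R[i] -> R).

Lemma harmonic_on_lapl U u : harmonic_on U u -> lapl U u.
Proof.
move=> [c0 c1 c2 c3].
have D F e z : C1_on U F -> U z -> e = 1 \/ e = 'i%C -> dirder e F z (ddir e F z).
  move=> cF Uz ee; have [dF _] := cF z e Uz ee.
  by apply/rderP; rewrite /ddir derive1E; split.
exists (ddir 1 u), (ddir 1 (ddir 1 u)), (ddir 'i%C u), (ddir 'i%C (ddir 'i%C u)) => z Uz.
split; last exact: c3.
- by apply: D; [exact: c0|exact: Uz|left].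
- by apply: D; [exact: c1|exact: Uz|left].
- by apply: D; [exact: c0|exact: Uz|right].
- by apply: D; [exact: c2|exact: Uz|right].
Qed.

Lemma within_ucontK (K : set R[i]) u : {within K, continuous u} -> ucontK K u.
Proof.
move=> cu z Kz e e0; have := cu z; rewrite /continuous_at /= => H.
have {H} H : u @ within K (nbhs z) --> u z by move: H; rewrite nbhs_subspace_in.
have /nbhsC[d d0 {}H] : nbhs z [set w | K w -> `|u w - u z| < e].
  by apply: filterS ((@cvgR R _ (within K (nbhs z)) _ u (u z)).1 H e e0) => w; exact.
by exists d => // w Kw wz; exact: H.
Qed.

Lemma bounded_cabs U : bounded_set U -> exists M : R, forall z, U z -> cabs z <= M.
Proof.
move=> [M0 [M0r H]]; exists (complex.Re (M0 + 1)) => z Uz.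
have : M0 < M0 + 1 by rewrite ltrDl.
move=> /H /(_ z Uz); rewrite /= normC_cabs lecE /= => /andP[_].
by [].
Qed.

(** The regular parts are chosen once for all poles, with the pole as first argument. [Gh] is built
    from them and agrees with G where G is specified. *)
Definition green_regular U (G : R[i] -> R[i] -> R) (h : R[i] -> R[i] -> R) :=
  forall ze, U ze -> [/\ smooth U (h ze), ucontK (closure U) (h ze),
    forall z, closure U z -> z != ze -> G z ze = h ze z - ln (cabs (z - ze)) &
    forall z, frontier U z -> h ze z = ln (cabs (z - ze))].

Lemma green_regular_exists U G : open U -> green_function U G ->
  exists h, green_regular U G h.
Proof.
move=> oU gG.
have /choice[h hP] : forall ze, exists h : R[i] -> R, U ze -> [/\ smooth U h,
    ucontK (closure U) h,
    forall z, closure U z -> z != ze -> G z ze = h z - ln (cabs (z - ze)) &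
    forall z, frontier U z -> h z = ln (cabs (z - ze))].
  move=> ze; have [Uz|nU] := pselect (U ze); last by exists (fun=> 0).
  have [[h [h1 h2 h3]] h4] := gG ze Uz; exists h => _.
  have E z : closure U z -> z != ze -> G z ze = h z - ln (cabs (z - ze)).
    by move=> cz zz; rewrite h3 // normC_cabs /= addrC.
  have cu := within_ucontK h2.
  split.
  - apply: smooth_lapl => //; last exact: harmonic_on_lapl.
    by apply: ucontK_sub cu => z; exact: subset_closure.
  - exact: cu.
  - exact: E.
  - move=> z Fz; have [cz nz] := (frontierE z oU).1 Fz.
    have zz : z != ze by apply/eqP => zE; apply: nz; rewrite zE.
    by have := h4 z Fz; rewrite E //; lra.
by exists h.
Qed.

Lemma ln_lip (x y m : R) : 0 < m -> m <= x -> m <= y -> `|ln x - ln y| <= `|x - y| / m.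
Proof.
move=> m0 mx my.
have one a b : m <= a -> m <= b -> ln a - ln b <= `|a - b| / m.
  move=> ma mb; have a0 : 0 < a by lra.
  have b0 : 0 < b by lra.
  rewrite -ln_div ?posrE //.
  have : ln (a / b) <= a / b - 1.
    by rewrite -ler_expR lnK ?posrE ?divr_gt0 //; have := @expR_ge1Dx R (a / b - 1); lra.
  move=> H; apply: le_trans H _.
  have -> : a / b - 1 = (a - b) / b by field; apply: lt0r_neq0.
  apply: (@le_trans _ _ (`|a - b| / b)).
    by rewrite ler_wpM2r ?invr_ge0 ?ler_norm // ltW.
  by rewrite ler_wpM2l // lef_pV2 ?posrE.
rewrite ler_norml; have := one x y mx my; have := one y x my mx.
by rewrite (distrC y x); move=> ? ?; apply/andP; split; lra.
Qed.

End GreenRegular.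

Section GreenFunction.
Context {R : realType} (U : set R[i]) (G : R[i] -> R[i] -> R) (h : R[i] -> R[i] -> R)
  (dU : domain U) (bU : bounded_set U) (hG : green_regular U G h).
Implicit Types (z w s p ze : R[i]) (u : R[i] -> R).

Definition Gh z ze := h ze z - ln (cabs (z - ze)).

Let oU : open U. Proof. by case: dU. Qed.

Lemma G_Gh z ze : U ze -> closure U z -> z != ze -> G z ze = Gh z ze.
Proof. by move=> /hG[_ _ H _]; exact: H. Qed.

Lemma sub_clos z : U z -> closure U z. Proof. exact: subset_closure. Qed.

Lemma not_frontier z : frontier U z -> ~ U z.
Proof. by move=> /(frontierE z oU)[]. Qed.

Lemma closure_bound : exists2 d : R, 1 < d &
  forall z w, closure U z -> closure U w -> cabs (z - w) <= d.
Proof.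
have [M MP] := bounded_cabs bU.
have MC z : closure U z -> cabs z <= M.
  move=> /closureC cz; rewrite leNgt; apply/negP => lt.
  have [w Uw wz] := cz (cabs z - M) ltac:(lra).
  by have := MP w Uw; have := cabs_subr z w; rewrite (cabsB z w); lra.
exists (`|M| + `|M| + 2); first by have := normr_ge0 M; lra.
move=> z w /MC zM /MC wM; have := cabsD z (- w); rewrite cabsN.
by have := ler_norm M; lra.
Qed.

Lemma compact_closure : compact (closure U).
Proof.
have [M MP] := bounded_cabs bU; apply: (@compactC _ _ M); first exact: closed_closure.
move=> z /closureC cz; rewrite leNgt; apply/negP => lt.
have [w Uw wz] := cz (cabs z - M) ltac:(lra).
by have := MP w Uw; have := cabs_subr z w; rewrite (cabsB z w); lra.
Qed.

Lemma max_closure u (m : R) : ucontK (closure U) u -> lapl U u ->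
  (forall z, frontier U z -> u z <= m) -> forall z, closure U z -> u z <= m.
Proof.
move=> cu lu um; apply: (maximum_principle (s := 0) compact_closure oU sub_clos cu).
  by apply: lapl_sub lu => z [].
by move=> z cz nz; apply: um; apply/(frontierE z oU); split; [exact: cz|exact: nz].
Qed.

Lemma max_closure_abs u (m : R) : ucontK (closure U) u -> lapl U u ->
  (forall z, frontier U z -> `|u z| <= m) -> forall z, closure U z -> `|u z| <= m.
Proof.
move=> cu lu um; apply: (maximum_principle_abs (s := 0) compact_closure oU sub_clos cu).
  by apply: lapl_sub lu => z [].
by move=> z cz nz; apply: um; apply/(frontierE z oU); split; [exact: cz|exact: nz].
Qed.

Lemma h_lapl ze : U ze -> lapl U (h ze).
Proof. by move=> /hG[H _ _ _]; apply: harm_lapl; exact: smooth_harm. Qed.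

Lemma h_cont ze : U ze -> ucontK (closure U) (h ze).
Proof. by move=> /hG[]. Qed.

Lemma h_frontier ze z : U ze -> frontier U z -> h ze z = ln (cabs (z - ze)).
Proof. by move=> /hG[_ _ _ H]; exact: H. Qed.

Lemma h_le (d : R) ze z : (forall z w, closure U z -> closure U w -> cabs (z - w) <= d) ->
  U ze -> closure U z -> h ze z <= ln d.
Proof.
move=> dP Uze; apply: max_closure; [exact: h_cont|exact: h_lapl|].
move=> w Fw; rewrite h_frontier //.
have [cw nw] := (frontierE w oU).1 Fw.
have w0 : 0 < cabs (w - ze).
  by rewrite cabs_gt0 subr_eq0; apply/eqP => E; apply: nw; rewrite E.
have wd := dP _ _ cw (sub_clos Uze).
by rewrite ler_ln ?posrE //; lra.
Qed.

Lemma harm_ln_dist (V : set R[i]) ze : (forall z, V z -> z != ze) ->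
  harm V (fun z => ln (cabs (z - ze))).
Proof.
move=> H; apply: harm_ln; first by apply: hol2B; [exact: hol2_id|exact: hol2_cst].
by move=> z /H; rewrite subr_eq0.
Qed.

Lemma harm_Gh ze : U ze -> harm [set z | U z /\ z != ze] (fun z => Gh z ze).
Proof.
move=> /hG[H _ _ _]; apply: harmB; last by apply: harm_ln_dist => z [].
by apply: harm_sub (smooth_harm H) => z [].
Qed.

Lemma cont_Gh ze : U ze -> ucontK [set z | closure U z /\ z != ze] (fun z => Gh z ze).
Proof.
move=> Uze; apply: ucontKB; first by apply: ucontK_sub (h_cont Uze) => z [].
by apply: (harm_ucontK (V := [set z | z != ze])); [exact: harm_ln_dist|move=> z []].
Qed.

Lemma Gh_frontier ze z : U ze -> frontier U z -> Gh z ze = 0.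
Proof. by move=> Uze Fz; rewrite /Gh h_frontier // subrr. Qed.

Lemma h_bounded ze : U ze -> exists2 M, 0 < M & forall z, closure U z -> `|h ze z| <= M.
Proof. by move=> /h_cont; exact: compact_bounded compact_closure. Qed.

Lemma Gh_near ze : U ze -> exists2 d : R, 0 < d &
  forall z, closure U z -> z != ze -> cabs (z - ze) <= d -> 0 < Gh z ze.
Proof.
move=> /h_bounded[M M0 HM]; exists (expR (- M - 1)); first exact: expR_gt0.
move=> z cz zz zd; have := HM z cz; rewrite ler_norml => /andP[h1 _].
have z0 : 0 < cabs (z - ze) by rewrite cabs_gt0 subr_eq0.
have : ln (cabs (z - ze)) <= - M - 1 by rewrite -ler_expR lnK ?posrE.
by rewrite /Gh; lra.
Qed.

Lemma Gh_ge0 ze z : U ze -> closure U z -> z != ze -> 0 <= Gh z ze.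
Proof.
move=> Uze cz zz; have [d d0 dP] := Gh_near Uze.
have z0 : 0 < cabs (z - ze) by rewrite cabs_gt0 subr_eq0.
pose e := Num.min d (cabs (z - ze)).
have e0 : 0 < e by rewrite lt_min d0.
have ed : e <= d by rewrite ge_min lexx.
have ez : e <= cabs (z - ze) by rewrite ge_min lexx orbT.
rewrite -oppr_le0.
have ne w : e <= cabs (w - ze) -> w != ze.
  by move=> we; rewrite -subr_eq0 -cabs_gt0; lra.
apply: (@maximum_principle R [set w | closure U w /\ e <= cabs (w - ze)]
  [set w | U w /\ e < cabs (w - ze)] (fun w => - Gh w ze) 0 0).
- by apply: compact_diff_ball; exact: compact_closure.
- exact: open_diff_ball.
- by move=> w [/sub_clos cw /ltW].
- apply: ucontKN; apply: ucontK_sub (cont_Gh Uze) => w [cw we].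
  by split; [exact: cw|exact: ne].
- apply: laplN; apply: lapl_sub (harm_lapl (harm_Gh Uze)) => w [[Uw /ltW we] _].
  by split; [exact: Uw|exact: ne].
- move=> w [cw we] nw; rewrite oppr_le0; have [Uw|nU] := pselect (U w).
    have [we'|we'] := leP (cabs (w - ze)) e; last by exfalso; apply: nw.
    by apply/ltW/dP; [exact: cw|exact: ne|lra].
  by rewrite Gh_frontier //; apply/(frontierE w oU); split; [exact: cw|exact: nU].
- by split; [exact: cz|exact: ez].
Qed.

(** Harnack's inequality on a disc avoiding the pole carries positivity to limit points in U, as a
    strong maximum principle would. *)
Lemma Gh_gt0 ze z : U ze -> U z -> z != ze -> 0 < Gh z ze.
Proof.
move=> Uze Uz zz; have [_ cU _] := dU.
pose A := [set w | U w /\ (w != ze -> 0 < Gh w ze)].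
suff : A z by case=> _; apply.
apply: (connected_clopen cU) Uz => [w []//| | |{z zz} z Uz H].
- by exists ze; split=> //; rewrite eqxx.
- apply/openC => w [Uw Gw]; have [e e0 He] := (openC U).1 oU w Uw.
  have [wz|wz] := eqVneq w ze.
    have [d d0 dP] := Gh_near Uze; exists (Num.min e d); first by rewrite lt_min e0.
    move=> v; rewrite lt_min => /andP[/He Uv vd]; split => // vz.
    by apply: dP => //; [exact: sub_clos|rewrite -wz ltW].
  have Gw0 := Gw wz.
  have [d d0 dP] := cont_Gh Uze (conj (sub_clos Uw) wz) Gw0.
  exists (Num.min e d); first by rewrite lt_min e0.
  move=> v; rewrite lt_min => /andP[/He Uv vd]; split => // vz.
  have := dP v (conj (sub_clos Uv) vz) vd; rewrite ltr_norml => /andP[]; lra.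
- split => // zz; have [e e0 He] := (openC U).1 oU z Uz.
  have z0 : 0 < cabs (z - ze) by rewrite cabs_gt0 subr_eq0.
  pose m := Num.min e (cabs (z - ze)).
  have m0 : 0 < m by rewrite lt_min e0.
  have me : m <= e by rewrite ge_min lexx.
  have mz : m <= cabs (z - ze) by rewrite ge_min lexx orbT.
  have [|w [Uw Gw] wz] := H (m / 4); first lra.
  have sub v : cdisc w (m / 2) v -> U v /\ v != ze.
    rewrite /cdisc /= => vw; have vz := cabs_tri v w z.
    split; first by apply: He; lra.
    by apply/eqP => E; move: vw vz; rewrite E (cabsB ze z); lra.
  have Gw0 : 0 < Gh w ze by apply: Gw; have [] := sub w; first by apply: cdisc_center; lra.
  have hw : harm (cdisc w (m / 2)) (fun v => Gh v ze).
    by apply: harm_sub (harm_Gh Uze) => v /sub.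
  have := harnack (z := z) _ hw; rewrite (cabsB z w) => /(_ ltac:(lra)).
  move=> /(_ _ ltac:(lra)) K.
  suff : Gh w ze <= 3 * Gh z ze by lra.
  by apply: K => v /sub[Uv vz]; apply: Gh_ge0 => //; exact: sub_clos.
Qed.

Lemma ext_disc_strict (a : R[i]) (r : R) z : 0 < r -> (forall w, closure U w -> r <= cabs (w - a)) ->
  U z -> r < cabs (z - a).
Proof.
move=> r0 ext Uz; rewrite lt_neqAle ext ?andbT; last exact: sub_clos.
apply/eqP => E; have [e e0 He] := (openC U).1 oU z Uz.
pose t := Num.min (1/2) (e / (2 * r)).
have t0 : 0 < t by rewrite lt_min !divr_gt0 ?mulr_gt0.
have t1 : t <= 1/2 by rewrite ge_min lexx.
have te : t * (2 * r) <= e by rewrite -ler_pdivlMr ?mulr_gt0 // ge_min lexx orbT.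
have rt : 0 < r * t by rewrite mulr_gt0.
have := ext (z - t%:C * (z - a)).
rewrite (_ : z - _ - a = (1 - t)%:C * (z - a)); last by rewrite rmorphB /=; ring.
rewrite cabsM cabsR -E ger0_norm; last lra.
move=> K; suff : r <= (1 - t) * r by lra.
apply/K/sub_clos/He.
rewrite (_ : _ - z = - (t%:C * (z - a))); last by ring.
by rewrite cabsN cabsM cabs_real_pos // -E; lra.
Qed.

(** The Green function of the exterior of the disc is ln (|r^2 - X conj Y| / (r |X - Y|)); the
    identity measures how far its argument exceeds 1. *)
Lemma kelvin_identity (X Y : R[i]) (r : R) :
  cabs ((r ^+ 2)%:C - X * conjc Y) ^+ 2 - r ^+ 2 * cabs (X - Y) ^+ 2 =
  (cabs X ^+ 2 - r ^+ 2) * (cabs Y ^+ 2 - r ^+ 2).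
Proof. by rewrite !sqr_cabs; case: X => a b; case: Y => c d /=; ring. Qed.

(* Comparison with the Green function of the exterior of the disc *)
Lemma Gh_ext_disc (a : R[i]) (r : R) z ze : 0 < r ->
  (forall w, closure U w -> r <= cabs (w - a)) -> U ze -> closure U z -> z != ze ->
  Gh z ze <= (cabs (z - a) ^+ 2 - r ^+ 2) * (cabs (ze - a) ^+ 2 - r ^+ 2) /
    (2 * r ^+ 2 * cabs (z - ze) ^+ 2).
Proof.
move=> r0 ext Uze cz zz; have rze := ext_disc_strict r0 ext Uze.
pose q w := (r ^+ 2)%:C - (w - a) * conjc (ze - a).
have q0 w : closure U w -> q w != 0.
  move=> /ext rw; rewrite subr_eq0; apply/eqP => /(congr1 cabs).
  rewrite cabsM cabs_conj cabs_real_pos ?exprn_gt0 // => E.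
  have : r * r < cabs (w - a) * cabs (ze - a) by nra.
  by rewrite -E expr2 ltxx.
have r2 : 0 < r ^+ 2 by rewrite exprn_gt0.
have kel w : closure U w -> r * cabs (w - ze) <= cabs (q w).
  move=> cw; have := kelvin_identity (w - a) (ze - a) r.
  rewrite (_ : w - a - (ze - a) = w - ze); last by ring.
  have h1 : r ^+ 2 <= cabs (w - a) ^+ 2 by rewrite lerXn2r ?nnegrE ?cabs_ge0 ?ext // ltW.
  have h2 : r ^+ 2 <= cabs (ze - a) ^+ 2 by rewrite lerXn2r ?nnegrE ?cabs_ge0 // ltW.
  have : 0 <= (cabs (w - a) ^+ 2 - r ^+ 2) * (cabs (ze - a) ^+ 2 - r ^+ 2).
    by rewrite mulr_ge0 //; lra.
  move=> h3 E; have : (r * cabs (w - ze)) ^+ 2 <= cabs (q w) ^+ 2 by rewrite exprMn /q; lra.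
  by rewrite ler_sqr ?nnegrE ?mulr_ge0 ?cabs_ge0 // ltW.
have hq : harm (closure U) (fun w => ln (cabs (q w))).
  apply: harm_ln => //; apply: hol2B; first exact: hol2_cst.
  apply: hol2M; last exact: hol2_cst.
  by apply: hol2B; [exact: hol2_id|exact: hol2_cst].
have le : h ze z - ln (cabs (q z)) <= - ln r.
  apply: (max_closure (u := fun w => h ze w - ln (cabs (q w)))) cz.
  - by apply: ucontKB; [exact: h_cont|exact: harm_ucontK hq _].
  - by apply: laplB; [exact: h_lapl|apply/harm_lapl/(harm_sub _ hq); exact: sub_clos].
  - move=> w Fw; rewrite h_frontier //; have [cw nw] := (frontierE w oU).1 Fw.
    have w0 : 0 < cabs (w - ze).
      by rewrite cabs_gt0 subr_eq0; apply/eqP => E; apply: nw; rewrite E.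
    have qw : 0 < cabs (q w) by rewrite cabs_gt0 q0.
    have : ln (r * cabs (w - ze)) <= ln (cabs (q w)).
      by rewrite ler_ln ?posrE ?mulr_gt0 // kel.
    by rewrite lnM ?posrE //; lra.
have z0 : 0 < cabs (z - ze) by rewrite cabs_gt0 subr_eq0.
have qz : 0 < cabs (q z) by rewrite cabs_gt0 q0.
set X := (_ * _) / _.
have XE : (cabs (q z) / (r * cabs (z - ze))) ^+ 2 = 1 + 2 * X.
  have := kelvin_identity (z - a) (ze - a) r.
  rewrite (_ : z - a - (ze - a) = z - ze); last by ring.
  rewrite -/(q z) /X => <-; field; rewrite !lt0r_neq0 //.
have P0 : 0 < cabs (q z) / (r * cabs (z - ze)) by rewrite divr_gt0 // mulr_gt0.
have : 2 * ln (cabs (q z) / (r * cabs (z - ze))) <= 2 * X.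
  rewrite mulr_natl -lnXn // XE -ler_expR lnK ?posrE ?expR_ge1Dx // -XE exprn_gt0 //.
rewrite ln_div ?posrE ?mulr_gt0 // lnM ?posrE // /Gh; lra.
Qed.

End GreenFunction.

(** * Dependence of the Green function on the pole *)

Section GreenPole.
Context {R : realType} (U : set R[i]) (G : R[i] -> R[i] -> R) (h : R[i] -> R[i] -> R)
  (dU : domain U) (bU : bounded_set U) (hG : green_regular U G h).
Implicit Types (z w s p ze : R[i]) (u : R[i] -> R).

Let oU : open U. Proof. by case: dU. Qed.

(** Comparison with the exterior disc tangent at p: the factor belonging to the point near p is
    O(de), the other one is bounded. The bound is symmetric, so either point may be the one near
    p. *)
Lemma Gh_vanish p (ep rho : R) : finitely_connected U -> analytic_boundary U ->
  frontier U p -> 0 < ep -> 0 < rho ->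
  exists2 de : R, 0 < de & forall z ze, closure U z -> U ze -> rho <= cabs (z - ze) ->
    cabs (ze - p) < de \/ cabs (z - p) < de -> Gh h z ze <= ep.
Proof.
move=> fU aU Fp ep0 rho0; have [Phi cP _] := chart_exists dU fU aU Fp ltr01.
have [a [r [r0 pa ext]]] := ext_disc_chart cP.
have [d d1 dP] := closure_bound bU.
have [cp _] := (frontierE p oU).1 Fp.
have dr0 : 0 < (d + r) ^+ 2 by rewrite exprn_gt0 //; lra.
have r20 : 0 < r ^+ 2 by rewrite exprn_gt0.
have rho20 : 0 < rho ^+ 2 by rewrite exprn_gt0.
pose k := (2 * r + 1) * (d + r) ^+ 2.
have k0 : 0 < k by rewrite mulr_gt0 //; lra.
pose b := ep * (2 * r ^+ 2 * rho ^+ 2).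
have b0 : 0 < b by rewrite /b !mulr_gt0.
pose de := Num.min 1 (b / k).
have de0 : 0 < de by rewrite lt_min ltr01 divr_gt0.
have de1 : de <= 1 by rewrite ge_min lexx.
have dek : de * k <= b by rewrite -ler_pdivlMr // ge_min lexx orbT.
have near_p x : closure U x -> cabs (x - p) < de -> 0 <= cabs (x - a) ^+ 2 - r ^+ 2 <= de * (2 * r + 1).
  move=> cx xp; have := ext x cx; have := cabs_tri x p a; rewrite pa => h1 h2.
  by apply/andP; split; nra.
have far x : closure U x -> 0 <= cabs (x - a) ^+ 2 - r ^+ 2 <= (d + r) ^+ 2.
  move=> cx; have := ext x cx; have := cabs_tri x p a; rewrite pa => h1 h2.
  have := dP _ _ cx cp => h3.
  by apply/andP; split; nra.
exists de; first exact: de0.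
move=> z ze cz Uze zz H; clear cP.
have z0 : z != ze by rewrite -subr_eq0 -cabs_gt0; lra.
apply: le_trans (Gh_ext_disc dU bU hG r0 ext Uze cz z0) _.
have zz2 : rho ^+ 2 <= cabs (z - ze) ^+ 2 by rewrite lerXn2r ?nnegrE ?cabs_ge0 // ltW.
have c2 : 0 < cabs (z - ze) ^+ 2 by lra.
rewrite ler_pdivrMr; last by apply: mulr_gt0 => //; apply: mulr_gt0.
apply: (@le_trans _ _ b); last first.
  by rewrite /b ler_pM2l; [apply: ler_wpM2l; [lra|exact: zz2]|exact: ep0].
apply: le_trans dek.
have cze : closure U ze by exact: subset_closure.
rewrite /k mulrA; case: H => xp.
  have /andP[a1 a2] := near_p ze cze xp; have /andP[a3 a4] := far z cz.
  by rewrite mulrC ler_pM.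
have /andP[a1 a2] := near_p z cz xp; have /andP[a3 a4] := far ze cze.
by rewrite ler_pM.
Qed.

Lemma h_lip_pole (m : R) ze ze' z : 0 < m -> U ze -> U ze' ->
  (forall w, frontier U w -> m <= cabs (w - ze) /\ m <= cabs (w - ze')) ->
  closure U z -> `|h ze z - h ze' z| <= cabs (ze - ze') / m.
Proof.
move=> m0 Uz Uz' H; apply: (max_closure_abs dU bU (u := fun z => h ze z - h ze' z)).
- by apply: ucontKB; exact: (h_cont hG).
- by apply: laplB; exact: (h_lapl hG).
- move=> w Fw; rewrite !(h_frontier hG) //; have [m1 m2] := H w Fw.
  apply: le_trans (ln_lip m0 m1 m2) _; rewrite ler_wpM2r ?invr_ge0 ?(ltW m0) //.
  have := lip_cabs (w - ze) (w - ze').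
  by rewrite (_ : w - ze - (w - ze') = - (ze - ze')) ?cabsN //; ring.
Qed.

Lemma ucontKZ (K : set R[i]) u (k : R) : ucontK K u -> ucontK K (fun z => k * u z).
Proof.
move=> H z Kz e e0; have k0 : 0 < `|k| + 1 by have := normr_ge0 k; lra.
have [d d0 {}H] := H z Kz _ (divr_gt0 e0 k0); exists d => // w Kw /(H w Kw).
rewrite ltr_pdivlMr // -mulrBr normrM; apply: le_lt_trans.
by rewrite mulrC ler_wpM2l //; lra.
Qed.

Lemma abs_ln_le (x m d : R) : 0 < m -> m <= x -> x <= d -> `|ln x| <= `|ln m| + `|ln d|.
Proof.
move=> m0 mx xd; have x0 : 0 < x by lra.
have h1 : ln m <= ln x by rewrite ler_ln ?posrE.
have h2 : ln x <= ln d by rewrite ler_ln ?posrE //; lra.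
have := ler_norm (ln d); have := ler_norm (- ln m); rewrite normrN.
have := normr_ge0 (ln m); have := normr_ge0 (ln d).
by move=> ? ? ? ?; rewrite ler_norml; apply/andP; split; lra.
Qed.

(** For w on the frontier, h ze w = ln |w - ze| is harmonic in ze and is approximated by a Poisson
    sum in the pole variable, uniformly in w. The coefficients are multiples of sampled values of h,
    so the maximum principle in z extends the approximation from the frontier to all z. *)
Lemma h_uniform_limit c (rho d : R) z : 0 < rho ->
  (forall w, cabs (w - c) <= 2 * rho -> U w) ->
  (forall z w, closure U z -> closure U w -> cabs (z - w) <= d) -> closure U z ->
  uniform_limit (fun s => h (c + rho%:C * s) z) (PC (`|ln rho| + `|ln d| + 1)).
Proof.
move=> rho0 cU dP cz e e0; set M := _ + 1.
have M0 : 0 < M by rewrite /M; have := normr_ge0 (ln rho); have := normr_ge0 (ln d); lra.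
have e4 : 0 < e / 4 by lra.
have cs s : cabs s <= 1 -> cabs (c + rho%:C * s - c) <= rho.
  rewrite (_ : _ - c = rho%:C * s); last by ring.
  by rewrite cabsM cabs_real_pos // => s1; rewrite ler_piMr // ltW.
have Us s : cabs s <= 1 -> U (c + rho%:C * s) by move=> /cs H; apply: cU; lra.
have far w s : frontier U w -> cabs s <= 1 -> rho <= cabs (w - (c + rho%:C * s)).
  move=> Fw /cs H; rewrite leNgt; apply/negP => lt.
  apply: (not_frontier dU Fw); apply: cU.
  by have := cabs_tri w (c + rho%:C * s) c; lra.
have hM s w : cabs s <= 1 -> closure U w -> `|h (c + rho%:C * s) w| <= M.
  move=> s1; apply: (max_closure_abs dU bU).
  - exact: (h_cont hG (Us s s1)).
  - exact: (h_lapl hG (Us s s1)).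
  - move=> v Fv; rewrite (h_frontier hG) //; last exact: Us.
    have [cv _] := (frontierE v oU).1 Fv.
    have := abs_ln_le rho0 (far v s Fv s1) (dP _ _ cv (subset_closure (Us s s1))).
    by rewrite /M; lra.
(* The sample points come before the function in [poisson_approx], so one choice serves all w. The
   functions t |-> ln |w - (c + rho t)| are 1-Lipschitz, so e / 4 is also the tolerance for the
   distance. *)
have [[ws r] /= [r12 ws0 wsr] app] := poisson_approx e4 e4 M0.
have r0 : 0 < r by lra.
have xs x : x \in ws -> cabs (x / r%:C) <= 1.
  by move=> /wsr E; rewrite cabsM cabsV E cabs_real_pos // divff ?lt0r_neq0.
pose l v : seq (R * R[i]) := [seq (h (c + rho%:C * (x / r%:C)) v / (size ws)%:R, x) | x <- ws].
exists (psum (l z)).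
  exists (l z); split => //.
  - by move=> q /mapP[x xw ->] /=; rewrite wsr.
  - rewrite /l big_map /=; apply: (@le_trans _ _ (\sum_(x <- ws) (M / (size ws)%:R))).
      rewrite big_seq [X in _ <= X]big_seq; apply: ler_sum => x xw.
      by rewrite normrM normfV (ger0_norm (ler0n R (size ws))) ler_wpM2r ?invr_ge0 // hM // xs.
    rewrite big_const_seq count_predT iter_addr addr0 -(mulr_natr (M / _)) divfK //.
    by rewrite pnatr_eq0 size_eq0.
move=> s s1.
(* For fixed s the sum is a finite combination of regular parts, hence continuous and harmonic in
   the field point v. *)
have Q ws' : (forall x, x \in ws' -> x \in ws) ->
    let l' v := [seq (h (c + rho%:C * (x / r%:C)) v / (size ws)%:R, x) | x <- ws'] in
    ucontK (closure U) (fun v => psum (l' v) s) /\ harm U (fun v => psum (l' v) s).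
  elim: ws' => [_|x ws' IH sub].
    split; first by move=> w cw e1 e10; exists 1 => // w' _ _; rewrite /psum !big_nil subrr normr0.
    have := harm_cst U (0 : R); congr harm; apply/funext => v.
    by rewrite /psum big_nil.
  have [|i1 i2] := IH; first by move=> y yw; apply: sub; rewrite inE yw orbT.
  have xw : cabs (x / r%:C) <= 1 by apply/xs/sub; rewrite inE eqxx.
  set k := poisson x s / (size ws)%:R.
  have E : (fun v => psum [seq (h (c + rho%:C * (y / r%:C)) v / (size ws)%:R, y) | y <- x :: ws'] s) =
    (fun v => k * h (c + rho%:C * (x / r%:C)) v +
      psum [seq (h (c + rho%:C * (y / r%:C)) v / (size ws)%:R, y) | y <- ws'] s).
    by apply/funext => v; rewrite /psum /= big_cons /= /k; congr (_ + _); ring.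
  move=> l'; rewrite /l' E; split.
    by apply: ucontKD i1; apply: ucontKZ; exact: (h_cont hG (Us _ xw)).
  apply: harmD i2; apply: harmZ; apply: smooth_harm.
  by have [] := hG (Us _ xw).
have [Q1 Q2] := Q ws (fun _ => id).
have s1' : cabs s <= 1 by exact: ltW.
apply: (max_closure_abs dU bU (u := fun v => h (c + rho%:C * s) v - psum (l v) s)) cz.
- by apply: ucontKB => //; exact: (h_cont hG (Us s s1')).
- by apply: laplB; [exact: (h_lapl hG (Us s s1'))|exact: harm_lapl].
- move=> w Fw; have [cw _] := (frontierE w oU).1 Fw.
  pose f t := ln (cabs (w - (c + rho%:C * t))).
  have lE : l w = [seq (f (x / r%:C) / (size ws)%:R, x) | x <- ws].
    by apply/eq_in_map => x xw; rewrite (h_frontier hG) //; apply/Us/xs.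
  rewrite (h_frontier hG) //; last exact: Us.
  rewrite lE -[ln _]/(f s).
  have hl : harm (cdisc 0 1) (psum [seq (f (x / r%:C) / (size ws)%:R, x) | x <- ws]).
    apply: (@harm_PC _ (\sum_(q <- [seq (f (x / r%:C) / (size ws)%:R, x) | x <- ws]) `|q.1|)).
      by exists [seq (f (x / r%:C) / (size ws)%:R, x) | x <- ws]; split => // q /mapP[x xw ->] /=; rewrite wsr.
    by move=> t; rewrite /cdisc /= subr0.
  have hf : harm (cdisc 0 1) f.
    apply: harm_ln.
      apply: hol2B; first exact: hol2_cst.
      by apply: hol2D; [exact: hol2_cst|apply: hol2Z; exact: hol2_id].
    move=> t; rewrite /cdisc /= subr0 => t1.
    by rewrite -cabs_gt0; have := far w t Fw t1; lra.
  have hfl := harmB hf hl.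
  apply: (maximum_principle_abs (s := 0) (@compact_cdisc R 0 1) (@open_odisc R 0 1)
    (@odisc_sub_cdisc R 0 1) (u := fun t => f t - psum [seq (f (x / r%:C) / (size ws)%:R, x) | x <- ws] t)).
  + exact: harm_ucontK hfl _.
  + by apply: harm_lapl; apply: harm_sub hfl => t [/odisc_sub_cdisc].
  + move=> t; rewrite /cdisc /odisc /= subr0 => t1 t1'.
    have {t1'}t1' : cabs t = 1 by apply/eqP; rewrite eq_le t1 leNgt; apply/negP.
    rewrite distrC; apply: le_trans (app f _ _ t t1') _; last by lra.
    * move=> x x1; have x1' : cabs x <= 1 by rewrite x1.
      have := abs_ln_le rho0 (far w x Fw x1') (dP _ _ cw (subset_closure (Us x x1'))).
      by rewrite /M /f; lra.
    * move=> x y x1 y1 xy; have x1' : cabs x <= 1 by rewrite x1.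
      have y1' : cabs y <= 1 by rewrite y1.
      apply: le_trans (ln_lip rho0 (far w x Fw x1') (far w y Fw y1')) _.
      rewrite ler_pdivrMr //; apply: le_trans (lip_cabs _ _) _.
      rewrite (_ : _ - _ - _ = - (rho%:C * (x - y))); last by ring.
      by rewrite cabsN cabsM cabs_real_pos // mulrC ler_pM2r // ltW.
  + by rewrite /cdisc /= subr0.
Qed.

Lemma h_smooth_pole z : closure U z -> smooth U (fun ze => h ze z).
Proof.
move=> cz c Uc; have [d d1 dP] := closure_bound bU.
have [r r0 rU] := (openC U).1 oU c Uc.
have r20 : 0 < r / 4 by lra.
have H : est c (r / 4) (`|ln (r / 4)| + `|ln d| + 1) (fun ze => h ze z).
  apply: (est_limit r20); apply: (h_uniform_limit r20 _ dP cz) => w wc.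
  by apply: rU; lra.
have [|? _ _ _] := H c; last by [].
by rewrite subrr cabs0; lra.
Qed.

Lemma harm_Gh_pole z : closure U z -> harm [set ze | U ze /\ ze != z] (fun ze => Gh h z ze).
Proof.
move=> cz; rewrite /Gh; apply: harmB.
  by apply: harm_sub (smooth_harm (h_smooth_pole cz)) => w [].
apply: harm_ln; first by apply: hol2B; [exact: hol2_cst|exact: hol2_id].
by move=> w [_ wz]; rewrite subr_eq0 eq_sym.
Qed.

End GreenPole.

(** * Boundary expansion of the Green function *)

Section OddExtension.
Context {R : realType}.
Implicit Types (z w s c p : R[i]) (u v f : R[i] -> R) (r M m : R).

(** The value 0 on the real axis is imposed, since f may be meaningless there, as for a Green
    function whose pole has reached the frontier. *)
Definition oddx f s : R :=
  if 0 < complex.Im s then f s else if complex.Im s < 0 then - f (conjc s) else 0.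

Lemma Im_conj s : complex.Im (conjc s) = - complex.Im s. Proof. by case: s. Qed.

Lemma oddx_up f s : 0 < complex.Im s -> oddx f s = f s.
Proof. by rewrite /oddx => ->. Qed.

Lemma oddx_real f s : complex.Im s = 0 -> oddx f s = 0.
Proof. by rewrite /oddx => ->; rewrite ltxx. Qed.

Lemma oddx_odd f : odd_conj (oddx f).
Proof.
move=> s; rewrite /oddx Im_conj oppr_gt0 oppr_lt0 conjcK.
by case: ltrgtP; rewrite ?opprK ?oppr0.
Qed.

Lemma ucontK_ext (K : set R[i]) u v : (forall z, K z -> u z = v z) -> ucontK K u -> ucontK K v.
Proof.
move=> uv H z Kz e e0; have [d d0 {}H] := H z Kz e e0.
by exists d => // w Kw wz; rewrite -!uv //; exact: H.
Qed.

Lemma harm_ext (V : set R[i]) u v : open V -> (forall z, V z -> u z = v z) ->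
  harm V u -> harm V v.
Proof.
move=> /openC oV uv [p [p1 H]]; exists p, p1 => z Vz; have [H1 H2] := H z Vz; split=> //.
by have [e e0 eV] := oV z Vz; apply: (cgrad_ext_near e0 _ H1) => w /eV; exact: uv.
Qed.

Definition upper_disc : set R[i] := [set s | cabs s <= 1 /\ 0 <= complex.Im s].

Lemma oddx_ucontK f : ucontK upper_disc (oddx f) -> ucontK (cdisc 0 1) (oddx f).
Proof.
move=> H.
have {}H s : upper_disc s -> forall e, 0 < e -> exists2 d, 0 < d &
    forall w, cabs w <= 1 -> cabs (w - s) < d -> `|oddx f w - oddx f s| < e.
  move=> us e e0; have [d d0 {}H] := H s us e e0.
  have [s1 sI] := us.
  pose d' := if 0 < complex.Im s then Num.min d (complex.Im s) else d.
  have d'0 : 0 < d' by rewrite /d'; case: ifP => // I0; rewrite lt_min d0.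
  have d'd : d' <= d by rewrite /d'; case: ifP => // _; rewrite ge_min lexx.
  exists d'; first exact: d'0.
  move=> w w1 ws; have [wI|wI] := leP 0 (complex.Im w).
    by apply: H; [split|lra].
  have sI0 : complex.Im s = 0.
    apply/eqP; rewrite eq_le sI andbT leNgt; apply/negP => sI'.
    have : d' <= complex.Im s by rewrite /d' sI' ge_min lexx orbT.
    by have := cabs_Im (w - s); rewrite ImD ImN ler_norml => /andP[]; lra.
  have sE : conjc s = s by case: (s) sI0 => a b /= ->; rewrite oppr0.
  have -> : oddx f w = - oddx f (conjc w) by rewrite oddx_odd opprK.
  rewrite [oddx f s]oddx_real // subr0 normrN -[oddx f _]subr0 -(oddx_real f sI0).
  apply: H; first by split; [rewrite cabs_conj|rewrite Im_conj; lra].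
  by rewrite -sE -rmorphB cabs_conj; lra.
move=> s; rewrite /cdisc /= subr0 => s1 e e0.
have [sI|sI] := leP 0 (complex.Im s).
  have [d d0 {}H] := H s (conj s1 sI) e e0.
  by exists d => // w; rewrite /cdisc /= subr0; exact: H.
have [|d d0 {}H] := H (conjc s) _ e e0.
  by split; [rewrite cabs_conj|rewrite Im_conj; lra].
exists d => // w; rewrite /cdisc /= subr0 => w1 ws.
have := H (conjc w); rewrite !oddx_odd cabs_conj -rmorphB cabs_conj.
by move=> /(_ w1 ws); rewrite -opprD normrN.
Qed.

Lemma open_half_disc s0 : open [set s : R[i] | half_disc s /\ s != s0].
Proof.
apply/openC => s [[s1 sI] ss].
pose d := Num.min (Num.min (1 - cabs s) (complex.Im s)) (cabs (s - s0)).
exists d; first by rewrite !lt_min cabs_gt0 subr_eq0 ss sI subr_gt0 s1.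
move=> w; rewrite !lt_min => /andP[/andP[w1 w2] w3]; split; first split.
- by have := cabs_subr w s; lra.
- by have := cabs_Im (w - s); rewrite ImD ImN ler_norml => /andP[]; lra.
- by apply/eqP => E; rewrite E cabsB ltxx in w3.
Qed.

Lemma oddx_lapl f s0 : harm [set s | half_disc s /\ s != s0] f ->
  lapl [set s | half_disc s /\ s != s0] (oddx f).
Proof.
move=> H; apply: harm_lapl; apply: harm_ext H; first exact: open_half_disc.
by move=> s [[_ sI] _]; rewrite oddx_up.
Qed.

Lemma oddx_bound f M : 0 < M -> (forall s, cabs s = 1 -> 0 < complex.Im s -> `|f s| <= M) ->
  forall s, cabs s = 1 -> `|oddx f s| <= M.
Proof.
move=> M0 H s s1; rewrite /oddx; case: ltP => [/H|_]; first exact.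
case: ltP => [sI|_]; last by rewrite normr0 ltW.
by rewrite normrN; apply: H; rewrite ?cabs_conj // Im_conj; lra.
Qed.

Lemma oddx_est f M s0 : 0 < M -> ucontK upper_disc (oddx f) ->
  harm [set s | half_disc s /\ s != s0] f ->
  (forall s, cabs s = 1 -> 0 < complex.Im s -> `|f s| <= M) -> est 0 1 M (oddx f).
Proof.
move=> M0 cf hf bf; apply: (reflection_est (s0 := s0) M0).
- exact: oddx_ucontK.
- exact: oddx_odd.
- exact: oddx_lapl.
- exact: oddx_bound.
Qed.

Lemma oddx_hopf f M s0 s : 0 < M -> ucontK upper_disc (oddx f) ->
  harm [set s | half_disc s /\ s != s0] f ->
  (forall s, cabs s = 1 -> 0 < complex.Im s -> 0 <= f s <= M) -> cabs s <= 1/20 ->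
  f (0 +i* (1/2)) / 256 <= - complex.Im (gr (oddx f) s).
Proof.
move=> M0 cf hf bf s1.
have -> : - complex.Im (gr (oddx f) s) = complex.Re ('i%C * gr (oddx f) s).
  by rewrite ReM /= mul0r mul1r sub0r.
have -> : f (0 +i* (1/2)) = oddx f (0 +i* (1/2)) by rewrite oddx_up //=; lra.
apply: (hopf (s0 := s0) M0) s1.
- exact: oddx_ucontK.
- exact: oddx_odd.
- exact: oddx_lapl.
- by apply: oddx_bound => // t t1 tI; have /andP[b1 b2] := bf t t1 tI; rewrite ger0_norm.
- move=> t t1; rewrite le_eqVlt => /orP[/eqP tI|tI]; first by rewrite oddx_real.
  by rewrite oddx_up //; have /andP[] := bf t t1 tI.
Qed.

Lemma est_gr_lip M u s : est 0 1 M u -> 0 < M -> cabs s < 1/2 ->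
  cabs (gr u s - gr u 0) <= 2 * (CT * M) * cabs s.
Proof.
move=> H M0 s1; have [|_ _ b2 K] := H 0; first by rewrite subrr cabs0; lra.
have [|_] := K s; first by rewrite add0r subr0; lra.
rewrite add0r expr1n divr1 => K2; rewrite expr1n divr1 in b2.
have B0 : 0 < CT * M by rewrite mulr_gt0 ?CT_gt0.
have h1 : cabs (dc (gr u) 0 * s) <= CT * M * cabs s.
  by rewrite cabsM ler_wpM2r ?cabs_ge0.
have h2 : CT * M * cabs s ^+ 2 <= CT * M * cabs s.
  by rewrite ler_pM2l // expr2 ler_piMl ?cabs_ge0 //; lra.
have := cabsD (gr u s - gr u 0 - dc (gr u) 0 * s) (dc (gr u) 0 * s).
by rewrite subrK; lra.
Qed.

(** Expansion at the real point below s, where u vanishes: the increment is vertical, so the error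
    is quadratic in Im s instead of |s|. *)
Lemma odd_taylor M u s : est 0 1 M u -> odd_conj u -> cabs s < 1/2 ->
  `|u s + complex.Im (gr u (complex.Re s)%:C) * complex.Im s| <= CT * M * complex.Im s ^+ 2.
Proof.
move=> H ou s1; set x := complex.Re s.
have xs : cabs x%:C <= cabs s by rewrite cabsR; exact: cabs_Re.
have [|_ _ _ K] := H x%:C; first by rewrite subr0; lra.
have sE : x%:C + 'i%C * (complex.Im s)%:C = s by rewrite /x; case: (s) => a b; simpc.
have [|{}K _] := K ('i%C * (complex.Im s)%:C); first by rewrite sE subr0; lra.
move: K; rewrite sE (odd_conj_real (s := x%:C) ou) // subr0 expr1n divr1.
rewrite cabsM cabsi mul1r cabsR real_normK ?num_real //.
by congr (`|_| <= _); rewrite ReM ReM ImM /=; ring.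
Qed.

Lemma odd_bound M u s : est 0 1 M u -> odd_conj u -> 0 < M -> cabs s < 1/2 ->
  `|u s| <= 2 * (CT * M) * `|complex.Im s|.
Proof.
move=> H ou M0 s1; have := odd_taylor H ou s1; set x := complex.Re s.
have xs : cabs x%:C <= cabs s by rewrite cabsR; exact: cabs_Re.
have [|_ b1 _ _] := H x%:C; first by rewrite subr0; lra.
rewrite divr1 in b1.
have B0 : 0 < CT * M by rewrite mulr_gt0 ?CT_gt0.
have I1 : `|complex.Im s| <= 1 by have := cabs_Im s; lra.
rewrite -[complex.Im s ^+ 2]real_normK ?num_real // => T.
have h1 : `|complex.Im (gr u x%:C) * complex.Im s| <= CT * M * `|complex.Im s|.
  by rewrite normrM ler_wpM2r //; have := cabs_Im (gr u x%:C); lra.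
have h2 : CT * M * `|complex.Im s| ^+ 2 <= CT * M * `|complex.Im s|.
  by rewrite ler_pM2l // expr2 ler_piMl.
have := ler_normB (u s + complex.Im (gr u x%:C) * complex.Im s) (complex.Im (gr u x%:C) * complex.Im s).
by rewrite addrK; lra.
Qed.

(** The number - Im (gr u 0) is the derivative of u at 0 in the direction i; dividing by Im s turns
    the vanishing of u on the axis into convergence to it. *)
Lemma odd_normal M u s : est 0 1 M u -> odd_conj u -> 0 < M -> cabs s < 1/2 ->
  0 < complex.Im s ->
  `|(complex.Im s)^-1 * u s - - complex.Im (gr u 0)| <= 4 * (CT * M) * cabs s.
Proof.
move=> H ou M0 s1 sI; have := odd_taylor H ou s1; set x := complex.Re s.
have xs : cabs x%:C <= cabs s by rewrite cabsR; exact: cabs_Re.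
have := est_gr_lip (s := x%:C) H M0 ltac:(lra).
have B0 : 0 < CT * M by rewrite mulr_gt0 ?CT_gt0.
set y := complex.Im s; set A := gr u x%:C; set B := gr u 0 => h1 T.
have h2 : `|y^-1 * u s + complex.Im A| <= CT * M * y.
  rewrite -(@ler_pM2l _ y) //; apply: le_trans _ (_ : CT * M * y ^+ 2 <= _).
    rewrite -[X in X * `|_|]gtr0_norm // -normrM; apply: le_trans T.
    by rewrite mulrDr mulrA divff ?lt0r_neq0 // mul1r [y * _]mulrC.
  by rewrite expr2 mulrCA mulrA.
have h3 : `|complex.Im A - complex.Im B| <= 2 * (CT * M) * cabs s.
  have := cabs_Im (A - B); rewrite ImD ImN => h3; apply: le_trans h3 _; apply: le_trans h1 _.
  by rewrite ler_pM2l // mulr_gt0.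
have ys : CT * M * y <= CT * M * cabs s.
  by rewrite ler_pM2l //; have := cabs_Im s; rewrite -/y ger0_norm // ltW.
have P : 0 <= CT * M * cabs s by rewrite mulr_ge0 ?cabs_ge0 // ltW.
have -> : y^-1 * u s - - complex.Im B = (y^-1 * u s + complex.Im A) - (complex.Im A - complex.Im B).
  by ring.
by apply: le_trans (ler_normB _ _) _; lra.
Qed.

Lemma harm_uniform_limit c r M u : 0 < r -> 0 < M ->
  (forall e, 0 < e -> exists v, [/\ harm (cdisc c r) v,
     forall z, cdisc c r z -> `|v z| <= M &
     forall z, cdisc c r z -> `|u z - v z| <= e]) -> est c r M u.
Proof.
move=> r0 M0 H; apply: (est_limit r0); apply: uniform_limit_trans => e e0.
have [v [v1 v2 v3]] := H e e0; exists (fun s => v (c + r%:C * s)).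
  exact: uniform_limit_harm.
by move=> s s1; apply: v3; apply: affine_cdisc => //; rewrite /cdisc /= subr0 ltW.
Qed.

Lemma harm_cgrad (V : set R[i]) u z : harm V u -> V z -> cgrad u z (gr u z).
Proof. by move=> [p [p1 H]] /H[H1 _]; rewrite (cgrad_gr H1). Qed.

Lemma gr_close c r m u v z : 0 < r -> 0 < m -> harm (cdisc c r) u -> harm (cdisc c r) v ->
  (forall w, cdisc c r w -> `|u w - v w| <= m) -> cabs (z - c) < r / 2 ->
  cabs (gr u z - gr v z) <= CT * m / r.
Proof.
move=> r0 m0 hu hv uv zc; have zr : cdisc c r z by rewrite /cdisc /=; lra.
have [_ H _ _] := est_harm r0 m0 (harmB hu hv) uv zc.
have E := cgradD (harm_cgrad hu zr) (cgradZ (-1) (harm_cgrad hv zr)).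
have {}E : gr (fun w => u w - v w) z = gr u z + (-1)%:C * gr v z.
  apply: cgrad_gr; apply: cgrad_ext_near ltr01 _ E => w _; by rewrite mulN1r.
by rewrite E rmorphN mulN1r in H.
Qed.

End OddExtension.

(** * The normal derivative of the Green function at the boundary *)

Section BoundaryExpansion.
Context {R : realType} (U : set R[i]) (G : R[i] -> R[i] -> R) (h : R[i] -> R[i] -> R)
  (dU : domain U) (bU : bounded_set U) (hG : green_regular U G h)
  (fU : finitely_connected U) (aU : analytic_boundary U).
Implicit Types (z w s c p q : R[i]) (u v : R[i] -> R) (Phi : R[i] -> R[i]) (r M : R).

Let oU : open U. Proof. by case: dU. Qed.

(** The function E of the overview, as a function of the chart parameter s of the pole. *)
Definition bE Phi w := oddx (fun s => Gh h w (Phi s)).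

(* Up to a positive factor, the normal derivative at the boundary point Phi 0
   of the Green function with pole w, that is, the Poisson kernel of U *)
Definition bd Phi w : R := - complex.Im (gr (bE Phi w) 0).

Lemma Gh_chart_harm p Phi w (V : set R[i]) : chart U p Phi -> closure U w ->
  (forall s, V s -> [/\ cabs s <= 1, 0 < complex.Im s & Phi s != w]) ->
  harm V (fun s => Gh h w (Phi s)).
Proof.
move=> [hP _ _ _ up _ _ _] cw H.
apply: (harm_comp (harm_Gh_pole dU bU hG cw)).
  by apply: hol2_sub hP => s /H[]; rewrite /cdisc /= subr0.
by move=> s /H[s1 sI sw]; split; [exact: up|exact: sw].
Qed.

Lemma chart_continuous p Phi s (e : R) : chart U p Phi -> cabs s <= 1 -> 0 < e ->
  exists2 d, 0 < d & forall w, cabs (w - s) < d -> cabs (Phi w - Phi s) < e.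
Proof.
move=> [hP _ _ _ _ _ _ _] s1 e0; have [|l Hl] := hol2_cder hP (z := s).
  by rewrite /cdisc /= subr0.
exact: cder_cont Hl _ e0.
Qed.

Lemma bE_ucontK p Phi w : chart U p Phi -> closure U w ->
  (forall s, cabs s <= 1 -> Phi s != w) -> ucontK upper_disc (bE Phi w).
Proof.
move=> cP cw Pw s [s1]; rewrite le_eqVlt => /orP[/eqP sI|sI] e e0.
  have F0 := chart_real cP s1 (esym sI).
  have w0 : 0 < cabs (Phi s - w) by rewrite cabs_gt0 subr_eq0 Pw.
  (* At a real s the pole Phi t tends to the frontier point Phi s, and w stays away from it. *)
  have [de de0 van] := Gh_vanish dU bU hG fU aU F0 (ep := e / 2) (rho := cabs (Phi s - w) / 2)
    ltac:(lra) ltac:(lra).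
  have [d d0 dP] := chart_continuous (e := Num.min de (cabs (Phi s - w) / 2)) cP s1
    ltac:(by rewrite lt_min de0 divr_gt0).
  exists d; first exact: d0.
  move=> t [t1 tI] ts; rewrite [bE _ _ s]oddx_real; last exact: esym sI.
  rewrite subr0; move: tI; rewrite le_eqVlt => /orP[/eqP tI|tI].
    by rewrite [bE _ _ t]oddx_real ?normr0.
  rewrite [bE _ _ t]oddx_up //.
  have Ut := chart_up cP t1 tI.
  have := dP t ts; rewrite lt_min => /andP[k1 k2].
  have k3 : cabs (Phi s - w) / 2 <= cabs (w - Phi t).
    by have := cabs_tri (Phi s) (Phi t) w; rewrite (cabsB w) (cabsB (Phi s) (Phi t)); lra.
  have := van w (Phi t) cw Ut k3 (or_introl k1).
  have := Gh_ge0 dU bU hG Ut cw; rewrite eq_sym => /(_ (Pw t t1)) g0 g1.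
  by rewrite ger0_norm; lra.
have hh : harm [set t | cabs t <= 1 /\ 0 < complex.Im t] (fun s => Gh h w (Phi s)).
  by apply: (Gh_chart_harm cP cw) => t [t1 tI]; split => //; exact: Pw.
have [d d0 {}hh] := harm_ucontK hh (fun _ => id) (conj s1 sI) e0.
exists (Num.min d (complex.Im s)); first by rewrite lt_min d0.
move=> t [t1 _]; rewrite lt_min => /andP[td tI].
have {}tI : 0 < complex.Im t.
  by have := cabs_Im (t - s); rewrite ImD ImN ler_norml => /andP[]; lra.
by rewrite [bE _ _ s]oddx_up // [bE _ _ t]oddx_up //; apply: hh.
Qed.

Lemma bE_half_disc p Phi w : chart U p Phi -> closure U w ->
  (forall s, cabs s <= 1 -> Phi s != w) ->
  harm [set s | half_disc s /\ s != 0] (fun s => Gh h w (Phi s)).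
Proof.
move=> cP cw Pw; apply: (Gh_chart_harm cP cw) => s [[s1 sI] _].
by split; [exact: ltW|exact: sI|apply/Pw/ltW].
Qed.

Lemma Gh_chart_ge0 p Phi w s : chart U p Phi -> closure U w ->
  (forall s, cabs s <= 1 -> Phi s != w) -> cabs s <= 1 -> 0 < complex.Im s ->
  0 <= Gh h w (Phi s).
Proof.
move=> cP cw Pw s1 sI; apply: (Gh_ge0 dU bU hG (chart_up cP s1 sI) cw).
by rewrite eq_sym Pw.
Qed.

Lemma bE_est p Phi w M : chart U p Phi -> closure U w ->
  (forall s, cabs s <= 1 -> Phi s != w) -> 0 < M ->
  (forall s, cabs s = 1 -> 0 < complex.Im s -> Gh h w (Phi s) <= M) -> est 0 1 M (bE Phi w).
Proof.
move=> cP cw Pw M0 GM; apply: (oddx_est (s0 := 0) M0).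
- exact: bE_ucontK cP cw Pw.
- exact: bE_half_disc cP cw Pw.
- move=> s s1 sI; rewrite ger0_norm; first exact: GM.
  by apply: (Gh_chart_ge0 cP cw Pw); rewrite // s1.
Qed.

Lemma bd_gt0_away p Phi w M : chart U p Phi -> U w ->
  (forall s, cabs s <= 1 -> Phi s != w) -> 0 < M ->
  (forall s, cabs s = 1 -> 0 < complex.Im s -> Gh h w (Phi s) <= M) -> 0 < bd Phi w.
Proof.
move=> cP Uw Pw M0 GM; have cw := subset_closure Uw.
have i2 : cabs (0 +i* (1/2) : R[i]) <= 1.
  by have := cabs_ReIm (0 +i* (1/2) : R[i]); rewrite /= normr0 ger0_norm; lra.
have iI : 0 < complex.Im (0 +i* (1/2) : R[i]) by rewrite /=; lra.
have : 0 < Gh h w (Phi (0 +i* (1/2))).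
  apply: (Gh_gt0 dU bU hG (chart_up cP i2 iI) Uw).
  by rewrite eq_sym Pw.
have : Gh h w (Phi (0 +i* (1/2))) / 256 <= bd Phi w.
  apply: (oddx_hopf (s0 := 0) M0).
  - exact: bE_ucontK cP cw Pw.
  - exact: bE_half_disc cP cw Pw.
  - move=> s s1 sI; apply/andP; split; last exact: GM.
    by apply: (Gh_chart_ge0 cP cw Pw); rewrite // s1.
  - by rewrite cabs0; lra.
by lra.
Qed.

Lemma Gh_le (rho d : R) w ze : 0 < rho ->
  (forall z w, closure U z -> closure U w -> cabs (z - w) <= d) ->
  U ze -> closure U w -> rho <= cabs (w - ze) -> Gh h w ze <= `|ln rho| + `|ln d| + 1.
Proof.
move=> rho0 dP Uze cw wz; have := h_le dU bU hG dP Uze cw.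
have : ln rho <= ln (cabs (w - ze)) by rewrite ler_ln ?posrE //; lra.
have := ler_norm (ln d); have := ler_norm (- ln rho); rewrite normrN /Gh.
by lra.
Qed.

(** The disc about c avoids the image of the chart, so a single bound M holds for E(w, s) over all w
    in it, and every estimate is uniform in w. *)
Definition away Phi c r M := [/\ 0 < r, 0 < M, forall w, cdisc c r w -> U w,
  forall w s, cdisc c r w -> cabs s <= 1 -> Phi s != w &
  forall w s, cdisc c r w -> cabs s <= 1 -> 0 < complex.Im s -> Gh h w (Phi s) <= M].

Lemma chart_shrink p Phi (e : R) : chart U p Phi -> 0 < e ->
  exists k : R, [/\ 0 < k, k <= 1, chart U p (fun s => Phi (k%:C * s)) &
    forall s, cabs s <= 1 -> cabs (Phi (k%:C * s) - p) < e].
Proof.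
move=> cP e0; have [|d d0 dP] := chart_continuous (s := 0) cP _ e0.
  by rewrite cabs0; lra.
pose k := Num.min 1 (d / 2).
have k0 : 0 < k by rewrite /k lt_min ltr01 divr_gt0.
have k1 : k <= 1 by rewrite /k ge_min lexx.
have kd : k <= d / 2 by rewrite /k ge_min lexx orbT.
exists k; split; [exact: k0|exact: k1|exact: chart_scale|] => s s1.
rewrite -(chart_center cP); apply: dP; rewrite subr0 cabsM cabs_real_pos //.
have : k * cabs s <= k by rewrite ler_piMr // ltW.
by lra.
Qed.

Lemma away_of_small p Phi c (e : R) : chart U p Phi -> U c -> 0 < e -> 3 * e <= cabs (c - p) ->
  (forall s, cabs s <= 1 -> cabs (Phi s - p) < e) -> exists r M, away Phi c r M.
Proof.
move=> cP Uc e0 ec Pe; have [d d1 dP] := closure_bound bU.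
have [e' e'0 eU] := (openC U).1 oU c Uc.
pose r := Num.min (e' / 2) e.
have r0 : 0 < r by rewrite /r lt_min e0 andbT divr_gt0.
have re : r <= e by rewrite /r ge_min lexx orbT.
have re' : r <= e' / 2 by rewrite /r ge_min lexx.
have Ur w : cdisc c r w -> U w by rewrite /cdisc /= => wc; apply: eU; lra.
have far w s : cdisc c r w -> cabs s <= 1 -> e <= cabs (w - Phi s).
  rewrite /cdisc /= => wc /Pe Ps.
  have := cabs_tri c w p; have := cabs_tri w (Phi s) p; rewrite (cabsB c w).
  by lra.
exists r, (`|ln e| + `|ln d| + 1); split.
- exact: r0.
- by have := normr_ge0 (ln e); have := normr_ge0 (ln d); lra.
- exact: Ur.
- move=> w s wc s1; apply/eqP => E; have := far w s wc s1.
  by rewrite E subrr cabs0; lra.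
- move=> w s wc s1 sI; apply: (Gh_le e0 dP (chart_up cP s1 sI)).
    by apply: subset_closure; exact: Ur.
  exact: far.
Qed.

Lemma frontier_neq p c : frontier U p -> U c -> 0 < cabs (c - p).
Proof.
move=> Fp Uc; rewrite cabs_gt0 subr_eq0; apply/eqP => E.
by apply: (not_frontier dU Fp); rewrite -E.
Qed.

Lemma chart_frontier p Phi : chart U p Phi -> frontier U p.
Proof. by move=> cP; rewrite -(chart_center cP); apply: (chart_real cP); rewrite ?cabs0. Qed.

Lemma away_scale p Phi c : chart U p Phi -> U c ->
  exists (k : R) r M, [/\ 0 < k, chart U p (fun s => Phi (k%:C * s)) &
    away (fun s => Phi (k%:C * s)) c r M].
Proof.
move=> cP Uc; have c0 := frontier_neq (chart_frontier cP) Uc.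
have [k [k0 k1 cPk kP]] := chart_shrink (e := cabs (c - p) / 3) cP ltac:(lra).
have [r [M H]] := away_of_small (e := cabs (c - p) / 3) cPk Uc ltac:(lra) ltac:(lra) kP.
by exists k, r, M.
Qed.

Lemma away_est p Phi c r M w : chart U p Phi -> away Phi c r M -> cdisc c r w ->
  est 0 1 M (bE Phi w).
Proof.
move=> cP [r0 M0 aw1 aw2 aw3] wc; apply: (bE_est cP) M0 _.
- by apply: subset_closure; exact: aw1.
- by move=> s; exact: aw2.
- by move=> s s1; apply: aw3; rewrite // s1.
Qed.

(** Shrinking the chart only multiplies the normal derivative by k, so what is proved in a chart
    small enough for [away] transfers to the given one. *)
Lemma bd_scale (k : R) Phi w M : 0 < k -> est 0 1 M (bE (fun s => Phi (k%:C * s)) w) ->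
  bd (fun s => Phi (k%:C * s)) w = k * bd Phi w.
Proof.
move=> k0 H; have [|[H1 _ _] _ _ _] := H 0; first by rewrite subrr cabs0; lra.
have kC : (k%:C : R[i]) != 0 by rewrite -cabs_gt0 cabs_real_pos.
have E s : bE Phi w s = bE (fun s => Phi (k%:C * s)) w (k^-1%:C * s).
  have kI : complex.Im (k^-1%:C * s) = k^-1 * complex.Im s.
    by rewrite ImM /= mul0r addr0.
  have kK t : k%:C * (k^-1%:C * t) = t by rewrite mulrA -rmorphM divff ?lt0r_neq0 // mul1r.
  rewrite /bE /oddx kI pmulr_rgt0 ?invr_gt0 // pmulr_rlt0 ?invr_gt0 //.
  have cE : conjc (k^-1%:C * s) = k^-1%:C * conjc s.
    by case: (s) => x y; apply: complex_ext; rewrite /= !mul0r ?subr0 ?addr0 //; ring.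
  by rewrite cE !kK.
have H2 : cder (fun s => k^-1%:C * s) 0 k^-1%:C.
  by have := cderZ k^-1%:C (cder_id 0); rewrite mulr1.
have : cgrad (bE Phi w) 0 (gr (bE (fun s => Phi (k%:C * s)) w) 0 * k^-1%:C).
  rewrite (funext E); apply: cgrad_comp H2; rewrite mulr0; exact: H1.
move=> /cgrad_gr E2; rewrite /bd E2 ImM /= mulr0 add0r.
by rewrite mulrN mulrCA divff ?mulr1 // lt0r_neq0.
Qed.

Lemma bE_harm p Phi c r M s : chart U p Phi -> away Phi c r M -> cabs s <= 1 ->
  harm (cdisc c r) (fun w => bE Phi w s).
Proof.
move=> cP [r0 M0 aw1 aw2 aw3].
have up t : cabs t <= 1 -> 0 < complex.Im t -> harm (cdisc c r) (fun w => Gh h w (Phi t)).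
  move=> t1 tI; apply: harm_sub (harm_Gh hG (chart_up cP t1 tI)) => w wc.
  by split; [exact: aw1|rewrite eq_sym aw2].
move=> s1; rewrite /bE /oddx; case: ltP => [sI|_]; first exact: up.
case: ltP => [sI|_]; last exact: harm_cst.
have H : harm (cdisc c r) (fun w => Gh h w (Phi (conjc s))).
  by apply: up; rewrite ?cabs_conj // Im_conj; lra.
have := harmZ (-1) H; congr harm; apply/funext => w; exact: mulN1r.
Qed.

(** The derivative in s is a limit, uniform in w, of the difference quotients v, which are harmonic
    in w; the Taylor bound gives the error B t. *)
Lemma bE_gr_est p Phi c r M s (e : R[i]) : chart U p Phi -> away Phi c r M ->
  cabs s < 1/2 -> cabs e = 1 ->
  est c r (2 * (CT * M)) (fun w => complex.Re (gr (bE Phi w) s * e)).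
Proof.
move=> cP aw s1 e1; have [r0 M0 _ _ _] := aw.
have B0 : 0 < CT * M by rewrite mulr_gt0 ?CT_gt0.
apply: (harm_uniform_limit r0); first lra.
move=> ep ep0; set B := CT * M in B0 *.
pose t := Num.min (Num.min 1 ((1/2 - cabs s) / 2)) (ep / B).
have t0 : 0 < t by rewrite /t !lt_min ltr01 !divr_gt0 ?subr_gt0.
have t1 : t <= 1 by rewrite /t !ge_min lexx.
have ts : t <= (1/2 - cabs s) / 2 by rewrite /t !ge_min lexx orbT.
have tB : B * t <= ep by rewrite mulrC -ler_pdivlMr // /t !ge_min lexx orbT.
clearbody t.
have te : cabs (t%:C * e) = t by rewrite cabsM e1 mulr1 cabs_real_pos.
have st : cabs (s + t%:C * e) < 1/2 by have := cabsD s (t%:C * e); rewrite te; lra.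
pose v w := t^-1 * (bE Phi w (s + t%:C * e) - bE Phi w s).
have close w : cdisc c r w -> cabs (gr (bE Phi w) s) <= B /\
    `|complex.Re (gr (bE Phi w) s * e) - v w| <= B * t.
  move=> wc; have H := away_est cP aw wc.
  have [|_ b1 _ K] := H s; first by rewrite subr0; lra.
  have [|{}K _] := K (t%:C * e); first by rewrite subr0; lra.
  rewrite expr1n !divr1 te -/B in K b1; split; first exact: b1.
  rewrite -(@ler_pM2l _ t) //; apply: (@le_trans _ _ (B * t ^+ 2)); last first.
    by rewrite expr2 mulrCA.
  apply: le_trans K; rewrite -[X in X * `|_|]gtr0_norm // -normrM -normrN.
  rewrite (_ : - (t * _) = bE Phi w (s + t%:C * e) - bE Phi w s -
      t * complex.Re (gr (bE Phi w) s * e)); last by rewrite /v; field; exact: lt0r_neq0.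
  have -> : gr (bE Phi w) s * (t%:C * e) = t%:C * (gr (bE Phi w) s * e) by ring.
  by rewrite [complex.Re (t%:C * _)]ReM /= mul0r subr0.
exists v; split.
- have := harmZ t^-1 (harmB (bE_harm cP aw (ltW (lt_trans st _))) (bE_harm cP aw (ltW (lt_trans s1 _)))).
  by apply; lra.
- move=> w wc; have [b1 b2] := close w wc.
  have b3 := cabs_Re (gr (bE Phi w) s * e); rewrite cabsM e1 mulr1 in b3.
  have b4 : B * t <= B by rewrite ler_piMr // ltW.
  have := ler_normB (complex.Re (gr (bE Phi w) s * e)) (complex.Re (gr (bE Phi w) s * e) - v w).
  by rewrite opprB addrCA subrr addr0; lra.
- by move=> w wc; have [_ b2] := close w wc; lra.
Qed.

Lemma est_harm_disc c r M u : est c r M u -> harm (odisc c (r / 2)) u.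
Proof. by move=> H; exists (gr u), (dc (gr u)) => z /H[[]]. Qed.

Lemma bdE Phi w : bd Phi w = complex.Re (gr (bE Phi w) 0 * 'i%C).
Proof. by rewrite ReM /= mulr0 mulr1 sub0r. Qed.

Lemma bd_est p Phi c r M : chart U p Phi -> away Phi c r M ->
  est c r (2 * (CT * M)) (bd Phi).
Proof.
move=> cP aw; have := bE_gr_est (s := 0) (e := 'i%C) cP aw.
rewrite cabs0 cabsi (_ : (fun w => _) = bd Phi); last first.
  by apply/funext => w; rewrite bdE.
by apply; [lra|].
Qed.

Lemma smooth_local (V : set R[i]) u :
  (forall c, V c -> exists2 r, 0 < r & harm (odisc c r) u) -> smooth V u.
Proof.
move=> H c /H[r r0 hu]; apply: (harm_smooth (@open_odisc R c r) hu).
exact: odisc_center.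
Qed.

Lemma bd_smooth p Phi : chart U p Phi -> smooth U (bd Phi).
Proof.
move=> cP; apply: smooth_local => c Uc.
have [k [r [M [k0 cPk aw]]]] := away_scale cP Uc; have [r0 M0 _ _ _] := aw.
exists (r / 2); first by rewrite divr_gt0.
apply: harm_ext (@open_odisc R c (r / 2)) _ (harmZ k^-1 (est_harm_disc (bd_est cPk aw))).
move=> w wc; rewrite (bd_scale k0 (away_est cPk aw _)); last by move: wc; rewrite /cdisc /odisc /=; lra.
by rewrite mulrA mulVf ?mul1r // lt0r_neq0.
Qed.

Lemma bd_gt0 p Phi w : chart U p Phi -> U w -> 0 < bd Phi w.
Proof.
move=> cP Uw; have [k [r [M [k0 cPk aw]]]] := away_scale cP Uw.
have [r0 M0 aw1 aw2 aw3] := aw; have ww := cdisc_center w (ltW r0).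
rewrite -(pmulr_rgt0 _ k0) -(bd_scale k0 (away_est cPk aw ww)).
apply: (bd_gt0_away cPk Uw _ M0).
- by move=> s; exact: aw2.
- by move=> s s1; apply: aw3; rewrite // s1.
Qed.

(** For w near q the Green function is small over the whole shrunk chart, and the estimate for the
    reflected function passes this to its gradient at 0. *)
Lemma bd_vanish p Phi q (e : R) : chart U p Phi -> frontier U q -> q != p -> 0 < e ->
  exists2 w, U w & bd Phi w < e.
Proof.
move=> cP Fq qp e0; have q0 : 0 < cabs (q - p) by rewrite cabs_gt0 subr_eq0.
have [k [k0 k1 cPk kP]] := chart_shrink (e := cabs (q - p) / 3) cP ltac:(lra).
have ek0 : 0 < e * k / (2 * CT) by rewrite divr_gt0 ?mulr_gt0 ?CT_gt0.
have q3 : 0 < cabs (q - p) / 3 by lra.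
have [de de0 van] := Gh_vanish dU bU hG fU aU Fq ek0 q3.
have [cq _] := (frontierE q oU).1 Fq.
have [|w Uw wq] := (closureC U q).1 cq (Num.min de (cabs (q - p) / 3)).
  by rewrite lt_min de0.
exists w; first exact: Uw.
move: wq; rewrite lt_min => /andP[wq1 wq2].
have far s : cabs s <= 1 -> cabs (q - p) / 3 <= cabs (w - Phi (k%:C * s)).
  move=> /kP Ps; have := cabs_tri q w p; have := cabs_tri w (Phi (k%:C * s)) p.
  by rewrite (cabsB q w); lra.
have H : est 0 1 (e * k / (2 * CT)) (bE (fun s => Phi (k%:C * s)) w).
  apply: (bE_est cPk (subset_closure Uw) _ ek0).
  - by move=> s /far E; apply/eqP => sw; rewrite sw subrr cabs0 in E; lra.
  - move=> s s1 sI; have s1' : cabs s <= 1 by rewrite s1.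
    by apply: van (subset_closure Uw) (chart_up cPk s1' sI) (far s s1') (or_intror wq1).
have [|_ b1 _ _] := H 0; first by rewrite subrr cabs0; lra.
rewrite divr1 in b1.
have E := bd_scale k0 H.
rewrite -(ltr_pM2l k0) -E /bd.
have := cabs_Im (gr (bE (fun s => Phi (k%:C * s)) w) 0); rewrite ler_norml => /andP[b2 _].
have b3 : CT * (e * k / (2 * CT)) = k * e / 2 by field; rewrite lt0r_neq0 // CT_gt0.
have : 0 < k * e by rewrite mulr_gt0.
by lra.
Qed.

Lemma gr0_constant (V : set R[i]) u z w : open V -> connected V -> smooth V u ->
  (forall z, V z -> gr u z = 0) -> V z -> V w -> u w = u z.
Proof.
move=> oV cV su g0 Vz; have hu := smooth_harm su.
pose A := [set x | V x /\ u x = u z].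
suff H : forall x, V x -> A x by move=> /H[].
apply: (connected_clopen cV) => [z' []//| | |z1 Vz1 H].
- by exists z.
- apply/openC => w' [Vw' uw']; have [e e0 He] := (openC V).1 oV w' Vw'.
  exists e => // x xw; split; first exact: He.
  rewrite -uw'; have seg t : 0 <= t <= 1 -> rder (fun t => u (w' + t%:C * (x - w'))) t 0.
    move=> /andP[t0 t1]; apply: rder_shift.
    have Vt : V (w' + t%:C * (x - w')).
      apply: He; rewrite (_ : _ - w' = t%:C * (x - w')); last by ring.
      rewrite cabsM cabsR ger0_norm //.
      have : t * cabs (x - w') <= cabs (x - w') by rewrite ler_piMl ?cabs_ge0.
      by lra.
    have := cgrad_dirder (x - w') (harm_cgrad hu Vt); rewrite (g0 _ Vt) mul0r /dirder /=.
    by apply: rder_ext => t'; rewrite rmorphD mulrDl addrA.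
  have [t _ E] := rder_mvt (f' := fun=> 0) ltr01 seg; move: E.
  have -> : w' + 0%:C * (x - w') = w' by rewrite rmorph0 mul0r addr0.
  have -> : w' + 1%:C * (x - w') = x by rewrite rmorph1 mul1r addrC subrK.
  by rewrite mul0r => /eqP; rewrite subr_eq0 => /eqP.
- split; first exact: Vz1.
  apply/eqP; rewrite -subr_eq0 -normr_le0; apply/ler_addgt0Pl => e e0; rewrite addr0.
  have [d d0 dP] := cgrad_cont (harm_cgrad hu Vz1) e0.
  by have [w' [_ <-] ww] := H d d0; rewrite distrC ltW // dP.
Qed.

Lemma bd_gr_nonzero p Phi z r : chart U p Phi -> U z -> 0 < r ->
  exists2 w, cabs (w - z) < r & gr (bd Phi) w != 0.
Proof.
move=> cP Uz r0; apply: contrapT => H.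
have {}H w : cabs (w - z) < r -> gr (bd Phi) w = 0.
  by move=> wz; apply/eqP/negPn/negP => nz; apply: H; exists w.
have cU : connected U by case: dU.
have sb := bd_smooth cP.
have g0 := identity_theorem oU cU (smooth_hol2 sb) Uz r0 H.
(* Phi t is a frontier point other than p, towards which a constant [bd] would have to be
   arbitrarily small. *)
set t : R[i] := (1/2 : R)%:C.
have h2 : cabs t = 1/2 by rewrite cabs_real_pos; lra.
have Fq : frontier U (Phi t) by apply: (chart_real cP); [lra|].
have qp : Phi t != p.
  rewrite -(chart_center cP) -subr_eq0 -cabs_gt0.
  have [c0 c00 lip] := chart_lip cP.
  have := lip t 0; rewrite h2 cabs0 subr0 h2 => /(_ ltac:(lra) ltac:(lra)).
  have : 0 < c0 * (1/2) by apply: mulr_gt0; lra.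
  by lra.
have b0 := bd_gt0 cP Uz.
have [w Uw] := bd_vanish cP Fq qp b0.
by rewrite (gr0_constant oU cU sb g0 Uz Uw) ltxx.
Qed.

Lemma harm_away p Phi c r M : chart U p Phi -> away Phi c r M -> harm (cdisc c (r / 3)) (bd Phi).
Proof.
move=> cP aw; have [r0 _ _ _ _] := aw.
by apply: harm_sub (est_harm_disc (bd_est cP aw)) => z; rewrite /cdisc /odisc /=; lra.
Qed.

(** [odd_normal] is uniform in w on a disc, so interior estimates turn it into convergence of the
    gradients in w at rate |s|. *)
Lemma Gh_gr_limit p Phi c r M z s : chart U p Phi -> away Phi c r M -> cabs (z - c) < r / 6 ->
  cabs s < 1/2 -> 0 < complex.Im s ->
  cabs ((complex.Im s)^-1%:C * gr (fun w => Gh h w (Phi s)) z - gr (bd Phi) z) <=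
    CT * (4 * (CT * M) * cabs s) / (r / 3).
Proof.
move=> cP aw zc s1 sI; have [r0 M0 _ _ _] := aw.
have s0 : 0 < cabs s by have := cabs_Im s; rewrite ger0_norm; [lra|exact: ltW].
have E w : bE Phi w s = Gh h w (Phi s) by rewrite /bE oddx_up.
have hE : harm (cdisc c (r / 3)) (fun w => Gh h w (Phi s)).
  have := bE_harm cP aw (s := s) ltac:(lra); rewrite (funext E).
  by apply: harm_sub => w; rewrite /cdisc /=; lra.
have zr : cdisc c (r / 3) z by rewrite /cdisc /=; lra.
have <- : gr (fun w => (complex.Im s)^-1 * Gh h w (Phi s)) z =
    (complex.Im s)^-1%:C * gr (fun w => Gh h w (Phi s)) z.
  by apply: cgrad_gr; apply: cgradZ; exact: harm_cgrad hE zr.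
apply: (@gr_close R c (r / 3) (4 * (CT * M) * cabs s)).
- by lra.
- by have := mulr_gt0 (mulr_gt0 CT_gt0 M0) s0; lra.
- exact: harmZ.
- exact: harm_away cP aw.
- move=> w wc; rewrite -E; apply: (odd_normal _ _ M0 s1 sI).
  + by apply: (away_est cP aw); move: wc; rewrite /cdisc /=; lra.
  + exact: oddx_odd.
- by lra.
Qed.

Lemma bE_gr_limit p Phi c r M s (e : R[i]) : chart U p Phi -> away Phi c r M ->
  cabs s < 1/2 -> s != 0 -> cabs e = 1 ->
  cabs (gr (fun w => complex.Re (gr (bE Phi w) s * e)) c -
        gr (fun w => complex.Re (gr (bE Phi w) 0 * e)) c) <=
    CT * (2 * (CT * M) * cabs s) / (r / 3).
Proof.
move=> cP aw s1 s0 e1; have [r0 M0 _ _ _] := aw.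
have hE t : cabs t < 1/2 -> harm (cdisc c (r / 3)) (fun w => complex.Re (gr (bE Phi w) t * e)).
  move=> t1; apply: harm_sub (est_harm_disc (bE_gr_est cP aw t1 e1)) => w.
  by rewrite /cdisc /odisc /=; lra.
apply: (@gr_close R c (r / 3) (2 * (CT * M) * cabs s)).
- by lra.
- have : 0 < cabs s by rewrite cabs_gt0.
  by move=> /(mulr_gt0 (mulr_gt0 CT_gt0 M0)); lra.
- exact: hE.
- by apply: hE; rewrite cabs0; lra.
- move=> w wc.
  rewrite -ReN -ReD -mulNr -mulrDl; apply: le_trans (cabs_Re _) _.
  rewrite cabsM e1 mulr1; apply: (est_gr_lip _ M0 s1).
  by apply: (away_est cP aw); move: wc; rewrite /cdisc /=; lra.
- by rewrite subrr cabs0; lra.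
Qed.

End BoundaryExpansion.

(** * Critical points *)

Section CriticalPoints.
Context {R : realType} (U : set R[i]) (G : R[i] -> R[i] -> R) (h : R[i] -> R[i] -> R)
  (dU : domain U) (bU : bounded_set U) (hG : green_regular U G h)
  (fU : finitely_connected U) (aU : analytic_boundary U).
Implicit Types (z w s t c p q ze sg : R[i]) (u v : R[i] -> R) (Phi : R[i] -> R[i]) (r M d : R).

Let oU : open U. Proof. by case: dU. Qed.

(* (z - ze) times the gradient of the Green function: unlike the latter it is
   holomorphic at the pole ze, where it is equal to -1. *)
Definition kap ze z : R[i] := (z - ze) * gr (h ze) z - 1.

Definition crit ze z := U z /\ kap ze z = 0.

(** Only the nearby poles ze' are required to lie in U, so z and ze may be frontier points. *)
Definition crit_free z ze := exists2 d, 0 < d & forall z' ze', cabs (z' - z) < d ->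
  cabs (ze' - ze) < d -> U ze' -> ~ crit ze' z'.

Lemma h_cgrad ze z : U ze -> U z -> cgrad (h ze) z (gr (h ze) z).
Proof. by move=> /hG[H _ _ _] /H[]. Qed.

Lemma cgrad_ln_dist z ze : z != ze -> cgrad (fun w => ln (cabs (w - ze))) z (z - ze)^-1.
Proof.
move=> zz; have H : cder (fun w => w - ze) z 1.
  by have := cderD (cder_id z) (cder_cst (- ze) z); rewrite addr0.
rewrite -[_^-1]mulr1; apply: (cgrad_comp (u := fun w => ln (cabs w)) _ H).
by apply: cgrad_ln; rewrite subr_eq0.
Qed.

Lemma Gh_cgrad ze z : U ze -> U z -> z != ze ->
  cgrad (fun w => Gh h w ze) z (kap ze z / (z - ze)).
Proof.
move=> Uze Uz zz; have z0 : z - ze != 0 by rewrite subr_eq0.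
have := cgradD (h_cgrad Uze Uz) (cgradZ (-1) (cgrad_ln_dist zz)).
rewrite rmorphN rmorph1 mulN1r.
have -> : gr (h ze) z - (z - ze)^-1 = kap ze z / (z - ze).
  by rewrite /kap mulrBl mul1r mulrAC mulfV // mul1r.
by apply: cgrad_ext_near ltr01 _ => w _; rewrite mulN1r.
Qed.

Lemma crit_neq ze z : crit ze z -> z != ze.
Proof.
move=> [_ E]; apply/eqP => zz; move: E; rewrite zz /kap subrr mul0r sub0r => /eqP.
by rewrite oppr_eq0 oner_eq0.
Qed.

Lemma crit_cgrad ze z : U ze -> crit ze z -> cgrad (fun w => Gh h w ze) z 0.
Proof.
move=> Uze cz; have [Uz E] := cz; have := Gh_cgrad Uze Uz (crit_neq cz).
by rewrite E mul0r.
Qed.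

Lemma chart_cder p Phi s : chart U p Phi -> cabs s <= 1 -> cder Phi s (dc Phi s).
Proof.
move=> [hP _ _ _ _ _ _ _] s1; have [|l Hl] := hol2_cder hP (z := s).
  by rewrite /cdisc /= subr0.
by rewrite (cder_dc Hl).
Qed.

Lemma ucontK_chart (K : set R[i]) p Phi u : chart U p Phi ->
  ucontK K u -> (forall s, upper_disc s -> K (Phi s)) -> ucontK upper_disc (fun s => u (Phi s)).
Proof.
move=> cP cu KP s us e e0; have [d d0 dP] := cu (Phi s) (KP s us) e e0.
have [d' d'0 d'P] := chart_continuous cP us.1 d0.
by exists d' => // w uw ws; apply: dP; [exact: KP|exact: d'P].
Qed.

Lemma chart_closure p Phi s : chart U p Phi -> upper_disc s -> closure U (Phi s).
Proof.
move=> cP [s1]; rewrite le_eqVlt => /orP[/eqP sI|sI].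
  by have [] := (frontierE (Phi s) oU).1 (chart_real cP s1 (esym sI)).
by apply: subset_closure; exact: (chart_up cP s1 sI).
Qed.

Lemma chart_preimage_up p Phi s : chart U p Phi -> cabs s <= 1 -> U (Phi s) -> 0 < complex.Im s.
Proof.
move=> cP s1 Us; case: (ltrgtP (complex.Im s) 0) => // sI.
  by case: (chart_low cP s1 sI); exact: subset_closure.
by case: (not_frontier dU (chart_real cP s1 sI)).
Qed.

Lemma near_up s : 0 < complex.Im s -> exists2 d, 0 < d &
  forall w, cabs (w - s) < d -> 0 < complex.Im w.
Proof.
move=> sI; exists (complex.Im s); first exact: sI.
by move=> w ws; have := cabs_Im (w - s); rewrite ImD ImN ler_norml => /andP[]; lra.
Qed.

(** Here the chart straightens the boundary for the field point: near p the function Gh h (Phi t)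
    ze' is reflected, and a critical point would violate the lower bound of [oddx_hopf]. *)
Lemma crit_free_away p ze : frontier U p -> closure U ze -> ze != p -> crit_free p ze.
Proof.
move=> Fp cze zp; have n0 : 0 < cabs (ze - p) by rewrite cabs_gt0 subr_eq0.
set n := cabs (ze - p) in n0 *.
have [Phi cP Pn] := chart_exists dU fU aU Fp (e := n / 3) ltac:(lra).
have [de de0 deP] := chart_open cP (eta := 1/20) ltac:(lra).
have [dm d1 dmP] := closure_bound bU.
exists (Num.min de (n / 3)); first by rewrite lt_min de0 divr_gt0.
move=> z' ze'; rewrite !lt_min => /andP[/deP[s s1 sz] _] /andP[_ zz] Uze cr.
have Uz' : U z' by case: cr.
have far t : cabs t <= 1 -> n / 3 <= cabs (Phi t - ze').
  move=> /Pn Pt; have := cabs_tri ze ze' p; have := cabs_tri ze' (Phi t) p.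
  by rewrite (cabsB ze ze') (cabsB ze' (Phi t)) -/n; lra.
have ne t : cabs t <= 1 -> Phi t != ze'.
  by move=> /far H; apply/eqP => E; rewrite E subrr cabs0 in H; lra.
pose f t := Gh h (Phi t) ze'.
have s1' : cabs s <= 1 by lra.
have sI : 0 < complex.Im s by apply: (chart_preimage_up cP s1'); rewrite sz.
have M0 : 0 < `|ln (n / 3)| + `|ln dm| + 1.
  by have := normr_ge0 (ln (n / 3)); have := normr_ge0 (ln dm); lra.
have c1 : ucontK upper_disc (oddx f).
  apply: (ucontK_ext (u := f)).
    move=> t [t1]; rewrite le_eqVlt => /orP[/eqP tI|tI]; last by rewrite oddx_up.
    rewrite [oddx f t]oddx_real; last exact: esym tI.
    exact: (Gh_frontier hG Uze (chart_real cP t1 (esym tI))).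
  apply: (ucontK_chart cP (cont_Gh hG Uze)) => t ut.
  by split; [exact: (chart_closure cP ut)|exact: ne ut.1].
have c2 : harm [set t | half_disc t /\ t != 0] f.
  apply: (harm_comp (harm_Gh hG Uze)).
    by apply: hol2_sub (chart_hol cP) => t [[/ltW]]; rewrite /cdisc /= subr0.
  by move=> t [[/ltW t1 tI] _]; split; [exact: (chart_up cP t1 tI)|exact: ne].
have c3 t : cabs t = 1 -> 0 < complex.Im t -> 0 <= f t <= `|ln (n / 3)| + `|ln dm| + 1.
  move=> t1 tI; have t1' : cabs t <= 1 by rewrite t1.
  have ct : closure U (Phi t) by apply: (chart_closure cP); split => //; exact: ltW.
  apply/andP; split; first by apply: (Gh_ge0 dU bU hG Uze ct); exact: ne.
  by apply: (Gh_le dU bU hG _ dmP Uze ct (far t t1')); lra.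
have s20 : cabs s <= 1/20 by exact: ltW.
have := oddx_hopf M0 c1 c2 c3 s20.
have -> : gr (oddx f) s = 0.
  apply: cgrad_gr; rewrite -(mul0r (dc Phi s)).
  have [d d0 dP] := near_up sI.
  apply: (cgrad_ext_near (u := f) d0); first by move=> w /dP wI; rewrite oddx_up.
  apply: (cgrad_comp (u := fun w => Gh h w ze') _ (chart_cder cP s1')).
  by rewrite sz; exact: crit_cgrad.
have i2 : cabs (0 +i* (1/2) : R[i]) <= 1.
  by have := cabs_ReIm (0 +i* (1/2) : R[i]); rewrite /= normr0 ger0_norm; lra.
have iI : 0 < complex.Im (0 +i* (1/2) : R[i]) by rewrite /=; lra.
have := Gh_gt0 dU bU hG Uze (chart_up cP i2 iI) (ne _ i2).
by rewrite -/(f _) /=; lra.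
Qed.

Definition lower_lip (c0 : R) Phi := forall s s', cabs s <= 1 -> cabs s' <= 1 ->
  c0 * cabs (s - s') <= cabs (Phi s - Phi s').

Definition ratio Phi sg t := if t == sg then dc Phi sg else (Phi t - Phi sg) / (t - sg).

Lemma ratio_ge (c0 : R) Phi sg t : lower_lip c0 Phi -> cabs sg <= 1 -> cabs t <= 1 -> t != sg ->
  c0 <= cabs (ratio Phi sg t).
Proof.
move=> lip sg1 t1 ts; rewrite /ratio (negPf ts) cabsM cabsV ler_pdivlMr ?lip //.
by rewrite cabs_gt0 subr_eq0.
Qed.

Lemma lower_lip_neq0 (c0 : R) Phi sg t : 0 < c0 -> lower_lip c0 Phi -> cabs sg <= 1 ->
  cabs t <= 1 -> t != sg -> Phi t - Phi sg != 0.
Proof.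
move=> c00 lip sg1 t1 ts; rewrite -cabs_gt0; apply: lt_le_trans (lip _ _ t1 sg1).
by rewrite mulr_gt0 // cabs_gt0 subr_eq0.
Qed.

Lemma harm_ratio (c0 : R) Phi sg : 0 < c0 -> lower_lip c0 Phi -> hol2 (cdisc 0 1) Phi ->
  cabs sg <= 1 -> harm [set t | cabs t <= 1 /\ t != sg]
  (fun t => ln (cabs ((Phi t - Phi sg) / (t - sg)))).
Proof.
move=> c00 lip hP sg1; apply: harm_ln => [|t [t1 ts]]; last first.
  rewrite mulf_neq0 ?invr_eq0 ?subr_eq0 // -subr_eq0.
  exact: lower_lip_neq0 c00 lip sg1 t1 ts.
apply: hol2M.
  apply: hol2B; last exact: hol2_cst.
  by apply: hol2_sub hP => t []; rewrite /cdisc /= subr0.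
apply: hol2V; first by apply: hol2B; [exact: hol2_id|exact: hol2_cst].
by move=> t [_]; rewrite subr_eq0.
Qed.

Lemma ucontK_ln_ratio (m : R) Phi sg : 0 < m -> lower_lip m Phi -> hol2 (cdisc 0 1) Phi ->
  cabs sg < 1 -> ucontK (cdisc 0 1) (fun t => ln (cabs (ratio Phi sg t))).
Proof.
move=> m0 lip hP sg1' t; rewrite /cdisc /= subr0 => t1 e e0.
have sg1 : cabs sg <= 1 by exact: ltW.
have [->|ts] := eqVneq t sg; last first.
  have [d d0 dP] := cgrad_cont (harm_cgrad (harm_ratio m0 lip hP sg1) (conj t1 ts)) e0.
  exists (Num.min d (cabs (t - sg))); first by rewrite lt_min d0 cabs_gt0 subr_eq0.
  move=> w _; rewrite lt_min => /andP[wd wt].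
  have ws : w != sg by apply/eqP => E; rewrite E cabsB ltxx in wt.
  by rewrite /ratio (negPf ts) (negPf ws); exact: dP.
set l := dc Phi sg.
have app e1 : 0 < e1 -> exists2 d, 0 < d & forall w, w != sg -> cabs (w - sg) < d ->
    cabs (ratio Phi sg w - l) <= e1.
  have [|l' Hl] := hol2_cder hP (z := sg); first by rewrite /cdisc /= subr0.
  rewrite /l (cder_dc Hl) => e10.
  have [d d0 dP] := Hl _ e10; exists d => // w ws wd.
  have w0 : 0 < cabs (w - sg) by rewrite cabs_gt0 subr_eq0.
  have := dP (w - sg) wd; rewrite (addrC sg) subrK => H.
  rewrite -(ler_pM2r w0) -cabsM mulrBl /ratio (negPf ws) divfK //.
  by rewrite subr_eq0.
(* The derivative inherits a lower bound from the difference quotient at a nearby point sg + k of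
   the disc. *)
have l0 : m / 2 <= cabs l.
  have [d d0 dP] := app (m / 2) ltac:(lra).
  pose k := Num.min (d / 2) (1 - cabs sg).
  have k0 : 0 < k by rewrite lt_min divr_gt0 // subr_gt0.
  have kd : k <= d / 2 by rewrite ge_min lexx.
  have k4 : k <= 1 - cabs sg by rewrite ge_min lexx orbT.
  clearbody k.
  have kE : cabs (sg + k%:C - sg) = k by rewrite addrC addKr cabs_real_pos.
  have ks : sg + k%:C != sg by rewrite -subr_eq0 -cabs_gt0 kE.
  have kk : cabs (sg + k%:C) <= 1 by have := cabsD sg k%:C; rewrite cabs_real_pos //; lra.
  have := ratio_ge lip sg1 kk ks; have := dP _ ks; rewrite kE => /(_ ltac:(lra)).
  by have := cabs_subr (ratio Phi sg (sg + k%:C)) l; lra.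
have ec : 0 < e * (m / 2) / 2 by rewrite !mulr_gt0 ?invr_gt0.
have [d d0 dP] := app _ ec; exists d => // w; rewrite /cdisc /= subr0 => w1 wd.
have [->|ws] := eqVneq w sg; first by rewrite subrr normr0.
have c2 : 0 < m / 2 by lra.
have Qs : ratio Phi sg sg = l by rewrite /ratio eqxx.
apply: le_lt_trans (ln_lip c2 _ _) _.
- by have := ratio_ge lip sg1 w1 ws; lra.
- by rewrite Qs.
- rewrite ltr_pdivrMr // Qs; apply: le_lt_trans (lip_cabs _ _) _.
  apply: le_lt_trans (dP w ws wd) _.
  have : 0 < e * (m / 2) by rewrite mulr_gt0.
  by lra.
Qed.

(** Reflection in the pole variable makes the Green function O(Im sg). The chart is halved so that
    its image keeps the distance c0 / 2 from Phi s with |s| = 1. *)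
Lemma Gh_collision_bound p Phi (c0 : R) : chart U p Phi -> 0 < c0 -> lower_lip c0 Phi ->
  exists2 B, 0 < B & forall s sg, cabs s = 1 -> 0 < complex.Im s ->
  cabs sg < 1/4 -> 0 < complex.Im sg -> `|Gh h (Phi s) (Phi sg)| <= B * complex.Im sg.
Proof.
move=> cP c00 lip; have [dm d1 dmP] := closure_bound bU.
have k0 : 0 < (1/2 : R) by lra.
have k1 : (1/2 : R) <= 1 by lra.
have cPk := chart_scale k0 k1 cP.
set M := `|ln (c0 / 2)| + `|ln dm| + 1.
have M0 : 0 < M.
  by rewrite /M; have := normr_ge0 (ln (c0 / 2)); have := normr_ge0 (ln dm); lra.
have B0 : 0 < CT * M by rewrite mulr_gt0 ?CT_gt0.
exists (4 * (CT * M)); first lra.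
move=> s sg s1 sI sg1 sgI; have s1' : cabs s <= 1 by rewrite s1.
have half t : cabs t <= 1 -> cabs ((1/2 : R)%:C * t) <= 1/2.
  by rewrite cabsM cabs_real_pos //; lra.
have Us := chart_up cP s1' sI.
have far (x : R[i]) : cabs x <= 1/2 -> c0 / 2 <= cabs (Phi s - Phi x).
  move=> t2; have x1 : cabs x <= 1 by lra.
  apply: le_trans (lip _ _ s1' x1); rewrite ler_pM2l //.
  by apply: le_trans (cabs_subr s x); rewrite s1; lra.
have H : est 0 1 M (bE h (fun t => Phi ((1/2 : R)%:C * t)) (Phi s)).
  apply: (bE_est dU bU hG fU aU cPk (subset_closure Us) _ M0).
  - move=> t /half/far E; apply/eqP => E2; move: E.
    by rewrite E2 subrr cabs0 leNgt divr_gt0.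
  - move=> t t1 tI; have t1' : cabs t <= 1 by rewrite t1.
    by apply: (Gh_le dU bU hG _ dmP (chart_up cPk t1' tI) (subset_closure Us) (far _ (half t t1'))); exact: divr_gt0.
have s2 : cabs ((2 : R)%:C * sg) < 1/2 by rewrite cabsM cabs_real_pos; lra.
have I2 : complex.Im ((2 : R)%:C * sg) = 2 * complex.Im sg by rewrite ImM /= mul0r addr0.
have := odd_bound H (oddx_odd _) M0 s2.
rewrite I2 /bE oddx_up; last by rewrite I2; lra.
rewrite (_ : (1/2 : R)%:C * ((2 : R)%:C * sg) = sg); last first.
  by rewrite mulrA -rmorphM (_ : 1 / 2 * 2 = 1 :> R) ?mul1r //; field.
rewrite (@ger0_norm _ (2 * _)); last by lra.
by lra.
Qed.

(** Subtracting the half plane Green function ln |t - conj sg| - ln |t - sg| leaves H0, which is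
    reflected and has gradient O(Im sg). At a critical point the gradient of H0 is (sg - conj sg) /
    ((s - sg) (s - conj sg)), and Im sg cancels. *)
Lemma collision_gr p Phi (c0 B : R) sg s : chart U p Phi -> 0 < c0 -> lower_lip c0 Phi ->
  cabs sg < 1/4 -> 0 < complex.Im sg -> 0 < B ->
  (forall s, cabs s = 1 -> 0 < complex.Im s -> `|Gh h (Phi s) (Phi sg)| <= B * complex.Im sg) ->
  cabs s < 1/2 -> 0 < complex.Im s -> s != sg ->
  cgrad (fun w => Gh h w (Phi sg)) (Phi s) 0 ->
  2 <= CT * (B + 4) * (cabs (s - sg) * cabs (s - conjc sg)).
Proof.
move=> cP c00 lip sg4 sgI B0 GB s2 sI ss g0; have s1 : cabs s <= 1 by lra.
have sg1 : cabs sg <= 1 by lra.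
have sg1' : cabs sg < 1 by lra.
have Usg : U (Phi sg) by exact: (chart_up cP sg1 sgI).
have conj_neq t : 0 <= complex.Im t -> t != conjc sg.
  by move=> tI; apply/eqP => E; move: tI; rewrite E Im_conj; lra.
have upn t : 0 < complex.Im t -> t != conjc sg by move=> /ltW; exact: conj_neq.
(* Written with [ratio], H0 is continuous at sg, where the two logarithmic poles cancel; sg is then
   the exceptional point of the reflection. *)
pose H0 t := h (Phi sg) (Phi t) - ln (cabs (ratio Phi sg t)) - ln (cabs (t - conjc sg)).
have H0E t : cabs t <= 1 -> t != sg ->
    H0 t = Gh h (Phi t) (Phi sg) + (ln (cabs (t - sg)) - ln (cabs (t - conjc sg))).
  move=> t1 ts; rewrite /H0 /ratio (negPf ts) cabsM cabsV.
  rewrite ln_div ?posrE ?cabs_gt0 ?subr_eq0 //; last first.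
    by rewrite -subr_eq0; exact: (lower_lip_neq0 c00 lip sg1 t1 ts).
  by rewrite /Gh; ring.
have M0 : 0 < (B + 4) * complex.Im sg by rewrite mulr_gt0 //; lra.
have c1 : ucontK upper_disc (oddx H0).
  apply: (ucontK_ext (u := H0)).
    move=> t [t1]; rewrite le_eqVlt => /orP[/eqP tI|tI]; last by rewrite oddx_up.
    have ts : t != sg by apply/eqP => E; move: sgI; rewrite -E -tI ltxx.
    rewrite [oddx _ t]oddx_real; last exact: esym tI.
    rewrite H0E //.
    rewrite (Gh_frontier hG Usg (chart_real cP t1 (esym tI))) add0r.
    rewrite (_ : t - conjc sg = conjc (t - sg)) ?cabs_conj ?subrr //.
    rewrite rmorphB /=; congr (_ - _); case: (t) tI => a b /= <-; by rewrite oppr0.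
  apply: ucontKB; first apply: ucontKB.
  - apply: (ucontK_chart cP (h_cont hG Usg)) => t; exact: (chart_closure cP).
  - by apply: ucontK_sub (ucontK_ln_ratio c00 lip (chart_hol cP) sg1') => t [t1 _]; rewrite /cdisc /= subr0.
  - apply: (harm_ucontK (V := upper_disc)) => //.
    by apply: harm_ln_dist => t [_]; exact: conj_neq.
have c2 : harm [set t | half_disc t /\ t != sg] H0.
  apply: (harm_ext (u := fun t => h (Phi sg) (Phi t) -
      ln (cabs ((Phi t - Phi sg) / (t - sg))) - ln (cabs (t - conjc sg)))).
  - exact: open_half_disc.
  - by move=> t [_ ts]; rewrite /H0 /ratio (negPf ts).
  apply: harmB; first apply: harmB.
  - apply: (harm_comp (V := U)).
    + by apply: smooth_harm; have [] := hG Usg.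
    + by apply: hol2_sub (chart_hol cP) => t [[/ltW]]; rewrite /cdisc /= subr0.
    + by move=> t [[/ltW t1 tI] _]; exact: (chart_up cP t1 tI).
  - by apply: harm_sub (harm_ratio c00 lip (chart_hol cP) sg1) => t [[/ltW t1 _] ts].
  - by apply: harm_ln_dist => t [[_ tI] _]; exact: upn.
have sgD : sg - conjc sg = 'i%C * (2 * complex.Im sg)%:C.
  by case: (sg) => a b; apply: complex_ext; rewrite /=; ring.
have sgC : cabs (sg - conjc sg) = 2 * complex.Im sg.
  by rewrite sgD cabsM cabsi mul1r cabs_real_pos //; lra.
(* The distances from t to sg and to its conjugate differ by at most 2 Im sg and are at least 1/2,
   whence the 4. *)
have c3 t : cabs t = 1 -> 0 < complex.Im t -> `|H0 t| <= (B + 4) * complex.Im sg.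
  move=> t1 tI; have ts : t != sg by apply/eqP => E; rewrite E in t1; lra.
  rewrite H0E ?t1 //; apply: le_trans (ler_normD _ _) _.
  have k1 : 1/2 <= cabs (t - sg) by have := cabs_subr t sg; lra.
  have k2 : 1/2 <= cabs (t - conjc sg) by have := cabs_subr t (conjc sg); rewrite cabs_conj; lra.
  have := ln_lip (m := 1/2) ltac:(lra) k1 k2.
  have := lip_cabs (t - sg) (t - conjc sg).
  rewrite (_ : t - sg - (t - conjc sg) = - (sg - conjc sg)) ?cabsN ?sgC; last by ring.
  by have := GB t t1 tI; lra.
have s0 : cabs (s - 0) < 1/2 by rewrite subr0.
have [_ g1 _ _] := oddx_est M0 c1 c2 c3 s0.
move: g1; have -> : gr (oddx H0) s = (s - sg)^-1 - (s - conjc sg)^-1.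
  apply: cgrad_gr.
  have [d d0 dP] := near_up sI.
  have e0 : 0 < Num.min (Num.min d (cabs (s - sg))) (1/2).
    by rewrite !lt_min d0 cabs_gt0 subr_eq0 ss; lra.
  have gG : cgrad (fun t => Gh h (Phi t) (Phi sg)) s 0.
    rewrite -(mul0r (dc Phi s)).
    exact: (cgrad_comp (u := fun w => Gh h w (Phi sg)) g0 (chart_cder cP s1)).
  have := cgradD gG (cgradD (cgrad_ln_dist ss) (cgradZ (-1) (cgrad_ln_dist (upn s sI)))).
  rewrite add0r rmorphN rmorph1 mulN1r; apply: (cgrad_ext_near e0) => w.
  rewrite !lt_min => /andP[/andP[/dP wI ws] w2].
  rewrite oddx_up // H0E ?mulN1r //.
    by have := cabs_subr w s; lra.
  by apply/eqP => E; rewrite E cabsB ltxx in ws.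
have n1 : s - sg != 0 by rewrite subr_eq0.
have n2 : s - conjc sg != 0 by rewrite subr_eq0 upn.
have -> : (s - sg)^-1 - (s - conjc sg)^-1 = (sg - conjc sg) / ((s - sg) * (s - conjc sg)).
  by field; rewrite n1 n2.
rewrite cabsM cabsV cabsM sgC divr1 ler_pdivrMr; last by rewrite mulr_gt0 ?cabs_gt0.
set X := cabs _ * cabs _.
have -> : CT * ((B + 4) * complex.Im sg) * X = (CT * (B + 4) * X) * complex.Im sg by ring.
by rewrite ler_pM2r.
Qed.

Lemma crit_free_collision p : frontier U p -> crit_free p p.
Proof.
move=> Fp; have [Phi cP _] := chart_exists dU fU aU Fp ltr01.
have [c0 c00 lip] := chart_lip cP.
have [B B0 GB] := Gh_collision_bound cP c00 lip.
pose C := CT * (B + 4).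
have C0 : 0 < C by rewrite mulr_gt0 ?CT_gt0 //; lra.
(* Then |s - sg| <= 2 eta and |s - conj sg| <= 1/2, and [collision_gr] would give 2 <= C eta <=
   1. *)
pose eta := Num.min (1/4) C^-1.
have e0 : 0 < eta by rewrite lt_min invr_gt0 C0 andbT; lra.
have e4 : eta <= 1/4 by rewrite ge_min lexx.
have eC : C * eta <= 1.
  by rewrite mulrC -ler_pdivlMr // mul1r ge_min lexx orbT.
have [d d0 dP] := chart_open cP e0.
exists d; first exact: d0.
move=> z' ze' /dP[s s1 <-] /dP[sg sg1 <-] Usg cr.
have Us : U (Phi s) by case: cr.
have sI : 0 < complex.Im s by apply: (chart_preimage_up cP _ Us); lra.
have sgI : 0 < complex.Im sg by apply: (chart_preimage_up cP _ Usg); lra.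
have ss : s != sg by apply/eqP => E; have := crit_neq cr; rewrite E eqxx.
have sg4 : cabs sg < 1/4 by lra.
have := collision_gr cP c00 lip sg4 sgI B0 (fun t ht hI => GB t sg ht hI sg4 sgI) _ sI ss
  (crit_cgrad Usg cr).
move=> /(_ ltac:(lra)); rewrite -/C.
have a1 : cabs (s - sg) <= 2 * eta.
  by have := cabsD s (- sg); rewrite cabsN; lra.
have a2 : cabs (s - conjc sg) <= 1/2.
  by have := cabsD s (- conjc sg); rewrite cabsN cabs_conj; lra.
have : cabs (s - sg) * cabs (s - conjc sg) <= 2 * eta * (1/2) by rewrite ler_pM ?cabs_ge0.
by rewrite -(ler_pM2l C0); lra.
Qed.

Lemma crit_free_frontier p ze : frontier U p -> closure U ze -> crit_free p ze.
Proof.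
move=> Fp cze; have [->|zp] := eqVneq ze p; first exact: crit_free_collision.
exact: crit_free_away.
Qed.

End CriticalPoints.

Section Hurwitz.
Context {R : realType}.
Implicit Types (z w c : R[i]) (f g : R[i] -> R[i]).

(** A zero free g close to f would satisfy |g w|^3 <= (M + 1)^2 |g c| by [zero_free_small]; but g c
    is close to f c = 0 and g w is close to f w. The tolerance e precedes g, so it serves a whole
    family. *)
Lemma hurwitz c (r : R) f : 0 < r -> hol2 (cdisc c r) f -> f c = 0 ->
  (exists2 w, cdisc c (r / 2) w & f w != 0) ->
  exists2 e : R, 0 < e & forall g, hol2 (cdisc c r) g ->
    (forall z, cdisc c r z -> cabs (g z - f z) <= e) -> exists2 z, cdisc c r z & g z = 0.
Proof.
move=> r0 hf fc [w wc fw]; have [M M0 fM] := hol2_bounded hf.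
set a := cabs (f w); have a0 : 0 < a by rewrite cabs_gt0.
have M2 : 0 < (M + 1) ^+ 2 by rewrite exprn_gt0 //; lra.
(* Then (M + 1)^2 b = a^3 / 16 is less than (a / 2)^3. *)
pose b := a ^+ 3 / (16 * (M + 1) ^+ 2).
have a3 : 0 < a ^+ 3 by rewrite exprn_gt0.
have b0 : 0 < b by rewrite divr_gt0 // mulr_gt0.
pose e := Num.min (Num.min 1 (a / 2)) b.
have e0 : 0 < e by rewrite !lt_min ltr01 divr_gt0.
have e1 : e <= 1 by rewrite !ge_min lexx.
have ea : e <= a / 2 by rewrite !ge_min lexx orbT.
have eb : e <= b by rewrite !ge_min lexx orbT.
exists e; first exact: e0.
move=> g hg gf; apply: contrapT => nz.
have gz z : cdisc c r z -> g z != 0 by move=> zc; apply/eqP => gz; apply: nz; exists z.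
have cc : cdisc c r c by apply: cdisc_center; exact: ltW.
have wc' : cdisc c r w by move: wc; rewrite /cdisc /=; lra.
have gM z : cdisc c r z -> cabs (g z) <= M + 1.
  move=> zc; have := cabs_subr (g z) (f z); have := gf z zc; have := fM z zc.
  by lra.
have H := zero_free_small r0 hg gz gM wc.
have gc : cabs (g c) <= e by have := gf c cc; rewrite fc subr0.
have gw : a / 2 <= cabs (g w).
  by have := cabs_subr (f w) (g w); rewrite cabsB -/a; have := gf w wc'; lra.
have h1 : (a / 2) ^+ 3 <= cabs (g w) ^+ 3.
  by rewrite lerXn2r ?nnegrE ?cabs_ge0 //; lra.
have h2 : (M + 1) ^+ 2 * cabs (g c) <= (M + 1) ^+ 2 * b by rewrite ler_pM2l //; lra.
have h3 : (M + 1) ^+ 2 * b = a ^+ 3 / 16 by rewrite /b; field; rewrite lt0r_neq0 //; lra.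
have h4 : (a / 2) ^+ 3 = a ^+ 3 / 8 by field.
by lra.
Qed.

End Hurwitz.

(** * Persistence of critical points as the pole moves *)

Section CriticalPersistence.
Context {R : realType} (U : set R[i]) (G : R[i] -> R[i] -> R) (h : R[i] -> R[i] -> R)
  (dU : domain U) (bU : bounded_set U) (hG : green_regular U G h)
  (fU : finitely_connected U) (aU : analytic_boundary U).
Implicit Types (z w s c p ze : R[i]) (Phi : R[i] -> R[i]) (r M d : R).

Let oU : open U. Proof. by case: dU. Qed.

Lemma kap_hol2 ze : U ze -> hol2 U (kap h ze).
Proof.
move=> /hG[H _ _ _]; apply: hol2B; last exact: hol2_cst.
apply: hol2M; last exact: smooth_hol2.
by apply: hol2B; [exact: hol2_id|exact: hol2_cst].
Qed.

Lemma kap_nonzero ze c r : U ze -> U c -> 0 < r -> exists2 w, cabs (w - c) < r & kap h ze w != 0.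
Proof.
move=> Uze Uc r0; apply: contrapT => H.
have {}H w : cabs (w - c) < r -> kap h ze w = 0.
  by move=> wc; apply/eqP/negPn/negP => nz; apply: H; exists w.
have cU : connected U by case: dU.
have /eqP := identity_theorem oU cU (kap_hol2 Uze) Uc r0 H Uze.
by rewrite /kap subrr mul0r sub0r oppr_eq0 oner_eq0.
Qed.

Lemma kap_close ze c r : U ze -> 0 < r -> (forall w, cdisc c (3 * r) w -> U w) ->
  exists C d, [/\ 0 < C, 0 < d & forall ze' z, U ze' -> cabs (ze' - ze) < d -> cdisc c r z ->
    cabs (kap h ze' z - kap h ze z) <= C * cabs (ze' - ze)].
Proof.
move=> Uze r0 cU; have [dm d1 dmP] := closure_bound bU.
have [m m0 mU] := (openC U).1 oU ze Uze.
have r30 : 0 < 3 * r by lra.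
have hh v : U v -> harm (cdisc c (3 * r)) (h v).
  by move=> /hG[H _ _ _]; apply: harm_sub (smooth_harm H).
have hg : hol2 (cdisc c r) (gr (h ze)).
  have [H _ _ _] := hG Uze; apply: hol2_sub (smooth_hol2 H) => w wc.
  by apply: cU; move: wc; rewrite /cdisc /=; lra.
have [N N0 gN] := hol2_bounded hg.
pose K := CT / (m / 2) / (3 * r).
have K0 : 0 < K by rewrite !divr_gt0 ?CT_gt0.
exists (dm * K + N), (m / 2); split.
- by rewrite addr_gt0 // mulr_gt0 //; lra.
- by rewrite divr_gt0.
move=> ze' z Uze' zz zc.
have far w : frontier U w -> m / 2 <= cabs (w - ze') /\ m / 2 <= cabs (w - ze).
  move=> Fw; have nw := not_frontier dU Fw.
  have wm : m <= cabs (w - ze) by rewrite leNgt; apply/negP => /mU.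
  by have := cabs_tri w ze' ze; split; lra.
have m20 : 0 < m / 2 by rewrite divr_gt0.
have lip w : closure U w -> `|h ze' w - h ze w| <= cabs (ze' - ze) / (m / 2).
  exact: (h_lip_pole dU bU hG m20 Uze' Uze far).
have g1 : cabs (gr (h ze') z - gr (h ze) z) <= K * cabs (ze' - ze).
  have [->|ne] := eqVneq ze' ze; first by rewrite !subrr cabs0 mulr0.
  have q0 : 0 < cabs (ze' - ze) / (m / 2) by rewrite divr_gt0 // cabs_gt0 subr_eq0.
  have zc3 : cabs (z - c) < 3 * r / 2 by move: zc; rewrite /cdisc /=; lra.
  apply: le_trans (gr_close r30 q0 (hh _ Uze') (hh _ Uze) _ zc3) _.
    by move=> w /cU /subset_closure; exact: lip.
  rewrite le_eqVlt; apply/orP; left; apply/eqP; rewrite /K; field.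
  by rewrite !lt0r_neq0.
have Uz : U z by apply: cU; move: zc; rewrite /cdisc /=; lra.
have -> : kap h ze' z - kap h ze z =
    (z - ze') * (gr (h ze') z - gr (h ze) z) - (ze' - ze) * gr (h ze) z.
  by rewrite /kap; ring.
apply: le_trans (cabsD _ _) _; rewrite cabsN [X in _ <= X]mulrDl lerD //.
  rewrite -mulrA; apply: cabsM_le g1.
  exact: dmP (subset_closure Uz) (subset_closure Uze').
by rewrite mulrC; apply: cabsM_le => //; exact: gN.
Qed.

Lemma disc_in c : U c -> exists2 r, 0 < r & forall w, cdisc c (3 * r) w -> U w.
Proof.
move=> Uc; have [e e0 eU] := (openC U).1 oU c Uc; exists (e / 4); first by rewrite divr_gt0.
by move=> w; rewrite /cdisc /= => wc; apply: eU; lra.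
Qed.

Lemma crit_free_interior z ze : U z -> U ze -> kap h ze z != 0 -> crit_free U h z ze.
Proof.
move=> Uz Uze k0; have [r r0 rU] := disc_in Uz.
have [C [d [C0 d0 H]]] := kap_close Uze r0 rU.
set a := cabs (kap h ze z); have a0 : 0 < a by rewrite cabs_gt0.
have [l Hl] := hol2_cder (kap_hol2 Uze) Uz.
have [d' d'0 d'P] := cder_cont Hl (e := a / 2) ltac:(lra).
pose e := Num.min (Num.min r d') (Num.min d (a / (4 * C))).
have e0 : 0 < e by rewrite !lt_min r0 d'0 d0 divr_gt0 // mulr_gt0.
exists e; first exact: e0.
move=> z' ze'; rewrite !lt_min => /andP[/andP[zr zd] _] /andP[_ /andP[zed zeC]] Uze' [_ E].
have zc : cdisc z r z' by exact: ltW.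
have := H ze' z' Uze' zed zc; rewrite E sub0r cabsN.
have := d'P z' zd; have := cabs_subr (kap h ze z) (kap h ze z'); rewrite (cabsB (kap h ze z) _) -/a.
have : C * cabs (ze' - ze) < a / 4.
  by move: zeC; rewrite ltr_pdivlMr ?mulr_gt0 // => zeC; lra.
by lra.
Qed.

Lemma Gh_hol2 p Phi c r M s : chart U p Phi -> away U h Phi c r M -> cabs s <= 1 ->
  0 < complex.Im s -> hol2 (odisc c r) (gr (fun w => Gh h w (Phi s))).
Proof.
move=> cP [r0 M0 aw1 aw2 _] s1 sI; apply: smooth_hol2.
apply: (harm_smooth (@open_odisc R c r)).
apply: harm_sub (harm_Gh hG (chart_up cP s1 sI)) => w /odisc_sub_cdisc wc.
by split; [exact: aw1|rewrite eq_sym aw2].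
Qed.

(** At a critical point for the pole Phi s, [Gh_gr_limit] bounds the gradient of [bd] by a multiple
    of |s|, against its nonzero value at c. *)
Lemma crit_free_boundary p Phi c r M : chart U p Phi -> away U h Phi c r M ->
  gr (bd h Phi) c != 0 -> crit_free U h c p.
Proof.
move=> cP aw b0; have [r0 M0 aw1 aw2 aw3] := aw.
have cc : cdisc c r c by apply: cdisc_center; exact: ltW.
have sb := smooth_hol2 (bd_smooth dU bU hG fU aU cP).
have [l Hl] := hol2_cder sb (aw1 c cc).
set a := cabs (gr (bd h Phi) c); have a0 : 0 < a by rewrite cabs_gt0.
have [d d0 dP] := cder_cont Hl (e := a / 2) ltac:(lra).
pose K := CT * (4 * (CT * M)) / (r / 3).
have K0 : 0 < K.
  have := mulr_gt0 (CT_gt0 (R := R)) M0 => CM.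
  by apply: divr_gt0; [apply: mulr_gt0; [exact: CT_gt0|lra]|lra].
pose eta := Num.min (1/2) (a / (4 * K)).
have eta0 : 0 < eta by rewrite lt_min; apply/andP; split; apply: divr_gt0 => //; apply: mulr_gt0.
have eta1 : eta <= 1/2 by rewrite ge_min lexx.
have K4 : 0 < 4 * K by apply: mulr_gt0.
have etaK : eta * (4 * K) <= a by rewrite -ler_pdivlMr // ge_min lexx orbT.
have [e e0 eP] := chart_open cP eta0.
exists (Num.min e (Num.min d (r / 6))); first by rewrite !lt_min e0 d0 divr_gt0.
move=> z' ze'; rewrite !lt_min => /andP[_ /andP[zd zr]] /andP[/eP[s s1 <-] _] Us cr.
have s2 : cabs s < 1/2 by lra.
have s1' : cabs s <= 1 by lra.
have sI : 0 < complex.Im s by exact: (chart_preimage_up dU cP s1' Us).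
have := Gh_gr_limit dU bU hG fU aU cP aw zr s2 sI.
rewrite (cgrad_gr (crit_cgrad hG Us cr)) mulr0 sub0r cabsN.
have -> : CT * (4 * (CT * M) * cabs s) / (r / 3) = K * cabs s by rewrite /K; ring.
have h1 : a - cabs (gr (bd h Phi) z') <= cabs (gr (bd h Phi) z' - gr (bd h Phi) c).
  by rewrite cabsB; exact: cabs_subr.
have h2 := dP z' zd.
have h3 : K * cabs s <= K * eta by rewrite (ler_pM2l K0); exact: ltW.
clear - h1 h2 h3 etaK a0; lra.
Qed.

(** Divided by Im s, the gradients tend to that of [bd] instead of 0, at a rate depending on |s|
    alone, so Hurwitz's theorem applies to all poles near p at once. *)
Lemma crit_near p Phi c r M (e : R) : chart U p Phi -> away U h Phi c r M ->
  gr (bd h Phi) c = 0 -> 0 < e ->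
  exists2 d, 0 < d & forall ze, U ze -> cabs (ze - p) < d ->
    exists2 z, crit U h ze z & cabs (z - c) <= e.
Proof.
move=> cP aw b0 e0; have [r0 M0 aw1 aw2 aw3] := aw.
have cc : cdisc c r c by apply: cdisc_center; exact: ltW.
have sb := smooth_hol2 (bd_smooth dU bU hG fU aU cP).
pose r1 := Num.min e (r / 12).
have r10 : 0 < r1 by rewrite lt_min e0 divr_gt0.
have r1e : r1 <= e by rewrite ge_min lexx.
have r1r : r1 <= r / 12 by rewrite ge_min lexx orbT.
have hb : hol2 (cdisc c r1) (gr (bd h Phi)).
  by apply: hol2_sub sb => w wc; apply: aw1; move: wc; rewrite /cdisc /=; lra.
have nz : exists2 w, cdisc c (r1 / 2) w & gr (bd h Phi) w != 0.
  have [|w wc w0] := bd_gr_nonzero dU bU hG fU aU (r := r1 / 2) cP (aw1 c cc).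
    by rewrite divr_gt0.
  by exists w => //; exact: ltW.
have [ep ep0 hur] := hurwitz r10 hb b0 nz.
pose K := CT * (4 * (CT * M)) / (r / 3).
have K0 : 0 < K.
  have := mulr_gt0 (CT_gt0 (R := R)) M0 => CM.
  by apply: divr_gt0; [apply: mulr_gt0; [exact: CT_gt0|lra]|lra].
pose eta := Num.min (1/2) (ep / K).
have eta0 : 0 < eta by rewrite lt_min; apply/andP; split; exact: divr_gt0.
have eta1 : eta <= 1/2 by rewrite ge_min lexx.
have etaK : eta * K <= ep by rewrite -ler_pdivlMr // ge_min lexx orbT.
have [d d0 dP] := chart_open cP eta0.
exists d; first exact: d0.
move=> ze Uze /dP[s s1 sE]; rewrite -sE in Uze *.
have s2 : cabs s < 1/2 by lra.
have s1' : cabs s <= 1 by lra.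
have sI : 0 < complex.Im s by exact: (chart_preimage_up dU cP s1' Uze).
have [||z zc gz] := hur (fun z => (complex.Im s)^-1%:C * gr (fun w => Gh h w (Phi s)) z).
- apply: hol2Z; apply: hol2_sub (Gh_hol2 cP aw s1' sI) => w.
  by rewrite /cdisc /odisc /=; lra.
- move=> z zc; have zc6 : cabs (z - c) < r / 6 by move: zc; rewrite /cdisc /=; lra.
  apply: le_trans (Gh_gr_limit dU bU hG fU aU cP aw zc6 s2 sI) _.
  have -> : CT * (4 * (CT * M) * cabs s) / (r / 3) = K * cabs s by rewrite /K; ring.
  have : K * cabs s <= K * eta by rewrite ler_pM2l //; lra.
  by lra.
have zr : cdisc c r z by move: zc; rewrite /cdisc /=; lra.
have zs : z != Phi s by rewrite eq_sym aw2.
exists z; last by move: zc; rewrite /cdisc /=; lra.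
split; first exact: aw1.
have := cgrad_gr (Gh_cgrad hG Uze (aw1 z zr) zs).
move: gz => /eqP; rewrite mulf_eq0.
have -> : ((complex.Im s)^-1%:C == 0 :> R[i]) = false.
  by apply/negbTE; rewrite -cabs_gt0 cabs_real_pos invr_gt0.
move=> /eqP -> /esym/eqP; rewrite mulf_eq0 invr_eq0 (subr_eq0 z) (negPf zs) orbF.
by move=> /eqP.
Qed.

Lemma crit_free_uniform (K : set R[i]) ze : compact K ->
  (forall z, K z -> crit_free U h z ze) ->
  exists2 d, 0 < d & forall ze' z, U ze' -> cabs (ze' - ze) < d -> K z -> ~ crit U h ze' z.
Proof.
move=> cK H.
have [] := @compact_uniform R K (fun d z => forall ze', U ze' -> cabs (ze' - ze) < d ->
  ~ crit U h ze' z) cK.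
- by move=> d d' z d0 dd P ze' Uze' zd; apply: P => //; lra.
- move=> z /H[d d0 dP]; exists d => // w Kw wz ze' Uze' zd.
  exact: dP.
- by move=> d d0 dP; exists d => // ze' z Uze' zd Kz; exact: dP.
Qed.

Lemma crit_all ze0 z0 : U ze0 -> crit U h ze0 z0 -> forall ze, U ze -> exists z, crit U h ze z.
Proof.
move=> Uze0 cr0; have cU : connected U by case: dU.
pose A := [set ze | U ze /\ exists z, crit U h ze z].
suff H : forall ze, U ze -> A ze by move=> ze /H[].
apply: (connected_clopen cU) => [v []//| | |ze Uze H].
- by exists ze0; split => //; exists z0.
- apply/openC => ze [Uze [z [Uz kz]]].
  have [r r0 rU] := disc_in Uz.
  have [C [d [C0 d0 cl]]] := kap_close Uze r0 rU.
  have rU1 w : cdisc z r w -> U w by move=> wz; apply: rU; move: wz; rewrite /cdisc /=; lra.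
  have kh v : U v -> hol2 (cdisc z r) (kap h v).
    by move=> Uv; apply: hol2_sub (kap_hol2 Uv).
  have nz : exists2 w, cdisc z (r / 2) w & kap h ze w != 0.
    have [|w wz w0] := kap_nonzero Uze Uz (r := r / 2); first by rewrite divr_gt0.
    by exists w => //; exact: ltW.
  have [ep ep0 hur] := hurwitz r0 (kh _ Uze) kz nz.
  have [e e0 eU] := (openC U).1 oU ze Uze.
  exists (Num.min e (Num.min d (ep / C))); first by rewrite !lt_min e0 d0 divr_gt0.
  move=> ze'; rewrite !lt_min => /andP[/eU Uze' /andP[zd zC]]; split; first exact: Uze'.
  have [|z' zz' kz'] := hur _ (kh _ Uze').
    move=> w wz; apply: le_trans (cl ze' w Uze' zd wz) _.
    by rewrite mulrC -ler_pdivlMr // ltW.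
  by exists z'; split; [exact: rU1|exact: kz'].
(* Were ze without critical points, every point of the closure would be [crit_free] for it, and by
   compactness nearby poles would have none either. *)
- split; first exact: Uze.
  apply: contrapT => nc.
  have [|d d0 dP] := crit_free_uniform (K := closure U) (ze := ze) (compact_closure bU).
    move=> z cz; have [Uz|nU] := pselect (U z).
      apply: crit_free_interior => //; apply/eqP => kz.
      by apply: nc; exists z.
    apply: (crit_free_frontier dU bU hG fU aU); first by apply/(frontierE z oU).
    exact: subset_closure.
  have [ze' [Uze' [z cz]] zd] := H d d0.
  apply: (dP ze' z Uze' zd _ cz).
  by case: cz => Uz _; exact: subset_closure.
Qed.

End CriticalPersistence.

(** * Boundary values of the kernels *)

Section WirtingerCalculus.
Context {R : realType}.
Implicit Types (z c w p q a : R[i]) (u X Y : R[i] -> R) (f : R[i] -> R[i]).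

Lemma wirtinger_cgrad f z p q : cgrad (fun w => complex.Re (f w)) z p ->
  cgrad (fun w => complex.Im (f w)) z q -> wirtinger f z = (p + 'i%C * q) / 2.
Proof.
move=> /cgrad_gr <- /cgrad_gr <-; rewrite /wirtinger /cddir !grE; congr (_ / _).
by apply: complex_ext; rewrite !ReImE /=; ring.
Qed.

Lemma ddir_cst (e : R[i]) (k : R) z : ddir e (fun=> k) z = 0.
Proof.
apply: dirder_ddir; rewrite /dirder => ep ep0; exists 1 => // t _.
by rewrite subrr mul0r subrr normr0 mulr_ge0 // ltW.
Qed.

Lemma wirtinger_real u z : wirtinger (fun w => (u w)%:C) z = gr u z / 2.
Proof.
rewrite /wirtinger /cddir grE /= !ddir_cst; congr (_ / _).
by apply: complex_ext; rewrite !ReImE /=; ring.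
Qed.

Lemma wirtinger_bar_real u z : wirtinger_bar (fun w => (u w)%:C) z = conjc (gr u z) / 2.
Proof.
rewrite /wirtinger_bar /cddir grE /= !ddir_cst; congr (_ / _).
by apply: complex_ext; rewrite !ReImE /=; ring.
Qed.

(** One computation for both kernels: up to a constant factor, the derivative in the pole is X + i Y
    for [bergman] and X - i Y for [schiffer]. *)
Lemma wirtinger_lin (sg d : R) f X Y a c p q : 0 < d -> cgrad X c p -> cgrad Y c q ->
  (forall w, cabs (w - c) < d -> f w = a * (X w +i* (sg * Y w))) ->
  wirtinger f c = a / 2 * (p + 'i%C * (sg%:C * q)).
Proof.
move=> d0 hX hY fE.
have H1 : cgrad (fun w => complex.Re (f w)) c
    ((complex.Re a)%:C * p + (- (sg * complex.Im a))%:C * q).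
  apply: cgrad_ext_near d0 _ (cgradD (cgradZ (complex.Re a) hX) (cgradZ (- (sg * complex.Im a)) hY)).
  by move=> w /fE ->; rewrite ReM /=; ring.
have H2 : cgrad (fun w => complex.Im (f w)) c
    ((complex.Im a)%:C * p + (sg * complex.Re a)%:C * q).
  apply: cgrad_ext_near d0 _ (cgradD (cgradZ (complex.Im a) hX) (cgradZ (sg * complex.Re a) hY)).
  by move=> w /fE ->; rewrite ImM /=; ring.
rewrite (wirtinger_cgrad H1 H2) mulrAC; congr (_ / _).
case: a {fE H1 H2} => x y; case: p hX => p1 p2 _; case: q hY => q1 q2 _.
by apply: complex_ext; rewrite !ReImE /=; ring.
Qed.

End WirtingerCalculus.

(** * The kernels in a chart and their limits *)

Section Kernels.
Context {R : realType} (U : set R[i]) (G : R[i] -> R[i] -> R) (h : R[i] -> R[i] -> R)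
  (dU : domain U) (bU : bounded_set U) (hG : green_regular U G h)
  (fU : finitely_connected U) (aU : analytic_boundary U).
Implicit Types (z w s c p v : R[i]) (Phi : R[i] -> R[i]).

Let oU : open U. Proof. by case: dU. Qed.

Section OneChart.
Context (p : R[i]) (Phi : R[i] -> R[i]) (c : R[i]) (r M : R).
Context (cP : chart U p Phi) (aw : away U h Phi c r M).

(** The factors 1 and i select the derivatives of E in s along and across the boundary; the gradient
    is then taken in w. *)
Definition bX s := gr (fun w => complex.Re (gr (bE h Phi w) s * 1)) c.
Definition bY s := gr (fun w => complex.Re (gr (bE h Phi w) s * 'i%C)) c.

Lemma gr_pole w s : cdisc c r w -> cabs s < 1/2 -> 0 < complex.Im s -> dc Phi s != 0 ->
  gr (fun v => G w v) (Phi s) = gr (bE h Phi w) s / dc Phi s.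
Proof.
move=> wc s2 sI ds; have [r0 M0 aw1 aw2 _] := aw; have s1 : cabs s <= 1 by lra.
have Uw := aw1 w wc; have cw := subset_closure Uw; have Us := chart_up cP s1 sI.
have sw := aw2 w s wc s1.
have Hq := harm_cgrad (harm_Gh_pole dU bU hG cw) (conj Us sw).
have [e e0 eU] := (openC U).1 oU _ Us.
have w0 : 0 < cabs (Phi s - w) by rewrite cabs_gt0 subr_eq0.
have ew0 : 0 < Num.min e (cabs (Phi s - w)) by rewrite lt_min e0.
have -> : gr (fun v => G w v) (Phi s) = gr (fun ze => Gh h w ze) (Phi s).
  apply: cgrad_gr; apply: (cgrad_ext_near ew0 _ Hq) => v; rewrite lt_min => /andP[/eU Uv vw].
  rewrite (G_Gh hG Uv cw) //; apply/eqP => E; move: vw.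
  by rewrite -E cabsB ltxx.
have [d d0 dP] := near_up sI.
have : cgrad (bE h Phi w) s (gr (fun ze => Gh h w ze) (Phi s) * dc Phi s).
  apply: (cgrad_ext_near (u := fun t => Gh h w (Phi t)) d0).
    by move=> t /dP tI; rewrite /bE oddx_up.
  exact: (cgrad_comp (u := fun ze => Gh h w ze) Hq (chart_cder cP s1)).
by move=> /cgrad_gr ->; rewrite mulfK.
Qed.

Lemma bE_components w s : gr (bE h Phi w) s =
  complex.Re (gr (bE h Phi w) s * 1) +i* (- complex.Re (gr (bE h Phi w) s * 'i%C)).
Proof. by apply: complex_ext; rewrite !ReImE /=; ring. Qed.

Lemma components_cgrad s (e : R[i]) : cabs s < 1/2 -> cabs e = 1 ->
  cgrad (fun w => complex.Re (gr (bE h Phi w) s * e)) c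
    (gr (fun w => complex.Re (gr (bE h Phi w) s * e)) c).
Proof.
move=> s2 e1; have [r0 M0 _ _ _] := aw.
have [|[H _ _] _ _ _] := bE_gr_est dU bU hG fU aU cP aw s2 e1 (z := c); last exact: H.
by rewrite subrr cabs0 divr_gt0.
Qed.

Lemma bergman_chart s : cabs s < 1/2 -> 0 < complex.Im s -> dc Phi s != 0 ->
  bergman G c (Phi s) =
    - (2 / pi)%:C * (conjc (dc Phi s)^-1 / 2 / 2 * (bX s + 'i%C * bY s)).
Proof.
move=> s2 sI ds; have [r0 M0 _ _ _] := aw; rewrite /bergman; congr (_ * _).
rewrite (wirtinger_lin (sg := 1) (a := conjc (dc Phi s)^-1 / 2) r0
  (components_cgrad s2 cabs1) (components_cgrad s2 cabsi)).
  by rewrite rmorph1 mul1r.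
move=> w wc; rewrite wirtinger_bar_real gr_pole //; last exact: ltW.
rewrite {1}bE_components.
set x := complex.Re _; set y := complex.Re _; set k := (dc Phi s)^-1.
have -> : conjc ((x +i* - y) * k) = conjc k * (x +i* y).
  by case: (k) => k1 k2; apply: complex_ext; rewrite /=; ring.
by rewrite mul1r mulrAC.
Qed.

Lemma schiffer_chart s : cabs s < 1/2 -> 0 < complex.Im s -> dc Phi s != 0 ->
  schiffer G c (Phi s) =
    - (2 / pi)%:C * ((dc Phi s)^-1 / 2 / 2 * (bX s - 'i%C * bY s)).
Proof.
move=> s2 sI ds; have [r0 M0 _ _ _] := aw; rewrite /schiffer; congr (_ * _).
rewrite (wirtinger_lin (sg := -1) (a := (dc Phi s)^-1 / 2) r0
  (components_cgrad s2 cabs1) (components_cgrad s2 cabsi)).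
  by rewrite rmorphN rmorph1 mulN1r mulrN.
move=> w wc; rewrite wirtinger_real gr_pole //; last exact: ltW.
rewrite {1}bE_components mulN1r.
by rewrite -mulrA mulrC.
Qed.

(** E vanishes for real s, so its tangential derivative at 0 is zero for every w. Only the normal
    derivative survives in the limit, which is why both kernels have the same zeros on the
    boundary. *)
Lemma bX0 : bX 0 = 0.
Proof.
have [r0 M0 _ _ _] := aw.
apply: cgrad_gr; apply: (cgrad_ext_near r0 _ (cgrad_cst 0 c)) => w wc.
have wc' : cdisc c r w by exact: ltW.
have [|[H _ _] _ _ _] := away_est dU bU hG fU aU cP aw wc' (z := 0).
  by rewrite subrr cabs0; lra.
have := dirder_ddir (cgrad_dirder 1 H) => <-.
rewrite (_ : ddir 1 _ 0 = 0) //; apply: dirder_ddir => e e0; exists 1 => // t _.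
have E x : bE h Phi w (0 + x%:C * 1) = 0 by rewrite /bE oddx_real // ImD ImM /= ; ring.
by rewrite !E mul0r !subr0 normr0 mulr_ge0 // ltW.
Qed.

Lemma bY0 : bY 0 = gr (bd h Phi) c.
Proof. by rewrite /bY; congr (gr _ c); apply/funext => w; rewrite bdE. Qed.

Definition up_filter := within [set s : R[i] | 0 < complex.Im s] (nbhs (0 : R[i])).

Lemma up_filterP (P : set R[i]) (d : R) : 0 < d ->
  (forall s, cabs s < d -> 0 < complex.Im s -> P s) -> up_filter P.
Proof. by move=> d0 H; apply/nbhsC; exists d => // s; rewrite subr0; exact: H. Qed.

Lemma cvg_up (f : R[i] -> R[i]) l : (forall e : R, 0 < e -> exists2 d : R, 0 < d &
    forall s, cabs s < d -> 0 < complex.Im s -> cabs (f s - l) < e) -> f @ up_filter --> l.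
Proof.
move=> H; apply: (@cvgC R R[i] up_filter _ f l).2 => e e0.
by have [d d0 dP] := H e e0; exact: up_filterP dP.
Qed.

Lemma components_cvg (e : R[i]) : cabs e = 1 ->
  (fun s => gr (fun w => complex.Re (gr (bE h Phi w) s * e)) c) @ up_filter -->
  gr (fun w => complex.Re (gr (bE h Phi w) 0 * e)) c.
Proof.
move=> e1; apply: cvg_up => ep ep0; have [r0 M0 _ _ _] := aw.
pose K := CT * (2 * (CT * M)) / (r / 3).
have K0 : 0 < K.
  have := mulr_gt0 (CT_gt0 (R := R)) M0 => CM.
  apply: divr_gt0; last by rewrite divr_gt0.
  by apply: mulr_gt0; [exact: CT_gt0|apply: mulr_gt0].
exists (Num.min (1/2) (ep / K)).
  by rewrite lt_min; apply/andP; split; exact: divr_gt0.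
move=> s; rewrite lt_min => /andP[s2 sK] sI.
have s0 : s != 0 by apply/eqP => E; rewrite E /= ltxx in sI.
apply: le_lt_trans (bE_gr_limit dU bU hG fU aU cP aw s2 s0 e1) _.
have -> : CT * (2 * (CT * M) * cabs s) / (r / 3) = K * cabs s by rewrite /K; ring.
by rewrite mulrC -ltr_pdivlMr.
Qed.

Lemma inv_dc_cvg : (fun s => (dc Phi s)^-1) @ up_filter --> (dc Phi 0)^-1.
Proof.
have [f1 [f2 H]] := chart_hol cP.
have fE s : cdisc 0 1 s -> dc Phi s = f1 s by move=> /H[/cder_dc].
have c0 : cdisc 0 1 (0 : R[i]) by apply: cdisc_center.
have d0 := chart_der cP; rewrite fE // in d0.
have [_ H1] := H 0 c0.
have H2 := cder_comp (cderV d0) H1.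
apply: cvg_up => e e0; have [d dd dP] := cder_cont H2 e0.
exists (Num.min d 1); first by rewrite lt_min dd ltr01.
move=> s; rewrite lt_min => /andP[sd s1] _; rewrite !fE //.
  by apply: dP; rewrite subr0.
by rewrite /cdisc /= subr0 ltW.
Qed.

Lemma dc_near_neq0 : up_filter [set s | [/\ cabs s < 1/2, 0 < complex.Im s & dc Phi s != 0]].
Proof.
have [f1 [f2 H]] := chart_hol cP.
have fE s : cdisc 0 1 s -> dc Phi s = f1 s by move=> /H[/cder_dc].
have c0 : cdisc 0 1 (0 : R[i]) by apply: cdisc_center.
have d0 := chart_der cP; rewrite fE // in d0.
have [_ H1] := H 0 c0.
have n0 : 0 < cabs (f1 0) by rewrite cabs_gt0.
have [d dd dP] := cder_cont H1 n0.
apply: (@up_filterP _ (Num.min d (1/2))); first by rewrite lt_min dd divr_gt0.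
move=> s; rewrite lt_min => /andP[sd s1] sI; split; [exact: s1|exact: sI|].
rewrite fE; last by rewrite /cdisc /= subr0; lra.
apply/eqP => E; have := dP s; rewrite subr0 E sub0r cabsN => /(_ sd).
by rewrite ltxx.
Qed.

(** Every pole of U near p has a parameter near 0, necessarily in the upper half plane, so limits in
    the parameter are limits within U. *)
Lemma chart_inverse_cvg (F : R[i] -> R[i]) (f : R[i] -> R[i]) (l : R[i]) :
  up_filter [set s | F (Phi s) = f s] -> f @ up_filter --> l ->
  F @ within U (nbhs p) --> l.
Proof.
move=> Ff fl A /fl fA.
have : up_filter [set s | A (F (Phi s))].
  by apply: filterS (filterI Ff fA) => s [/= ->].
rewrite /up_filter /within /= => /nbhsC[e e0 eA].
have e10 : 0 < Num.min e 1 by rewrite lt_min e0 ltr01.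
have [d d0 dP] := chart_open cP e10.
apply/nbhsC; exists d; first exact: d0.
move=> v /dP[s se <-] Us; move: se; rewrite lt_min => /andP[se s1].
by apply: eA; [rewrite subr0|apply: (chart_preimage_up dU cP _ Us); exact: ltW].
Qed.

Lemma boundary_limit (F : R[i] -> R[i]) (l : R[i]) : F @ within U (nbhs p) --> l ->
  lim (F @ within U (nbhs p)) = l.
Proof.
have PF : ProperFilter (within U (nbhs p)).
  have [cp _] := (frontierE p oU).1 (chart_frontier cP).
  apply: within_nbhs_proper; exact: cp.
by move=> H; apply: (cvg_lim (@norm_hausdorff _ _) H).
Qed.

Lemma const_neq0 : - (2 / pi)%:C != 0 :> R[i].
Proof. by rewrite oppr_eq0 -cabs_gt0 cabs_real_pos divr_gt0 ?pi_gt0. Qed.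

Lemma bergman_zero : boundary_value U (bergman G) c p = 0 <-> gr (bd h Phi) c = 0.
Proof.
have L : bX @ up_filter --> (0 : R[i]) by rewrite -bX0; exact: components_cvg cabs1.
have L' : bY @ up_filter --> gr (bd h Phi) c by rewrite -bY0; exact: components_cvg cabsi.
have K := inv_dc_cvg.
have K' : (fun s => conjc (dc Phi s)^-1) @ up_filter --> conjc (dc Phi 0)^-1.
  apply: (@cvgC R R[i] up_filter _ _ _).2 => e e0.
  apply: filterS ((@cvgC R R[i] up_filter _ _ _).1 K e e0) => s.
  by rewrite -rmorphB cabs_conj.
have H : (fun s => - (2 / pi)%:C * (conjc (dc Phi s)^-1 / 2 / 2 * (bX s + 'i%C * bY s))) @ up_filter -->
    - (2 / pi)%:C * (conjc (dc Phi 0)^-1 / 2 / 2 * (0 + 'i%C * gr (bd h Phi) c)).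
  apply: cvgM; first exact: cvg_cst.
  apply: cvgM.
    by apply: cvgM; [apply: cvgM; [exact: K'|exact: cvg_cst]|exact: cvg_cst].
  by apply: cvgD; [exact: L|apply: cvgM; [exact: cvg_cst|exact: L']].
rewrite /boundary_value (boundary_limit (chart_inverse_cvg (F := bergman G c) _ H)); last first.
  by apply: filterS dc_near_neq0 => s [s2 sI ds] /=; rewrite bergman_chart.
split=> [/eqP|->]; last by rewrite mulr0 add0r !mulr0.
rewrite add0r !mulf_eq0 (negPf const_neq0) !invr_eq0 pnatr_eq0 conjc_eq0 invr_eq0.
rewrite (negPf (chart_der cP)) (_ : 'i%C == 0 = false) /=; first by move=> /eqP.
by apply/negbTE; rewrite -cabs_gt0 cabsi.
Qed.

Lemma schiffer_zero : boundary_value U (schiffer G) c p = 0 <-> gr (bd h Phi) c = 0.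
Proof.
have L : bX @ up_filter --> (0 : R[i]) by rewrite -bX0; exact: components_cvg cabs1.
have L' : bY @ up_filter --> gr (bd h Phi) c by rewrite -bY0; exact: components_cvg cabsi.
have K := inv_dc_cvg.
have H : (fun s => - (2 / pi)%:C * ((dc Phi s)^-1 / 2 / 2 * (bX s + - 'i%C * bY s))) @ up_filter -->
    - (2 / pi)%:C * ((dc Phi 0)^-1 / 2 / 2 * (0 + - 'i%C * gr (bd h Phi) c)).
  apply: cvgM; first exact: cvg_cst.
  apply: cvgM.
    by apply: cvgM; [apply: cvgM; [exact: K|exact: cvg_cst]|exact: cvg_cst].
  by apply: cvgD; [exact: L|apply: cvgM; [exact: cvg_cst|exact: L']].
rewrite /boundary_value (boundary_limit (chart_inverse_cvg (F := schiffer G c) _ H)); last first.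
  by apply: filterS dc_near_neq0 => s [s2 sI ds] /=; rewrite schiffer_chart // (mulNr 'i%C).
split=> [/eqP|->]; last by rewrite mulr0 add0r !mulr0.
rewrite add0r !mulf_eq0 (negPf const_neq0) !invr_eq0 pnatr_eq0 oppr_eq0.
rewrite (negPf (chart_der cP)) (_ : 'i%C == 0 = false) /=; first by move=> /eqP.
by apply/negbTE; rewrite -cabs_gt0 cabsi.
Qed.

End OneChart.
End Kernels.

Section Sequences.
Context {R : realType}.
Implicit Types (z w : R[i]).

Lemma cvg_seqC (z_ : nat -> R[i]) z : z_ @ \oo --> z <-> forall e : R, 0 < e ->
  exists N, forall n, (N <= n)%N -> cabs (z_ n - z) < e.
Proof.
split=> [H e e0|H].
  have [N _ NP] := (@cvgC R nat \oo _ z_ z).1 H e e0.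
  by exists N => n Nn; exact: NP.
apply: (@cvgC R nat \oo _ z_ z).2 => e e0; have [N NP] := H e e0.
by exists N => // n /= Nn; exact: NP.
Qed.

Lemma archi_inv (e : R) : 0 < e -> exists N, forall n, (N <= n)%N -> n.+1%:R^-1 < e.
Proof.
move=> e0; pose N := Num.bound e^-1; exists N => n Nn.
have n0 : 0 < n.+1%:R :> R by rewrite ltr0n.
rewrite -(invrK e) ltf_pV2 ?posrE ?invr_gt0 //.
apply: lt_le_trans (archi_boundP _) _; first by rewrite invr_ge0 ltW.
by rewrite ler_nat; exact: leq_trans Nn (leqnSn n).
Qed.

(** One choice serves every tolerance: nearest critical points up to 1 / (n + 1) converge to z as
    soon as some critical points do. *)
Lemma nearly_closest (A : set R[i]) z (e : R) : A !=set0 -> 0 < e ->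
  exists2 w, A w & forall v, A v -> cabs (w - z) <= cabs (v - z) + e.
Proof.
move=> [w0 Aw0] e0; pose S := [set cabs (w - z) | w in A].
have iS : has_inf S.
  by split; [exists (cabs (w0 - z)), w0|exists 0 => _ [w _ <-]; exact: cabs_ge0].
have [_ [w Aw <-] we] := inf_adherent e0 iS.
exists w => // v Av; have : inf S <= cabs (v - z) by apply: ge_inf; [case: iS|exists v].
by move: we; lra.
Qed.

End Sequences.

(** * Sequences of critical points *)

Section MainEquivalences.
Context {R : realType} (U : set R[i]) (G : R[i] -> R[i] -> R) (h : R[i] -> R[i] -> R)
  (dU : domain U) (bU : bounded_set U) (hG : green_regular U G h)
  (fU : finitely_connected U) (aU : analytic_boundary U).
Implicit Types (z w s c p ze zeta : R[i]) (Phi : R[i] -> R[i]).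

Let oU : open U. Proof. by case: dU. Qed.

(** Off the pole, [dzG] equals kap / (2 (z - ze)); at the pole [kap] equals -1, so its zeros are
    distinct from ze. *)
Lemma green_criticalE ze z : U ze -> green_critical U G ze z <-> crit U h ze z.
Proof.
move=> Uze.
have E : U z -> z != ze -> dzG G z ze = kap h ze z / (z - ze) / 2.
  move=> Uz zz; rewrite /dzG wirtinger_real; congr (_ / 2); apply: cgrad_gr.
  have [e e0 eU] := (openC U).1 oU z Uz.
  have e1 : 0 < Num.min e (cabs (z - ze)) by rewrite lt_min e0 cabs_gt0 subr_eq0.
  apply: cgrad_ext_near e1 _ (Gh_cgrad hG Uze Uz zz) => w.
  rewrite lt_min => /andP[/eU Uw wz]; rewrite (G_Gh hG Uze) //; first exact: subset_closure.
  by apply/eqP => Ew; rewrite Ew cabsB ltxx in wz.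
split=> [[Uz zz]|cr].
  rewrite E // => /eqP; rewrite !mulf_eq0 !invr_eq0 (subr_eq0 z) (negPf zz) pnatr_eq0 !orbF.
  by move=> /eqP.
have zz := crit_neq cr; have [Uz k0] := cr.
by split => //; rewrite E // k0 !mul0r.
Qed.

Lemma chart_away z zeta : U z -> frontier U zeta ->
  exists Phi (r M : R), chart U zeta Phi /\ away U h Phi z r M.
Proof.
move=> Uz Fz; have [Phi cP _] := chart_exists dU fU aU Fz ltr01.
have [k [r [M [_ cPk aw]]]] := away_scale dU bU hG cP Uz.
by exists (fun s => Phi (k%:C * s)), r, M.
Qed.

Lemma crit_seq_not_free (z_ zeta_ : nat -> R[i]) z zeta :
  (forall n, U (zeta_ n) /\ crit U h (zeta_ n) (z_ n)) ->
  z_ @ \oo --> z -> zeta_ @ \oo --> zeta -> ~ crit_free U h z zeta.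
Proof.
move=> cr /cvg_seqC zz /cvg_seqC ze [d d0 dP].
have [N1 H1] := zz d d0; have [N2 H2] := ze d d0.
have [Uz cz] := cr (maxn N1 N2).
by apply: (dP _ _ (H1 _ (leq_maxl N1 N2)) (H2 _ (leq_maxr N1 N2)) Uz cz).
Qed.

(** One pole close to p has a critical point, so by [crit_all] all poles of the sequence do, the
    first ones included. Taking nearly the closest ones makes them converge. *)
Lemma crit_sequences p Phi z (r M : R) (zeta_ : nat -> R[i]) : chart U p Phi -> away U h Phi z r M ->
  gr (bd h Phi) z = 0 -> (forall n, U (zeta_ n)) -> zeta_ @ \oo --> p ->
  exists2 z_ : nat -> R[i], forall n, crit U h (zeta_ n) (z_ n) & z_ @ \oo --> z.
Proof.
move=> cP aw b0 Uz /cvg_seqC zp.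
have [d d0 dP] := crit_near dU bU hG fU aU cP aw b0 ltr01.
have [N NP] := zp d d0.
have [z0 cz0 _] := dP _ (Uz N) (NP N (leqnn N)).
have all_crit := crit_all dU bU hG fU aU (Uz N) cz0.
have /choice[z_ zP] : forall n, exists w, crit U h (zeta_ n) w /\
    forall v, crit U h (zeta_ n) v -> cabs (w - z) <= cabs (v - z) + n.+1%:R^-1.
  move=> n; have n0 : 0 < n.+1%:R^-1 :> R by rewrite invr_gt0 ltr0n.
  have [w cw wP] := @nearly_closest R (crit U h (zeta_ n)) z _ (all_crit _ (Uz n)) n0.
  by exists w.
exists z_ => [n|]; first by case: (zP n).
apply/cvg_seqC => e e0; have e2 : 0 < e / 2 by lra.
have [d1 d10 d1P] := crit_near dU bU hG fU aU cP aw b0 e2.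
have [N1 N1P] := zp d1 d10; have [N2 N2P] := archi_inv e2.
exists (maxn N1 N2) => n; rewrite geq_max => /andP[n1 n2].
have [v cv ve] := d1P _ (Uz n) (N1P n n1).
have [_ H] := zP n; apply: le_lt_trans (H v cv) _.
by rewrite [e]splitr; exact: ler_ltD ve (N2P n n2).
Qed.

Lemma frontier_sequence zeta : frontier U zeta ->
  exists2 zeta_ : nat -> R[i], forall n, U (zeta_ n) & zeta_ @ \oo --> zeta.
Proof.
move=> /(frontierE zeta oU)[/closureC cz _].
have /choice[zeta_ zP] : forall n, exists w, U w /\ cabs (w - zeta) < n.+1%:R^-1.
  by move=> n; have [|w Uw wz] := cz n.+1%:R^-1; [rewrite invr_gt0 ltr0n|exists w].
exists zeta_ => [n|]; first by case: (zP n).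
apply/cvg_seqC => e /archi_inv[N NP]; exists N => n /NP ne.
by have [_ H] := zP n; exact: lt_trans H ne.
Qed.

Definition critical_pairs z zeta := exists z_ zeta_ : nat -> R[i],
  (forall n, U (zeta_ n) /\ green_critical U G (zeta_ n) (z_ n)) /\
  (fun n => (z_ n, zeta_ n)) @ \oo --> (z, zeta).

Definition critical_lifts z zeta := forall zeta_ : nat -> R[i],
  (forall n, U (zeta_ n)) -> zeta_ @ \oo --> zeta ->
  exists z_ : nat -> R[i], (forall n, green_critical U G (zeta_ n) (z_ n)) /\ z_ @ \oo --> z.

Lemma pairs_of_lifts z zeta : frontier U zeta -> critical_lifts z zeta -> critical_pairs z zeta.
Proof.
move=> Fz H; have [zeta_ Uz zz] := frontier_sequence Fz.
have [z_ [cz z0]] := H zeta_ Uz zz; exists z_, zeta_; split; first by move=> n; split.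
exact: (cvg_pair z0 zz).
Qed.

Lemma pairs_crit (z_ zeta_ : nat -> R[i]) :
  (forall n, U (zeta_ n) /\ green_critical U G (zeta_ n) (z_ n)) ->
  forall n, U (zeta_ n) /\ crit U h (zeta_ n) (z_ n).
Proof. by move=> H n; have [Uz cz] := H n; split => //; apply/green_criticalE. Qed.

Lemma bd_of_pairs p Phi z (r M : R) : chart U p Phi -> away U h Phi z r M ->
  critical_pairs z p -> gr (bd h Phi) z = 0.
Proof.
move=> cP aw [z_ [zeta_ [H cv]]].
have c1 : z_ @ \oo --> z.
  move=> A zA; apply: (cv [set x | A x.1]); exists (A, setT); last by move=> [x y] [].
  by split; [exact: zA|exact: filterT].
have c2 : zeta_ @ \oo --> p.
  move=> A zA; apply: (cv [set x | A x.2]); exists (setT, A); last by move=> [x y] [].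
  by split; [exact: filterT|exact: zA].
apply/eqP/negPn/negP => nb; apply: (crit_seq_not_free (pairs_crit H) c1 c2).
exact: (crit_free_boundary dU bU hG fU aU cP aw nb).
Qed.

Lemma lifts_of_bd p Phi z (r M : R) : chart U p Phi -> away U h Phi z r M ->
  gr (bd h Phi) z = 0 -> critical_lifts z p.
Proof.
move=> cP aw b0 zeta_ Uz zp; have [z_ cz zz] := crit_sequences cP aw b0 Uz zp.
by exists z_; split => // n; apply/green_criticalE.
Qed.

Lemma frontier_compact : compact (frontier U).
Proof.
apply: (subclosed_compact _ (compact_closure bU)) => [z /closureC cz|z /(frontierE z oU)[]//].
apply/(frontierE z oU); split.
  apply/closureC => e e0; have e2 : 0 < e / 2 by lra.
  have [w /(frontierE w oU)[/closureC cw _] wz] := cz _ e2.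
  have [v Uv vw] := cw _ e2; exists v => //.
  by have := cabs_tri v w z; lra.
move=> Uz; have [e e0 eU] := (openC U).1 oU z Uz.
by have [w /(not_frontier dU) nw /eU] := cz e e0.
Qed.

(** The poles approach the frontier as a set without converging to a point; compactness of the
    frontier makes [crit_free] uniform instead. *)
Lemma limit_crit (z_ zeta_ : nat -> R[i]) z :
  (forall n, U (zeta_ n) /\ crit U h (zeta_ n) (z_ n)) ->
  zeta_ @ \oo `=>` set_nbhs (frontier U) -> z_ @ \oo --> z ->
  exists2 zeta, frontier U zeta & ~ crit_free U h z zeta.
Proof.
move=> cr fr /cvg_seqC zz; apply: contrapT => H.
have {}H zeta : frontier U zeta -> crit_free U h z zeta.
  by move=> Fz; apply: contrapT => nf; apply: H; exists zeta.
have [] := @compact_uniform R (frontier U) (fun d zeta => forall z' ze', cabs (z' - z) < d ->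
  cabs (ze' - zeta) < d -> U ze' -> ~ crit U h ze' z') frontier_compact.
- by move=> d d' w d0 dd P z' ze' z'd ze'd; apply: P; lra.
- move=> zeta /H[d d0 dP]; exists (d / 2); first by rewrite divr_gt0.
  move=> w _ wz z' ze' z'd ze'd; apply: dP; first by lra.
  by have := cabs_tri ze' w zeta; lra.
move=> d d0 dP.
have [N1 _ N1P] : (zeta_ @ \oo) [set v : R[i] | exists2 w, frontier U w & cabs (v - w) < d].
  by apply: fr => w Fw; apply/nbhsC; exists d => // v vw; exists w.
have [N2 N2P] := zz d d0.
have [w Fw wd] := N1P (maxn N1 N2) (leq_maxl N1 N2).
have [Uz cz] := cr (maxn N1 N2).
exact: (dP w Fw _ _ (N2P _ (leq_maxr N1 N2)) wd Uz cz).
Qed.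

Lemma crit_limit_closure (z_ zeta_ : nat -> R[i]) z :
  (forall n, U (zeta_ n) /\ crit U h (zeta_ n) (z_ n)) ->
  z_ @ \oo --> z -> closure U z.
Proof.
move=> cr /cvg_seqC zz; apply/closureC => e e0; have [N NP] := zz e e0.
by exists (z_ N); [case: (cr N) => _ []|exact: NP].
Qed.

End MainEquivalences.

Theorem corollary3p3 (R : realType) (Omega : set R[i])
    (G : R[i] -> R[i] -> R)
    (Omega_domain : domain Omega) (Omega_bounded : bounded_set Omega)
    (Omega_finitely_connected : finitely_connected Omega)
    (Omega_analytic : analytic_boundary Omega)
    (G_green : green_function Omega G) :
  critical_limit_set Omega G =
    [set z | Omega z /\ exists2 zeta, frontier Omega zeta &
               boundary_value Omega (bergman G) z zeta = 0] /\
  forall z zeta : R[i], Omega z -> frontier Omega zeta ->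
    [<-> boundary_value Omega (bergman G) z zeta = 0;
         boundary_value Omega (schiffer G) z zeta = 0;
         exists z_ zeta_ : nat -> R[i],
           (forall n, Omega (zeta_ n) /\
                      green_critical Omega G (zeta_ n) (z_ n)) /\
           (fun n => (z_ n, zeta_ n)) @ \oo --> (z, zeta);
         forall zeta_ : nat -> R[i],
           (forall n, Omega (zeta_ n)) -> zeta_ @ \oo --> zeta ->
           exists z_ : nat -> R[i],
             (forall n, green_critical Omega G (zeta_ n) (z_ n)) /\
             z_ @ \oo --> z].
Proof.
have oU : open Omega by case: Omega_domain.
have [h hG] := green_regular_exists oU G_green.
split; last first.
  move=> z zeta Oz Fz.
  have [Phi [r [M [cP aw]]]] := chart_away Omega_domain Omega_bounded hG
    Omega_finitely_connected Omega_analytic Oz Fz.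
  have BZ := bergman_zero Omega_domain Omega_bounded hG Omega_finitely_connected
    Omega_analytic cP aw.
  have SZ := schiffer_zero Omega_domain Omega_bounded hG Omega_finitely_connected
    Omega_analytic cP aw.
  have LZ := lifts_of_bd Omega_domain Omega_bounded hG Omega_finitely_connected
    Omega_analytic cP aw.
  have ZP := bd_of_pairs Omega_domain Omega_bounded hG Omega_finitely_connected
    Omega_analytic cP aw.
  tfae; [by move=> /BZ/SZ|by move=> /SZ/LZ; exact: (pairs_of_lifts Omega_domain Fz)|
    by move=> /ZP/LZ|].
  by move=> H; apply/BZ/ZP; exact: (pairs_of_lifts Omega_domain Fz).
apply/seteqP; split => [z [z_ [zeta_ [H fr zz]]]|z [Oz [zeta Fz Bz]]].
  have cr := pairs_crit Omega_domain hG H.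
  have [zeta Fz nf] := limit_crit Omega_domain Omega_bounded cr fr zz.
  have [czeta _] := (frontierE zeta oU).1 Fz.
  (* The limit z is a priori in the closure only; [crit_free_frontier] excludes the frontier. *)
  have Oz : Omega z.
    apply: contrapT => nO; apply: nf.
    apply: (crit_free_frontier Omega_domain Omega_bounded hG Omega_finitely_connected
      Omega_analytic _ czeta).
    apply/(frontierE z oU); split; [exact: crit_limit_closure cr zz|exact: nO].
  split; first exact: Oz.
  exists zeta; first exact: Fz.
  have [Phi [r [M [cP aw]]]] := chart_away Omega_domain Omega_bounded hG
    Omega_finitely_connected Omega_analytic Oz Fz.
  apply/(bergman_zero Omega_domain Omega_bounded hG Omega_finitely_connected
    Omega_analytic cP aw)/eqP/negPn/negP => nb; apply: nf.
  exact: (crit_free_boundary Omega_domain Omega_bounded hG Omega_finitely_connected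
    Omega_analytic cP aw nb).
have [Phi [r [M [cP aw]]]] := chart_away Omega_domain Omega_bounded hG
  Omega_finitely_connected Omega_analytic Oz Fz.
move: Bz => /(bergman_zero Omega_domain Omega_bounded hG Omega_finitely_connected
    Omega_analytic cP aw).
move=> /(lifts_of_bd Omega_domain Omega_bounded hG Omega_finitely_connected
    Omega_analytic cP aw) lz.
have [zeta_ Uz zzeta] := frontier_sequence Omega_domain Fz.
have [z_ [cz zz]] := lz zeta_ Uz zzeta.
exists z_, zeta_; split => //.
(* A neighborhood of the whole frontier is one of zeta. *)
by move=> A FA; exact: zzeta (FA zeta Fz).
Qed.
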